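(* Let $(M,\omega)$ be a closed symplectic manifold of dimension $2n$ satisfying at least one of the following conditions: (a) $(M,\omega)$ is symplectically aspherical; (b) $(M,\omega)$ is spherically monotone; (c) $(M,\omega)$ has the weak Lefschetz property. Then the homomorphism $e:\Gamma\to\pi_1(M)$ is injective.
   Context: $M$ is connected. $\mathrm{Symp}_0(M,\omega)$ is the identity component of the group of symplectic diffeomorphisms of $(M,\omega)$. For a smooth path $\{\psi_t\}_{t\in[0,1]}$ in $\mathrm{Symp}_0(M,\omega)$ with $\psi_0=\mathrm{id}$, generated by the time-dependent vector field $X^t$, the flux is $\widetilde{\mathrm{Flux}}(\{\psi_t\})=\int_0^1[\iota_{X^t}\omega]\,dt\in H^1(M;\mathbb{R})$; it depends only on the homotopy class of the path with fixed endpoints, and defines a homomorphism on the universal cover of $\mathrm{Symp}_0(M,\omega)$. The flux group $\Gamma\subset H^1(M;\mathbb{R})$ is the image of $\pi_1(\mathrm{Symp}_0(M,\omega),\mathrm{id})$ under $\widetilde{\mathrm{Flux}}$. The evaluation homomorphism $ev:\pi_1(\mathrm{Symp}_0(M,\omega),\mathrm{id})\to\pi_1(M,x_0)$ is $ev([\{\psi_t\}])=[\{\psi_t(x_0)\}]$; its image lies in the center of $\pi_1(M,x_0)$ and the maps for different base points are identified. The $e$-homomorphism $e:\Gamma\to\pi_1(M)$ is the well-defined homomorphism determined by $e(\widetilde{\mathrm{Flux}}(\{\psi_t\}))=ev([\{\psi_t\}])$ for every loop $\{\psi_t\}$ in $\mathrm{Symp}_0(M,\omega)$ based at $\mathrm{id}$.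 Conditions: symplectically aspherical means $[\omega]$ vanishes on the image of the Hurewicz map $\pi_2(M)\to H_2(M;\mathbb{Z})$. Spherically monotone means there is a constant $\lambda\in\mathbb{R}\setminus\{0\}$ with $[\omega]|_{\pi_2(M)}=\lambda\cdot c_1(M)|_{\pi_2(M)}$, where $c_1(M)$ is the first Chern class of $(M,\omega)$. Weak Lefschetz property means multiplication by $[\omega]^{n-1}$, $H^1(M;\mathbb{R})\to H^{2n-1}(M;\mathbb{R})$, is injective. *)

(* Defs.v *)
From HB Require Import structures.
From mathcomp Require Import all_boot all_order all_fingroup all_algebra.
From mathcomp Require Import all_classical all_reals all_analysis.

Set Implicit Arguments.
Unset Strict Implicit.
Unset Printing Implicit Defensive.

Import Order.TTheory GRing.Theory Num.Theory.
Import numFieldNormedType.Exports.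

Local Open Scope classical_set_scope.
Local Open Scope ring_scope.

(* Functions are total; the notions below only depend on their values on the
   open set U. *)
Fixpoint Ck (R : realType) (V : normedModType R) (k : nat) (U : set V)
    (f : V -> R) : Prop :=
  match k with
  | 0%N => forall x, U x -> {for x, continuous f}
  | k'.+1 => forall v : V,
      (forall x, U x -> derivable (f : V -> R^o) x v) /\
      Ck k' U (fun x => 'D_v (f : V -> R^o) x)
  end.

Definition smooth_fun (R : realType) (V : normedModType R) (U : set V)
    (f : V -> R) : Prop :=
  forall k, Ck k U f.

Definition smooth_mx (R : realType) (V : normedModType R) (p q : nat)
    (U : set V) (f : V -> 'M[R]_(p, q)) : Prop :=
  forall i j, smooth_fun U (fun x => f x i j).

(* A smooth atlas modelled on row vectors of length m, without boundary.
   [param i] is the inverse of [chart i], and [chart_at x] selects one chart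
   around x. *)
Record atlas (R : realType) (m : nat) (M : topologicalType) := Atlas {
  idx : Type;
  dom : idx -> set M;
  cod : idx -> set 'rV[R]_m;
  chart : idx -> M -> 'rV[R]_m;
  param : idx -> 'rV[R]_m -> M;
  chart_at : M -> idx;
  dom_open : forall i, open (dom i);
  cod_open : forall i, open (cod i);
  chart_cod : forall i x, dom i x -> cod i (chart i x);
  param_dom : forall i y, cod i y -> dom i (param i y);
  chartK : forall i x, dom i x -> param i (chart i x) = x;
  paramK : forall i y, cod i y -> chart i (param i y) = y;
  chart_continuous : forall i x, dom i x -> {for x, continuous (chart i)};
  param_continuous : forall i y, cod i y -> {for y, continuous (param i)};
  chart_at_dom : forall x, dom (chart_at x) x;
  transition_smooth : forall i j,
    smooth_mx (cod i `&` param i @^-1` dom j) (chart j \o param i)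
}.

Section Manifold.
Variables (R : realType) (m : nat) (M : topologicalType) (A : atlas R m M).

(* There is no boundary by definition of an atlas, and second countability
   follows from compactness. *)
Definition closed_connected_manifold : Prop :=
  [/\ hausdorff_space M, compact [set: M] & connected [set: M]].

Definition smooth_to (V : normedModType R) (U : set V) (g : V -> M) : Prop :=
  (forall x, U x -> {for x, continuous g}) /\
  (forall j : idx A, smooth_mx (U `&` g @^-1` dom j) (chart j \o g)).

Definition smooth_self (f : M -> M) : Prop :=
  forall i : idx A, smooth_to (cod i) (f \o param i).

Definition diffeo (f : M -> M) : Prop :=
  smooth_self f /\
  exists g, [/\ smooth_self g, cancel f g & cancel g f].

Definition transition (i j : idx A) : 'rV[R]_m -> 'rV[R]_m :=
  chart j \o param i.

Definition overlap (i j : idx A) : set 'rV[R]_m :=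
  cod i `&` param i @^-1` dom j.

(* Tangent vectors at the point with coordinates x in the chart i are row
   vectors, and a matrix whose rows are v_1, ..., v_k stands for the k-tuple
   (v_1, ..., v_k).  Jacobians act on the right, by the convention of
   [jacobian].  The values of a form outside the codomains of the charts are
   irrelevant. *)
Definition dform (k : nat) : Type :=
  idx A -> 'rV[R]_m -> 'M[R]_(k, m) -> R.

Definition multilinear (k : nat) (a : 'M[R]_(k, m) -> R) : Prop :=
  forall (r : 'I_k) (V V1 V2 : 'M[R]_(k, m)) (c1 c2 : R),
    row r V = c1 *: row r V1 + c2 *: row r V2 ->
    row' r V1 = row' r V -> row' r V2 = row' r V ->
    a V = c1 * a V1 + c2 * a V2.

Definition alternating (k : nat) (a : 'M[R]_(k, m) -> R) : Prop :=
  forall (V : 'M[R]_(k, m)) (r s : 'I_k),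
    r != s -> row r V = row s V -> a V = 0.

Definition is_form (k : nat) (a : dform k) : Prop :=
  [/\ forall i x, cod i x -> multilinear (a i x) /\ alternating (a i x),
      forall i V, smooth_fun (cod i) (fun x => a i x V)
    & forall i j x V, overlap i j x ->
        a i x V = a j (transition i j x) (V *m jacobian (transition i j) x)].

Definition form_eq (k : nat) (a b : dform k) : Prop :=
  forall i x V, cod i x -> a i x V = b i x V.

Definition form0 (k : nat) : dform k := fun _ _ _ => 0.

Definition form_sub (k : nat) (a b : dform k) : dform k :=
  fun i x V => a i x V - b i x V.

Definition ext_d (k : nat) (a : dform k) : dform k.+1 :=
  fun i x V => \sum_(r < k.+1)
    (-1) ^+ r * 'D_(row r V) (fun y => a i y (row' r V) : R^o) x.

(* Normalized so that (a /\ b)(v, w) = a(v) b(w) - a(w) b(v) for 1-forms. *)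
Definition wedge (k l : nat) (a : dform k) (b : dform l) : dform (k + l)%N :=
  fun i x V => ((k`! * l`!)%N%:R)^-1 * \sum_(s : 'S_(k + l))
    (-1) ^+ s * a i x (usubmx (row_perm s V)) * b i x (dsubmx (row_perm s V)).

Fixpoint wedge_pow (w : dform 2) (k : nat) : dform (k * 2)%N :=
  match k return dform (k * 2)%N with
  | 0%N => fun _ _ _ => 1
  | k'.+1 => wedge w (@wedge_pow w k')
  end.

Definition closed_form (k : nat) (a : dform k) : Prop :=
  is_form a /\ form_eq (ext_d a) (@form0 k.+1).

Definition exact_form (k : nat) (a : dform k.+1) : Prop :=
  exists b : dform k, is_form b /\ form_eq (ext_d b) a.

(* The de Rham class of a closed (k+1)-form, as a set of closed forms. *)
Definition deRham_class (k : nat) (a : dform k.+1) : set (dform k.+1) :=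
  [set b | closed_form b /\ exact_form (form_sub b a)].

Definition symplectic_form (w : dform 2) : Prop :=
  closed_form w /\
  forall i x (v : 'rV[R]_m), cod i x -> v != 0 ->
    exists u : 'rV[R]_m, w i x (col_mx v u) != 0.

Definition symplecto (w : dform 2) (f : M -> M) : Prop :=
  diffeo f /\
  forall (i j : idx A) x V, cod i x -> dom j (f (param i x)) ->
    let g := chart j \o f \o param i in
    w i x V = w j (g x) (V *m jacobian g x).

(* A smooth path [0, 1] -> Symp(M, w) is given by a map psi that is smooth on
   R x M; its values outside [0, 1] are irrelevant.  Every family that is
   smooth on the manifold with boundary [0, 1] x M has such an extension. *)
Definition smooth_symp_path (w : dform 2) (psi : R -> M -> M) : Prop :=
  (forall i : idx A, smooth_to ([set: R^o] `*` cod i : set (R^o * 'rV[R]_m))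
               (fun p => psi p.1 (param i p.2))) /\
  (forall t : R, 0 <= t <= 1 -> symplecto w (psi t)).

(* Symp(M, w) is locally smoothly path connected for the C^oo topology, so
   its identity component consists of the endpoints of smooth paths from id. *)
Definition Symp0 (w : dform 2) : set (M -> M) :=
  [set f | exists psi, [/\ smooth_symp_path w psi, psi 0 = id & psi 1 = f]].

Definition Symp0_loop (w : dform 2) (psi : R -> M -> M) : Prop :=
  [/\ smooth_symp_path w psi,
      forall t : R, 0 <= t <= 1 -> Symp0 w (psi t),
      psi 0 = id & psi 1 = id].

(* The vector field X^t with d/dt psi_t = X^t o psi_t, read in charts. *)
Definition generator (psi : R -> M -> M) (t : R) (i : idx A)
    (y : 'rV[R]_m) : 'rV[R]_m :=
  let x := xget (param i y) [set z | psi t z = param i y] in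
  derive1 (fun s => chart i (psi s x)) t.

Definition flux_form (w : dform 2) (psi : R -> M -> M) : dform 1 :=
  fun i y v => \int[@lebesgue_measure R]_(t in `[0, 1])
                 w i y (col_mx (generator psi t i y) v).

Definition flux (w : dform 2) (psi : R -> M -> M) : set (dform 1) :=
  deRham_class (flux_form w psi).

Definition flux_group (w : dform 2) : set (set (dform 1)) :=
  [set c | exists2 psi, Symp0_loop w psi & c = flux w psi].

Definition loop_at (x0 : M) (g : R -> M) : Prop :=
  [/\ {within `[0, 1], continuous g}, g 0 = x0 & g 1 = x0].

Definition loop_homotopic (x0 : M) (g h : R -> M) : Prop :=
  exists H : R * R -> M,
    {within `[0, 1] `*` `[0, 1], continuous H} /\
    forall s : R, 0 <= s <= 1 ->
      [/\ H (0, s) = g s, H (1, s) = h s, H (s, 0) = x0 & H (s, 1) = x0].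

(* Elements of pi_1(M, x0) are sets of the form [pi1_class x0 g]. *)
Definition pi1_class (x0 : M) (g : R -> M) : set (R -> M) :=
  [set h | loop_at x0 h /\ loop_homotopic x0 g h].

Definition ev (x0 : M) (psi : R -> M -> M) : set (R -> M) :=
  pi1_class x0 (fun t => psi t x0).

(* This determines e on Gamma, and its being a homomorphism follows from it;
   the values of e outside Gamma are irrelevant. *)
Definition is_e_hom (w : dform 2) (x0 : M)
    (e : set (dform 1) -> set (R -> M)) : Prop :=
  forall psi, Symp0_loop w psi -> e (flux w psi) = ev x0 psi.

(* Spheres are smooth maps of the plane that are constant outside the open
   unit square; they represent all the elements of pi_2(M). *)
Definition sphere (u : 'rV[R]_2 -> M) : Prop :=
  smooth_to [set: 'rV[R]_2] u /\
  exists p, forall z : 'rV[R]_2,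
    ~~ [forall k, 0 < z 0 k < 1] -> u z = p.

(* The coefficient of the pulled back form u^* a, computed in any chart. *)
Definition pullback_density (u : 'rV[R]_2 -> M) (a : dform 2)
    (z : 'rV[R]_2) : R :=
  let i := chart_at A (u z) in
  a i (chart i (u z)) (jacobian (chart i \o u) z).

Definition sphere_integral (u : 'rV[R]_2 -> M) (a : dform 2) : R :=
  \int[@lebesgue_measure R]_(s in `[0, 1])
    \int[@lebesgue_measure R]_(t in `[0, 1])
      pullback_density u a (\row_(k < 2) if k == 0 then s else t).

Definition symplectically_aspherical (w : dform 2) : Prop :=
  forall u, sphere u -> sphere_integral u w = 0.

Definition endo : Type := idx A -> 'rV[R]_m -> 'M[R]_m.

Definition compatible_J (w : dform 2) (J : endo) : Prop :=
  [/\ forall i, smooth_mx (cod i) (J i),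
      forall i j x, overlap i j x ->
        J i x *m jacobian (transition i j) x =
        jacobian (transition i j) x *m J j (transition i j x),
      forall i x, cod i x -> J i x *m J i x = - 1%:M,
      forall i x (u v : 'rV[R]_m), cod i x ->
        w i x (col_mx (u *m J i x) (v *m J i x)) = w i x (col_mx u v)
    & forall i x (v : 'rV[R]_m), cod i x -> v != 0 ->
        0 < w i x (col_mx v (v *m J i x))].

(* Connection matrices of a connection on TM: in the chart i, the covariant
   derivative of a vector field s along v is D_v s + s *m C i x v. *)
Definition conn : Type := idx A -> 'rV[R]_m -> 'rV[R]_m -> 'M[R]_m.

Definition is_connection (C : conn) : Prop :=
  [/\ forall i x a (v u : 'rV[R]_m), cod i x ->
        C i x (a *: v + u) = a *: C i x v + C i x u,
      forall i v, smooth_mx (cod i) (fun x => C i x v)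
    & forall i j x v, overlap i j x ->
        let T := jacobian (transition i j) in
        C i x v *m T x = 'D_v T x + T x *m C j (transition i j x) (v *m T x)].

(* The connection satisfies nabla J = 0. *)
Definition preserves_J (J : endo) (C : conn) : Prop :=
  forall i x v, cod i x ->
    'D_v (J i) x + J i x *m C i x v = C i x v *m J i x.

Definition curvature (C : conn) (i : idx A) (x v u : 'rV[R]_m) : 'M[R]_m :=
  'D_v (fun y => C i y u) x - 'D_u (fun y => C i y v) x
  + C i x u *m C i x v - C i x v *m C i x u.

(* Chern-Weil: c_1 is represented by the real part of i/(2 pi) tr_C F; the
   imaginary part is exact.  As tr_C F = (tr F - i tr (J F)) / 2 for the real
   trace tr, the real part is tr (J F) / (4 pi). *)
Definition chern_form (J : endo) (C : conn) : dform 2 :=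
  fun i x V => (4 * pi)^-1 *
    \tr (curvature C i x (@usubmx R 1 1 m V) (@dsubmx R 1 1 m V) *m J i x).

(* [a] is a closed form representing c_1(M, w). *)
Definition represents_c1 (w : dform 2) (a : dform 2) : Prop :=
  exists J C,
    [/\ compatible_J w J, is_connection C, preserves_J J C
      & deRham_class (chern_form J C) a].

Definition spherically_monotone (w : dform 2) : Prop :=
  exists lambda : R, lambda != 0 /\
  exists2 c1 : dform 2, represents_c1 w c1 &
    forall u, sphere u -> sphere_integral u w = lambda * sphere_integral u c1.

End Manifold.

(* Injectivity of H^1 -> H^(2n-1), [a] |-> [a /\ w^(n-1)]. *)
Definition weak_lefschetz (R : realType) (n : nat) (M : topologicalType)
    (A : atlas R (2 * n)%N M) (w : dform A 2) : Prop :=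
  let L (a : dform A 1) : dform A (n.-1 * 2).+1%N :=
    wedge a (@wedge_pow _ _ _ _ w n.-1) in
  forall a b : dform A 1, closed_form a -> closed_form b ->
    deRham_class (L a) = deRham_class (L b) ->
    deRham_class a = deRham_class b.

(* Main.v *)
(* Let psi, phi be symplectic loops at the identity with homotopic orbits of x0,
and T the fiber integral over [0, 1] along the inverse flow; the flux of psi is
the class of - T w, and it suffices that T_psi w - T_phi w is exact.

(a), (b): the period of T eta along a loop p is an area of eta over a torus
t, s |-> Phi_t (p s). A grid on the homotopy between the orbits turns the
difference of the periods for psi and phi into areas of eta over spheres, for
any closed eta. In case (a) eta = w. In case (b) eta = w - lambda c1, and T c1
is exact: the connection pulled back by the flow, twisted by the complex
isomorphisms from J to Phi_t^* J, preserves a fixed complex structure, so the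
complex trace of its curvature is a coboundary, and the time derivative in it
integrates to zero around the loop.

(c): for the volume form sigma = w ^ ... ^ w, interior multiplication by the flow
field shows that T sigma is a multiple of T w ^ w^(n-1). For top forms mu the
class of T_psi mu - T_phi mu depends on the mass of mu only, since a form may be
moved inside cells by compactly supported primitives; following the homotopy of
orbits cell by cell, a form concentrated near x0 has exact difference. So
(T_psi w - T_phi w) ^ w^(n-1) is exact, and weak Lefschetz concludes. *)
From HB Require Import structures.
Require Import Defs.
From mathcomp Require Import all_boot all_order all_fingroup all_algebra.
From mathcomp Require Import all_classical all_reals all_analysis.
From mathcomp Require Import ring lra zify.
Set Implicit Arguments.
Unset Strict Implicit.
Unset Printing Implicit Defensive.
Import Order.TTheory GRing.Theory Num.Theory.
Import numFieldNormedType.Exports.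
Local Open Scope classical_set_scope.
Local Open Scope ring_scope.

(** The homotopy between the orbits is only continuous, and it is never smoothed. A grid of cells
    carries an abstract notion of state instead, with continuation along connected sets and
    uniqueness inside one cell. The same monodromy statement serves twice: states are paths from the
    base point in (a) and (b), and pairs of a top form and an accumulated primitive in (c). For (c)
    neither an orientation nor an integral over M is constructed. Either an exact top form supported
    in a cell always has a primitive supported there, which is the uniqueness that the grid needs,
    or some form of nonzero mass is exact, and then every top form supported in a cell is exact. The
    inverse flow enters because Psi_t preserves w: the contraction of Phi^* w with d/dt at (t, y) is
    then minus the contraction of w at y with the velocity of Psi, which is the integrand of the
    flux up to sign. Paths, squares and flows are all made stationary outside [0, 1] by a smooth
    step function, so that pieces can be concatenated without corners and areas and line integrals
    add up. *)

Implicit Types (R : realType) (M : topologicalType) (m : nat).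
Local Notation mu := (@lebesgue_measure _).
Local Notation "\i[ a , b ] t , F" := (\int[mu]_(t in `[a, b]) F) (at level 36, t name, F at level 36).
Local Notation dd v f x := ('D_v (f : _ -> _^o) x).
Local Notation is_dd x v f d := (is_derive x v (f : _ -> _^o) d).
Local Notation deriv1 f t := ('D_1 (f : _^o -> _^o) t).
Local Notation is_deriv t f d := (is_derive (t : _^o) (1 : _^o) (f : _^o -> _^o) d).
Local Notation smooth1 f := (smooth_fun [set: _^o] (f : _^o -> _)).
Arguments cod_open {R m M a} i.

(** * Smooth functions through iterated directional derivatives *)

Section Smoothness.
Context {R : realType}.
Implicit Types (V : normedModType R).

Lemma nearU (T : topologicalType) (U : set T) (P : T -> Prop) x :
 open U -> U x -> (forall y, U y -> P y) -> \forall y \near x, P y.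
move=> oU Ux UP; have : nbhs x U by exact: open_nbhs_nbhs.
by apply: filterS.
Qed.

Lemma Ck_ext V k (U : set V) (f g : V -> R) : open U ->
 (forall x, U x -> f x = g x) -> Ck k U f -> Ck k U g.
move=> oU; elim: k f g => [|k IH] f g fg /=.
 move=> fc x Ux; rewrite /prop_for /continuous_at -(fg _ Ux).
 apply: cvg_trans (fc x Ux); apply: near_eq_cvg.
 exact: nearU fg.
move=> fk v; have [fd fD] := fk v; split.
 move=> x Ux; apply: near_eq_derivable (fd x Ux).
 exact: nearU fg.
apply: IH fD => x Ux; apply: near_eq_derive.
exact: nearU fg.
Qed.

Lemma Ck_sub V k (U W : set V) (f : V -> R) : U `<=` W -> Ck k W f -> Ck k U f.
move=> UW; elim: k f => [|k IH] f /= Wf; first by move=> x /UW; exact: Wf.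
move=> v; have [] := Wf v; split; [move=> x /UW; auto|exact: IH].
Qed.

Lemma Ck_local V k (U : set V) (f : V -> R) :
 (forall x, U x -> exists2 W : set V, W x & Ck k W f) -> Ck k U f.
elim: k f => [|k IH] f Uf /=.
 move=> x /Uf[W Wx]; exact.
move=> v; split.
 move=> x /Uf[W Wx /(_ v)[+ _]]; exact.
by apply: IH => x /Uf[W Wx /(_ v)[]]; exists W.
Qed.

(** Directional derivability does not give continuity, so [Ck k.+1] does not formally contain
    [Ck k]. Asking for all lower orders at once restores this, and the inductions below rely on
    it. *)
Definition CK V (k : nat) (U : set V) (f : V -> R) :=
 forall j, (j <= k)%N -> Ck j U f.

Lemma CK_smooth V (U : set V) (f : V -> R) :
 smooth_fun U f <-> forall k, CK k U f.
split=> [fs k j _|fs k]; [exact: fs|exact: fs]. Qed.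

Lemma CK_ext V k (U : set V) (f g : V -> R) : open U ->
 (forall x, U x -> f x = g x) -> CK k U f -> CK k U g.
move=> oU fg fk j jk; apply: Ck_ext fg _ => //; exact: fk. Qed.

Lemma CK_le V k l (U : set V) (f : V -> R) : (l <= k)%N -> CK k U f -> CK l U f.
move=> lk fk j jl; apply: fk; exact: leq_trans lk. Qed.

Lemma CK_cont V k (U : set V) (f : V -> R) x : CK k U f -> U x ->
 {for x, continuous f}.
move/(_ 0); exact. Qed.

Lemma CKS_dd V k (U : set V) (f : V -> R) x v : CK k.+1 U f -> U x ->
 is_dd x v f (dd v f x).
move=> /(_ 1 isT) /(_ v)[fd _] Ux; apply/derivableP; exact: fd. Qed.

Lemma CKS_D V k (U : set V) (f : V -> R) v : CK k.+1 U f ->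
 CK k U (fun x => dd v f x).
by move=> fk j jk; have := fk j.+1 jk => /(_ v)[]. Qed.

(** Introduction rule for inductions on the order: it takes a formula [df] for the derivatives, so
    that the inductive step only concerns [df]. *)
Lemma CKSI V k (U : set V) (f : V -> R) (df : V -> V -> R) : open U ->
 (forall x, U x -> {for x, continuous f}) ->
 (forall v x, U x -> is_dd x v f (df v x)) ->
 (forall v, CK k U (df v)) -> CK k.+1 U f.
move=> oU fc fd fk [|j] jk; first exact: fc.
move=> v; split=> [x Ux|]; first by have := fd v x Ux.
by apply: Ck_ext oU _ (fk v j jk) => x Ux; have /@derive_val := fd v x Ux.
Qed.

Lemma CK_cst V k (U : set V) (c : R) : open U -> CK k U (fun=> c).
move=> oU; elim: k c => [|k IH] c.
 case=> // _ x _; exact: cvg_cst.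
apply: CKSI => // x _; exact: cvg_cst.
Qed.

Lemma CKD V k (U : set V) (f g : V -> R) : open U -> CK k U f -> CK k U g ->
 CK k U (fun x => f x + g x).
move=> oU; elim: k f g => [|k IH] f g fk gk.
 case=> // _ x Ux; apply: cvgD; [exact: CK_cont fk _|exact: CK_cont gk _].
apply(@CKSI _ _ _ _ (fun v x => dd v f x + dd v g x)) => //.
- move=> x Ux; apply: cvgD; [exact: CK_cont fk _|exact: CK_cont gk _].
- move=> v x Ux; apply: is_deriveD; [exact: CKS_dd fk _|exact: CKS_dd gk _].
- move=> v; apply: IH; exact: CKS_D.
Qed.

Lemma CKM V k (U : set V) (f g : V -> R) : open U -> CK k U f -> CK k U g ->
 CK k U (fun x => f x * g x).
move=> oU; elim: k f g => [|k IH] f g fk gk.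
 case=> // _ x Ux; apply: cvgM; [exact: CK_cont fk _|exact: CK_cont gk _].
apply(@CKSI _ _ _ _ (fun v x => f x * dd v g x + g x * dd v f x)) => //.
- move=> x Ux; apply: cvgM; [exact: CK_cont fk _|exact: CK_cont gk _].
- move=> v x Ux; apply: is_deriveM; [exact: CKS_dd fk _|exact: CKS_dd gk _].
- move=> v; apply: CKD => //; apply: IH;
  by [apply: CK_le |apply: gk|exact: CKS_D].
Qed.

Lemma CKV V k (U : set V) (f : V -> R) : open U -> (forall x, U x -> f x != 0) ->
 CK k U f -> CK k U (fun x => (f x)^-1).
move=> oU f0; elim: k => [|k IH] fk.
 case=> // _ x Ux; apply: cvgV; [exact: f0|exact: CK_cont fk _].
apply(@CKSI _ _ _ _ (fun v x => -1 * ((f x)^-1 * (f x)^-1 * dd v f x))) => //.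
- move=> x Ux; apply: cvgV; [exact: f0|exact: CK_cont fk _].
- move=> v x Ux; have h := CKS_dd v fk Ux.
 have [fd _] := h; split; first exact: (derivableV (f0 _ _)).
 rewrite (deriveV (f0 _ Ux) fd) /GRing.scale /= invfM; ring.
- move=> v; have ? := IH (CK_le (leqnSn k) fk).
 apply: CKM => //; [exact: CK_cst|apply: CKM => //; [exact: CKM|exact: CKS_D]].
Qed.

Lemma smooth_cst V (U : set V) (c : R) : open U -> smooth_fun U (fun=> c).
move=> oU; apply/CK_smooth => k; exact: CK_cst. Qed.

Lemma smoothD V (U : set V) (f g : V -> R) : open U -> smooth_fun U f ->
 smooth_fun U g -> smooth_fun U (fun x => f x + g x).
move=> oU /CK_smooth fs /CK_smooth gs; apply/CK_smooth => k; exact: CKD. Qed.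

Lemma smoothM V (U : set V) (f g : V -> R) : open U -> smooth_fun U f ->
 smooth_fun U g -> smooth_fun U (fun x => f x * g x).
move=> oU /CK_smooth fs /CK_smooth gs; apply/CK_smooth => k; exact: CKM. Qed.

Lemma smoothV V (U : set V) (f : V -> R) : open U -> (forall x, U x -> f x != 0) ->
 smooth_fun U f -> smooth_fun U (fun x => (f x)^-1).
move=> oU f0 /CK_smooth fs; apply/CK_smooth => k; exact: CKV. Qed.

Lemma smooth_ext V (U : set V) (f g : V -> R) : open U ->
 (forall x, U x -> f x = g x) -> smooth_fun U f -> smooth_fun U g.
by move=> oU fg fs k; apply: Ck_ext fg _. Qed.

Lemma smooth_sub V (U W : set V) (f : V -> R) : U `<=` W -> smooth_fun W f ->
 smooth_fun U f.
by move=> UW fs k; apply: Ck_sub UW _. Qed.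

Lemma smooth_local V (U : set V) (f : V -> R) :
 (forall x, U x -> exists2 W : set V, W x & smooth_fun W f) -> smooth_fun U f.
by move=> fs k; apply: Ck_local => x /fs[W]; exists W. Qed.

Lemma smoothN V (U : set V) (f : V -> R) : open U -> smooth_fun U f ->
 smooth_fun U (fun x => - f x).
move=> oU fs; apply(@smooth_ext _ _ (fun x => -1 * f x)) => //.
 by move=> x; rewrite mulN1r.
apply: smoothM => //; exact: smooth_cst.
Qed.

Lemma smoothB V (U : set V) (f g : V -> R) : open U -> smooth_fun U f ->
 smooth_fun U g -> smooth_fun U (fun x => f x - g x).
move=> oU fs gs; apply: smoothD => //; exact: smoothN. Qed.

Lemma smooth_sum V (U : set V) (I : Type) (r : seq I) (P : pred I) (f : I -> V -> R) :
 open U -> (forall i, P i -> smooth_fun U (f i)) ->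
 smooth_fun U (fun x => \sum_(i <- r | P i) f i x).
move=> oU fs; elim: r => [|i r IH].
 by apply: smooth_ext oU _ (smooth_cst 0 oU) => x; rewrite big_nil.
case Pi: (P i).
 apply: (smooth_ext oU _ (smoothD oU (fs i Pi) IH)) => x _.
 by rewrite big_cons Pi.
by apply: smooth_ext oU _ IH => x; rewrite big_cons Pi.
Qed.

Lemma smooth_prod V (U : set V) (I : Type) (r : seq I) (P : pred I) (f : I -> V -> R) :
 open U -> (forall i, P i -> smooth_fun U (f i)) ->
 smooth_fun U (fun x => \prod_(i <- r | P i) f i x).
move=> oU fs; elim: r => [|i r IH].
 by apply: smooth_ext oU _ (smooth_cst 1 oU) => x; rewrite big_nil.
case Pi: (P i).
 apply: (smooth_ext oU _ (smoothM oU (fs i Pi) IH)) => x _.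
 by rewrite big_cons Pi.
by apply: smooth_ext oU _ IH => x; rewrite big_cons Pi.
Qed.

Lemma smooth_D V (U : set V) (f : V -> R) v : smooth_fun U f ->
 smooth_fun U (fun x => dd v f x).
by move=> /CK_smooth fs; apply/CK_smooth => k; apply: CKS_D. Qed.

Lemma smooth_cont V (U : set V) (f : V -> R) x : smooth_fun U f -> U x ->
 {for x, continuous f}.
move/CK_smooth /(_ 0); exact: CK_cont. Qed.

Lemma smooth_dd V (U : set V) (f : V -> R) x v : smooth_fun U f -> U x ->
 is_dd x v f (dd v f x).
move/CK_smooth /(_ 1); exact: CKS_dd. Qed.

Lemma smooth_derivable V (U : set V) (f : V -> R) x v : smooth_fun U f -> U x ->
 derivable (f : V -> R^o) x v.
by move=> fs Ux; have := smooth_dd v fs Ux. Qed.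

Lemma smooth_lin V (U : set V) (f : V -> R) : open U -> continuous f ->
 (forall (a : R) x y, f (a *: x + y) = a * f x + f y) -> smooth_fun U f.
move=> oU fc fl; apply/CK_smooth; case=> [|k].
 case=> // _ x _; exact: fc.
apply(@CKSI _ _ _ _ (fun v _ => f v)) => // [x _|v x _|v]; [exact: fc| |exact: CK_cst].
have E : (fun h => h^-1 *: ((f \o shift x) (h *: v) - f x)) @ (0:R)^' --> f v.
 apply: (@cvg_trans _ (_ @ (0:R)^')); last exact: cvg_cst.
 apply: near_eq_cvg; near=> h.
 rewrite /= fl addrK /GRing.scale /= mulKf //.
 near: h; exact: nbhs_dnbhs_neq.
by split; [apply/cvg_ex; exists (f v)|exact: cvg_lim].
Unshelve. all: by end_near. Qed.

Lemma smooth_coord p q (U : set 'M[R]_(p, q)) i j : open U ->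
 smooth_fun U (fun z : 'M[R]_(p, q) => z i j).
by move=> oU; apply: smooth_lin => // [|a x y]; [exact: coord_continuous|rewrite !mxE].
Qed.

(* Precomposition with a continuous affine map: no differentiability of [f]
  is needed, since directional derivatives are transported as they are. *)
Lemma is_dd_aff V V' (L : V' -> V) (f : V -> R) x v v' :
 (forall h : R, L (h *: v' + x) = h *: v + L x) ->
 derivable (f : V -> R^o) (L x) v ->
 is_dd x v' (f \o L) (dd v f (L x)).
move=> Lh fd.
have E : (fun h => h^-1 *: (((f \o L : _ -> R) \o shift x) (h *: v') - (f \o L) x)) =
  fun h => h^-1 *: ((f \o shift (L x)) (h *: v) - f (L x)).
 by apply/funext => h /=; rewrite Lh.
by split; rewrite /derivable /derive E.
Qed.

Lemma CK_aff V V' k (L L0 : V' -> V) (U : set V') (W : set V) (f : V -> R) :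
 open U -> (forall x, U x -> W (L x)) -> continuous L ->
 (forall (h : R) v x, L (h *: v + x) = h *: L0 v + L x) ->
 CK k W f -> CK k U (f \o L).
move=> oU UW Lc Lh.
have c0 (g : V -> R) (x : V') : (forall y, W y -> {for y, continuous g}) -> U x -> {for x, continuous (g \o L)}.
 move=> gc Ux; apply: continuous_comp; [exact: Lc|exact/gc/UW].
elim: k f => [|k IH] f fk.
 case=> // _ x; apply: c0 => y; exact: CK_cont fk.
apply: (@CKSI _ _ _ _ (fun v => (fun y => dd (L0 v) f y) \o L)) => //.
- move=> x; apply: c0 => y; exact: CK_cont fk.
- move=> v x Ux; apply: is_dd_aff => // .
 by have := CKS_dd _ fk (UW _ Ux).
- by move=> v; apply: IH; exact: CKS_D.
Qed.

Lemma smooth_aff V V' (L L0 : V' -> V) (U : set V') (W : set V) (f : V -> R) :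
 open U -> (forall x, U x -> W (L x)) -> continuous L ->
 (forall (h : R) v x, L (h *: v + x) = h *: L0 v + L x) ->
 smooth_fun W f -> smooth_fun U (f \o L).
by move=> oU UW Lc Lh /CK_smooth fs; apply/CK_smooth => k; apply(@CK_aff _ _ _ L L0 _ W).
Qed.

End Smoothness.

(** * Differentiability in finite dimension: chain rule and symmetry of second derivatives *)

Section Differentiability.
Context {R : realType}.
Implicit Types (V : normedModType R).

Lemma eq_lerr (x y : R) : x = y -> x <= y.
by move->. Qed.

Lemma dist_le_half (a b c e : R) : `|a - c| <= e / 2 -> `|b - c| <= e / 2 ->
 `|a - b| <= e.
move=> h1 h2; rewrite (splitr e) (le_trans _ (lerD h1 h2)) //.
rewrite [X in _ <= _ X]distrC (le_trans _ (ler_normD _ _)) //.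
rewrite eq_lerr //; congr `|_|; ring.
Qed.

Lemma mx_cvgP (T : Type) (F : set_system T) (FF : Filter F) p q
  (f : T -> 'M[R]_(p, q)) (l : 'M[R]_(p, q)) :
 (forall i j, (fun t => f t i j) @ F --> l i j) -> f @ F --> l.
move=> fl; apply/cvgrPdist_le => /= e e0; near=> x.
rewrite /Num.Def.normr/= mx_normrE (bigmax_le _ (ltW _))//= => i _.
rewrite !mxE; move: i; near: x; apply: filter_forall => /= i.
exact: (cvgrPdist_le _ _).1.
Unshelve. all: by end_near. Qed.

Lemma mx_continuousP (T : topologicalType) p q (f : T -> 'M[R]_(p, q)) x :
 (forall i j, {for x, continuous (fun y => f y i j)}) -> {for x, continuous f}.
move=> fc; apply: mx_cvgP => j; exact: fc. Qed.

Lemma coord_cvg (T : Type) (F : set_system T) (FF : Filter F) p q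
  (f : T -> 'M[R]_(p, q)) (l : 'M[R]_(p, q)) i j :
 f @ F --> l -> (fun t => f t i j) @ F --> l i j.
move=> fl; apply(@cvg_comp _ _ _ f (fun M : 'M[R]__ => M i j) F (nbhs l)) => //.
exact: coord_continuous.
Qed.

Lemma coord_le p q (x : 'M[R]_(p, q)) i j : `|x i j| <= `|x|.
rewrite [leRHS]/Num.Def.normr/= mx_normrE.
exact: le_bigmax (i, j).
Qed.

Lemma mx_norm_le p q (x : 'M[R]_(p, q)) e : 0 <= e ->
 (forall i j, `|x i j| <= e) -> `|x| <= e.
move=> e0 xe; rewrite /Num.Def.normr/= mx_normrE.
apply: bigmax_le => //.
Qed.

Lemma MVT_dir V (f df : V -> R) x v :
 (forall t : R, 0 <= t <= 1 ->
   is_dd (t *: v + x) v f (df (t *: v + x))) ->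
 exists2 t : R, 0 <= t <= 1 & f (v + x) - f x = df (t *: v + x).
move=> fd; pose g t : R^o := f (t *: v + x).
have gd (t : R) : 0 <= t <= 1 -> is_deriv t g (df (t *: v + x)).
 move=> /fd ft; have [fdt <-] := ft.
 apply: is_dd_aff => // h.
 have -> : h *: 1 = h by rewrite /GRing.scale /= mulr1.
 by rewrite scalerDl addrA.
have [|||c] := @MVT R g (fun t => df (t *: v + x)) 0 1.
- exact: ltr01.
- by move=> t; rewrite /= => /andP[t0 t1]; apply: gd; rewrite !ltW.
- apply: derivable_within_continuous => t; rewrite in_itv /= => t01.
 by have [] := gd t.
rewrite in_itv /= => /andP[c0 c1] gE; exists c; first by rewrite !ltW.
by move: gE; rewrite /g scale1r scale0r add0r subr0 mulr1.
Qed.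

Lemma derive_line V (W : normedModType R) (f : V -> W) x v :
 'D_v f x = 'D_(1 : R^o) (fun h : R^o => f (h *: v + x)) 0.
rewrite /derive; set g1 := fun h => h^-1 *: _; set g2 := fun h => h^-1 *: _.
suff -> : g1 = g2 by [].
rewrite funeqE /g1 /g2 => h /=.
by rewrite addr0 scale0r add0r /GRing.scale /= mulr1.
Qed.

Lemma is_derive_lineP V (W : normedModType R) (f : V -> W) x v d :
 is_derive x v f d <->
 is_derive (0 : R^o) (1 : R^o) (fun h : R^o => f (h *: v + x)) d.
split=> -[fd <-]; split.
- exact: (iffLR (derivable1P f x v)).
- by rewrite -derive_line.
- exact: (iffRL (derivable1P f x v)).
- by rewrite derive_line.
Qed.

Lemma is_dd_scale V (f : V -> R) x v (c d : R) :
 is_dd x v f d -> is_dd x (c *: v) f (c * d).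
move=> /is_derive_lineP fd; apply/is_derive_lineP.
rewrite mulrC.
have -> : (fun h : R^o => f (h *: (c *: v) + x)) =
  (fun h => f (h *: v + x)) \o fun h => h * c.
 by apply/funext => h; rewrite scalerA.
apply: is_derive1_comp; first by rewrite mul0r.
have -> : (fun h => h * c) = c *: id by apply/funext => h; rewrite mulrC.
by apply: is_derive_eq; rewrite /GRing.scale /= mulr1.
Qed.

(** The increment from [x] to [w + x] is split into changes of one coordinate. The mean value
    theorem on each piece, with the continuity of the partial derivatives, compares it with the
    linear map [l]. *)
Lemma CK1_differentiable p (U : set 'rV[R]_p) (f : 'rV[R]_p -> R) x :
 open U -> CK 1 U f -> U x -> differentiable (f : 'rV[R]_p -> R^o) x.
move=> oU f1 Ux.
pose e_ (j : 'I_p) : 'rV[R]_p := delta_mx 0 j.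
pose l (w : 'rV[R]_p) : R^o := \sum_j w 0 j * dd (e_ j) f x.
have ll : linear l.
 move=> a u v; rewrite /l /GRing.scale /= mulr_sumr -big_split /=.
 by apply: eq_bigr => j _; rewrite !mxE mulrDl mulrA.
pose L := HB.pack_for {linear 'rV[R]_p -> R^o} l (GRing.isLinear.Build R _ _ _ l ll).
have Lc : continuous L.
 move=> w; have /(@smooth_cont _ _ [set: 'rV[R]_p] _ w) : smooth_fun [set: 'rV[R]_p] (l : 'rV[R]_p -> R).
  apply: smooth_sum => [|j _]; first exact: openT.
  by apply: smoothM; [exact: openT|apply: smooth_coord; exact: openT|apply: smooth_cst; exact: openT].
 by apply.
have key : forall eps : R, 0 < eps -> \forall w \near (0 : 'rV[R]_p),
  `|f (w + x) - f x - l w| <= eps * `|w|.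
 move=> eps eps0.
 (* The denominator [p.+1] in place of [p] also covers dimension 0. *)
 have e0 : 0 < eps / p.+1%:R by rewrite divr_gt0.
 have [d d0 dP] : exists2 d : R, 0 < d & forall y, `|y - x| < d ->
   U y /\ forall j, `|dd (e_ j) f y - dd (e_ j) f x| <= eps / p.+1%:R.
  have : \forall y \near x, U y /\ forall j, `|dd (e_ j) f y - dd (e_ j) f x| <= eps / p.+1%:R.
   near=> y; split; first by near: y; exact: open_nbhs_nbhs.
   move=> j; move: j; near: y; apply: filter_forall => j.
   have := CK_cont (CKS_D (e_ j) f1) Ux.
   by move=> /cvgrPdist_le /(_ _ e0); apply: filterS => y; rewrite distrC.
  move=> /nbhs_ballP [d d0 dP]; exists d => // y yx; apply: dP.
  by rewrite -ball_normE /ball_ /= distrC.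
 apply/nbhs_ballP; exists d => //= w; rewrite -ball_normE /ball_ /= sub0r normrN => wd.
 (* Staircase from 0 to [w]: the first [k] coordinates of [w] are kept. *)
 pose tr k : 'rV[R]_p := \row_j (if (j < k)%N then w 0 j else 0).
 have trS (j : 'I_p) : tr j.+1 = w 0 j *: e_ j + tr j.
  apply/rowP => k; rewrite !mxE /= ltnS leq_eqVlt.
  have [->|kj] := eqVneq k j; first by rewrite eqxx ltnn /= mulr1 addr0.
  by rewrite (inj_eq val_inj) (negbTE kj) /= mulr0 add0r.
 have step (j : 'I_p) : `|f (tr j.+1 + x) - f (tr j + x) - w 0 j * dd (e_ j) f x|
   <= eps / p.+1%:R * `|w|.
  have bnd s : 0 <= s <= 1 -> `|s *: (w 0 j *: e_ j) + (tr j + x) - x| <= `|w|.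
   move=> /andP[s0 s1]; rewrite addrA addrK; apply: mx_norm_le => // i k.
   rewrite !mxE ord1 eqxx /=; have [->|kj] := eqVneq k j.
   rewrite ltnn addr0 mulr1 normrM (ger0_norm s0).
   by rewrite (le_trans (ler_piMl (normr_ge0 _) s1)) // coord_le.
   rewrite mulr0 mulr0 add0r; case: ifP => _; first exact: coord_le.
   by rewrite normr0.
  have [s s01 sE] := @MVT_dir _ f
   (fun y => w 0 j * dd (e_ j) f y) (tr j + x) (w 0 j *: e_ j)
   (fun t t01 => is_dd_scale (w 0 j) (CKS_dd (e_ j) f1
   (proj1 (dP _ (le_lt_trans (bnd _ t01) wd))))).
  have -> : f (tr j.+1 + x) - f (tr j + x) = w 0 j * dd (e_ j) f (s *: (w 0 j *: e_ j) + (tr j + x)).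
   by rewrite -sE trS addrA.
  rewrite -mulrBr normrM mulrC ler_pM //; last exact: coord_le.
  by have [_] := dP _ (le_lt_trans (bnd _ s01) wd); apply.
 have tr0 : tr 0%N = 0 by apply/rowP => k; rewrite !mxE.
 have trp : tr p = w by apply/rowP => k; rewrite !mxE ltn_ord.
 have -> : f (w + x) - f x = \sum_(j < p) (f (tr j.+1 + x) - f (tr j + x)).
  rewrite -(big_mkord predT (fun j => f (tr j.+1 + x) - f (tr j + x))).
  by rewrite telescope_sumr // trp tr0 add0r.
 rewrite /l -sumrB (le_trans (ler_norm_sum _ _ _)) //.
 apply: le_trans (ler_sum _ (fun j _ => step j)) _.
 rewrite sumr_const card_ord -mulrnAl ler_wpM2r // -mulr_natr -mulrA ler_piMr ?(ltW eps0) //.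
 by rewrite mulrC ler_pdivrMr // mul1r ler_nat.
have [:lo] dE : 'd (f : 'rV[R]_p -> R^o) x = L :> ('rV[R]_p -> R^o).
 apply: diff_unique => //; abstract: lo.
 by apply/eqaddoP => eps eps0; have := key _ eps0; apply: filterS => w /=; rewrite opprD addrA.
by apply/diff_locallyP; rewrite dE; split.
Unshelve. all: by end_near. Qed.


(** Restriction to the line through [x] makes [g] differentiable in one variable, so its derivative
    in the single direction [v] suffices and the source may be any normed module, in particular time
    times space. *)
Lemma is_derive_comp p V (f : 'rV[R]_p -> R) (g : V -> 'rV[R]_p) x v (dg : 'rV[R]_p) :
 differentiable (f : 'rV[R]_p -> R^o) (g x) ->
 (forall j, is_dd x v (fun y => g y 0 j) (dg 0 j)) ->
 is_dd x v (fun y => f (g y))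
  (\sum_j dg 0 j * dd (delta_mx 0 j) f (g x)).
move=> fd gd.
have gdv : derivable g x v by apply/derivable_mxP => j; rewrite ord1.
have gE : 'D_v g x = dg.
 rewrite derive_mx //; apply/rowP => j; rewrite mxE.
 by have [] := gd j.
pose l h := g (h *: v + x).
have ld : differentiable l 0.
 by apply: (iffLR (derivable1_diffP l 0)); exact: (iffLR (derivable1P g x v)).
have l0 : l 0 = g x by rewrite /l scale0r add0r.
have fld : differentiable (f \o l) 0.
 by apply: differentiable_comp => //; rewrite l0.
have lE : 'd l 0 1 = dg.
 by rewrite -deriveE // -gE [RHS]derive_line.
have E : dd v (fun y => f (g y)) x = 'D_1 (f \o l) 0.
 by rewrite derive_line.
split.
 apply(derivable1P).
 exact: (iffRL (derivable1_diffP _ 0)).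
rewrite E deriveE // diff_comp //= ?l0 // lE.
rewrite {1}(row_sum_delta dg) linear_sum; apply: eq_bigr => j _.
by rewrite linearZ deriveE.
Qed.

Lemma derive_lin p (f : 'rV[R]_p -> R) x (a : R) u v :
 differentiable (f : 'rV[R]_p -> R^o) x ->
 dd (a *: u + v) f x =
 a * dd u f x + dd v f x.
by move=> fd; rewrite !deriveE // linearP. Qed.

Lemma derive_coord p (f : 'rV[R]_p -> R) x v :
 differentiable (f : 'rV[R]_p -> R^o) x ->
 dd v f x =
 \sum_j v 0 j * dd (delta_mx 0 j) f x.
move=> fd; rewrite deriveE // {1}(row_sum_delta v) linear_sum.
by apply: eq_bigr => j; rewrite linearZ deriveE.
Qed.

Lemma smooth_differentiable p (U : set 'rV[R]_p) (f : 'rV[R]_p -> R) x :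
 open U -> smooth_fun U f -> U x -> differentiable (f : 'rV[R]_p -> R^o) x.
move=> oU /CK_smooth /(_ 1); exact: CK1_differentiable. Qed.

(** The outer function is smooth, so only the order of [g] drops in the induction. The finite order
    matters in [smooth_inverse], where [g] gains one order at a time. *)
Lemma CK_comp p V k (U : set V) (W : set 'rV[R]_p) (f : 'rV[R]_p -> R)
  (g : V -> 'rV[R]_p) : open U -> open W -> (forall x, U x -> W (g x)) ->
 smooth_fun W f -> (forall j, CK k U (fun x => g x 0 j)) ->
 CK k U (fun x => f (g x)).
move=> oU oW UW.
have c0 (f' : 'rV[R]_p -> R) x : smooth_fun W f' -> (forall j, {for x, continuous (fun x => g x 0 j)}) -> U x ->
  {for x, continuous (fun x => f' (g x))}.
 move=> f's gc Ux; apply: (@continuous_comp _ _ _ g f').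
  by apply: mx_continuousP => i j; rewrite ord1; exact: gc.
 exact: smooth_cont f's (UW _ Ux).
elim: k f => [|k IH] f fs gs.
 by case=> // _ x Ux; apply: c0 => // j; exact: CK_cont (gs j) Ux.
apply: (@CKSI _ _ _ _ _ (fun v x => \sum_j dd v (fun x => g x 0 j) x *
  dd (delta_mx 0 j) f (g x))) => //.
- by move=> x Ux; apply: c0 => // j; exact: CK_cont (gs j) Ux.
- move=> v x Ux.
 have := @is_derive_comp p V f g x v (\row_j dd v (fun x => g x 0 j) x)
  (smooth_differentiable oW fs (UW _ Ux)).
 under eq_bigr do rewrite mxE; apply=> j.
 by rewrite mxE; apply: CKS_dd (gs j) Ux.
- move=> v; have gk j : CK k U (fun x => g x 0 j) by apply: CK_le (gs j).
 have H j : CK k U (fun x => dd v (fun x => g x 0 j) x *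
   dd (delta_mx 0 j) f (g x)).
  apply: CKM => //; first exact: CKS_D (gs j).
  by apply: (IH (fun y => dd (delta_mx 0 j) f y)) => //; exact: smooth_D.
 have : forall r : seq 'I_p, CK k U (fun x => \sum_(j <- r) (dd v (fun x => g x 0 j) x *
   dd (delta_mx 0 j) f (g x))).
  elim=> [|j r IHr].
   by apply: (CK_ext oU _ (CK_cst 0 oU)) => x _; rewrite big_nil.
  by apply: (CK_ext oU _ (CKD oU (H j) IHr)) => x _; rewrite big_cons.
 by apply.
Qed.

Lemma smooth_comp p V (U : set V) (W : set 'rV[R]_p) (f : 'rV[R]_p -> R)
  (g : V -> 'rV[R]_p) : open U -> open W -> (forall x, U x -> W (g x)) ->
 smooth_fun W f -> smooth_mx U g -> smooth_fun U (fun x => f (g x)).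
move=> oU oW UW fs gs; apply/CK_smooth => k; apply: CK_comp oU oW UW fs _ => j.
by move: k; apply/CK_smooth.
Qed.

(** The second difference of [f] over the parallelogram spanned by [h *: u] and [h *: v], computed
    in both orders, is h^2 times either mixed derivative at a point close to [x]; continuity of both
    derivatives at [x] concludes. *)
Lemma smooth_schwarz p (U : set 'rV[R]_p) (f : 'rV[R]_p -> R) u v x :
 open U -> smooth_fun U f -> U x ->
 dd u (fun y => dd v f y) x =
 dd v (fun y => dd u f y) x.
move=> oU fs Ux.
pose D2 (u v : 'rV_p) y : R := dd u (fun y => dd v f y) y.
have D2c u' v' : {for x, continuous (D2 u' v')}.
 by apply: smooth_cont Ux; do 2 apply: smooth_D.
apply/eqP; rewrite -subr_eq0 -normr_le0; apply/ler_addgt0Pr => e e0; rewrite add0r.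
have e2 : 0 < e / 2 by rewrite divr_gt0.
have : \forall y \near x, U y /\ `|D2 u v x - D2 u v y| <= e / 2 /\ `|D2 v u x - D2 v u y| <= e / 2.
 have /cvgrPdist_le /(_ _ e2) H1 := D2c u v.
 have /cvgrPdist_le /(_ _ e2) H2 := D2c v u.
 exact: filterI (open_nbhs_nbhs _) (filterI H1 _).
move=> /nbhs_ballP [d d0 dP].
have {}dP y : `|y - x| < d -> U y /\ (`|D2 u v x - D2 u v y| <= e / 2 /\ `|D2 v u x - D2 v u y| <= e / 2).
 by move=> yx; apply: dP; rewrite -ball_normE //= distrC.
(* With this [h] the parallelogram stays within [d] of [x]; the summand 1 covers the case of two
   zero vectors. *)
pose h := d / 2 / (`|u| + `|v| + 1).
have n0 : 0 < `|u| + `|v| + 1 by rewrite //.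
have h0 : 0 < h by rewrite !divr_gt0.
have nz (s : R) (w : 'rV[R]_p) : 0 <= s -> `|s *: w| = s * `|w|.
 by move=> s0; rewrite normrZ ger0_norm.
have near_x (s t : R) : 0 <= s <= 1 -> 0 <= t <= 1 -> `|s *: (h *: u) + (t *: (h *: v) + x) - x| < d.
 move=> /andP[s0 s1] /andP[t0 t1]; rewrite addrA addrK.
 apply(@le_lt_trans _ _ (h * (`|u| + `|v| + 1))); last first.
  by rewrite divfK // ltr_pdivrMr // ltr_pMr // ltr1n.
 rewrite (le_trans (ler_normD _ _)) // !nz ?(ltW h0) //.
 rewrite mulrDr mulr1 -[leLHS]addr0 lerD ?(ltW h0) // mulrDr.
 by apply: lerD; rewrite ler_piMl // mulr_ge0 // ltW.
have main (u' v' : 'rV_p) :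
  (forall s t : R, 0 <= s <= 1 -> 0 <= t <= 1 -> `|s *: (h *: u') + (t *: (h *: v') + x) - x| < d) ->
  exists2 y, `|y - x| < d & f (h *: u' + (h *: v' + x)) - f (h *: v' + x) - (f (h *: u' + x) - f x) = h * (h * D2 u' v' y).
 move=> nx.
 have fD z w : U z -> is_dd z (h *: w) f (h * dd w f z).
  by move=> Uz; apply: is_dd_scale; apply: smooth_dd.
 pose g y := f (h *: u' + y) - f y.
 have [|t t01] := @MVT_dir _ g (fun y => h * dd v' f (h *: u' + y) - h * dd v' f y) x (h *: v').
  move=> t t01; apply: is_deriveB.
   have Uz : U (h *: u' + (t *: (h *: v') + x)).
   by have := nx 1 t; rewrite scale1r => /(_ _ _) /dP[]//; rewrite ler01 lexx.
   have [D <-] := fD _ v' Uz.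
   apply@is_dd_aff => // k.
   by rewrite addrCA.
  apply: fD; have := nx 0 t; rewrite scale0r add0r => /(_ _ _) /dP[]//.
  by rewrite ler01 lexx.
 rewrite /g => gE.
 have [|s s01 sE] := @MVT_dir _ (fun y => dd v' f y) (fun y => h * D2 u' v' y) (t *: (h *: v') + x) (h *: u').
  move=> s s01; apply: is_dd_scale; apply(@smooth_dd _ _ U).
   exact: smooth_D.
  by have [] := dP _ (nx s t _ _).
 exists (s *: (h *: u') + (t *: (h *: v') + x)); first exact: nx.
 by rewrite -sE mulrBr.
have [y1 /dP[_ [_ y1e]] y1E] := main v u (fun s t s01 t01 =>
 eq_ind _ (fun z => `|z| < d) (near_x t s t01 s01) _ (congr1 (fun z => z - x) (addrCA _ _ _))).
have [y2 /dP[_ [y2e _]] y2E] := main u v near_x.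
have E : D2 u v y2 = D2 v u y1.
 have hn : h != 0 by rewrite gt_eqF.
 apply(mulfI hn); apply(mulfI hn).
 rewrite -[LHS]y2E -y1E [h *: v + (h *: u + x)]addrCA.
 ring.
rewrite -E in y1e; exact: dist_le_half y1e.
Qed.

End Differentiability.

(** * Integrals over segments and their dependence on parameters *)

Section Integrals.
Context {R : realType}.
Implicit Types (V : normedModType R).

Lemma cont_integrable (f : R -> R) a b : continuous f ->
 mu.-integrable `[a, b] (EFin \o f).
move=> fc; apply: continuous_compact_integrable; first exact: segment_compact.
exact: continuous_subspaceT.
Qed.
Hint Resolve cont_integrable : core.

Lemma int_point (f : R -> R) a : \i[a, a] t, f t = 0.
by rewrite set_itv1 Rintegral_set1. Qed.

Lemma eq_int (f g : R -> R) a b : (forall t, a <= t <= b -> f t = g t) ->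
 \i[a, b] t, f t = \i[a, b] t, g t.
move=> fg; apply: eq_Rintegral => t; rewrite inE; exact: fg. Qed.

Lemma int_cst a b (c : R) : a <= b -> \i[a, b] t, c = c * (b - a).
move=> ab; rewrite Rintegral_cst //= lebesgue_measure_itv /= lte_fin.
by case: ltgtP ab => // ->; rewrite subrr.
Qed.

Lemma FTC2 (f F : R -> R) a b : a <= b -> continuous f ->
 (forall t : R, a <= t <= b -> is_deriv t F (f t)) ->
 \i[a, b] t, f t = F b - F a.
rewrite le_eqVlt => /predU1P[->|ab] fc Fd; first by rewrite int_point subrr.
have Fc t : a <= t <= b -> {for t, continuous F}.
 move=> /Fd [+ _] => /derivable1_diffP; exact: differentiable_continuous.
rewrite /Rintegral (@continuous_FTC2 _ f F) //.
- exact: continuous_subspaceT.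
- split.
 + by move=> t; rewrite /= => /andP[ta tb]; have [] := Fd t; rewrite ?ltW.
 + by apply: cvg_at_right_filter; apply: Fc; rewrite lexx ltW.
 + by apply: cvg_at_left_filter; apply: Fc; rewrite lexx ltW.
- move=> t; rewrite in_itv /= => /andP[ta tb]; rewrite derive1E.
 by have [] := Fd t; rewrite ?ltW.
Qed.

Lemma FTC1 (f : R -> R) c x : continuous f -> c < x ->
 is_deriv x (fun y => \i[c, y] t, f t) (f x).
move=> fc cx.
have [] := @continuous_FTC1_closed R f c x (x + 1) _ _ cx (fc x).
- by rewrite ltrDl.
- exact: cont_integrable.
by move=> d; rewrite derive1E => <-; apply/derivableP.
Qed.

Lemma intD (f g : R -> R) a b : continuous f -> continuous g ->
 \i[a, b] t, (f t + g t) =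
 \i[a, b] t, f t + \i[a, b] t, g t.
move=> fc gc; rewrite RintegralD //; exact: cont_integrable. Qed.

Lemma intB (f g : R -> R) a b : continuous f -> continuous g ->
 \i[a, b] t, (f t - g t) =
 \i[a, b] t, f t - \i[a, b] t, g t.
move=> fc gc; rewrite RintegralB //; exact: cont_integrable. Qed.

Lemma intZ (f : R -> R) a b c : continuous f ->
 \i[a, b] t, (c * f t) = c * \i[a, b] t, f t.
move=> fc; rewrite RintegralZl //; exact: cont_integrable. Qed.

Lemma intN (f : R -> R) a b : continuous f ->
 \i[a, b] t, (- f t) = - \i[a, b] t, f t.
move=> fc; rewrite -mulN1r -intZ //; apply: eq_int => t _.
by rewrite mulN1r.
Qed.

Lemma int_sum (I : Type) (r : seq I) (f : I -> R -> R) a b :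
 (forall i, continuous (f i)) ->
 \i[a, b] t, (\sum_(i <- r) f i t) =
 \sum_(i <- r) \i[a, b] t, f i t.
move=> fc.
have sc s : continuous (fun t => \sum_(i <- s) f i t).
 elim: s => [|i s IH].
  rewrite (_ : (fun => _) = fun=> 0); first exact: cst_continuous.
  by apply/funext => u; rewrite big_nil.
 rewrite (_ : (fun => _) = fun u => f i u + \sum_(i <- s) f i u).
  move=> t; apply: cvgD; [exact: fc|exact: IH].
 by apply/funext => u; rewrite big_cons.
elim: r => [|i r IH].
 rewrite big_nil (@eq_int _ (fun=> 0)); last by move=> t; rewrite big_nil.
 by rewrite /Rintegral integral0.
rewrite big_cons -IH -intD //.
by apply: eq_int => t; rewrite big_cons.
Qed.

Lemma int_norm_le (f : R -> R) a b c : a <= b -> continuous f ->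
 (forall t, a <= t <= b -> `|f t| <= c) ->
 `|\i[a, b] t, f t| <= c * (b - a).
move=> ab fc fle; have i := @cont_integrable f a b fc.
rewrite (le_trans (le_normr_Rintegral _ i)) // -int_cst //.
apply: le_Rintegral => //.
- apply@cont_integrable => t; apply: cvg_norm; exact: fc.
- apply: cont_integrable => t; exact: cvg_cst.
Qed.

(** Compactness of [a, b] turns continuity at each point (t, x0) into an estimate near [x0] that is
    uniform in t. *)
Lemma unif_near V a b (G : R -> V -> R) x0 :
 (forall t, a <= t <= b -> {for (t, x0), continuous (fun p : R * V => G p.1 p.2)}) ->
 forall e, 0 < e -> \forall x \near x0, forall t, a <= t <= b -> `|G t x - G t x0| <= e.
move=> Gc e e0; have e2 : 0 < e / 2 by rewrite divr_gt0.
have C := iffLR (compact_near_coveringP _) (@segment_compact R a b) V (nbhs x0)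
 (fun x t => `|G t x - G t x0| <= e).
have H : forall t, `[a, b]%classic t ->
  \forall t' \near t & x \near x0, `|G t' x - G t' x0| <= e.
 move=> t; rewrite /= => /Gc /cvgrPdist_le /(_ _ e2) tc.
 have [[A B] /= [nA nB] AB] := tc.
 exists (A, B) => // -[t' x] /= [At' Bx].
 have h1 := AB (_, x) (conj At' Bx).
 have h2 := AB (_, _) (conj At' (nbhs_singleton nB)).
 move: h1 h2 => /= h1 h2; rewrite distrC in h1.
 rewrite (splitr e) (le_trans _ (lerD h1 h2)) // (le_trans _ (ler_normD _ _)) //.
 rewrite eq_lerr //; congr `|_|; ring.
have := C (nbhs_filter _) H; apply: filterS => x Hx t tab.
by apply: Hx.
Qed.

Lemma joint_cont_at V (G : R -> V -> R) x t :
 {for (t, x), continuous (fun p : R * V => G p.1 p.2)} ->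
 {for t, continuous (fun t => G t x)}.
move=> Gc.
apply(@continuous_comp _ _ _ (fun t => (t, x)) (fun p => G p.1 p.2)); last exact: Gc.
exact: cvg_pair _ cvg_id (cvg_cst x).
Qed.

Lemma joint_cont V (G : R -> V -> R) x :
 (forall t, {for (t, x), continuous (fun p : R * V => G p.1 p.2)}) ->
 continuous (fun t => G t x).
by move=> Gc t; apply: joint_cont_at.
Qed.

Lemma int_continuous V (U : set V) a b (G : R -> V -> R) x : a <= b -> open U ->
 (forall t y, U y -> {for (t, y), continuous (fun p : R * V => G p.1 p.2)}) ->
 U x -> {for x, continuous (fun y => \i[a, b] t, G t y)}.
move=> ab oU Gc Ux; apply/cvgrPdist_le => e e0.
have e1 : 0 < e / (b - a + 1) by rewrite divr_gt0 // ltr_wpDl // subr_ge0.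
have := @unif_near V a b G x (fun t _ => Gc t x Ux) _ e1.
have := open_nbhs_nbhs (conj oU Ux).
apply: filterS2 => y Uy Hy.
have c1 := joint_cont (fun t => Gc t x Ux).
have c2 := joint_cont (fun t => Gc t y Uy).
rewrite -intB //; apply: (le_trans (@int_norm_le _ a b (e / (b - a + 1)) ab _ _)).
- move=> t; apply: cvgB; [exact: c1|exact: c2].
- move=> t; rewrite distrC; exact: Hy.
by rewrite mulrAC ler_pdivrMr ?ltr_wpDl ?subr_ge0 // ler_wpM2l ?ltW // ltrDl.
Qed.

(** By the mean value theorem the difference quotient of [G t] is a value of [dG t] at a point near
    [x], and [unif_near] makes the comparison with [dG t x] uniform in t. *)
Lemma int_is_derive V (U : set V) a b (G dG : R -> V -> R) x v : a <= b -> open U ->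
 (forall t y, U y -> {for (t, y), continuous (fun p : R * V => G p.1 p.2)}) ->
 (forall t y, U y -> {for (t, y), continuous (fun p : R * V => dG p.1 p.2)}) ->
 (forall t y, U y -> is_dd y v (G t) (dG t y)) ->
 U x -> is_dd x v (fun y => \i[a, b] t, G t y)
   (\i[a, b] t, dG t x).
move=> ab oU Gc dGc Gd Ux.
suff H : (fun h : R => h^-1 *: ((\i[a, b] t, G t (h *: v + x) : R^o) -
   (\i[a, b] t, G t x : R^o))) @ (0 : R)^' --> (\i[a, b] t, dG t x : R^o).
 by split; [apply/cvg_ex; eexists; exact: H|exact: cvg_lim H].
apply/cvgrPdist_le => e e0.
have e1 : 0 < e / (b - a + 1) by rewrite divr_gt0 // ltr_wpDl // subr_ge0.
have N1 := @unif_near V a b dG x (fun t _ => dGc t x Ux) _ e1.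
have /nbhs_ballP[d d0 dP] : nbhs x [set y | U y /\ forall t : R, a <= t <= b ->
  `|dG t y - dG t x| <= e / (b - a + 1)].
 by apply: filterI => //; exact: open_nbhs_nbhs.
near=> h.
have h0 : h != 0 by near: h; exact: nbhs_dnbhs_neq.
have hd : `|h| * (`|v| + 1) < d.
 rewrite -ltr_pdivlMr ?ltr_wpDl //; near: h; apply: dnbhs0_lt.
 by rewrite divr_gt0 // ltr_wpDl.
have Us (s : R) : 0 <= s <= 1 -> ball x d (s *: (h *: v) + x).
 move=> /andP[s0 s1]; rewrite -ball_normE /ball_ /= opprD addrCA subrr addr0 normrN.
 apply: le_lt_trans hd; rewrite !normrZ (ger0_norm s0).
 rewrite (le_trans (ler_piMl _ s1)) ?mulr_ge0 // ler_wpM2l // lerDl //.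
have Uh : U (h *: v + x).
 by have := Us 1; rewrite scale1r ler01 lexx => /(_ isT) /dP[].
have c1 := joint_cont (fun t => Gc t x Ux).
have c2 := joint_cont (fun t => Gc t _ Uh).
have c3 := joint_cont (fun t => dGc t x Ux).
have c4 : continuous (fun t => G t (h *: v + x) - G t x).
 by move=> t; apply: cvgB; [exact: c2|exact: c1].
have c5 : continuous (fun t => h^-1 * (G t (h *: v + x) - G t x)).
 by move=> t; apply: cvgM; [exact: cvg_cst|exact: c4].
rewrite -[X in _ *: X]intB // /GRing.scale /= -intZ // -intB //.
apply: (le_trans (@int_norm_le _ a b (e / (b - a + 1)) ab _ _)).
- by move=> t; apply: cvgB; [exact: c3|exact: c5].
- move=> t tab.
 have [s s01 ->] := @MVT_dir R V (G t) (fun y => h * dG t y) x (h *: v)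
   (fun s s01 => is_dd_scale h (Gd t _ (proj1 (dP _ (Us s s01))))).
 rewrite mulKf // distrC.
 by have [_] := dP _ (Us s s01); apply.
by rewrite mulrAC ler_pdivrMr ?ltr_wpDl ?subr_ge0 // ler_wpM2l ?ltW // ltrDl.
Unshelve. all: by end_near. Qed.

Lemma CK_int V k (U : set V) a b (G : R -> V -> R) : a <= b -> open U ->
 CK k ([set: R^o] `*` U : set (R^o * V)%type) (fun p => G p.1 p.2) ->
 CK k U (fun y => \i[a, b] t, G t y).
move=> ab oU; elim: k G => [|k IH] G Gk.
 case=> // _ x Ux; apply(int_continuous ab oU) => // t y Uy.
 exact: (CK_cont Gk).
pose dG v t y : R := dd (0, v) (fun p : R^o * V => G p.1 p.2) (t, y).
have dGk v : CK k ([set: R^o] `*` U : _) (fun p => dG v p.1 p.2).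
 have := CKS_D (0, v) Gk; rewrite /dG.
 by [].
have Gd v t y : U y -> is_dd y v (G t) (dG v t y).
 move=> Uy.
 have [d _] := @CKS_dd R _ k _ _ (t, y) (0, v) Gk (conj I Uy).
 apply: (@is_dd_aff R _ V (fun y => (t, y))) d => h.
 by congr pair; rewrite /= ?scaler0 ?add0r.
apply(@CKSI _ _ _ _ _ (fun v y => \i[a, b] t, dG v t y)) => //.
- move=> x; apply: int_continuous => // t y Uy; exact: (CK_cont Gk).
- move=> v x Ux; apply: int_is_derive => // t y Uy.
  exact: (CK_cont Gk).
 exact: CK_cont.
- by move=> v; apply: IH.
Qed.

Lemma smooth_int V (U : set V) a b (G : R -> V -> R) : a <= b -> open U ->
 smooth_fun ([set: R^o] `*` U : set (R^o * V)%type) (fun p => G p.1 p.2) ->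
 smooth_fun U (fun y => \i[a, b] t, G t y).
move=> ab oU /CK_smooth Gs; apply/CK_smooth => k; exact: CK_int. Qed.

Lemma smooth_int_is_derive V (U : set V) a b (G : R -> V -> R) x v : a <= b -> open U ->
 smooth_fun ([set: R^o] `*` U : set (R^o * V)%type) (fun p => G p.1 p.2) -> U x ->
 is_dd x v (fun y => \i[a, b] t, G t y)
   (\i[a, b] t, (dd v (G t) x)).
move=> ab oU Gs Ux.
pose dG t y : R := dd (0, v) (fun p : R^o * V => G p.1 p.2) (t, y).
have dGs : smooth_fun ([set: R^o] `*` U : _) (fun p => dG p.1 p.2).
 have := smooth_D (0, v) Gs; rewrite /dG.
 by [].
have Gd t y : U y -> is_dd y v (G t) (dG t y).
 move=> Uy.
 have [d _] := @smooth_dd R _ _ _ (t, y) (0, v) Gs (conj I Uy).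
 apply: (@is_dd_aff R _ V (fun y => (t, y))) d => h.
 by congr pair; rewrite /= ?scaler0 ?add0r.
rewrite (@eq_int _ (dG ^~ x)); last by move=> t; have [] := Gd t x.
apply: int_is_derive => // t y Uy.
 exact: smooth_cont.
exact: smooth_cont.
Qed.

End Integrals.

(** * A smooth step function *)

Section SmoothStep.
Context {R : realType}.

Lemma smooth_comp1 (V : normedModType R) (U : set V) (W : set R^o) (f : R^o -> R)
  (g : V -> R) : open U -> open W -> (forall x, U x -> W (g x)) ->
 smooth_fun W f -> smooth_fun U g -> smooth_fun U (fun x => f (g x)).
move=> oU oW UW fs gs.
pose L (z : 'rV_1) : R^o := z 0 0.
have Lc : continuous L by exact: coord_continuous.
have E x : L (g x)%:M = g x by rewrite /L mxE.
suff H : smooth_fun U (fun x => (f \o L) (g x)%:M).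
 by apply: smooth_ext oU _ H => x; rewrite /= E.
apply(@smooth_comp R 1 V U (L @^-1` W) _ _ oU).
- apply: open_comp => //.
- move=> x; rewrite /= E; exact: UW.
- apply(@smooth_aff _ _ _ L L _ W) => //.
  apply: open_comp => //.
 by move=> h v x; rewrite /L !mxE.
- move=> i j; apply: (smooth_ext oU _ gs) => x _.
 by rewrite mxE !ord1.
Qed.

(** With an arbitrary polynomial [P] the family is closed under derivation, so that smoothness of
    all orders becomes one induction. *)
Definition flat_exp (P : {poly R}) (s : R) : R :=
 if 0 < s then P.[s^-1] * expR (- s^-1) else 0.

(** From exp x >= x^(n+1) / (n+1)! at x = 1/s, the term s^(-n) exp (-1/s) is at most (n+1)! s; the
    monomials of [P] are then summed. *)
Lemma flat_exp_bound (P : {poly R}) :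
 exists2 C : R, 0 <= C & forall s, `|flat_exp P s| <= C * `|s|.
have mono n : exists2 C : R, 0 <= C & forall s : R, 0 < s ->
  s^-1 ^+ n * expR (- s^-1) <= C * s.
 exists n.+1`!%:R => // s s0.
 have i0 : 0 < s^-1 by rewrite invr_gt0.
 have := expR_ge1Dxn n (ltW i0).
 rewrite expRN => h.
 rewrite ler_pdivrMr ?expR_gt0 //.
 have : s^-1 ^+ n.+1 <= n.+1`!%:R * expR s^-1.
  rewrite mulrC -ler_pdivrMr // (le_trans _ h) // lerDr //.
 rewrite -(ler_pM2r s0) exprS mulrAC mulVf ?gt_eqF // mul1r.
 by rewrite mulrAC.
pose Cn n := s2val (cid2 (mono n)).
have Cn0 n : 0 <= Cn n := s2valP (cid2 (mono n)).
have CnP n := s2valP' (cid2 (mono n)).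
exists (\sum_(i < size P) `|P`_i| * Cn i).
 by apply: sumr_ge0 => i; rewrite mulr_ge0.
move=> s; rewrite /flat_exp; case: ifP => s0; last first.
 rewrite normr0 mulr_ge0 //; apply: sumr_ge0 => i; rewrite mulr_ge0 //.
rewrite horner_coef mulr_suml (le_trans (ler_norm_sum _ _ _)) // mulr_suml.
apply: ler_sum => i; rewrite -!mulrA normrM ler_wpM2l // (gtr0_norm s0).
by rewrite ger0_norm ?CnP // mulr_ge0 // exprn_ge0 // invr_ge0 ltW.
Qed.

Lemma flat_exp_cvg0 (P : {poly R}) : flat_exp P @ (0 : R) --> (0 : R).
have [C C0 CP] := flat_exp_bound P.
apply/cvgrPdist_le => e e0.
have : \forall s \near 0 : R, `|s| <= e / (C + 1).
 by apply: nbhs0_le; rewrite divr_gt0 // ltr_wpDl.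
apply: filterS => s sle.
rewrite sub0r normrN (le_trans (CP s)) //.
rewrite (@le_trans _ _ ((C + 1) * `|s|)) ?ler_wpM2r ?lerDl //.
by rewrite mulrC -ler_pdivlMr ?ltr_wpDl.
Qed.

Lemma flat_exp_is_derive (P : {poly R}) (s : R) :
 is_deriv s (flat_exp P)
  (flat_exp ('X^2 * (P - P^`())) s).
have [s0|s0|->] := ltgtP s 0.
- have E : \forall t \near (s : R^o), (fun=> 0 : R^o) t = flat_exp P t.
  near=> t; rewrite /flat_exp ifF //; apply/negbTE; rewrite -leNgt ltW //.
  by near: t; exact: lt_nbhsl.
 rewrite {2}/flat_exp ltNge (ltW s0) /=.
 by apply: near_eq_is_derive E _; exact: is_derive_cst.
- have E : \forall t \near (s : R^o), (fun t : R^o => P.[t^-1] * expR (- t^-1) : R^o) t = flat_exp P t.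
  near=> t; rewrite /flat_exp ifT //.
  by near: t; exact: lt_nbhsr.
 rewrite {2}/flat_exp s0.
 apply: near_eq_is_derive E _.
 have sn0 : s != 0 by rewrite gt_eqF.
 have dV : is_derive (s : R^o) (1 : R^o) (fun t : R => t^-1) (- s ^- 2).
  have did := @derivable_id R R^o (s : R^o) 1.
  split; first exact: (@derivableV R R^o id s 1 sn0 did).
  by rewrite (@deriveV R R^o id s 1 sn0 did) derive_id /GRing.scale /= mulr1.
 have dP : is_derive (s : R^o) (1 : R^o) (horner P \o (fun t : R => t^-1)) (P^`().[s^-1] * - s ^- 2).
  have hd : is_deriv (s^-1) (horner P) (P^`().[s^-1]).
   by split; [exact: derivable_horner|rewrite -derive1E -derivE].
  exact: is_derive1_comp hd dV.
 have dE : is_derive (s : R^o) (1 : R^o) (expR \o (fun t : R => - t^-1)) (expR (- s^-1) * s ^- 2).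
  apply: is_derive1_comp => //.
  by have := is_deriveN dV; rewrite opprK.
 have [dP1 dP2] := dP; have [dE1 dE2] := dE.
 split; first exact: (@derivableM R R^o (horner P \o (fun t : R => t^-1)) (expR \o (fun t : R => - t^-1)) s 1 dP1 dE1).
 rewrite (@deriveM R R^o (horner P \o (fun t : R => t^-1)) (expR \o (fun t : R => - t^-1)) s 1 dP1 dE1) dP2 dE2.
 rewrite /GRing.scale /= hornerM hornerXn hornerD hornerN exprVn; ring.
- rewrite {2}/flat_exp ltxx.
 have H : (fun h : R => h^-1 *: ((flat_exp P (h *: 1 + 0) : R^o) - flat_exp P 0)) @ (0 : R)^' --> (0 : R^o).
  (* At 0 the difference quotient belongs to the same family, with the polynomial ['X * P]. *)
  rewrite (_ : (fun _ => _) = flat_exp ('X * P)); last first.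
   apply/funext => h; rewrite /flat_exp ltxx subr0 addr0 /GRing.scale /= mulr1.
   by case: ifP => _; rewrite ?mulr0 // hornerM hornerX mulrA.
  apply: cvg_trans (flat_exp_cvg0 ('X * P)); apply: cvg_app; exact: nbhs_dnbhs.
 by split; [apply/cvg_ex; eexists; exact: H|exact: cvg_lim H].
Unshelve. all: by end_near. Qed.

Lemma flat_exp_smooth (P : {poly R}) : smooth1 (flat_exp P).
have C (Q : {poly R}) (s : R) : {for s, continuous (flat_exp Q)}.
 have [+ _] := flat_exp_is_derive Q s.
 move/derivable1_diffP; exact: differentiable_continuous.
apply/CK_smooth => k; elim: k P => [|k IH] P.
 by case=> x.
apply(@CKSI R R^o k [set: R^o] _ (fun v x => v * flat_exp ('X^2 * (P - P^`())) x)); first exact: openT.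
- by [].
- move=> v x _; have := is_dd_scale v (flat_exp_is_derive P x).
 by rewrite {}/GRing.scale /= mulr1.
- move=> v; apply: CKM; [exact: openT|apply: CK_cst; exact: openT|exact: IH].
Qed.

Definition smooth_step (s : R) : R :=
 flat_exp 1 s / (flat_exp 1 s + flat_exp 1 (1 - s)).

Lemma flat_exp1_ge0 s : 0 <= flat_exp 1 s.
by rewrite /flat_exp; case: ifP => //; rewrite hornerC. Qed.

Lemma flat_exp1_gt0 s : 0 < s -> 0 < flat_exp 1 s.
by move=> s0; rewrite /flat_exp s0 hornerC mul1r expR_gt0. Qed.

Lemma flat_exp1_0 s : s <= 0 -> flat_exp 1 s = 0.
by move=> s0; rewrite /flat_exp ltNge s0. Qed.

Lemma smooth_step_den s : 0 < flat_exp 1 s + flat_exp 1 (1 - s).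
have [s0|s0] := ltP 0 s.
 by rewrite ltr_pwDl ?flat_exp1_gt0 ?flat_exp1_ge0.
rewrite ltr_wpDl ?flat_exp1_ge0 // flat_exp1_gt0 // subr_gt0.
by rewrite (le_lt_trans s0).
Qed.

Lemma step0 s : s <= 0 -> smooth_step s = 0.
by move=> s0; rewrite /smooth_step flat_exp1_0 // mul0r. Qed.

Lemma step1 s : 1 <= s -> smooth_step s = 1.
move=> s1; have := smooth_step_den s.
rewrite /smooth_step [_ (1 - s)]flat_exp1_0 ?subr_le0 // addr0.
by move=> h; rewrite divff // gt_eqF.
Qed.

Lemma step_ge0 s : 0 <= smooth_step s.
by rewrite divr_ge0 ?flat_exp1_ge0 // ltW // smooth_step_den. Qed.

Lemma step_le1 s : smooth_step s <= 1.
by rewrite ler_pdivrMr ?smooth_step_den // mul1r lerDl flat_exp1_ge0.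
Qed.

Lemma step_smooth : smooth1 smooth_step.
have oT : open [set: R^o] := openT.
have s1 := flat_exp_smooth 1.
have s2 : smooth_fun [set: R^o] (fun s : R^o => flat_exp 1 (1 - s)).
 apply(@smooth_comp1 R^o _ [set: R] _ (fun s => 1 - s)) => //.
 apply: smoothB => //; first exact: smooth_cst.
 by apply: smooth_lin => // x.
apply: smoothM => //; apply: smoothV => //; last exact: smoothD.
by move=> s; rewrite gt_eqF // smooth_step_den.
Qed.

End SmoothStep.

(** * Multilinear and alternating functions of the rows of a matrix *)

Section Multilinear.
Context {R : realType}.
Implicit Types (k p : nat).

Definition setrow k p (r : 'I_k) (u : 'rV[R]_p) (V : 'M[R]_(k, p)) : 'M[R]_(k, p) :=
 \matrix_(i, j) if i == r then u 0 j else V i j.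

Lemma row_setrow k p (r s : 'I_k) (u : 'rV[R]_p) (V : 'M[R]_(k, p)) :
 row s (setrow r u V) = if s == r then u else row s V.
by apply/rowP => j; rewrite !mxE; case: ifP; rewrite ?mxE. Qed.

Lemma row'_setrow k p (r : 'I_k) (u : 'rV[R]_p) (V : 'M[R]_(k, p)) :
 row' r (setrow r u V) = row' r V.
by apply/matrixP => i j; rewrite !mxE eq_sym (negbTE (neq_lift _ _)). Qed.

Lemma setrow_id k p (r : 'I_k) (V : 'M[R]_(k, p)) : setrow r (row r V) V = V.
by apply/matrixP => i j; rewrite !mxE; case: eqVneq => [->|]. Qed.

Lemma setrow_comm k p (r s : 'I_k) (u v : 'rV[R]_p) (V : 'M[R]_(k, p)) : r != s ->
 setrow r u (setrow s v V) = setrow s v (setrow r u V).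
move=> rs; apply/matrixP => i j; rewrite !mxE.
by case(eqVneq) => [->|//]; rewrite (negbTE rs).
Qed.

Section Ml.
Variables (k p : nat) (a : 'M[R]_(k, p) -> R).
Hypothesis aml : multilinear a.

Lemma ml_lin r (c : R) u v V :
 a (setrow r (c *: u + v) V) = c * a (setrow r u V) + a (setrow r v V).
rewrite -[a (_ v V)]mul1r; apply(aml (r := r)); rewrite ?row'_setrow //.
by rewrite !row_setrow eqxx scale1r.
Qed.

Lemma ml_row0 r V : a (setrow r 0 V) = 0.
by have := ml_lin r (-1) 0 0 V; rewrite scaler0 addr0 mulN1r addNr.
Qed.

Lemma ml_scale r (c : R) u V : a (setrow r (c *: u) V) = c * a (setrow r u V).
by rewrite -[c *: u]addr0 ml_lin ml_row0 addr0. Qed.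

Lemma ml_add r u v V : a (setrow r (u + v) V) = a (setrow r u V) + a (setrow r v V).
by rewrite -[u]scale1r ml_lin mul1r scale1r. Qed.

Lemma ml_sum (I : Type) (s : seq I) (P : pred I) r (c : I -> R) (u : I -> 'rV[R]_p) V :
 a (setrow r (\sum_(i <- s | P i) c i *: u i) V) =
 \sum_(i <- s | P i) c i * a (setrow r (u i) V).
elim: s => [|i s IH]; first by rewrite !big_nil ml_row0.
by rewrite !big_cons; case: ifP => //; rewrite ml_lin IH.
Qed.

Lemma ml_expand r u V :
 a (setrow r u V) = \sum_j u 0 j * a (setrow r (delta_mx 0 j) V).
by rewrite {1}(row_sum_delta u) ml_sum. Qed.

Lemma ml_expand_row r V : a V = \sum_j V r j * a (setrow r (delta_mx 0 j) V).
rewrite -{1}(setrow_id r V) ml_expand; apply: eq_bigr => j _.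
by rewrite mxE.
Qed.

Hypothesis aalt : Defs.alternating a.

Lemma alt_setrow (r s : 'I_k) u V : r != s -> a (setrow r u (setrow s u V)) = 0.
move=> rs; apply(aalt rs); rewrite !row_setrow eqxx.
by rewrite eq_sym (negbTE rs) eqxx.
Qed.

Lemma alt_swap (r s : 'I_k) V : r != s -> a (xrow r s V) = - a V.
move=> rs; set u := row r V; set v := row s V.
have E1 : setrow r u (setrow s v V) = V.
 by rewrite /v setrow_id /u setrow_id.
have E2 : setrow r v (setrow s u V) = xrow r s V.
 apply/matrixP => i j; rewrite !mxE.
 case(eqVneq) => [->|ir]; first by rewrite tpermL.
 case(eqVneq) => [->|ins]; first by rewrite tpermR.
 by rewrite tpermD // eq_sym.
have := alt_setrow (u + v) V rs.
rewrite ml_add ![_ _ (_ s _ _)]setrow_comm // !ml_add.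
rewrite -![_ _ (_ r _ _)]setrow_comm // !alt_setrow //.
rewrite E1 E2 add0r addr0 => /eqP; rewrite addr_eq0 => /eqP ->.
by rewrite opprK.
Qed.

Lemma alt_perm (s : 'S_k) V : a (row_perm s V) = (-1) ^+ s * a V.
have [ts -> dts] := prod_tpermP s.
elim: ts dts => [_|t ts IH] /=.
 by rewrite big_nil odd_perm1 mul1r row_perm1.
move=> /andP[dt dts]; rewrite big_cons odd_mul_tperm dt.
rewrite row_permM [row_perm _ _](_ : _ = xrow t.1 t.2 (row_perm (\prod_(t <- ts) tperm t.1 t.2) V)) //.
rewrite alt_swap // IH // signrN mulNr //.
Qed.

End Ml.

Definition fmx k p (f : 'I_k -> 'I_p) : 'M[R]_(k, p) := \matrix_(i, j) (j == f i)%:R.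

(** The rows are expanded in the standard basis from the last to the first: in [H] the rows of index
    at least [n] are already basis vectors. *)
Lemma ml_eq k p (a b : 'M[R]_(k, p) -> R) : multilinear a -> multilinear b ->
 (forall f : 'I_k -> 'I_p, a (fmx f) = b (fmx f)) -> forall V, a V = b V.
move=> am bm ab V.
have H n : forall V : 'M[R]__, (forall r : 'I_k, (n <= r)%N -> exists j, row r V = delta_mx 0 j) -> a V = b V.
 elim: n => [|n IH] W WP.
  have [f fP] := fin_all_exists (fun r => WP r (leq0n r)).
  have -> : W = fmx f.
   apply/matrixP => i j; have := congr1 (fun r : 'rV_p => r 0 j) (fP i).
   by rewrite !mxE.
  exact: ab.
 have [nk|kn] := ltnP n k; last first.
  by apply: IH => r nr; have := leq_trans kn nr; rewrite leqNgt ltn_ord.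
 rewrite (ml_expand_row am (Ordinal nk)) (ml_expand_row bm (Ordinal nk)).
 apply: eq_bigr => j _; congr (_ _); apply: IH => r.
 rewrite leq_eqVlt => /predU1P[nr|nr].
  have -> : r = Ordinal nk by apply: val_inj.
  by exists j; rewrite row_setrow eqxx.
 have [l lP] := WP r nr; exists l; rewrite row_setrow ifN //.
 by apply/eqP => E; rewrite E ltnn in nr.
by apply(H k) => r; rewrite leqNgt ltn_ord.
Qed.

Lemma alt_eq k p (a b : 'M[R]_(k, p) -> R) :
 multilinear a -> Defs.alternating a -> multilinear b -> Defs.alternating b ->
 (forall f : 'I_k -> 'I_p, injective f -> a (fmx f) = b (fmx f)) -> forall V, a V = b V.
move=> am aa bm ba ab; apply: ml_eq => // f.
have [/injectiveP |/injectivePn[r [s rs frs]]] := boolP (injectiveb f); first exact: ab.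
have E : row r (fmx f) = row s (fmx f) by apply/rowP => j; rewrite !mxE frs.
by rewrite (aa _ _ _ rs E) (ba _ _ _ rs).
Qed.

Lemma det_ml k : multilinear (fun V : 'M[R]_k => \det V).
move=> r V c2 E; exact: determinant_multilinear. Qed.

Lemma det_alt k : Defs.alternating (fun V : 'M[R]_k => \det V).
by move=> V r s rs E; apply: (determinant_alternate rs) => j;
 have := congr1 (fun r : 'rV_k => r 0 j) E; rewrite !mxE.
Qed.

Lemma alt_top k (a : 'M[R]_k -> R) : multilinear a -> Defs.alternating a ->
 forall V, a V = a 1%:M * \det V.
move=> am aa; apply: alt_eq => //.
- move=> r V V1 V2 c1 c2 E E1 E2; rewrite (det_ml E E1 E2); ring.
- by move=> V r s rs E; rewrite (det_alt rs E) mulr0.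
move=> f fi; pose s := perm fi.
have -> : fmx f = row_perm s 1%:M.
 by apply/matrixP => i j; rewrite !mxE permE eq_sym.
by rewrite (alt_perm am aa) (alt_perm (@det_ml k) (@det_alt k)) det1 mulr1 mulrC.
Qed.

Lemma row'_col_mx0 k p (X : 'rV[R]_p) (V : 'M[R]_(k, p)) :
 row' (0 : 'I_(1 + k)) (col_mx X V) = V.
apply/matrixP => i j; rewrite mxE.
have -> : lift 0 i = rshift 1 i by apply: val_inj.
by rewrite col_mxEd.
Qed.

Lemma row'_col_mxS k p (X : 'rV[R]_p) (V : 'M[R]_(k.+1, p)) (r : 'I_k.+1) :
 row' (rshift 1 r : 'I_(1 + k.+1)) (col_mx X V) = col_mx X (row' r V) :> 'M[R]_(k.+1, p).
apply/matrixP => i j; rewrite mxE.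
case(unliftP 0 i) => [i'|] ->; last first.
 have -> : lift (rshift 1 r : 'I__) 0 = lshift k.+1 0 by apply: val_inj.
 rewrite col_mxEu.
 have -> : 0 = lshift k (0 : 'I_1) by apply: val_inj.
 by rewrite (@col_mxEu _ 1).
have -> : lift (rshift 1 r : 'I__) (lift 0 i') = rshift 1 (lift r i').
 by apply: val_inj; rewrite /= /bump addnS.
rewrite col_mxEd.
have -> : lift 0 i' = rshift 1 i' by apply: val_inj.
by rewrite (@col_mxEd _ 1) mxE.
Qed.

Lemma det_col_mx k (X : 'rV[R]_k.+1) (V : 'M[R]_(k, k.+1)) :
 \det (col_mx X V : 'M[R]_(k.+1)) = \sum_j X 0 j * ((-1) ^+ j * \det (col' j V)).
rewrite (expand_det_row _ 0); apply: eq_bigr => j _.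
have -> : 0 = lshift k (0 : 'I_1) by apply: val_inj.
rewrite (@col_mxEu _ 1); congr (_ _); rewrite /cofactor add0n.
congr (_ * \det _).
apply/matrixP => i l; rewrite !mxE.
have -> : lift (lshift k (0 : 'I_1) : 'I_k.+1) i = rshift 1 i by apply: val_inj.
case: fintype.splitP => [i' E|i' /= E]; first by have := ltn_ord i'; rewrite -E.
by congr (V _ _); apply: val_inj; move: E => /eqP; rewrite eqSS => /eqP.
Qed.

Lemma cofactor_col_mx k (X : 'rV[R]_k.+1) (V : 'M[R]_k.+1) (r : 'I_k.+1) :
 (-1) ^+ r * \det (col_mx X (row' r V) : 'M[R]_k.+1) = \sum_j X 0 j * cofactor V r j.
rewrite det_col_mx mulr_sumr; apply: eq_bigr => j _.
rewrite /cofactor exprD mulrCA; congr (_ _); rewrite mulrA; congr (_ * \det _).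
by apply/matrixP => i l; rewrite !mxE.
Qed.

(* [xi] is a covector, and the sum is the first-column Laplace expansion of a
  singular determinant of size [k + 2]. *)
Lemma det_cramer k (X : 'rV[R]_k.+1) (V : 'M[R]_k.+1) (xi : 'I_k.+1 -> R) :
 \sum_(r < k.+1) (-1) ^+ r * (\sum_l V r l * xi l) * \det (col_mx X (row' r V) : 'M[R]_k.+1) =
 (\sum_l X 0 l * xi l) * \det V.
transitivity (\sum_r \sum_l \sum_j xi l * X 0 j * (V r l * cofactor V r j)).
 apply: eq_bigr => r _; rewrite mulrAC cofactor_col_mx mulr_suml exchange_big /=.
 apply: eq_bigr => l _; rewrite mulr_sumr; apply: eq_bigr => j _; ring.
rewrite exchange_big /= mulr_suml; apply: eq_bigr => l _.
rewrite exchange_big (bigD1 l) //= [X in _ + X]big1 ?addr0.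
 rewrite -mulr_sumr -expand_det_col; ring.
move=> j jl; rewrite -mulr_sumr.
have := congr1 (fun B : 'M[R]_k.+1 => B j l) (mul_adj_mx V).
rewrite !mxE (negbTE jl) mulr0n => E.
have -> : \sum_(i < k.+1) V i l * cofactor V i j = 0.
 by rewrite -[RHS]E; apply: eq_bigr => i; rewrite mxE mulrC.
by rewrite mulr0.
Qed.

Lemma det_col_mx_ml k (X : 'rV[R]_k.+1) : multilinear (fun V : 'M[R]_(k, k.+1) => \det (col_mx X V : 'M[R]_k.+1)).
case: k X => [|k] X r V V1 V2 c1 c2 E E1 E2; first by case: r E E1 E2 => [].
apply(det_ml (r := rshift 1 r : 'I__)).
- by rewrite !rowKd.
- by rewrite !row'_col_mxS E1.
- by rewrite !row'_col_mxS E2.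
Qed.

Lemma det_col_mx_alt k (X : 'rV[R]_k.+1) : Defs.alternating (fun V : 'M[R]_(k, k.+1) => \det (col_mx X V : 'M[R]_k.+1)).
move=> V r s rs E; apply: (determinant_alternate (i1 := rshift 1 r : 'I__) (i2 := rshift 1 s)).
 by [].
move=> j; rewrite !col_mxEd.
by have := congr1 (fun r : 'rV_k.+1 => r 0 j) E; rewrite !mxE.
Qed.

(** An injective tuple of k basis vectors in dimension k + 1 misses exactly one index [j], hence is
    a permutation of the rows of the identity other than row [j]. Both sides are compared on these
    tuples, where the determinant picks out the coordinate [j] of the vector. *)
Lemma alt_cotop k (a : 'M[R]_(k, k.+1) -> R) : multilinear a -> Defs.alternating a ->
 forall V, a V = \det (col_mx (\row_j ((-1) ^+ j * a (row' j (1%:M : 'M[R]_k.+1)))) V : 'M[R]_k.+1).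
move=> am aa; set X := \row_j _.
apply: alt_eq => //; [exact: det_col_mx_ml|exact: det_col_mx_alt|].
move=> f fi.
have [j jf] : exists j, forall i, f i != j.
 have : (#|codom f| < #|'I_k.+1|)%N by rewrite card_codom // !card_ord.
 have [] := boolP [forall j, j \in codom f].
  move=> /forallP h; rewrite ltnNge; case/negP.
  by apply: subset_leq_card; apply/fintype.subsetP => x.
 rewrite negb_forall => /existsP[j jn] _; exists j => i.
 apply: contra jn => /eqP <-; exact: codom_f.
have /fin_all_exists[g gE] : forall i, exists i', f i = lift j i'.
 move=> i; case: (unliftP j (f i)) => [i'|] E; first by exists i'.
 by have := jf i; rewrite E eqxx.
have gi : injective g by move=> x y gxy; apply: fi; rewrite gE gxy.
have -> : fmx f = row_perm (perm gi) (row' j 1%:M).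
 by apply/matrixP => x y; rewrite !mxE permE gE eq_sym.
rewrite (alt_perm am aa) (alt_perm (@det_col_mx_ml k X) (@det_col_mx_alt k X)); congr (_ _).
have := cofactor_col_mx X 1%:M j.
rewrite (bigD1 j) //= big1 => [|l lj]; last first.
 have := congr1 (fun B : 'M[R]_k.+1 => B l j) (mul_mx_adj (1%:M : 'M[R]_k.+1)).
 by rewrite mul1mx !mxE (negbTE lj) => ->; rewrite mulr0.
have := congr1 (fun B : 'M[R]_k.+1 => B j j) (mul_mx_adj (1%:M : 'M[R]_k.+1)).
rewrite mul1mx det1 !mxE eqxx => ->; rewrite addr0 mulr1 => /(congr1 (fun z => (-1) ^+ j * z)).
by rewrite !signrMK => ->.
Qed.

End Multilinear.

(** * Smooth matrix-valued maps and Jacobians *)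

Section SmoothMaps.
Context {R : realType}.
Implicit Types (V : normedModType R).

Lemma open_preim (T T' : topologicalType) (U : set T) (W : set T') (g : T -> T') :
 open U -> open W -> (forall x, U x -> {for x, continuous g}) ->
 open (U `&` g @^-1` W).
move=> oU oW gc; rewrite openE => x [Ux Wgx].
apply: filterI; first exact: open_nbhs_nbhs.
apply(gc x Ux); exact: open_nbhs_nbhs.
Qed.

Lemma smooth_mx_comp V p q r (U : set V) (W : set 'rV[R]_p) (f : 'rV[R]_p -> 'M[R]_(q, r))
  (g : V -> 'rV[R]_p) : open U -> open W -> (forall x, U x -> W (g x)) ->
 smooth_mx W f -> smooth_mx U g -> smooth_mx U (fun x => f (g x)).
move=> oU oW UW fs gs i j.
exact: (@smooth_comp _ _ _ _ _ _ g _ _ _ (fs i j)).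
Qed.

Lemma smooth_mx_ext V q r (U : set V) (f g : V -> 'M[R]_(q, r)) : open U ->
 (forall x, U x -> f x = g x) -> smooth_mx U f -> smooth_mx U g.
by move=> oU fg fs i j; apply: smooth_ext oU _ (fs i j) => x /fg ->. Qed.

Lemma smooth_mx_sub V q r (U W : set V) (f : V -> 'M[R]_(q, r)) : U `<=` W ->
 smooth_mx W f -> smooth_mx U f.
by move=> UW fs i j; apply: smooth_sub UW _. Qed.

Lemma smooth_mx_local V q r (U : set V) (f : V -> 'M[R]_(q, r)) :
 (forall x, U x -> exists2 W : set V, W x & smooth_mx W f) -> smooth_mx U f.
move=> fs i j; apply: smooth_local => x /fs[W]; exists W => //.
Qed.

Lemma smooth_mx_cst V q r (U : set V) (B : 'M[R]_(q, r)) : open U ->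
 smooth_mx U (fun=> B).
move=> oU i j; exact: smooth_cst. Qed.

Lemma smooth_mx_id p (U : set 'rV[R]_p) : open U -> smooth_mx U id.
move=> oU i j; exact: smooth_coord. Qed.

Lemma smooth_mulmx V p q r (U : set V) (f : V -> 'M[R]_(p, q)) (g : V -> 'M[R]_(q, r)) :
 open U -> smooth_mx U f -> smooth_mx U g -> smooth_mx U (fun x => f x *m g x).
move=> oU fs gs i j.
apply(@smooth_ext _ _ _ (fun x => \sum_l f x i l * g x l j)) => //.
 by move=> x; rewrite mxE.
by apply: smooth_sum => // l _; apply: smoothM.
Qed.

Lemma smooth_mxD V p q (U : set V) (f g : V -> 'M[R]_(p, q)) :
 open U -> smooth_mx U f -> smooth_mx U g -> smooth_mx U (fun x => f x + g x).
move=> oU fs gs i j; apply(@smooth_ext _ _ _ (fun x => f x i j + g x i j)) => //.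
 by move=> x; rewrite mxE.
exact: smoothD.
Qed.

Lemma smooth_det V p (U : set V) (f : V -> 'M[R]_p) : open U -> smooth_mx U f ->
 smooth_fun U (fun x => \det (f x)).
move=> oU fs; apply: smooth_sum => // s _; apply: smoothM => //; first exact: smooth_cst.
apply: smooth_prod => //.
Qed.

Lemma smooth_invmx V p (U : set V) (f : V -> 'M[R]_p) : open U -> smooth_mx U f ->
 (forall x, U x -> f x \in unitmx) -> smooth_mx U (fun x => invmx (f x)).
move=> oU fs fu i j.
apply(@smooth_ext _ _ _ (fun x => (\det (f x))^-1 * ((-1) ^+ (j + i) * \det (row' j (col' i (f x)))))) => //.
 by move=> x Ux; rewrite /invmx fu // !mxE.
apply: smoothM => //.
 by apply: smoothV => //; [move=> x /fu; rewrite unitmxE unitfE|exact: smooth_det].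
apply: smoothM => //; first exact: smooth_cst.
apply: smooth_det => // k l.
by apply: smooth_ext oU _ (fs _ _) => x; rewrite !mxE.
Qed.

Lemma smooth_mx_cont V p q (U : set V) (f : V -> 'M[R]_(p, q)) x : smooth_mx U f ->
 U x -> {for x, continuous f}.
by move=> fs Ux; apply: mx_continuousP => i j; apply: smooth_cont. Qed.

Lemma open_preim_mx V p q (U : set V) (W : set 'M[R]_(p, q)) (f : V -> 'M[R]_(p, q)) :
 open U -> open W -> smooth_mx U f -> open (U `&` f @^-1` W).
move=> oU oW fs; apply(open_preim oU oW) => x; exact: smooth_mx_cont. Qed.

Lemma differentiable_rv p q (h : 'rV[R]_p -> 'rV[R]_q) x :
 (forall j, differentiable (fun y => h y 0 j : R^o) x) -> differentiable h x.
move=> hd.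
have -> : h = \sum_(j < q) fun y => h y 0 j *: delta_mx 0 j.
 by apply/funext => y; rewrite fct_sumE {1}(row_sum_delta (h y)).
apply: differentiable_sum => j; exact: differentiableZl.
Qed.

Section Jac.
Variables (p q : nat) (U : set 'rV[R]_p) (h : 'rV[R]_p -> 'rV[R]_q).
Hypotheses (oU : open U) (hs : smooth_mx U h).

Lemma smooth_diff x : U x -> differentiable h x.
by move=> Ux; apply: differentiable_rv => j; apply: smooth_differentiable Ux. Qed.

Lemma derive_jac x v : U x -> 'D_v h x = v *m jacobian h x.
move=> Ux; apply: deriveEjacobian; exact: smooth_diff. Qed.

Lemma derive_jacE x v j : U x -> dd v (fun y => h y 0 j) x = (v *m jacobian h x) 0 j.
move=> Ux; rewrite -(derive_jac v Ux) derive_mx ?mxE; first reflexivity.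
apply: diff_derivable; exact: smooth_diff.
Qed.

Lemma jacE x i j : U x -> jacobian h x i j = dd (delta_mx 0 i) (fun y => h y 0 j) x.
by move=> Ux; rewrite (derive_jacE _ _ Ux) -rowE [RHS]mxE. Qed.

Lemma smooth_jac : smooth_mx U (jacobian h).
move=> i j; apply(@smooth_ext _ _ _ (fun x => dd (delta_mx 0 i) (fun y => h y 0 j) x)) => //.
 by move=> x Ux; rewrite jacE.
by apply: smooth_D.
Qed.

Lemma is_derive_jac x v j : U x ->
 is_dd x v (fun y => h y 0 j) ((v *m jacobian h x) 0 j).
move=> Ux; rewrite -(derive_jacE _ _ Ux); exact: smooth_dd. Qed.

End Jac.

Lemma jac_ext p q (U : set 'rV[R]_p) (f g : 'rV[R]_p -> 'rV[R]_q) x : open U ->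
 smooth_mx U f -> (forall y, U y -> f y = g y) -> U x -> jacobian f x = jacobian g x.
move=> oU fs fg Ux; apply/matrixP => i j; have gs := smooth_mx_ext oU fg fs.
apply(etrans (jacE oU fs i j Ux)); apply: etrans (esym (jacE oU gs i j Ux)).
apply: near_eq_derive.
by apply(nearU oU Ux) => y /fg ->.
Qed.

Lemma jac_comp p q r (U : set 'rV[R]_p) (W : set 'rV[R]_q) (g : 'rV[R]_p -> 'rV[R]_q)
  (f : 'rV[R]_q -> 'rV[R]_r) x : open U -> open W -> smooth_mx U g ->
 smooth_mx W f -> (forall y, U y -> W (g y)) -> U x ->
 jacobian (f \o g) x = jacobian g x *m jacobian f (g x).
move=> oU oW gs fs UW Ux.
have gd := smooth_diff oU gs Ux; have fd := smooth_diff oW fs (UW x Ux).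
apply/row_matrixP => i.
have fgd : differentiable (f \o g) x by exact: differentiable_comp.
rewrite row_mul !rowE -(deriveEjacobian _ fgd) (deriveE _ fgd) (diff_comp gd fd) /=.
by rewrite -(deriveE _ fd) (deriveEjacobian _ fd) -(deriveE _ gd) (deriveEjacobian).
Qed.

Lemma jac_id p (x : 'rV[R]_p) : jacobian id x = 1%:M.
apply/row_matrixP => i; have idd : differentiable id x by [].
by rewrite !rowE -(deriveEjacobian _ idd) derive_id mulmx1.
Qed.

(** The expansion over all basis tuples reduces calculus with a moving form at moving arguments to
    sums of products of scalar functions. *)
Lemma ml_full k p (a : 'M[R]_(k, p) -> R) (B : 'M[R]_(k, p)) : multilinear a ->
 a B = \sum_(f : {ffun 'I_k -> 'I_p}) (\prod_r B r (f r)) * a (fmx f).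
move=> am; apply: (ml_eq am (b := fun B => \sum_f _)).
 move=> r V V1 V2 c1 c2 /rowP E /matrixP E1 /matrixP E2.
 rewrite !mulr_sumr -big_split; apply: eq_bigr => f _; rewrite !(bigD1 r (P := predT)) //=.
 have P W : (forall i j, row' r W i j = row' r V i j) ->
   \prod_(s | s != r) W s (f s) = \prod_(s | s != r) V s (f s).
  move=> EW; apply: eq_bigr => s; rewrite eq_sym => /unlift_some[s' -> _].
  by have := EW s' (f (lift r s')); rewrite !mxE.
 have := E (f r); rewrite !mxE (P _ E1) (P _ E2) => ->; ring.
move=> f; rewrite (bigD1 (finfun f)) //= addrC big1 => [|g gf].
 rewrite add0r big1 ?mul1r => [|r]; last by rewrite mxE ffunE eqxx.
 by congr a; apply/matrixP => i j; rewrite !mxE ffunE.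
have /existsP[r gr] : [exists r, g r != f r].
 apply: contraNT gf; rewrite negb_exists => /forallP H; apply/eqP/ffunP => r.
 by rewrite ffunE; apply/eqP; rewrite -[_ == _]negbK.
by rewrite (bigD1 r) //= mxE (negbTE gr) !mul0r.
Qed.

Lemma is_dd_prod V n (w : 'I_n -> V -> R) (dw : 'I_n -> R) x v : (forall r, is_dd x v (w r) (dw r)) ->
 is_dd x v (fun y => \prod_r w r y) (\sum_r \prod_s (if s == r then dw s else w s x)).
elim: n w dw => [|n IH] w dw d.
 rewrite big_ord0 (_ : (fun => _) = cst 1); first exact: is_derive_cst.
 by apply/funext => y; rewrite big_ord0.
rewrite (_ : (fun => _) = w ord0 * fun y => \prod_r w (lift ord0 r) y); last first.
 by apply/funext => y; rewrite big_ord_recl.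
apply(is_derive_eq (_ (IH _ _ (fun r => d _)))).
rewrite big_ord_recl /GRing.scale addrC big_ord_recl /=; congr (_ + _).
 by rewrite mulrC.
rewrite mulr_sumr; apply: eq_bigr => r _; rewrite big_ord_recl; congr _.
Qed.

(** Product rule: one term differentiates the form at fixed arguments, and one term for each row
    differentiates that row. *)
Lemma is_derive_ml V k p (U : set V) (a : V -> 'M[R]_(k, p) -> R)
  (W : V -> 'M[R]_(k, p)) x v (DW : 'M[R]_(k, p)) :
 open U -> U x -> (forall y, U y -> multilinear (a y)) ->
 (forall B, derivable (fun y => a y B : R^o) x v) ->
 (forall i j, is_dd x v (fun y => W y i j) (DW i j)) ->
 is_dd x v (fun y => a y (W y))
  (dd v (fun y => a y (W x)) x + \sum_r a x (setrow r (row r DW) (W x))).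
move=> oU Ux aml ad WD; have E B y Uy := ml_full B (aml y Uy).
have dA f : is_dd x v (fun y => a y (fmx f)) (dd v (fun y => a y (fmx f)) x) by exact/_/ad.
have S (G : {ffun 'I_k -> 'I_p} -> V -> R) dG b : (forall f, is_dd x v (G f) (dG f)) ->
  (forall y, U y -> b y = \sum_f G f y) -> is_dd x v b (\sum_f dG f).
 move=> GD bE; have EE : \forall y \near x, (\sum_f G f) y = b y.
  by apply(nearU oU Ux) => y Uy; rewrite fct_sumE bE.
 have D : is_dd x v (\sum_f G f) (\sum_f dG f).
  elim/big_ind2 : _ => // *; [exact: is_derive_cst|exact: is_deriveD].
 exact: near_eq_is_derive.
have [_ ->] := S _ _ _ _ (E (W x)).
have D := S _ _ _
 (fun f => is_deriveM (is_dd_prod (fun r => WD r _)) (dA f)) (fun y => E _ y).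
apply(is_derive_eq D); rewrite /GRing.scale big_split /=; congr (_ _).
rewrite (eq_bigr _ (fun r _ => E _ x Ux)) exchange_big /=.
apply: eq_bigr => f _; rewrite mulrC mulr_suml; apply: eq_bigr => r _; congr (_ * _).
by apply: eq_bigr => s; rewrite mxE; case: eqP => // ->; rewrite mxE.
Qed.

Lemma smooth_ml V k p (U : set V) (a : V -> 'M[R]_(k, p) -> R) (W : V -> 'M[R]_(k, p)) :
 open U -> (forall y, U y -> multilinear (a y)) ->
 (forall B, smooth_fun U (fun y => a y B)) -> smooth_mx U W ->
 smooth_fun U (fun y => a y (W y)).
move=> oU aml asm Ws.
apply(smooth_ext oU (f := fun y => \sum_(f : {ffun 'I_k -> 'I_p}) \prod_r W y r (f r) * a y (fmx f))).
 by move=> y /aml am; rewrite ml_full.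
apply(smooth_sum _ oU) => f _; apply: (smoothM oU _ (asm _)).
by apply(smooth_prod _ oU) => r.
Qed.

End SmoothMaps.

Opaque jacobian derive.

(** * Naturality of the exterior derivative under pullback *)

Section Naturality.
Context {R : realType}.

(** Bringing row [q] to the top is a cycle of q + 1 rows, of sign (-1)^q. *)
Lemma alt_cycle k p (a : 'M[R]_(k.+1, p) -> R) (V : 'M[R]_(k.+1, p)) (q : 'I_k.+1) :
 multilinear a -> Defs.alternating a ->
 a V = (-1) ^+ q * a (col_mx (row q V) (row' q V) : 'M[R]_(1 + k, p)).
move=> am aa; pose s := lift_perm 0 q (1%g : 'S_k).
have -> : (col_mx (row q V) (row' q V) : 'M[R]__) = row_perm s V.
 apply/matrixP => i j; rewrite [RHS]mxE.
 case(unliftP 0 i) => [i'|] ->.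
  rewrite lift_perm_lift perm1.
  have -> : lift 0 i' = rshift 1 i' by apply: val_inj.
  by rewrite col_mxEd mxE.
 rewrite lift_perm_id.
 have -> : 0 = lshift k (0 : 'I_1) by apply: val_inj.
 by rewrite col_mxEu mxE.
rewrite (alt_perm am aa) odd_lift_perm odd_perm1 addbF signr_odd.
by rewrite mulrA -expr2 sqrr_sign mul1r.
Qed.

(** Two rows are deleted in either order. The index of the second deletion shifts in exactly one of
    the two orders, so the remaining rows agree while the parities of the index sums are
    opposite. *)
Lemma bumpC (r s q q' i : nat) : bump r q = s -> bump s q' = r ->
 bump r (bump q i) = bump s (bump q' i) /\
 ((s + q')%N = (r + q).+1 \/ (r + q)%N = (s + q').+1).
rewrite /bump; case(leqP) => h1 /= E1; case(leqP) => h2 /= E2; subst.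
- lia.
- split; [case(leqP) => h3; case(leqP) => /=; do !case: leqP => ?; lia|lia].
- split; [case(leqP) => h3; case(leqP _ i) => /=; do !case: leqP => ?; lia|lia].
- lia.
Qed.

Lemma lift2C k (r s : 'I_k.+2) (q q' : 'I_k.+1) (i : 'I_k) :
 lift r q = s -> lift s q' = r -> lift r (lift q i) = lift s (lift q' i).
move=> /(congr1 val) /= E1 /(congr1 val) /= E2; apply: val_inj => /=.
by have [] := bumpC i E1 E2.
Qed.

Lemma lift_sign k (r s : 'I_k.+2) (q q' : 'I_k.+1) :
 lift r q = s -> lift s q' = r -> (-1) ^+ (s + q') = - (-1) ^+ (r + q) :> R.
move=> /(congr1 val) /= E1 /(congr1 val) /= E2.
have [_ [h|h]] := bumpC 0 E1 E2.
- by rewrite h exprS mulN1r.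
- by rewrite h exprS mulN1r opprK.
Qed.

Lemma antisym_sum0 (I : finType) (G : I -> I -> R) :
 (forall i j, G i j = - G j i) -> \sum_i \sum_j G i j = 0.
move=> GN; set S := \sum_i _.
have SN : S = - S.
 rewrite {1}/S exchange_big /= /S -sumrN; apply: eq_bigr => i _.
 by rewrite -sumrN; apply: eq_bigr => j _; exact: GN.
by apply/eqP; have := subrr S; rewrite {2}SN opprK -mulr2n => /eqP; rewrite mulrn_eq0.
Qed.

(* Second derivatives cancel in pairs in the exterior derivative of a pullback. *)
Lemma alt_hessian0 k p (a : 'M[R]_(k, p) -> R) (U : 'M[R]_(k.+1, p))
  (H : 'I_k.+1 -> 'I_k.+1 -> 'rV[R]_p) : multilinear a -> Defs.alternating a ->
 (forall r s, H r s = H s r) ->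
 \sum_(r < k.+1) (-1) ^+ r * (\sum_(q < k) a (setrow q (H r (lift r q)) (row' r U))) = 0.
move=> am aa HC; case: k a U H am aa HC => [|k] a U H am aa HC.
 by rewrite big1 // => r; rewrite big_ord0 mulr0.
pose G r s : R := if unlift r s is Some q then
 (-1) ^+ (r + q) * a (col_mx (H r s) (row' q (row' r U)) : 'M[R]_(1 + k, p)) else 0.
transitivity (\sum_r \sum_s G r s).
 apply: eq_bigr => r _; rewrite (bigD1_ord r) //= {1}/G unlift_none add0r mulr_sumr.
 apply: eq_bigr => q' _; rewrite /G liftK exprD -mulrA; congr (_ _).
 rewrite (alt_cycle _ q' am aa) row_setrow eqxx row'_setrow.
 by [].
apply: antisym_sum0 => r s; rewrite /G.
case(unliftP) => [q1 E1|->]; last by rewrite unlift_none oppr0.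
case(unliftP) => [q2 E2|E2]; last first.
 by have := neq_lift r q1; rewrite -E1 E2 eqxx.
rewrite (lift_sign (esym E1) (esym E2)) mulNr opprK HC.
have -> // : row' q1 (row' r U) = row' q2 (row' s U).
apply/matrixP => i j; rewrite !mxE; congr (U _).
exact: lift2C.
Qed.

(** The formula of [ext_d] on an open set of a coordinate space, without an atlas; it applies to
    pullbacks to the plane or to time times a chart. *)
Definition extdE p k (a : 'rV[R]_p -> 'M[R]_(k, p) -> R) (x : 'rV[R]_p)
  (V : 'M[R]_(k.+1, p)) : R :=
 \sum_(r < k.+1) (-1) ^+ r * dd (row r V) (fun y => a y (row' r V)) x.

Lemma extdE_ext p k (U : set 'rV[R]_p) (a b : 'rV[R]_p -> 'M[R]_(k, p) -> R) x V :
 open U -> (forall y B, U y -> a y B = b y B) -> U x -> extdE a x V = extdE b x V.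
move=> oU ab Ux; apply: eq_bigr => r _.
by rewrite (near_eq_derive _ (nearU _ _ (fun y Uy => ab y _ Uy))).
Qed.

Lemma row'_mul k p q (r : 'I_k) (V : 'M[R]_(k, p)) (B : 'M[R]_(p, q)) :
 row' r (V *m B) = row' r V *m B.
by apply/matrixP => i j; rewrite !mxE; apply: eq_bigr => l; rewrite mxE. Qed.

(** By the product rule, the derivative of [a] at frozen Jacobian gives the right-hand side. The
    derivative of the Jacobian brings in the second derivatives [H] of [h], which are symmetric and
    cancel by [alt_hessian0]. *)
Lemma extdE_pull k p q (U : set 'rV[R]_p) (W : set 'rV[R]_q)
  (h : 'rV[R]_p -> 'rV[R]_q) (a : 'rV[R]_q -> 'M[R]_(k, q) -> R) x V :
 open U -> open W -> smooth_mx U h -> (forall y, U y -> W (h y)) ->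
 (forall y, W y -> multilinear (a y) /\ Defs.alternating (a y)) ->
 (forall B, smooth_fun W (fun y => a y B)) -> U x ->
 extdE (fun y V => a (h y) (V *m jacobian h y)) x V =
 extdE a (h x) (V *m jacobian h x).
move=> oU oW hs UW aml asm Ux.
have [am aa] := aml _ (UW x Ux).
pose H r s : 'rV_q :=
 \row_j dd (row r V) (fun y => dd (row s V) (fun z => h z 0 j) y) x.
have HC r s : H r s = H s r.
 by apply/rowP => j; rewrite [LHS]mxE mxE; apply: smooth_schwarz Ux.
have ac B y : U y -> differentiable (fun z => a z B) (h y).
 by move=> Uy; apply: smooth_differentiable (UW _ _).
have D r : dd (row r V) (fun y => a (h y) (row' r V *m jacobian h y)) x =
  dd (row r (V *m jacobian h x)) (fun y => a y (row' r (V *m jacobian h x))) (h x) +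
  \sum_(s < k) a (h x) (setrow s (H r (lift r s)) (row' r (V *m jacobian h x))).
 have cd B : is_dd x (row r V) (fun y => a (h y) B)
   (dd (row r (V *m jacobian h x)) (fun y => a y B) (h x)).
  have := is_derive_comp
   (ac B x Ux) (fun j => is_derive_jac oU hs (row r V) j Ux).
  by rewrite (derive_coord _ (ac B x Ux)) row_mul.
 pose DW : 'M[R]_(k, q) := \matrix_(i, j) H r (lift r i) 0 j.
 have WD i j : is_dd x (row r V) (fun y => (row' r V *m jacobian h y) i j) (DW i j).
  have E : \forall y \near x, (fun => dd (row (lift r i) V) (fun z => h z 0 j) y) y = (row' r V *m jacobian h y) i j.
   apply(nearU oU Ux) => y Uy; rewrite (derive_jacE oU hs _ _ Uy).
   by rewrite !mxE; apply: eq_bigr => l; rewrite !mxE.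
  apply(near_eq_is_derive E); rewrite mxE mxE.
  by apply(@smooth_dd R _ U) => //; apply: smooth_D.
 have [_ ->] := is_derive_ml oU Ux (fun y Uy => proj1 (aml _ (UW y Uy)))
  (fun B => @ex_derive _ _ _ _ _ _ _ (cd B)).
 have [_ ->] := cd (row' r V *m jacobian h x).
 rewrite row'_mul; congr (_ _); apply: eq_bigr => s _; congr (a _ (_ _ _)).
 by apply/rowP => j; rewrite mxE mxE.
rewrite /extdE; under eq_bigr do rewrite D mulrDr.
by rewrite big_split /= alt_hessian0 // addr0.
Qed.

End Naturality.

(** * Smooth maps into the manifold and pullbacks of forms *)

Section Manifold.
Context {R m M} {A : atlas R m M}.

Lemma overlap_open (i j : idx A) : open (overlap i j).
apply: open_preim; [exact: cod_open|exact: dom_open|move=> x; exact: param_continuous]. Qed.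

Lemma trans_smx (i j : idx A) : smooth_mx (overlap i j) (transition i j).
exact: transition_smooth. Qed.

Lemma smooth_to_open (V : normedModType R) (U : set V) (g : V -> M) (W : set M) : open U ->
 smooth_to A U g -> open W -> open (U `&` g @^-1` W).
move=> oU [gc _] oW; exact: open_preim. Qed.

(** It is enough to factor [g] near each point through one parametrization; the transition maps
    provide all the other charts. *)
Lemma smooth_toI (V : normedModType R) (U : set V) (g : V -> M) : open U ->
 (forall x, U x -> exists W (j : idx A) h, [/\ open W, W x, smooth_mx W h &
   forall y, W y -> cod j (h y) /\ g y = param j (h y)]) -> smooth_to A U g.
move=> oU H.
have gc x : U x -> {for x, continuous g}.
 move=> /H[W [j [h [oW Wx hs hE]]]].
 have hc : {for x, continuous (param j \o h)}.
  apply: continuous_comp; first exact: smooth_mx_cont.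
  by apply: param_continuous; have [] := hE x.
 rewrite /prop_for /continuous_at (proj2 (hE x Wx)).
 apply: cvg_trans hc; apply: near_eq_cvg.
 by apply(nearU oW Wx) => y /hE[].
split => // j'; apply: smooth_mx_local => x [Ux gx].
have [W [j [h [oW Wx hs hE]]]] := H x Ux.
pose W' := W `&` h @^-1` (overlap j j').
have oW' : open W'.
 exact: (open_preim_mx _ (@overlap_open j _)).
exists W'.
 by have [cx gE] := hE x Wx; split=> //; split => //=; rewrite -gE.
apply(@smooth_mx_ext _ _ _ _ _ (fun y => transition j j' (h y))) => //.
 by move=> y [/hE[_ gE]]; rewrite //= gE.
apply(@smooth_mx_comp _ _ _ _ _ _ (overlap j j')) => //.
- exact: overlap_open.
- by move=> y [].
- exact: trans_smx.
- by apply: smooth_mx_sub hs => y [].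
Qed.

Lemma smooth_to_chart (V : normedModType R) (U : set V) (g : V -> M) x : open U -> smooth_to A U g -> U x ->
 let j := chart_at A (g x) in
 [/\ open (U `&` g @^-1` Defs.dom j), (U `&` g @^-1` Defs.dom j) x &
   smooth_mx (U `&` g @^-1` Defs.dom j) (chart j \o g)].
move=> oU gs Ux j; split; last exact: (proj2 gs).
- apply: smooth_to_open => //; exact: dom_open.
- split => //; exact: chart_at_dom.
Qed.

Lemma smooth_to_ext (V : normedModType R) (U : set V) (f g : V -> M) : open U ->
 (forall x, U x -> f x = g x) -> smooth_to A U f -> smooth_to A U g.
move=> oU fg fs; apply: smooth_toI => // x Ux.
have [oW Wx Ws] := smooth_to_chart oU fs Ux.
eexists; eexists; eexists; split; [exact: oW|exact: Wx|exact: Ws|].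
move=> y [Uy Wy] /=; split; first exact: chart_cod.
by rewrite chartK // fg.
Qed.

Lemma smooth_to_local (V : normedModType R) (U : set V) (g : V -> M) : open U ->
 (forall x, U x -> exists W, [/\ open W, W x & smooth_to A W g]) -> smooth_to A U g.
move=> oU H; apply: smooth_toI => // x /H[W [oW Wx gs]].
have [oW' Wx' Ws] := smooth_to_chart oW gs Wx.
eexists; eexists; eexists; split; [exact: oW'|exact: Wx'|exact: Ws|].
by move=> y []; split; [exact: chart_cod|rewrite chartK].
Qed.

Lemma smooth_to_sub (V : normedModType R) (U W : set V) (g : V -> M) : open U -> open W -> U `<=` W ->
 smooth_to A W g -> smooth_to A U g.
move=> oU oW UW gs; apply: smooth_toI => // x Ux.
have [oW' [Wx gx] Ws] := smooth_to_chart oW gs (UW x Ux).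
eexists; eexists; eexists; split; [exact: oW'|by split|exact: Ws|].
by move=> y []; split; [exact: chart_cod|rewrite chartK].
Qed.

Lemma smooth_to_cst (V : normedModType R) (U : set V) (x : M) : open U -> smooth_to A U (fun=> x).
move=> oU; apply: smooth_toI => // y Uy.
exists U, (chart_at A x), (fun=> chart (chart_at A x) x); split => //.
 exact: smooth_mx_cst.
move=> z _; split; first by apply: chart_cod; exact: chart_at_dom.
rewrite chartK //; exact: chart_at_dom.
Qed.

Lemma smooth_to_comp p (V : normedModType R) (U : set V) (W : set 'rV[R]_p) (F : 'rV[R]_p -> M)
  (h : V -> 'rV[R]_p) : open U -> open W -> (forall x, U x -> W (h x)) ->
 smooth_to A W F -> smooth_mx U h -> smooth_to A U (fun x => F (h x)).
move=> oU oW UW Fs hs; apply: smooth_toI => // x Ux.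
have [oW' Wx Ws] := smooth_to_chart oW Fs (UW x Ux).
set W' := W `&` _ in oW' Wx Ws.
exists (U `&` h @^-1` W'), (chart_at A (F (h x))), (fun y => chart (chart_at A (F (h x))) (F (h y))).
have oUW : open (U `&` h @^-1` W') by apply: open_preim => // y; exact: smooth_mx_cont.
split => //.
- apply: smooth_mx_comp oUW oW' _ Ws _; first by move=> y [].
 by apply: smooth_mx_sub hs => [].
- by move=> y [_ []]; split; [exact: chart_cod|rewrite chartK].
Qed.

Lemma smooth_to_param (i : idx A) : smooth_to A (cod i) (param i).
apply: smooth_toI; first exact: cod_open.
move=> x cx; exists (cod i), i, id; split => //; first exact: cod_open.
apply: smooth_mx_id; exact: cod_open.
Qed.

Lemma form_ml k (a : dform A k) i x : is_form a -> cod i x -> multilinear (a i x).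
by move=> [H _ _] /H[]. Qed.

Lemma form_alt k (a : dform A k) i x : is_form a -> cod i x -> Defs.alternating (a i x).
by move=> [H _ _] /H[]. Qed.

Lemma form_smooth k (a : dform A k) i (V0 : 'M[R]_(k, m)) : is_form a -> smooth_fun (cod i) (fun x => a i x V0).
by move=> []. Qed.

(** The chart is selected at [F x] and varies with [x]. By [pullbackE] the value is the same in
    every chart, and [pullback_local] freezes one chart near a given point. *)
Definition pullback p (F : 'rV[R]_p -> M) k (a : dform A k) (x : 'rV[R]_p)
  (V : 'M[R]_(k, p)) : R :=
 let i := chart_at A (F x) in
 a i (chart i (F x)) (V *m jacobian (chart i \o F) x).

Section Pullback.
Variables (p : nat) (U : set 'rV[R]_p) (F : 'rV[R]_p -> M).
Hypotheses (oU : open U) (Fs : smooth_to A U F).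

Lemma pullbackE k (a : dform A k) j x V : is_form a -> U x -> Defs.dom j (F x) ->
 pullback F a x V = a j (chart j (F x)) (V *m jacobian (chart j \o F) x).
move=> [_ _ aT] Ux dj; rewrite /pullback; set i := _ A _.
have [oW Wx Ws] := smooth_to_chart oU Fs Ux; rewrite -/i in oW Wx Ws.
have di : Defs.dom i (F x) by exact: chart_at_dom.
have ov : overlap i j (chart i (F x)) by split; [exact: chart_cod|rewrite /= chartK].
rewrite (aT _ _ _ _ ov) /transition /= chartK // -mulmxA; congr (a j _ (_ *m _)).
pose W' := U `&` F @^-1` Defs.dom i `&` (chart i \o F) @^-1` overlap i j.
have oW' : open W'.
 exact: (open_preim_mx _ (@overlap_open i j)).
have ovo : open (overlap i j) by exact: overlap_open.
have Ws' : smooth_mx W' (chart i \o F) by apply: smooth_mx_sub Ws => y [].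
have sub y : W' y -> overlap i j ((chart i \o F) y) by case.
have W'x : W' x by split.
rewrite -(jac_comp oW' ovo Ws' (trans_smx i j) sub W'x).
apply(@jac_ext _ _ _ W') => //.
 exact: (smooth_mx_comp _ _ _ (trans_smx i j)).
by move=> y [[_ dy]]; rewrite /transition /= chartK.
Qed.

Lemma pullback_local k (a : dform A k) x : is_form a -> U x ->
 let j := chart_at A (F x) in let W := U `&` F @^-1` Defs.dom j in
 [/\ open W, W x, smooth_mx W (chart j \o F) &
  forall y V, W y -> pullback F a y V = a j (chart j (F y)) (V *m jacobian (chart j \o F) y)].
move=> fa Ux j W; have [oW Wx Ws] := smooth_to_chart oU Fs Ux.
split; [exact: oW|exact: Wx|exact: Ws|].
move=> y V []; exact: pullbackE.
Qed.

Lemma pullback_ml k (a : dform A k) x : is_form a ->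
 multilinear (pullback F a x) /\ Defs.alternating (pullback F a x).
move=> fa; set j := chart_at A (F x).
have cj : cod j (chart j (F x)) by apply: chart_cod; exact: chart_at_dom.
split.
 move=> r V V1 V2 c1 c2 E E1 E2; rewrite /pullback -/j.
 apply(form_ml fa cj (r := r)).
 - by rewrite !row_mul E mulmxDl !scalemxAl.
 - by rewrite !row'_mul E1.
 - by rewrite !row'_mul E2.
move=> V r s rs E; rewrite /pullback -/j; apply(form_alt fa cj rs).
by rewrite !row_mul E.
Qed.

Lemma pullback_smooth_ml k (a : dform A k) (W : set 'rV[R]_p) (B : 'rV[R]_p -> 'M[R]_(k, p)) :
 open W -> W `<=` U -> is_form a -> smooth_mx W B ->
 smooth_fun W (fun x => pullback F a x (B x)).
move=> oW WU fa Bs; apply: smooth_local => x Wx.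
have [oW' Wx' Ws E] := pullback_local fa (WU x Wx).
set j := _ (F x) in oW' Ws E; set W' := _ `&` _ in oW' Wx' Ws E.
have oN : open (W `&` W') by exact: openI.
exists (W `&` W') => //.
apply: (smooth_ext oN) => [y [_ Wy]|]; first by rewrite E.
apply(@smooth_ml R _ k m _ (fun => a j _)) => //.
- move=> y [_ [_ dy]]; apply: form_ml fa _; exact: chart_cod.
- move=> C; apply: (smooth_comp (W := cod j) (f := fun y => a j y C) (g := _ \o F)) => //.
 + exact: cod_open.
 + move=> y [_ [_]]; exact: chart_cod.
 + exact: form_smooth.
 + by apply: smooth_mx_sub Ws => [].
- apply: smooth_mulmx => //; first by apply: smooth_mx_sub Bs => [].
 apply(@smooth_mx_sub _ _ _ _ _ W') => [y []//|]; exact: smooth_jac.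
Qed.

Lemma pullback_smooth k (a : dform A k) V : is_form a ->
 smooth_fun U (fun x => pullback F a x V).
move=> fa; apply: pullback_smooth_ml => //; exact: smooth_mx_cst. Qed.

Lemma extdE_pullback k (a : dform A k) (b : dform A k.+1) x V : is_form a ->
 is_form b -> form_eq (ext_d a) b -> U x ->
 extdE (pullback F a) x V = pullback F b x V.
move=> fa fb ab Ux; have [oW Wx Ws E] := pullback_local fa Ux.
set j := _ (F x) in oW Ws E; set W := _ `&` _ in oW Wx Ws E.
rewrite (pullbackE V fb Ux (chart_at_dom A _)) -ab; last first.
 apply: chart_cod; exact: chart_at_dom.
transitivity (extdE (fun y V => a j ((chart j \o F) y) (V *m jacobian (chart j \o F) y)) x V).
 exact: (extdE_ext _ oW).
apply: (@extdE_pull R k p m W (cod j)) => //.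
- exact: cod_open.
- move=> y [_]; exact: chart_cod.
- move=> y; split; [exact: form_ml|exact: form_alt].
- move=> B; exact: form_smooth.
Qed.

End Pullback.

Lemma pullback_comp p q (U : set 'rV[R]_p) (W : set 'rV[R]_q) (F : 'rV[R]_q -> M)
  (h : 'rV[R]_p -> 'rV[R]_q) k (a : dform A k) x V : open U -> open W ->
 smooth_to A W F -> smooth_mx U h -> (forall y, U y -> W (h y)) -> U x ->
 pullback (fun y => F (h y)) a x V = pullback F a (h x) (V *m jacobian h x).
move=> oU oW Fs hs UW Ux; rewrite /pullback; set j := _ A _.
have [oW' Wx' Ws] := smooth_to_chart oW Fs (UW x Ux).
set W' := W `&` _ in oW' Wx' Ws.
have oN : open (U `&` h @^-1` W') by apply: open_preim => // y; exact: smooth_mx_cont.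
rewrite -mulmxA; congr (a j _ (_ *m _)).
apply: (@jac_comp _ _ _ _ (U `&` h @^-1` W') W') => //.
- by apply: smooth_mx_sub hs => [].
- by move=> y [].
Qed.

Lemma pullback_ext p (U : set 'rV[R]_p) (F G : 'rV[R]_p -> M) k (a : dform A k) x V :
 open U -> smooth_to A U F -> (forall y, U y -> F y = G y) -> U x ->
 pullback F a x V = pullback G a x V.
move=> oU Fs FG Ux; rewrite /pullback -(FG x Ux).
have [oW Wx Ws] := smooth_to_chart oU Fs Ux.
set j := chart_at A (F x) in oW Wx Ws *.
have E y : (U `&` F @^-1` Defs.dom j) y -> (chart j \o F) y = (chart j \o G) y.
 by move=> [Uy]; rewrite /= FG.
by rewrite (jac_ext _ _ E).
Qed.

Lemma pullback_param (i : idx A) k (a : dform A k) x V : is_form a -> cod i x ->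
 pullback (param i) a x V = a i x V.
move=> fa cx; rewrite (pullbackE (cod_open i) (smooth_to_param i) V fa cx (param_dom cx)) paramK //.
congr a.
have -> : jacobian (chart i \o param i) x = jacobian id x.
 apply/esym/(jac_ext (cod_open i)) => //; first by apply: smooth_mx_id; exact: cod_open.
 by move=> y cy /=; rewrite paramK.
by rewrite jac_id mulmx1.
Qed.

End Manifold.

Arguments overlap_open {R m M A} i j.
Arguments trans_smx {R m M A} i j.

(** * Smoothness of continuous inverses *)

Section InverseFunction.
Context {R : realType}.

Lemma mulmx_bound p q (B : 'M[R]_(p, q)) :
 exists2 C : R, 0 <= C & forall y : 'rV[R]_p, `|y *m B| <= C * `|y|.
exists (\sum_i \sum_j `|B i j|); first by apply: sumr_ge0 => i _; apply: sumr_ge0.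
move=> y; apply: mx_norm_le => [|i j].
 by rewrite mulr_ge0 //; apply: sumr_ge0 => i _; apply: sumr_ge0.
rewrite mxE (le_trans (ler_norm_sum _ _ _)) // mulr_suml; apply: ler_sum => l _.
rewrite normrM mulrC ler_pM //; last exact: coord_le.
by rewrite (bigD1 j) //= lerDl sumr_ge0.
Qed.

Lemma unitmx_inj p (B : 'M[R]_p) : (forall v : 'rV[R]_p, v *m B = 0 -> v = 0) ->
 B \in unitmx.
move=> Bi; rewrite -row_free_unit -kermx_eq0; apply/eqP/row_matrixP => i.
by rewrite row0; apply: Bi; rewrite -row_mul mulmx_ker row0.
Qed.

Section Inv.
Variables (p : nat) (U W : set 'rV[R]_p) (f g : 'rV[R]_p -> 'rV[R]_p).
Hypotheses (oU : open U) (oW : open W) (fs : smooth_mx U f).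
Hypothesis (gK : forall z, W z -> U (g z) /\ f (g z) = z).
Hypothesis (gc : forall z, W z -> {for z, continuous g}).
Hypothesis (fu : forall z, W z -> jacobian f (g z) \in unitmx).

(** Continuity of [g] is given, so linearizing [f] suffices: the increment k of [g] satisfies h v =
    k J + o(k). Absorbing the error first gives k = O(h), and then k / h tends to [v *m K]. *)
Lemma inverse_derive z v j : W z ->
 is_dd z v (fun y => g y 0 j) ((v *m invmx (jacobian f (g z))) 0 j).
move=> Wz; set a := g z; set J := _ a; set K := _ J.
have [Ua fa] := gK Wz; have fd := smooth_diff oU fs Ua.
have [C C0 CK] := mulmx_bound K.
have lim : (fun h => h^-1 *: (g (h *: v + z) - g z)) @ 0^' --> v *m K.
 apply/cvgrPdist_le => e e0.
 (* The first bound makes [C * eps] at most 1/2 and yields [kh]; the second turns the remaining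
    error into [e]. *)
 pose eps := Num.min (2^-1 / (C + 1)) (e / (2 * (C + 1) * (`|v *m K| + 1))).
 have C1 : 0 < C + 1 by rewrite ltr_wpDl.
 have vK1 : 0 < `|v *m K| + 1 by rewrite ltr_wpDl.
 have eps0 : 0 < eps.
  by rewrite lt_min !divr_gt0 //= mulr_gt0 // mulr_gt0.
 have /eqaddoP/(_ _ eps0) N := diff_locally fd.
 pose k h := g (h *: v + z) - a.
 have zc : {for (0 : R), continuous (fun h : R => h *: v + z)}.
  by apply: cvgD; [apply: cvgZr_tmp; exact: cvg_id|exact: cvg_cst].
 have kc : k @ 0 --> (0 : 'rV_p).
  rewrite -(subrr a); apply: cvgB; last exact: cvg_cst.
  have := @continuous_comp _ _ _ _ g 0 zc.
  rewrite /prop_for /continuous_at /= scale0r add0r; apply; exact: gc.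
 have N1 : \forall h \near (0 : R), `|f (k h + a) - (f a + 'd f a (k h))| <= eps * `|k h|.
  by have := kc _ N.
 have N2 : \forall h \near 0, W (h *: v + z).
  have : nbhs (0 *: v + z) W by rewrite scale0r add0r; exact: open_nbhs_nbhs.
  by move/zc.
 have N3 : \forall h \near (0 : R)^', h != 0 by exact: nbhs_dnbhs_neq.
 move: (nbhs_dnbhs N1) (nbhs_dnbhs N2) N3; apply: filterS3 => h n1 n2 h0.
 have kE : f (k h + a) = h *: v + z by rewrite /k subrK; have [] := gK n2.
 rewrite kE fa -(deriveE _ fd) (deriveEjacobian _ fd) -/J in n1.
 have {}n1 : `|h *: v - k h *m J| <= eps * `|k h|.
  by move: n1; rewrite opprD addrA addrK.
 have JK : J *m K = 1%:M by rewrite mulmxV //; exact: fu.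
 have n2' : `|h *: (v *m K) - k h| <= C * (eps * `|k h|).
  have -> : h *: (v *m K) - k h = (h *: v - k h *m J) *m K.
   by rewrite mulmxBl -mulmxA JK mulmx1 scalemxAl.
  by rewrite (le_trans (CK _)) // ler_wpM2l.
 have Ce : C * eps <= 2^-1.
  rewrite (@le_trans _ _ ((C + 1) * (2^-1 / (C + 1)))) //.
   by rewrite ler_pM ?(ltW eps0) ?lerDl // ge_min lexx.
  by rewrite mulrC divfK // gt_eqF.
 have kh : `|k h| <= 2 * (`|h| * `|v *m K|).
  have : `|k h| <= `|h *: (v *m K)| + 2^-1 * `|k h|.
   rewrite -[X in `|X| <= _](subKr (h *: (v *m K))) (le_trans (ler_normB _ _)) // lerD2l.
   by rewrite (le_trans n2') // mulrA ler_wpM2r.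
  rewrite normrZ; lra.
 have E : v *m K - h^-1 *: (g (h *: v + z) - g z) = h^-1 *: (h *: (v *m K) - k h).
  by rewrite [RHS]scalerBr scalerA mulVf // scale1r.
 rewrite E normrZ normfV ler_pdivrMl ?normr_gt0 // (le_trans n2') //.
 apply(@le_trans _ _ ((C + 1) * (e / (2 * (C + 1) * (`|v *m K| + 1)) * (2 * (`|h| * (`|v *m K| + 1)))))).
  apply: ler_pM => //; first by rewrite mulr_ge0 // ltW.
   by rewrite lerDl.
  apply: ler_pM => //; first exact: ltW.
   by rewrite ge_min lexx orbT.
  by rewrite (le_trans kh) // ler_wpM2l // ler_wpM2l // lerDl.
 rewrite le_eqVlt; apply/orP; left; apply/eqP.
 have : C + 1 != 0 by rewrite gt_eqF.
 have : `|v *m K| + 1 != 0 by rewrite gt_eqF.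
 move: (C + 1) (`|v *m K| + 1) => c d d0 c0.
 by field; rewrite d0.
have gd : derivable g z v by apply/cvg_ex; exists (v *m K).
have gE : 'D_v g z = v *m K by exact: cvg_lim.
split; first exact: (iffLR (derivable_mxP g z v)).
by rewrite -gE (derive_mx gd) mxE.
Qed.

(** Bootstrap: the derivative of [g] is a smooth function of [g] itself, so each step of the
    induction gains one order. *)
Lemma smooth_inverse : smooth_mx W g.
have H k : forall j, CK k W (fun y => g y 0 j).
 elim: k => [|k IH] j.
  case=> // _ x Wx.
  exact: continuous_comp (gc Wx) (@coord_continuous _ _ _ _ _ _).
 apply(CKSI oW (df := fun v z => (v *m invmx (jacobian f (g z))) 0 j)).
 - move=> x Wx.
  exact: continuous_comp (gc Wx) (@coord_continuous _ _ _ _ _ _).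
 - move=> v x; exact: inverse_derive.
 - move=> v.
  pose U' := U `&` (fun x => \det (jacobian f x)) @^-1` [set t : R | t != 0].
  have oU' : open U'.
   apply(open_preim oU); first exact: open_neq.
   move=> x; apply: smooth_cont => //; apply(smooth_det oU); exact: smooth_jac.
  have S : smooth_mx U' (fun x => v *m invmx (jacobian f x)).
   apply(smooth_mulmx oU'); first exact: smooth_mx_cst.
   apply(smooth_invmx oU') => [|x []]; last by rewrite unitmxE unitfE.
   apply(@smooth_mx_sub _ _ _ _ _ U) => [x []//|]; exact: smooth_jac.
  apply: (CK_comp oW oU' _ (S 0 j) IH) => x Wx; split; first by have [] := gK Wx.
  by have := fu Wx; rewrite unitmxE unitfE.
by move=> i j; rewrite ord1; apply/CK_smooth => k.
Qed.

End Inv.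
End InverseFunction.

(** * Time as an additional coordinate *)

Section Join.
Context {R : realType}.

Lemma is_dd_coord p (x v : 'rV[R]_p) l :
 is_dd x v (fun y : 'rV[R]_p => y 0 l) (v 0 l).
have := @is_derive_jac R _ _ [set: 'rV_p] _ openT (smooth_mx_id openT) x v l I.
by rewrite jac_id mulmx1.
Qed.


(** Time times space is encoded as row vectors with time at index 0, so that Jacobians, pullbacks
    and [extdE] apply to it unchanged. *)
Definition tjoin m (t : R) (x : 'rV[R]_m) : 'rV[R]_(1 + m) := row_mx t%:M x.

Lemma tjoin0 m t (x : 'rV[R]_m) : tjoin t x 0 0 = t.
rewrite /tjoin; have -> : 0 = lshift m (0 : 'I_1) by apply: val_inj.
by rewrite row_mxEl mxE.
Qed.

Lemma tjoinr m t (x : 'rV[R]_m) : rsubmx (tjoin t x) = x.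
exact: row_mxKr. Qed.

Lemma tjoin_eta m (z : 'rV[R]_(1 + m)) : tjoin (z 0 0) (rsubmx z) = z.
rewrite -[RHS]hsubmxK /tjoin; congr row_mx.
apply/matrixP => i j; rewrite !ord1 !mxE; congr (z _).
exact: val_inj.
Qed.

Lemma smooth_tjoin (V : normedModType R) m (U : set V) (f : V -> R) (h : V -> 'rV[R]_m) :
 open U -> smooth_fun U f -> smooth_mx U h -> smooth_mx U (fun x => tjoin (f x) (h x)).
move=> oU fs hs i j; rewrite ord1.
case(splitP j) => j' jE.
 have -> : j = lshift m j' by apply: val_inj.
 apply: (smooth_ext oU _ fs) => x _.
 by rewrite row_mxEl mxE ord1.
have -> : j = rshift 1 j' by apply: val_inj.
by apply: smooth_ext oU _ (hs 0 _) => x; rewrite row_mxEr.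
Qed.

Lemma smooth_rsubmx m (U : set 'rV[R]_(1 + m)) : open U -> smooth_mx U (@rsubmx R 1 1 m).
move=> oU i j; apply: (smooth_ext oU _ (smooth_coord i (rshift 1 j) oU)) => x _.
by rewrite mxE.
Qed.

Lemma open_rsubmx m (U : set 'rV[R]_m) : open U -> open [set z : 'rV[R]_(1 + m) | U (rsubmx z)].
move=> oU; have -> : [set z : 'rV_(1 + m) | U (rsubmx z)] = setT `&` rsubmx @^-1` U.
 by rewrite setTI.
apply: (open_preim_mx openT oU); apply: smooth_rsubmx; exact: openT.
Qed.

Lemma tjoin_cont (T : topologicalType) m (f : T -> R) (h : T -> 'rV[R]_m) x :
 {for x, continuous f} -> {for x, continuous h} ->
 {for x, continuous (fun y => tjoin (f y) (h y))}.
move=> fc hc; apply: mx_continuousP => i j; rewrite ord1.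
case(splitP j) => j' jE.
 have -> : j = lshift m j' by apply: val_inj.
 rewrite (_ : (fun => _) = f) //; apply/funext => y.
 by rewrite row_mxEl mxE ord1.
have -> : j = rshift 1 j' by apply: val_inj.
rewrite (_ : (fun => _) = fun y => h y 0 j'); last by apply/funext => y; rewrite row_mxEr.
exact: coord_cvg.
Qed.

End Join.

(** * Smooth families of diffeomorphisms and their inverses *)

Section Families.
Context {R m M} {A : atlas R m M}.

Definition fam_map (Phi : R -> M -> M) (i : idx A) (z : 'rV[R]_(1 + m)) : M :=
 Phi (z 0 0) (param i (rsubmx z)).

Definition fam_dom (i : idx A) : set 'rV[R]_(1 + m) := [set z | cod i (rsubmx z)].

Definition smooth_family (Phi : R -> M -> M) :=
 forall i : idx A, smooth_to A (fam_dom i) (fam_map Phi i).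

Lemma fam_open i : open (fam_dom i).
apply: open_rsubmx; exact: cod_open. Qed.

Lemma smooth_to_aff (V V' : normedModType R) (L L0 : V' -> V) (U : set V') (W : set V)
  (F : V -> M) : open U -> open W -> (forall x, U x -> W (L x)) -> continuous L ->
 (forall (h : R) v x, L (h *: v + x) = h *: L0 v + L x) ->
 smooth_to A W F -> smooth_to A U (F \o L).
move=> oU oW UW Lc Lh Fs; apply: smooth_toI => // x Ux.
have [oW' Wx Ws] := smooth_to_chart oW Fs (UW x Ux).
set j := chart_at A _ in oW' Ws; set W' := _ `&` _ in oW' Wx Ws.
have oN : open (U `&` L @^-1` W') by apply(open_preim oU oW') => y _; exact: Lc.
exists (U `&` L @^-1` W'), j, (chart j \o F \o L); split => //.
- move=> k l; apply: (smooth_aff oN _ Lc Lh (Ws k l)).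
 by move=> y [].
- by move=> y [_ []]; split; [exact: chart_cod|rewrite chartK].
Qed.

Lemma family_comp (V : normedModType R) (U : set V) (f : V -> R) (g : V -> M) Phi :
 open U -> smooth_family Phi -> smooth_fun U f -> smooth_to A U g ->
 smooth_to A U (fun x => Phi (f x) (g x)).
move=> oU Ps fs gs; apply: smooth_to_local => // x Ux.
have [oW Wx Ws] := smooth_to_chart oU gs Ux.
set i := _ (g x) in oW Ws; set W := _ `&` _ in oW Wx Ws.
exists W; split => //.
apply(@smooth_to_ext _ _ _ _ _ _ (fun y => fam_map Phi i (tjoin (f y) (chart i (g y))))) => //.
 by move=> y [_ dy]; rewrite /fam_map tjoin0 tjoinr chartK.
apply: (smooth_to_comp oW (@fam_open i) _ (Ps i)).
 move=> y [_]; rewrite /fam_dom /= tjoinr; exact: chart_cod.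
by apply: smooth_tjoin => //; apply: smooth_sub fs => y [].
Qed.

Lemma smooth_to_rsub i : smooth_to A (fam_dom i) (fun z => param i (rsubmx z)).
apply: (smooth_to_comp (@fam_open i) (cod_open i) _ (smooth_to_param i)) => //.
exact: smooth_rsubmx (@fam_open i).
Qed.

Lemma smooth_time i : smooth_fun (fam_dom i) (fun z => z 0 0).
exact: smooth_coord (@fam_open i). Qed.

Lemma family_reparam Phi (f : R -> R) : smooth_family Phi ->
 smooth1 f -> smooth_family (fun t => Phi (f t)).
move=> Ps fs i; apply: (family_comp (@fam_open i) Ps _ (smooth_to_rsub i)).
exact: smooth_comp1 (@fam_open i) openT _ _ (smooth_time i).
Qed.

Lemma family_cont Phi : smooth_family Phi ->
 continuous (fun p : R * M => Phi p.1 p.2).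
move=> Ps [t x]; set i := chart_at A x.
have dx : Defs.dom i x by exact: chart_at_dom.
have cx : {for (t, x), continuous (fun p : R * M => tjoin p.1 (chart i p.2))}.
 apply: tjoin_cont; first exact: cvg_fst.
 apply: continuous_comp; first exact: cvg_snd.
 exact: chart_continuous.
have cF : {for (t, x), continuous (fun p : R * M => fam_map Phi i (tjoin p.1 (chart i p.2)))}.
 apply(continuous_comp cx).
 have [+ _] := Ps i; apply; rewrite /fam_dom /= tjoinr; exact: chart_cod.
have N : \forall p \near (t, x), fam_map Phi i (tjoin p.1 (chart i p.2)) = Phi p.1 p.2.
 have : nbhs (t, x) (snd @^-1` Defs.dom i).
  apply: cvg_snd; apply: open_nbhs_nbhs; split => //; exact: dom_open.
 by apply: filterS => -[t' x'] dx'; rewrite /fam_map tjoin0 tjoinr chartK.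
rewrite /prop_for /continuous_at -(nbhs_singleton N).
by apply: cvg_trans cF; apply: near_eq_cvg.
Qed.

Section InverseFamily.
Variables Psi Phi : R -> M -> M.
Hypothesis Mcl : closed_connected_manifold M.
Hypothesis Pc : continuous (fun p : R * M => Psi p.1 p.2).
Hypothesis PK : forall t, cancel (Psi t) (Phi t).
Hypothesis KP : forall t, cancel (Phi t) (Psi t).

(** Outside a neighbourhood [N] of the preimage of [y0], the map [Psi t0] avoids [y0]. The
    complement of [N] is compact and M is Hausdorff, so [Psi t] still avoids [y] there for (t, y)
    near (t0, y0). *)
Lemma inverse_continuous : continuous (fun p : R * M => Phi p.1 p.2).
have [Mh Mc _] := Mcl.
move=> [t0 y0] N0; rewrite nbhsE /= => -[N [oN Nx] NN0].
have cK : compact (~` N) by apply: (subclosed_compact _ Mc) => //; exact: open_closedC.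
have H := iffLR (compact_near_coveringP _) cK _ (nbhs (t0, y0))
 (fun p x => Psi p.1 x <> p.2).
have C : forall x, (~` N) x -> \forall x' \near x & p \near (t0, y0), Psi p.1 x' <> p.2.
 move=> x Nx'.
 have neq : Psi t0 x != y0.
  by apply/eqP => E; apply: Nx'; rewrite -(PK t0 x) E.
 have := Mh; rewrite open_hausdorff => /(_ _ _ neq)[[B1 B2] /= [xB yB] [oB1 oB2 /eqP dB]].
 have Hc : {for _, continuous _} := @Pc (t0, x).
 have := Hc B1; move=> []; first by apply: open_nbhs_nbhs; split => //; exact: set_mem.
 move=> [B3 B4] /= [n3 n4] B34.
 exists (B4, B3 `*` B2) => /=.
  split => //; exists (B3, B2) => //=; split => //.
  apply: open_nbhs_nbhs; split => //; exact: set_mem.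
 move=> [x' [t' y']] /= [Bx' [Bt' By']] E.
 have := B34 (_, _) (conj Bt' Bx'); rewrite /= E => B1y.
 by have : (B1 `&` B2) y' by []; rewrite dB.
have := H (nbhs_filter _) C; apply: filterS => -[t y] /= Hp.
apply: NN0; apply: contrapT => nN; have := Hp _ nN; apply.
exact: KP.
Qed.

Hypothesis Ps : smooth_family Psi.
Hypothesis Pd : forall t, diffeo A (Psi t).

Lemma diffeo_inverse_smooth t : smooth_self A (Phi t).
have [_ [g [gs gK Kg]]] := Pd t.
have -> : Phi t = g by apply/funext => y; rewrite -[y in LHS]Kg PK.
exact: gs.
Qed.

Lemma diffeo_jac_inj t (i j : idx A) x (v : 'rV[R]_m) : cod j x ->
 Defs.dom i (Psi t (param j x)) ->
 v *m jacobian (chart i \o Psi t \o param j) x = 0 -> v = 0.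
move=> cx dx v0.
have [Ps1 _] := Pd t; have Ph1 := diffeo_inverse_smooth t.
pose f := chart i \o Psi t \o param j; pose g := chart j \o Phi t \o param i.
pose Uf := cod j `&` (Psi t \o param j) @^-1` Defs.dom i.
pose Ug := cod i `&` (Phi t \o param i) @^-1` Defs.dom j.
have oUf : open Uf by apply: (smooth_to_open _ (Ps1 j)); [exact: cod_open|exact: dom_open].
have oUg : open Ug by apply: (smooth_to_open _ (Ph1 i)); [exact: cod_open|exact: dom_open].
have fs : smooth_mx Uf f by have [_ /(_ i)] := Ps1 j.
have gs : smooth_mx Ug g by have [_ /(_ j)] := Ph1 i.
have fg y : Uf y -> Ug (f y) /\ g (f y) = y.
 move=> [cy dy]; rewrite /g /f /= chartK // PK; split.
  split; [exact: chart_cod|rewrite /= chartK // PK; exact: param_dom].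
 by rewrite paramK.
have Ux : Uf x by split.
have E := jac_comp oUf oUg fs gs (fun y Uy => proj1 (fg y Uy)) Ux.
have E1 : jacobian (g \o f) x = 1%:M.
 rewrite -(jac_id x); apply/esym; apply: (jac_ext oUf _ _ Ux); first exact: smooth_mx_id.
 by move=> y /fg[].
by rewrite -[v]mulmx1 -E1 E mulmxA v0 mul0mx.
Qed.

(** [smooth_inverse] is applied to (t, x) |-> (t, Psi_t x). A kernel vector of the Jacobian has zero
    time component, and its space component is killed by the derivative of the diffeomorphism Psi_t,
    hence is zero. *)
Lemma inverse_family : smooth_family Phi.
move=> i; apply: smooth_toI; first exact: fam_open.
move=> z0 cz0; set j := chart_at A (fam_map Phi i z0).
pose G (z : 'rV_(1 + m)) := tjoin (z 0 0) (chart j (fam_map Phi i z)).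
pose F (z : 'rV_(1 + m)) := tjoin (z 0 0) (chart i (fam_map Psi j z)).
pose W := fam_dom i `&` fam_map Phi i @^-1` Defs.dom j.
pose U := fam_dom j `&` fam_map Psi j @^-1` Defs.dom i.
have Pzc z : fam_dom i z -> {for z, continuous (fam_map Phi i)}.
 move=> cz; apply: (@continuous_comp _ _ _ (fun z : 'rV_(1 + m) => (z 0 0, _))
  (fun p => _ p.1 p.2)); last exact: inverse_continuous.
 apply: (@cvg_pair _ _ _ (nbhs z) (nbhs (z 0 0)) (nbhs (_ i _))).
  exact: coord_continuous.
 by have [+ _] := smooth_to_rsub i; apply.
have oW : open W by apply(open_preim (@fam_open i) (dom_open j)).
have oU : open U by apply(smooth_to_open (@fam_open j) (Ps j)); exact: dom_open.
have Wz0 : W z0 by split => //; exact: chart_at_dom.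
have Us : smooth_mx U (chart i \o fam_map Psi j) by have [_] := Ps j; exact.
have Fs : smooth_mx U F.
 apply: (smooth_tjoin oU _ Us); exact: smooth_coord.
have GK z : W z -> U (G z) /\ F (G z) = z.
 move=> [cz dz]; rewrite /U /F /G /fam_dom /fam_map /= tjoin0 tjoinr chartK // KP.
 split; first by split; [exact: chart_cod|exact: param_dom].
 by rewrite paramK // tjoin_eta.
have Gc z : W z -> {for z, continuous G}.
 move=> [cz dz]; apply: tjoin_cont; first exact: coord_continuous.
 apply: continuous_comp; first exact: Pzc.
 exact: chart_continuous.
have Ju z : W z -> jacobian F (G z) \in unitmx.
 move=> Wz; have [Uz _] := GK z Wz; set u := G z in Uz *.
 apply: unitmx_inj => v v0.
 have D l : dd v (fun y => F y 0 l) u = 0 by rewrite (derive_jacE oU Fs _ _ Uz) v0 mxE.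
 have t0 : v 0 0 = 0.
  have E : \forall y \near u, (fun => F y 0 0) y = y 0 0.
   by apply: (nearU openT I) => y; rewrite tjoin0.
  have := D 0; rewrite (near_eq_derive _ E).
  by have [_ ->] := is_dd_coord u v 0.
 have vE : v = tjoin 0 (rsubmx v) by rewrite -t0 tjoin_eta.
 have [cu du] := Uz.
 pose e (y : 'rV_m) := tjoin (u 0 0) y.
 have es : smooth_mx (cod j) e.
  apply: smooth_tjoin (cod_open j) _ (smooth_mx_id (cod_open j)).
  exact: smooth_cst (cod_open j).
 have uE : u = e (rsubmx u) by rewrite /e tjoin_eta.
 suff : rsubmx v = 0.
  by move=> rv; rewrite vE rv; apply/rowP => l; rewrite mxE; case: splitP => l'; rewrite !mxE ?mul0rn.
 apply(@diffeo_jac_inj (u 0 0) i j (rsubmx u)) => //.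
 pose N := cod j `&` (Psi (u 0 0) \o param j) @^-1` Defs.dom i.
 have [Ps1 _] := Pd (u 0 0).
 have oN : open N by apply: (smooth_to_open _ (Ps1 j)); [exact: cod_open|exact: dom_open].
 have Nu : N (rsubmx u) by split.
 have Ns : smooth_mx N (chart i \o Psi (u 0 0) \o param j) by have [_ /(_ i)] := Ps1 j.
 apply/rowP => l; rewrite -(derive_jacE oN Ns _ _ Nu) [RHS]mxE.
 have Dl := D (rshift 1 l).
 have fd : differentiable (fun y => F y 0 (rshift 1 l)) u.
  exact: smooth_differentiable Uz.
 rewrite (derive_coord _ fd) in Dl.
 have de : forall l', is_dd (rsubmx u) (rsubmx v) (fun y => e y 0 l') (v 0 l').
  move=> l'; case(splitP l') => l'' lE.
   have -> : l' = 0 by apply: val_inj; rewrite /= lE ord1.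
   rewrite t0 (_ : (fun => _) = cst (u 0 0)); first exact: is_derive_cst.
   by apply/funext => y; rewrite /e tjoin0.
  have -> : l' = rshift 1 l'' by apply: val_inj.
  have -> : v 0 (rshift 1 l'') = rsubmx v 0 l'' by rewrite mxE.
  rewrite (_ : (fun => _) = fun y : 'rV_m => y 0 l''); first exact: is_dd_coord.
  by apply/funext => y; rewrite /e row_mxEr.
 have fde : differentiable (fun y => F y 0 (rshift 1 l)) (e (rsubmx u)) by rewrite -uE.
 have [_ C] := is_derive_comp fde; rewrite -uE Dl in C; rewrite -C.
 apply: near_eq_derive; apply: (nearU openT I) => y _.
 by rewrite /F /e /fam_map row_mxEr tjoin0 tjoinr.
have Gs := smooth_inverse oU oW Fs GK Gc Ju.
exists W, j, (chart j \o fam_map Phi i); split => //.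
 move=> k l; apply: (smooth_ext oW _ (Gs 0 (rshift 1 l))) => z _.
 by rewrite ord1 row_mxEr.
by move=> z []; split; [exact: chart_cod|rewrite chartK].
Qed.

End InverseFamily.
End Families.

Arguments fam_open {R m M A} i.

Arguments smooth_family {R m M} A Phi.

(** * Fibre integration over time and the homotopy formula *)

Section FiberIntegral.
Context {R m M} {A : atlas R m M}.

Lemma open_setTX (V : normedModType R) (U : set V) : open U ->
 open ([set: R^o] `*` U : set (R^o * V)%type).
move=> oU; have -> : [set: R^o] `*` U = setT `&` snd @^-1` U :_.
 by [].
apply(open_preim openT oU) => p _; exact: cvg_snd.
Qed.

(** The field d/dt on time times space; [hlift] gives the vectors tangent to a time slice. *)
Definition tvec : 'rV[R]_(1 + m) := tjoin 1 0.

Definition hlift k (V : 'M[R]_(k, m)) : 'M[R]_(k, 1 + m) := row_mx 0 V.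

Lemma row_hlift k (V : 'M[R]_(k, m)) r : row r (hlift V) = tjoin 0 (row r V).
by rewrite /hlift row_row_mx row0 /tjoin raddf0. Qed.

Lemma row'_hlift k (V : 'M[R]_(k, m)) r : row' r (hlift V) = hlift (row' r V).
by apply/matrixP => i j; rewrite !mxE; case: splitP => l; rewrite !mxE. Qed.

Lemma tjoin_lin (h s t : R) (v x : 'rV[R]_m) :
 tjoin (h * s + t) (h *: v + x) = h *: tjoin s v + tjoin t x.
by rewrite /tjoin scale_row_mx add_row_mx scale_scalar_mx raddfD.
Qed.

Lemma tjoin_line (h t : R) (x : 'rV[R]_m) : tjoin (h + t) x = h *: tvec + tjoin t x.
by rewrite -tjoin_lin mulr1 scaler0 add0r. Qed.

Lemma tjoin_affine (h t : R) (v x : 'rV[R]_m) :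
 tjoin t (h *: v + x) = h *: tjoin 0 v + tjoin t x.
by rewrite -tjoin_lin mulr0 add0r. Qed.

Lemma jac_time (j0 : nat) (U : set 'rV[R]_m) (T : 'rV[R]_m -> 'rV[R]_j0) z tau w :
 open U -> smooth_mx U T -> U (rsubmx z) ->
 tjoin tau w *m jacobian (fun z : 'rV[R]_(1 + m) => tjoin (z 0 0) (T (rsubmx z))) z =
 tjoin tau (w *m jacobian T (rsubmx z)).
move=> oU Ts Uz; set h := fun z => _.
have oU' := open_rsubmx oU.
have hs : smooth_mx [set z : 'rV__ | U (rsubmx z)] h.
 apply: smooth_tjoin => //; first exact: smooth_coord.
 apply(smooth_mx_comp oU' oU) => //; exact: smooth_rsubmx.
apply/rowP => l; rewrite -(derive_jacE oU' hs _ _ Uz).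
case(splitP l) => l' lE.
 have -> : l = 0 by apply: val_inj; rewrite /= lE ord1.
 rewrite tjoin0 /h (_ : (fun => _) = fun y : 'rV_(1 + m) => y 0 0).
  by have [] := is_dd_coord z (tjoin tau w) 0; rewrite tjoin0.
 by apply/funext => y; rewrite tjoin0.
have -> : l = rshift 1 l' by apply: val_inj.
rewrite row_mxEr -(derive_jacE oU Ts _ _ Uz).
have Td := @smooth_derivable R _ U (fun y => T y 0 _) _ w (Ts 0 l') Uz.
rewrite (_ : (fun => _) = (fun y => T y 0 l') \o rsubmx).
 have L c : rsubmx (c *: tjoin tau w + z) = c *: w + rsubmx z by rewrite linearP /= tjoinr.
 by have [] := @is_dd_aff R _ _ _ _ z w _ L Td.
by apply/funext => y; rewrite /h row_mxEr.
Qed.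

Lemma jac_time_mx (j0 : nat) (U : set 'rV[R]_m) (T : 'rV[R]_m -> 'rV[R]_j0) z k (V : 'M[R]_(k, m)) :
 open U -> smooth_mx U T -> U (rsubmx z) ->
 col_mx (tjoin 1 0) (hlift V) *m jacobian (fun z : 'rV[R]_(1 + m) => tjoin (z 0 0) (T (rsubmx z))) z =
 col_mx (tjoin 1 0) (row_mx 0 (V *m jacobian T (rsubmx z))).
move=> oU Ts Uz; rewrite mul_col_mx (jac_time _ _ oU Ts Uz) mul0mx; congr col_mx.
apply/row_matrixP => r; rewrite row_mul row_hlift (jac_time _ _ oU Ts Uz).
by rewrite row_row_mx row0 row_mul /tjoin raddf0.
Qed.

Lemma jac_tjoin (t : R) (x : 'rV[R]_m) k (V : 'M[R]_(k, m)) :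
 V *m jacobian (tjoin t) x = hlift V.
have es : smooth_mx [set: 'rV_m] (tjoin t).
 apply: smooth_tjoin; [exact: openT|exact: smooth_cst openT|exact: smooth_mx_id openT].
apply/row_matrixP => r; rewrite row_mul row_hlift; apply/rowP => l.
rewrite -(derive_jacE openT es _ _ I).
case(splitP l) => l' lE.
 have -> : l = 0 by apply: val_inj; rewrite /= lE ord1.
 rewrite tjoin0 (_ : (fun => _) = cst t); last by apply/funext => y; rewrite tjoin0.
 exact: derive_cst.
have -> : l = rshift 1 l' by apply: val_inj.
rewrite row_mxEr (_ : (fun => _) = fun y : 'rV_m => y 0 l'); last by apply/funext => y; rewrite row_mxEr.
by have [_ ->] := is_dd_coord x (row r V) l'.
Qed.

Variable Phi : R -> M -> M.
Hypothesis Phs : smooth_family A Phi.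

Definition slice_form t k (w : dform A k) : dform A k :=
 fun i x V => pullback (fun y => Phi t (param i y)) w x V.

(** Time occupies the first slot; this choice fixes the signs in [fiber_int_d] and
    [speed_fiber_int]. *)
Definition fiber_int (t0 t1 : R) k (w : dform A k.+1) : dform A k :=
 fun i x V => \i[t0, t1] t,
  pullback (fam_map Phi i) w (tjoin t x) (col_mx tvec (hlift V)).

Lemma slice_formE t k (w : dform A k) i x V : cod i x ->
 slice_form t w i x V = pullback (fam_map Phi i) w (tjoin t x) (hlift V).
move=> cx; rewrite /slice_form -(jac_tjoin t x).
rewrite -(pullback_comp _ _ (cod_open i) (fam_open i) (Phs i) _ _ cx).
- by congr (pullback _ w); apply/funext => y; rewrite /fam_map tjoin0 tjoinr.
- apply: smooth_tjoin; [exact: cod_open|exact: smooth_cst (cod_open i)|].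
 exact: smooth_mx_id (cod_open i).
- by move=> y; rewrite /fam_dom /= tjoinr.
Qed.

Lemma fiber_smooth k (w : dform A k) (i : idx A) B : is_form w ->
 smooth_fun ([set: R^o] `*` cod i : set (R^o * 'rV[R]_m)%type)
  (fun p => pullback (fam_map Phi i) w (tjoin p.1 p.2) B).
move=> fw.
have := @smooth_aff R _ (R^o * 'rV_m)%type (fun p => tjoin p.1 p.2) (fun p => tjoin p.1 p.2)
 ([set: R^o] `*` cod i) (fam_dom i) (fun z => pullback (fam_map Phi i) w z B).
apply.
- exact: open_setTX (cod_open i).
- by move=> p []; rewrite /fam_dom /= tjoinr.
- by move=> p; apply: tjoin_cont; [exact: cvg_fst|exact: cvg_snd].
- move=> h v x; exact: tjoin_lin.
- exact: (pullback_smooth (fam_open i)).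
Qed.

Lemma fiber_cont k (w : dform A k) (i : idx A) x B : is_form w -> cod i x ->
 continuous (fun t : R => pullback (fam_map Phi i) w (tjoin t x) B).
move=> fw cx t.
have := smooth_cont (fiber_smooth i B fw) (conj I cx : _ (t, x)).
by move=> /(@joint_cont_at R _ (fun t x => pullback (fam_map Phi i) w (tjoin t x) B)).
Qed.

Lemma fiber_ml k (w : dform A k.+1) (i : idx A) t x : is_form w ->
 let a V := pullback (fam_map Phi i) w (tjoin t x) (col_mx tvec (hlift V)) in
 multilinear a /\ Defs.alternating a.
move=> fw a.
have [pm pa] := pullback_ml (fam_map Phi i) (tjoin t x) fw.
split.
- case: k w fw @a pm pa => [|k] w fw a pm pa r V V1 V2 c1 c2 E E1 E2; first by case: r E E1 E2 => [].
 apply(pm (rshift 1 r : 'I__)).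
 + rewrite !(@rowKd _ 1 k.+1) !row_hlift E.
  have := tjoin_lin c1 0 0 (row r V1) (c2 *: row r V2).
  rewrite mulr0 addr0 => ->; congr (_ _).
  by have := tjoin_lin c2 0 0 (row r V2) 0; rewrite mulr0 !addr0 => ->; rewrite /tjoin raddf0 row_mx0 addr0.
 + by rewrite !row'_col_mxS !row'_hlift E1.
 + by rewrite !row'_col_mxS !row'_hlift E2.
- move=> V r s rs E; apply(pa _ (rshift 1 r : 'I__) (rshift 1 s)).
  by [].
 by rewrite !(@rowKd R 1) !row_hlift E.
Qed.

Lemma fiber_int_form t0 t1 k (w : dform A k.+1) : t0 <= t1 -> is_form w ->
 is_form (fiber_int t0 t1 w).
move=> t01 fw; split.
- move=> i x cx; split.
  move=> r V V1 V2 c1 c2 E E1 E2; rewrite /fiber_int.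
  have c B : continuous (fun t : R => pullback (fam_map Phi i) w (tjoin t x) B).
   exact: fiber_cont.
  rewrite -!intZ //.
  rewrite -intD; [|by move=> t; apply: cvgM; [exact: cvg_cst|exact: c]..].
  apply: eq_int => t _; have [am _] := fiber_ml i t x fw.
  exact: am E2.
 move=> V r s rs E; rewrite /fiber_int (@eq_int _ _ (fun=> 0)).
  by rewrite /Rintegral integral0.
 move=> t _; have [_ aa] := fiber_ml i t x fw; exact: aa E.
- move=> i V.
 exact: smooth_int
  (cod_open i) (fiber_smooth i _ fw).
- move=> i j x V ov; apply: eq_int => t _.
 have cx : cod i x by case: ov.
 pose U := [set z : 'rV[R]_(1 + m) | overlap i j (rsubmx z)].
 have oU : _ U := open_rsubmx (overlap_open i j).
 pose h (z : 'rV_(1 + m)) := tjoin (z 0 0) (transition i j (rsubmx z)).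
 have Uz : U (tjoin t x) by rewrite /U /= tjoinr.
 have sU : U `<=` fam_dom i by move=> z [].
 have hU z : U z -> fam_dom j (h z).
  move=> [_]; rewrite /fam_dom /= tjoinr; exact: chart_cod.
 have hs : smooth_mx U h.
  apply: smooth_tjoin => //; first exact: smooth_coord.
  apply: (smooth_mx_comp _ (overlap_open i j) _ (trans_smx i j)) => //.
  exact: smooth_rsubmx.
 have hE z : U z -> fam_map Phi i z = fam_map Phi j (h z).
  by move=> [_ dz]; rewrite /fam_map /h tjoin0 tjoinr chartK.
 have sF : smooth_to A U (fam_map Phi i) by exact: (smooth_to_sub _ (fam_open i)).
 rewrite (@pullback_ext _ _ _ _ _ U _ _ _ w _ _ oU sF hE Uz).
 rewrite (pullback_comp w _ oU (fam_open j) (Phs j) hs hU Uz).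
 rewrite /h (jac_time_mx V (overlap_open i j) (trans_smx i j)); last by rewrite tjoinr.
 by rewrite tjoin0 tjoinr.
Qed.

(** Homotopy formula. Evaluate d of the pullback on d/dt and the horizontal rows: the term
    differentiated along d/dt integrates to the difference of the slices, and the others are minus
    the terms of d of the fibre integral, differentiated under the integral sign. *)
Lemma fiber_int_d t0 t1 k (w : dform A k.+1) (dw : dform A k.+2) i x V : t0 <= t1 ->
 is_form w -> is_form dw -> form_eq (ext_d w) dw -> cod i x ->
 ext_d (fiber_int t0 t1 w) i x V =
 slice_form t1 w i x V - slice_form t0 w i x V - fiber_int t0 t1 dw i x V.
move=> t01 fw fdw wE cx.
pose P := pullback (fam_map Phi i) w.
have zc t : fam_dom i (tjoin t x) by rewrite /fam_dom /= tjoinr.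
have oF := fam_open i.
have Ps B : smooth_fun (fam_dom i) (fun z => P z B) by exact: pullback_smooth.
have DP B t v : is_dd x v (fun y => P (tjoin t y) B)
  (dd (tjoin 0 v) (fun z => P z B) (tjoin t x)).
 apply: is_dd_aff; first by move=> h; exact: tjoin_affine.
 exact: smooth_derivable.
have DT B t : is_deriv t (fun s => P (tjoin s x) B)
  (dd tvec (fun z => P z B) (tjoin t x)).
 apply: is_dd_aff.
  move=> h; rewrite /GRing.scale /= mulr1; exact: tjoin_line.
 exact: smooth_derivable.
have cD B v : continuous (fun t : R => dd v (fun z => P z B) (tjoin t x)).
 move=> t; apply: (@continuous_comp _ _ _ (fun => _) (fun z => dd v _ z)).
  apply: tjoin_cont; [exact: cvg_id|exact: cvg_cst].
 exact: smooth_cont (smooth_D v _) _.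
pose f (r : 'I_k.+1) t := (-1) ^+ r * dd (tjoin 0 (row r V)) (fun z => P z (col_mx tvec (hlift (row' r V)))) (tjoin t x).
have fc r : continuous (f r).
 move=> t; apply: cvgM; [exact: cvg_cst|exact: cD].
transitivity (\i[t0, t1] t, \sum_r f r t).
 rewrite int_sum // /ext_d; apply: eq_bigr => r _; rewrite /f intZ //; congr (_ _).
 have [_ ->] := smooth_int_is_derive (G := fun t x => P (_ t x) (col_mx tvec (hlift (row' r V))))
  (row r V) t01 (cod_open i) (fiber_smooth i _ fw) cx.
 by apply: eq_int => t; have [_] := DP (col_mx tvec (hlift (row' r V))) t (row r V).
have E t : \sum_r f r t = dd tvec (fun z => P z (hlift V)) (tjoin t x) -
  pullback (fam_map Phi i) dw (tjoin t x) (col_mx tvec (hlift V)).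
 rewrite -(extdE_pullback oF (Phs i) _ fw fdw wE (zc t)) /extdE.
 rewrite [X in - X]big_ord_recl /= mul1r.
 have -> : row 0 (col_mx tvec (hlift V) : 'M[R]__) = tvec.
  have -> : 0 = lshift k.+1 (0 : 'I_1) by apply: val_inj.
  by rewrite (@rowKu _ 1 k.+1) row_id.
 rewrite row'_col_mx0 opprD addrA subrr add0r -sumrN; apply: eq_bigr => r _.
 rewrite /f exprS mulN1r mulNr opprK; congr (_ _).
 have -> : lift 0 r = rshift 1 r :> 'I__ by apply: val_inj.
 by rewrite (@rowKd _ 1 k.+1) row_hlift row'_col_mxS row'_hlift.
rewrite (eq_int (fun t _ => E t)) intB; [|exact: cD|exact: fiber_cont].
congr (_ - _); rewrite (FTC2 t01 (cD _ _)).
by rewrite !slice_formE.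
Qed.

End FiberIntegral.

(** * Loops of symplectomorphisms as flows defined for all times *)

Section SymplecticLoops.
Context {R m M} {A : atlas R m M}.
Local Notation step := (@smooth_step R).

(** Both families live on all of R and are the identity before 0 and after 1, so that no one-sided
    derivatives occur and pieces glue smoothly. *)
Record flow_pair (w : dform A 2) (Psi Phi : R -> M -> M) : Prop := FlowPair {
 flow_smooth : smooth_family A Psi;
 inv_smooth : smooth_family A Phi;
 flowK : forall t, cancel (Psi t) (Phi t);
 flow_invK : forall t, cancel (Phi t) (Psi t);
 flow_symp : forall t, symplecto w (Psi t);
 flow0 : forall t, t <= 0 -> Psi t = id;
 flow1 : forall t, 1 <= t -> Psi t = id
}.

Lemma flow_inv0 (w : dform A 2) Psi Phi t : flow_pair w Psi Phi -> t <= 0 -> Phi t = id.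
by move=> F t0; apply/funext => x; have := flowK F t; rewrite (flow0 F). Qed.

Lemma flow_inv1 (w : dform A 2) Psi Phi t : flow_pair w Psi Phi -> 1 <= t -> Phi t = id.
by move=> F t0; apply/funext => x; have := flowK F t; rewrite (flow1 F). Qed.

Lemma symp_path_family (w : dform A 2) (psi : R -> M -> M) : smooth_symp_path w psi ->
 smooth_family A psi.
move=> [ps _] i.
pose L (z : 'rV[R]_(1 + m)) : (R^o * 'rV[R]_m)%type := (z 0 0, rsubmx z).
apply(@smooth_to_aff _ _ _ A (R^o * 'rV_m)%type _ L L _
 ([set: R^o] `*` cod i) (fun p => _ p.1 (_ p.2))).
- exact: fam_open.
- exact: open_setTX (cod_open i).
- by [].
- move=> z; apply: (@cvg_pair _ _ _ (nbhs z) (_ (z 0 0)) (nbhs (_ z))).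
  exact: coord_continuous.
 apply(smooth_mx_cont (U := [set: 'rV__])) => //; exact: smooth_rsubmx openT.
- by move=> h v x; rewrite /L !mxE linearP.
- exact: ps.
Qed.

Lemma inverse_choice (f : M -> M) : diffeo A f ->
 let g y := xget y [set x | f x = y] in cancel f g /\ cancel g f.
move=> [_ [g' [_ fK gK]]] g.
have gE y : g y = g' y.
 rewrite /g; apply: xget_unique => /=; first exact: gK.
 by move=> x <-; rewrite fK.
by split=> x; rewrite gE.
Qed.

(** [smooth_symp_path] makes [psi t] a symplectomorphism for t in [0, 1] only. Composition with the
    step keeps the time there and makes the flow stationary outside [0, 1]. *)
Lemma loop_flow (w : dform A 2) (psi : R -> M -> M) : closed_connected_manifold M ->
 Symp0_loop w psi ->
 flow_pair w (fun t => psi (step t)) (fun t y => xget y [set x | psi (step t) x = y]).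
move=> Mcl [ps _ p0 p1].
have st t : 0 <= step t <= 1 by rewrite step_ge0 step_le1.
have Pd t : diffeo A (psi (step t)) by have [_ /(_ _ (st t))[]] := ps.
have Pf := family_reparam (symp_path_family ps) step_smooth.
have PK t := inverse_choice (Pd t).
split => //.
- apply: (inverse_family Mcl _ _ _ Pf Pd).
 + exact: family_cont Pf.
 + by move=> t; have [] := PK t.
 + by move=> t; have [] := PK t.
- by move=> t; have [] := PK t.
- by move=> t; have [] := PK t.
- by move=> t; have [_ /(_ _ (st t))] := ps.
- by move=> t t0; rewrite step0.
- by move=> t t1; rewrite step1.
Qed.

Lemma tvec_solve (G B : 'M[R]_(1 + m, m)) :
 tjoin (@tvec R m 0 0) (@tvec R m *m G) *m B = rsubmx (@tvec R m) ->
 tjoin 0 (@tvec R m *m G) *m B = - (@tvec R m *m B).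
move: (_ *m G) => u; rewrite /tvec tjoin0 tjoinr => E.
have D : tjoin 1 u = tjoin 1 0 + tjoin 0 u :> 'rV__.
 by have := tjoin_lin 1 1 0 0 u; rewrite mulr1 addr0 scaler0 add0r scale1r.
rewrite D mulmxDl in E.
by apply/eqP; rewrite -addr_eq0 addrC E.
Qed.

Lemma setrow_col_mx k p (u : 'rV[R]_p) (V : 'M[R]_(k, p)) :
 col_mx u V = setrow (lshift k (0 : 'I_1)) u (col_mx 0 V).
apply/matrixP => a b; rewrite [RHS]mxE; case(splitP a) => a' aE.
 have -> : a = lshift k a' by apply: val_inj.
 by rewrite col_mxEu ord1.
have -> : a = rshift 1 a' by apply: val_inj.
by case: eqP => []; rewrite !col_mxEd.
Qed.

Lemma ml_col_scale k p (a : 'M[R]_(1 + k, p) -> R) c (u : 'rV[R]_p) (V : 'M[R]_(k, p)) :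
 multilinear a -> a (col_mx (c *: u) V) = c * a (col_mx u V).
move=> am; rewrite setrow_col_mx setrow_col_mx.
exact: ml_scale.
Qed.

Definition preserved k (a : dform A k) (f : M -> M) :=
 forall (i j : idx A) x V, cod i x -> Defs.dom j (f (param i x)) ->
 let g := chart j \o f \o param i in a i x V = a j (g x) (V *m jacobian g x).

Definition coord_fam (Psi : R -> M -> M) (j i : idx A) := chart i \o fam_map Psi j.
Definition coord_dom (Psi : R -> M -> M) (j i : idx A) :=
 fam_dom j `&` fam_map Psi j @^-1` Defs.dom i.

Section Flow.
Variables (w : dform A 2) (Psi Phi : R -> M -> M).
Hypothesis F : flow_pair w Psi Phi.
Hypothesis fw : is_form w.

Section Local.
Variables (i j : idx A) (t : R) (y x : 'rV[R]_m).
Hypotheses (cy : cod i y) (dj : Defs.dom j (Phi t (param i y))).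
Hypothesis xE : x = chart j (Phi t (param i y)).
Local Notation f := (coord_fam Psi j i).
Local Notation g := (coord_fam Phi i j).
Local Notation U := (coord_dom Psi j i).
Local Notation W := (coord_dom Phi i j).

Lemma flow_chart_open : open U /\ open W.
split.
 exact: smooth_to_open (fam_open j) (flow_smooth F j) (dom_open i).
exact: smooth_to_open (fam_open i) (inv_smooth F i) (dom_open j).
Qed.

Lemma flow_chart_smooth : smooth_mx U f /\ smooth_mx W g.
split; first by have [_ /(_ i)] := flow_smooth F j.
by have [_ /(_ j)] := inv_smooth F i.
Qed.

Lemma flow_chart_in : W (tjoin t y) /\ U (tjoin t x).
rewrite xE /coord_dom /fam_dom /fam_map; split; split=> /=; rewrite ?tjoin0 ?tjoinr //.
- exact: chart_cod.
- rewrite chartK // (flow_invK F); exact: param_dom.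
Qed.

Lemma flow_chartK z : W z -> U (tjoin (z 0 0) (g z)) /\ f (tjoin (z 0 0) (g z)) = rsubmx z.
move=> [cz dz]; rewrite /coord_fam /coord_dom /fam_dom /fam_map /= tjoin0 tjoinr.
rewrite chartK // (flow_invK F) paramK //; split => //.
split; [exact: chart_cod|exact: param_dom].
Qed.

(** The identity Psi_t (Phi_t y) = y is differentiated in time and space together; its two
    components are [flow_space] and [flow_time]. *)
Lemma flow_chart_jac : jacobian (fun z : 'rV[R]_(1 + m) => tjoin (z 0 0) (g z)) (tjoin t y) *m
 jacobian f (tjoin t x) = jacobian (@rsubmx R 1 1 m) (tjoin t y).
have [oU oW] := flow_chart_open; have [fs gs] := flow_chart_smooth.
have [Wy Ux] := flow_chart_in.
have hs : smooth_mx W (fun z : 'rV__ => tjoin (z 0 0) (g z)).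
 apply: smooth_tjoin => //; exact: smooth_coord.
have E := jac_comp oW oU hs fs (fun z Wz => proj1 (flow_chartK Wz)) Wy.
rewrite tjoin0 in E.
have -> : tjoin t x = tjoin t (g (tjoin t y)) by rewrite xE /coord_fam /= /fam_map tjoin0 tjoinr.
rewrite -E; apply: (jac_ext oW _ _ Wy).
 exact: (smooth_mx_comp _ _ (fun z _ => proj1 (flow_chartK _))).
by move=> z /flow_chartK[].
Qed.

Lemma mul_jac_rsubmx (z v : 'rV[R]_(1 + m)) : v *m jacobian (@rsubmx R 1 1 m) z = rsubmx v.
apply/rowP => l; rewrite -(derive_jacE openT (smooth_rsubmx openT) _ _ I).
rewrite (_ : (fun => _) = fun y : 'rV__ => y 0 (rshift 1 l)).
 by have [] := is_dd_coord z v (rshift 1 l); rewrite mxE.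
by apply/funext => y'; rewrite mxE.
Qed.

Lemma mul_jac_graph (v : 'rV[R]_(1 + m)) :
 v *m jacobian (fun z : 'rV[R]_(1 + m) => tjoin (z 0 0) (g z)) (tjoin t y) =
 tjoin (v 0 0) (v *m jacobian g (tjoin t y)).
have [oU oW] := flow_chart_open; have [fs gs] := flow_chart_smooth.
have [Wy Ux] := flow_chart_in.
have hs : smooth_mx W (fun z : 'rV__ => tjoin (z 0 0) (g z)).
 apply: smooth_tjoin => //; exact: smooth_coord.
apply/rowP => l; rewrite -(derive_jacE oW hs _ _ Wy).
case(splitP l) => l' lE.
 have -> : l = 0 by apply: val_inj; rewrite /= lE ord1.
 rewrite tjoin0 (_ : (fun => _) = fun y : 'rV_(1 + m) => y 0 0).
  by have [] := is_dd_coord (tjoin t y) v 0.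
 by apply/funext => z; rewrite tjoin0.
have -> : l = rshift 1 l' by apply: val_inj.
rewrite row_mxEr -(derive_jacE oW gs _ _ Wy).
have E : (fun z : 'rV_(1 + m) => tjoin (z 0 0) (g z) 0 (rshift 1 l')) = (fun z => g z 0 l').
 by apply/funext => z; rewrite row_mxEr.
by rewrite E.
Qed.

Lemma mul_jac_slice (u : 'rV[R]_m) :
 tjoin 0 u *m jacobian f (tjoin t x) = u *m jacobian (chart i \o Psi t \o param j) x.
have [oU oW] := flow_chart_open; have [fs gs] := flow_chart_smooth.
have [Wy Ux] := flow_chart_in.
have es : smooth_mx [set: 'rV_m] (tjoin t).
 apply: smooth_tjoin; [exact: openT|exact: smooth_cst openT|exact: smooth_mx_id openT].
pose N := [set: 'rV_m] `&` tjoin t @^-1` U.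
have oN : open N by exact: open_preim_mx openT _ _.
have es' : smooth_mx N (tjoin t) by apply: smooth_mx_sub es.
have Nx : N x by split.
have E := jac_comp oN oU es' fs (fun z Nz => proj2 Nz) Nx.
have <- : jacobian (f \o tjoin t) x = jacobian (chart i \o Psi t \o param j) x.
 congr (_ _ x); apply/funext => z.
 by rewrite /coord_fam /= /fam_map tjoin0 tjoinr.
rewrite E mulmxA; congr (_ *m _).
by have := jac_tjoin; rewrite /hlift /tjoin raddf0.
Qed.

Lemma flow_space (v : 'rV[R]_m) :
 tjoin 0 v *m jacobian g (tjoin t y) *m jacobian (chart i \o Psi t \o param j) x = v.
rewrite -mul_jac_slice.
have E := congr1 (mulmx (tjoin 0 v)) flow_chart_jac.
rewrite mul_jac_rsubmx tjoinr in E; apply: (etrans _ E).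
by rewrite mulmxA mul_jac_graph tjoin0.
Qed.

(** The velocity of the inverse flow, pushed forward by Psi_t, is the opposite of the velocity of
    the flow. *)
Lemma flow_time :
 tvec *m jacobian g (tjoin t y) *m jacobian (chart i \o Psi t \o param j) x =
 - (tvec *m jacobian f (tjoin t x)).
rewrite -mul_jac_slice.
have E := congr1 (mulmx tvec) flow_chart_jac.
rewrite mul_jac_rsubmx mulmxA mul_jac_graph in E.
exact: tvec_solve.
Qed.

Lemma flow_pull k (V : 'M[R]_(k, 1 + m)) (B : 'M[R]_(k, m)) (a : dform A k) : is_form a ->
 (forall x' V', cod j x' -> Defs.dom i (Psi t (param j x')) ->
  a j x' V' = a i ((chart i \o Psi t \o param j) x') (V' *m jacobian (chart i \o Psi t \o param j) x')) ->
 V *m jacobian g (tjoin t y) *m jacobian (chart i \o Psi t \o param j) x = B ->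
 pullback (fam_map Phi i) a (tjoin t y) V = a i y B.
move=> fa aP VB; have [[cw dw] _] := flow_chart_in.
rewrite (pullbackE (fam_open i) (inv_smooth F i) V fa cw dw).
have FE : fam_map Phi i (tjoin t y) = Phi t (param i y) by rewrite /fam_map tjoin0 tjoinr.
rewrite FE -xE -/(coord_fam _ i j) aP.
- rewrite VB xE /= chartK //; congr a.
 by rewrite (flow_invK F) paramK.
- rewrite xE; exact: chart_cod.
- rewrite xE chartK // (flow_invK F); exact: param_dom.
Qed.

Lemma slice_preserved k (a : dform A k) V : is_form a -> preserved a (Psi t) ->
 slice_form Phi t a i y V = a i y V.
move=> fa aP; rewrite (slice_formE (inv_smooth F)) //; apply: flow_pull => //.
 move=> V'; exact: aP.
apply/row_matrixP => r; rewrite !row_mul row_hlift; exact: flow_space.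
Qed.

(** Since Psi_t preserves [a], the pullback by Phi can be evaluated at the unmoved point [y] after
    pushing vectors forward by Psi_t. Horizontal vectors then return to themselves and d/dt becomes
    minus the velocity of Psi. *)
Lemma pull_time k (a : dform A k.+1) (V : 'M[R]_(k, m)) : is_form a -> preserved a (Psi t) ->
 pullback (fam_map Phi i) a (tjoin t y) (col_mx tvec (hlift V)) =
 - a i y (col_mx (tvec *m jacobian f (tjoin t x)) V).
move=> fa aP.
rewrite (@flow_pull _ _ (col_mx (- (tvec *m jacobian f (tjoin t x))) V)); last 3 first.
- exact: fa.
- move=> V'; exact: aP.
- rewrite !mul_col_mx flow_time; congr col_mx.
 apply/row_matrixP => r; rewrite !row_mul row_hlift; exact: flow_space.
by rewrite -scaleN1r (ml_col_scale _ _ _ (form_ml fa cy)) mulN1r.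
Qed.

End Local.
End Flow.
End SymplecticLoops.


(** * The flux form as a fibre integral *)

Section Flux.
Context {R m M} {A : atlas R m M}.
Local Notation step := (@smooth_step R).

Lemma continuous_sum_at (T : topologicalType) (I : Type) (r : seq I) (f : I -> T -> R) x :
 (forall i, {for x, continuous (f i)}) -> {for x, continuous (fun y => \sum_(i <- r) f i y)}.
move=> fc; elim: r => [|i r IH].
 rewrite (_ : (fun y => _) = fun=> 0); first exact: cvg_cst.
 by apply/funext => y; rewrite big_nil.
rewrite (_ : (fun y => _) = fun y => f i y + \sum_(j <- r) f j y).
 apply: cvgD; [exact: fc|exact: IH].
by apply/funext => y; rewrite big_cons.
Qed.

(** The primitive starts at [c], strictly below the values of [f], and is therefore differentiable
    at both ends of the range. *)
Lemma int_subst (f df g : R -> R) a b c : a <= b -> continuous g -> continuous df ->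
 (forall t : R, is_deriv t f (df t)) ->
 (forall t, a <= t <= b -> c < f t) -> f a <= f b ->
 \i[a, b] t, (df t * g (f t)) = \i[f a, f b] t, g t.
move=> ab gc dfc fd cf fab.
have fc : continuous f.
 move=> t; have [+ _] := fd t => /derivable1_diffP; exact: differentiable_continuous.
pose P x := \i[c, x] t, g t.
have [ca cb] : c < f a /\ c < f b by split; apply: cf; rewrite ?lexx ?ab.
have ic : continuous (fun t => df t * g (f t)).
 move=> t; apply: cvgM; [exact: dfc|exact: continuous_comp (fc t) (gc _)].
have Pd t : a <= t <= b -> is_deriv t (P \o f) (df t * g (f t)).
 move=> tab; have Pd := FTC1 gc (cf t tab).
 by have := @is_derive1_comp R P f t _ _ Pd (fd t); rewrite mulrC.
have Pd' t : f a <= t <= f b -> is_deriv t P (g t).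
 move=> /andP[at_ _]; exact: FTC1 (lt_le_trans ca _).
by rewrite (FTC2 ab ic) FTC2.
Qed.

Lemma family_derive (Psi : R -> M -> M) (i j : idx A) t x : smooth_family A Psi ->
 Defs.dom j x -> Defs.dom i (Psi t x) ->
 (forall l, is_dd (t : R^o) (1 : R^o) (fun s : R^o => chart i (Psi s x) 0 l)
   ((tvec *m jacobian (coord_fam Psi j i) (tjoin t (chart j x))) 0 l)) /\
 derive1 (fun s => chart i (Psi s x)) t =
   tvec *m jacobian (coord_fam Psi j i) (tjoin t (chart j x)).
move=> Ps dj di; set J := jacobian _ _.
have oU := smooth_to_open (fam_open j) (Ps j) (dom_open i).
have fs : smooth_mx (coord_dom Psi j i) (coord_fam Psi j i) by have [_ /(_ i)] := Ps j.
have Ut : coord_dom Psi j i (tjoin t (chart j x)).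
 by split; rewrite /fam_dom /fam_map /= ?tjoin0 tjoinr; [exact: chart_cod|rewrite chartK].
have D l : is_dd t 1 (fun s : R^o => chart i (Psi s x) 0 l) ((tvec *m J) 0 l).
 have [dJ vJ] := is_derive_jac oU fs tvec l Ut.
 have := @is_dd_aff R _ R (fun s => _ _) (fun z => coord_fam Psi j i z 0 l) t _ 1 _ dJ.
 rewrite vJ (_ : (fun z => coord_fam _ j i z 0 l) \o _ = fun s => chart i (Psi s x) 0 l); last first.
  by apply/funext => s; rewrite /coord_fam /= /fam_map tjoin0 tjoinr chartK.
 apply=> h; rewrite /GRing.scale /= mulr1; exact: tjoin_line.
split; first exact: D.
have Dm : derivable (fun s : R^o => chart i (Psi s x)) t 1.
 by apply/derivable_mxP => l; rewrite ord1.
rewrite derive1E (derive_mx Dm); apply/rowP => l; rewrite mxE.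
by have [] := D l.
Qed.

(** [psi] is uncontrolled outside [0, 1]. Clamping time extends the flux density to a continuous
    function on R, as the integration lemmas require. *)
Definition clamp (t : R) : R := Num.max 0 (Num.min t 1).

Lemma clamp_itv t : 0 <= clamp t <= 1.
by rewrite /clamp le_max lexx ge_max ler01 ge_min lexx orbT. Qed.

Lemma clamp_id t : 0 <= t <= 1 -> clamp t = t.
by move=> /andP[t0 t1]; rewrite /clamp (min_idPl t1) (max_idPr _). Qed.

Lemma clamp_continuous : continuous clamp.
move=> t; apply@continuous_max; first exact: cvg_cst.
apply@continuous_min; [exact: cvg_id|exact: cvg_cst].
Qed.

Variables (w : dform A 2) (psi : R -> M -> M).
Hypotheses (Mcl : closed_connected_manifold M) (fw : is_form w).
Hypothesis psi_loop : Symp0_loop w psi.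

Lemma ps : smooth_family A psi.
by case: psi_loop => /symp_path_family. Qed.

Let inv (s : R) y := xget y [set z | psi s z = y].

Lemma invK s : 0 <= s <= 1 -> cancel (psi s) (inv s) /\ cancel (inv s) (psi s).
move=> s01; case: psi_loop => -[_ /(_ s s01)[pd _]] _ _ _; exact: inverse_choice pd.
Qed.

Lemma inv_clamp_continuous y : continuous (fun s => inv (clamp s) y).
have Pc : continuous (fun p : R * M => psi (clamp p.1) p.2).
 move=> p; apply(@continuous_comp _ _ _ (fun p : R * M => (clamp p.1, p.2)) (fun p => _ p.1 p.2)).
  apply: (@cvg_pair _ _ _ (nbhs p) (nbhs (_ p.1))); last exact: cvg_snd.
  by apply: (@continuous_comp _ _ _ fst clamp); [exact: cvg_fst|exact: clamp_continuous].
 exact: family_cont ps _.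
have IC : continuous (fun p : R * M => inv (clamp p.1) p.2).
 apply: (@inverse_continuous _ _ (fun s => psi (_ s)) (fun => _ _) Mcl Pc).
  by move=> t; have [] := invK (clamp_itv t).
 by move=> t; have [] := invK (clamp_itv t).
move=> s; apply: (@continuous_comp _ _ _ (fun s => (s, y)) (fun p => _ (_ p.1) p.2)); last exact: IC.
exact: cvg_pair cvg_id (cvg_cst y).
Qed.

Let flux_density i y v s := w i y (col_mx (generator psi (clamp s) i y) v).

Lemma generatorE (i j : idx A) y s : cod i y -> 0 <= s <= 1 -> Defs.dom j (inv s (param i y)) ->
 generator psi s i y =
 tvec *m jacobian (coord_fam psi j i) (tjoin s (chart j (inv s (param i y)))).
move=> cy s01 dj; have [_ K] := invK s01.
have di : Defs.dom i (psi s (inv s (param i y))) by rewrite K; exact: param_dom.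
by have [] := family_derive ps dj di.
Qed.

(** The preimage of the point under [psi s] moves continuously, so near [s0] it stays in one chart;
    there the generator is the Jacobian of the family at a continuous argument. *)
Lemma flux_density_continuous i y v : cod i y -> continuous (flux_density i y v).
move=> cy s0; set z0 := inv (clamp s0) (param i y); set j := chart_at A z0.
have N : \forall s \near s0, Defs.dom j (inv (clamp s) (param i y)).
 have : nbhs z0 (Defs.dom j) by apply: open_nbhs_nbhs; split; [exact: dom_open|exact: chart_at_dom].
 exact: inv_clamp_continuous.
pose J s := tvec *m jacobian (coord_fam psi j i) (tjoin (clamp s) (chart j (inv (clamp s) (param i y)))).
have E : \forall s \near s0, w i y (col_mx (J s) v) = flux_density i y v s.
 by apply: filterS N => s dj; rewrite /flux_density (generatorE _ (clamp_itv s) dj).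
have oU := smooth_to_open (fam_open j) (ps j) (dom_open i).
have fs : smooth_mx (coord_dom psi j i) (coord_fam psi j i) by have [_ /(_ i)] := ps j.
have d0 : Defs.dom j z0 by exact: chart_at_dom.
have Ut : coord_dom psi j i (tjoin (clamp s0) (chart j z0)).
 split; rewrite /fam_dom /fam_map /= ?tjoin0 tjoinr; first exact: chart_cod.
 rewrite chartK // /z0 (proj2 (invK (clamp_itv _))); exact: param_dom.
have Tc : {for s0, continuous (fun s => tjoin (clamp s) (chart j (inv (clamp s) (param i y))))}.
 apply: tjoin_cont; first exact: clamp_continuous.
 apply: (@continuous_comp _ _ _ (fun s => _)).
  exact: inv_clamp_continuous.
 exact: chart_continuous.
have Jc l : {for s0, continuous (fun s => J s 0 l)}.
 have Ss : smooth_mx (coord_dom psi j i) (fun z => tvec *m jacobian (coord_fam psi j i) z).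
  apply(smooth_mulmx oU); [exact: smooth_mx_cst|exact: smooth_jac].
 apply: (@continuous_comp _ _ _ _
  (fun z => (tvec *m _ z) 0 l)); first exact: Tc.
 exact: smooth_cont.
have Wc : {for s0, continuous (fun s => w i y (col_mx (J s) v))}.
 rewrite (_ : (fun s => _) = fun s => \sum_l J s 0 l * w i y (col_mx (delta_mx 0 l : 'rV_m) v)).
  apply: continuous_sum_at => l; apply: cvgM; [exact: Jc|exact: cvg_cst].
 apply/funext => s; rewrite setrow_col_mx (ml_expand (form_ml fw cy)).
 by apply: eq_bigr => l; rewrite -setrow_col_mx.
rewrite /prop_for /continuous_at.
have E0 : w i y (col_mx (J s0) v) = flux_density i y v s0 by exact: nbhs_singleton E.
rewrite -E0; apply: cvg_trans Wc; apply: near_eq_cvg.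
exact: E.
Qed.

(** Substitute [step t] for the time of [psi]: the velocity of the reparametrized flow is the
    derivative of the step times the generator at time [step t], and [pull_time] contributes the
    sign. *)
Lemma flux_fiber i y v : cod i y ->
 flux_form w psi i y v =
 - fiber_int (fun t y => xget y [set x | psi (step t) x = y]) 0 1 w i y v.
move=> cy; set Phi := fun t => _.
have F := loop_flow Mcl psi_loop.
have st t : 0 <= step t <= 1 by rewrite step_ge0 step_le1.
have sd t : is_deriv t step (deriv1 step t).
 exact: smooth_dd step_smooth I.
have dsc : continuous (fun t => deriv1 step t).
 move=> t; have := smooth_D (1 : R^o) step_smooth.
 by move/(_ 0); apply.
have gc := @flux_density_continuous i y v cy.
have ic : continuous (fun t => deriv1 step t * flux_density i y v (step t)).
 move=> t; apply: cvgM; first exact: dsc.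
 apply: continuous_comp; last exact: gc.
 exact: smooth_cont step_smooth I.
transitivity (\i[0, 1] t, flux_density i y v t).
 by apply: eq_int => t t01; rewrite /flux_density clamp_id.
have s0 : step 0 = 0 by rewrite step0.
have s1 : step 1 = 1 by rewrite step1.
have sN t : 0 <= t <= 1 -> -1 < step t.
 move=> _; rewrite (lt_le_trans _ (step_ge0 t)) //.
have s01 : step 0 <= step 1 by rewrite s0 s1.
have := int_subst ler01 gc dsc sd sN s01; rewrite s0 s1 => <-.
rewrite -[LHS]opprK -intN //; congr (- _); apply: eq_int => t _.
set j := chart_at A (Phi t (param i y)).
have dj : Defs.dom j (Phi t (param i y)) by exact: chart_at_dom.
rewrite (pull_time F cy dj erefl v fw (proj2 (flow_symp F t))); congr (- _).
rewrite -(ml_col_scale _ _ _ (form_ml fw cy)) /flux_density (clamp_id (st t)).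
have H (u u' : 'rV_m) : u = u' -> w i y (col_mx u v) = w i y (col_mx u' v) by move->.
apply: H.
have di : Defs.dom i (psi (step t) (Phi t (param i y))) by rewrite (flow_invK F); exact: param_dom.
have [D1 _] := family_derive ps dj di.
have [D2 _] := family_derive (flow_smooth F) dj di.
have cst01 : 0 <= step t <= 1 by exact: st.
rewrite (generatorE cy (st t) dj); apply/rowP => l; rewrite mxE.
have [_ e2] := D2 l.
have [_ e1] := @is_derive1_comp R (fun s => chart i _ 0 l) _ t _ _ (D1 l).
exact: etrans (etrans (mulrC _ _) _) e2.
Qed.

End Flux.

(** * Flat smooth paths, concatenation and coordinate cells *)

Section Paths.
Context {R m M} {A : atlas R m M}.
Local Notation step := (@smooth_step R).

(** The two maps agree on the slab a < c < d around the cut at [b], so that near each point the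
    result is one of them. *)
Lemma smooth_glue (V : normedModType R) (f g : V -> M) (c : V -> R) a b d :
 continuous c -> a < b < d -> smooth_to A setT f -> smooth_to A setT g ->
 (forall z, a < c z < d -> f z = g z) ->
 smooth_to A setT (fun z => if c z <= b then f z else g z).
move=> cc /andP[ab bd] fs gs fg.
have oT : open [set: V] := openT.
have oW1 : open [set z | c z < d] by rewrite -[X in _ X]setTI; apply(open_preim openT (@open_lt R d)) => z _; exact: cc.
have oW2 : open [set z | a < c z] by rewrite -[X in _ X]setTI; apply(open_preim openT (@open_gt R a)) => z _; exact: cc.
apply: smooth_to_local => // x _; have [xd|xd] := ltP (c x) d.
 exists [set z | c z < d]; split => //.
 apply: (smooth_to_ext oW1 _ (smooth_to_sub oW1 oT (fun _ _ => I) fs)) => z zd.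
 by case: leP => // zb; rewrite fg // (lt_trans ab).
exists [set z | a < c z]; split => //=; first by rewrite (lt_le_trans (lt_trans _ bd)).
apply: (smooth_to_ext oW2 _ (smooth_to_sub oW2 oT (fun _ _ => I) gs)) => z za.
by case: leP => // zb; rewrite fg // za (le_lt_trans zb).
Qed.

(** The three paths run in the windows [0, 1/5], [2/5, 3/5] and [4/5, 1] and rest in between; the
    cuts 3/10 and 7/10 are the middles of the gaps, where both neighbours are constant. *)
Definition cat3 (p q r : R -> M) (t : R) : M :=
 if t <= 3 / 10 then p (5 * t)
 else if t <= 7 / 10 then q (5 * t - 2) else r (5 * t - 4).

Definition flat (p : R -> M) : Prop :=
 (forall t, t <= 0 -> p t = p 0) /\ (forall t, 1 <= t -> p t = p 1).

Section Cat3.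
Variables p q r : R -> M.
Hypotheses (pf : flat p) (qf : flat q) (rf : flat r) (pq : p 1 = q 0) (qr : q 1 = r 0).

Lemma cat3_1 t : t < 2 / 5 -> cat3 p q r t = p (5 * t).
move=> t1; rewrite /cat3; case: leP => // t2.
rewrite ifT; last lra.
rewrite (proj2 pf) ?(proj1 qf) //; lra.
Qed.

Lemma cat3_2 t : 1 / 5 < t < 4 / 5 -> cat3 p q r t = q (5 * t - 2).
move=> /andP[t1 t1']; rewrite /cat3; case: leP => t2.
 rewrite (proj2 pf) ?(proj1 qf) //; lra.
case: leP => // t3.
rewrite (proj2 qf) ?(proj1 rf) //; lra.
Qed.

Lemma cat3_3 t : 3 / 5 < t -> cat3 p q r t = r (5 * t - 4).
move=> t1; rewrite /cat3; rewrite leNgt (lt_trans _ t1) /=; last lra.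
case: leP => // t3.
rewrite (proj2 qf) ?(proj1 rf) //; lra.
Qed.

Lemma cat3_flat : flat (cat3 p q r).
split=> t t0.
 rewrite !cat3_1 ?mulr0; [apply(pf)| |]; lra.
rewrite !cat3_3; [|lra|lra].
rewrite ?(proj2 rf) //; lra.
Qed.

Lemma cat3_0 : cat3 p q r 0 = p 0.
rewrite cat3_1 ?mulr0 //. Qed.

Lemma cat3_end : cat3 p q r 1 = r 1.
rewrite cat3_3; [congr r|]; lra. Qed.

Lemma cat3_in (W : set M) : (forall t, W (p t)) -> (forall t, W (q t)) -> (forall t, W (r t)) ->
 forall t, W (cat3 p q r t).
by move=> Wp Wq Wr t; rewrite /cat3; case: ifP => //; case: ifP. Qed.

End Cat3.

Lemma smooth_cat3 (V : normedModType R) (p q r : V -> R -> M) (c : V -> R) :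
 continuous c ->
 (forall z, flat (p z)) -> (forall z, flat (q z)) -> (forall z, flat (r z)) ->
 (forall z, p z 1 = q z 0) -> (forall z, q z 1 = r z 0) ->
 smooth_to A setT (fun z => p z (5 * c z)) ->
 smooth_to A setT (fun z => q z (5 * c z - 2)) ->
 smooth_to A setT (fun z => r z (5 * c z - 4)) ->
 smooth_to A setT (fun z => cat3 (p z) (q z) (r z) (c z)).
move=> cc pf qf rf pq qr ps qs rs; rewrite /cat3.
apply: (@smooth_glue V _ _ c (1 / 5) _ (2 / 5)) => //; first by lra.
 apply: (@smooth_glue V _ _ c (3 / 5) _ (4 / 5)) => //; first by lra.
 move=> z /andP[z1 z2]; rewrite (proj2 (qf z)); last lra.
 rewrite (proj1 (rf z)) //; lra.
move=> z /andP[z1 z2]; rewrite ifT; last lra.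
rewrite (proj2 (pf z)); last lra.
rewrite (proj1 (qf z)) //; lra.
Qed.

Definition curve (p : R -> M) : 'rV[R]_1 -> M := fun z => p (z 0 0).

Definition smooth_path (p : R -> M) : Prop := smooth_to A setT (curve p) /\ flat p.

Lemma scalar_smooth (V : normedModType R) (U : set V) (f : V -> R) : smooth_fun U f ->
 smooth_mx U (fun x => (f x)%:M : 'rV[R]_1).
move=> fs i j; rewrite !ord1.
by rewrite (_ : (fun => _) = f) //; apply/funext => x; rewrite mxE.
Qed.

Lemma curve_comp (V : normedModType R) (U : set V) (p : R -> M) (f : V -> R) : open U ->
 smooth_to A setT (curve p) -> smooth_fun U f -> smooth_to A U (fun z => p (f z)).
move=> oU ps fs.
have := @smooth_to_comp _ _ _ A 1 V U _ _ _ oU openT (fun _ _ => I) ps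
 (scalar_smooth fs).
by congr (_ _); apply/funext => z; rewrite /curve mxE.
Qed.

Lemma smooth_affine1 (V : normedModType R) (U : set V) (f : V -> R) (a b : R) : open U ->
 smooth_fun U f -> smooth_fun U (fun z => a * f z + b).
move=> oU fs; apply: smoothD => //; last exact: smooth_cst.
apply: smoothM => //; exact: smooth_cst.
Qed.

Lemma cat3_smooth p q r : smooth_path p -> smooth_path q -> smooth_path r ->
 p 1 = q 0 -> q 1 = r 0 -> smooth_path (cat3 p q r).
move=> [ps pf] [qs qf] [rs rf] pq qr; split; last exact: cat3_flat.
have cs : smooth_fun [set: 'rV[R]_1] (fun z => z 0 0) by exact: smooth_coord openT.
apply(@smooth_cat3 _ _ _ _ (fun z : 'rV_1 => z 0 0)) => //.
- exact: coord_continuous.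
- have := smooth_affine1 5 0 openT cs => /(curve_comp openT ps).
 by congr smooth_to; apply/funext => z; rewrite addr0.
- exact: curve_comp openT _ (smooth_affine1 5 _ openT _).
- exact: curve_comp openT _ (smooth_affine1 5 _ openT _).
Qed.

Definition rev (p : R -> M) (t : R) : M := p (1 - t).

Lemma rev_flat p : flat p -> flat (rev p).
move=> [p0 p1]; split=> t t0; rewrite /rev ?subr0 ?subrr; first by apply: p1; lra.
apply: p0; lra.
Qed.

Lemma rev_smooth p : smooth_path p -> smooth_path (rev p).
move=> [ps pf]; split; last exact: rev_flat.
have cs : smooth_fun [set: 'rV[R]_1] (fun z => z 0 0) by exact: smooth_coord openT.
have := smooth_affine1 (-1) 1 openT cs => /(curve_comp openT ps).
by congr smooth_to; apply/funext => z; rewrite /curve /rev mulN1r addrC.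
Qed.

Lemma cst_smooth x : smooth_path (fun=> x).
by split; [exact: smooth_to_cst openT|]. Qed.

(** Among the points of [W], those related to [x] and those not related to [x] both form open sets,
    because nearby points are related in both directions; connectedness of [K] excludes a split. The
    lemma serves for joining points by paths and again for moving top forms. *)
Lemma connected_rel (T : topologicalType) (K W : set T) (Rl : T -> T -> Prop) :
 connected K -> K `<=` W ->
 (forall x, W x -> exists U, [/\ open U, U x, U `<=` W & forall y, U y -> Rl x y /\ Rl y x]) ->
 (forall x y z, W x -> W y -> W z -> Rl x y -> Rl y z -> Rl x z) ->
 forall x y, K x -> K y -> Rl x y.
move=> Kc KW Ul Rt x y Kx Ky.
have op P : (forall z, W z /\ P z -> exists U, [/\ open U, U z & U `<=` W `&` P]) ->
  open (W `&` P).
 move=> H; rewrite openE => z /H[U [oU Uz UP]]; rewrite /interior.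
 apply(filterS UP); exact: open_nbhs_nbhs.
have o1 : open (W `&` Rl x).
 apply: op => z [Wz xz]; have [U [oU Uz UW UR]] := Ul z Wz; exists U; split => // z' Uz'.
 split; first exact: UW.
 by apply: (Rt x z z' (KW _ Kx) Wz (UW _ Uz') xz); have [] := UR _ Uz'.
have o2 : open (W `&` [set z | ~ Rl x z]).
 apply: op => z [Wz xz]; have [U [oU Uz UW UR]] := Ul z Wz; exists U; split => // z' Uz'.
 split; first exact: UW.
 move=> xz'; apply: xz; apply(Rt x _ z (KW _ Kx) (UW _ Uz') Wz xz').
 by have [] := UR _ Uz'.
have KE : K `&` (W `&` Rl x) = K.
 apply: Kc.
 - exists x; split => //; split; first exact: KW.
  by have [U [_ Ux _ UR]] := Ul x (KW _ Kx); have [] := UR _ Ux.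
 - by exists (W `&` Rl x).
 - exists (~` (W `&` [set z | ~ Rl x z])); first exact: open_closedC.
  apply/seteqP; split=> z [Kz H]; split => //.
   by move=> []; case: H.
  split; first exact: KW.
  apply: contrapT => xz; apply: H; split => //; exact: KW.
by have : K y by []; rewrite -KE => -[_ []].
Qed.

(** The norm on row vectors is the maximum norm, so cells are coordinate cubes; the Poincare lemmas
    for boxes depend on this. *)
Definition cell (i : idx A) (c : 'rV[R]_m) (r : R) : set M :=
 [set x | Defs.dom i x /\ `|chart i x - c| < r].

Definition good_cell (i : idx A) (c : 'rV[R]_m) (r : R) : Prop :=
 forall y, `|y - c| < r -> cod i y.

Lemma cell_open i c r : open (cell i c r).
have -> : cell i c r = Defs.dom i `&` chart i @^-1` [set y | `|y - c| < r] by [].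
apply: open_preim; [exact: dom_open| |exact: chart_continuous].
have -> : [set y : 'rV_m | `|y - c| < r] = ball c r.
 by apply/seteqP; split=> y; rewrite -ball_normE //= distrC.
exact: ball_open.
Qed.

Lemma cell_param i c r y : good_cell i c r -> `|y - c| < r -> cell i c r (param i y).
move=> g yr; have cy := g y yr.
by split; [exact: param_dom|rewrite paramK].
Qed.

Lemma cell_ex (W : set M) x i : open W -> W x -> Defs.dom i x -> exists2 r, 0 < r &
 good_cell i (chart i x) r /\ cell i (chart i x) r `<=` W.
move=> oW Wx dx; set c := _ x.
have cc : cod i c by exact: chart_cod.
have o : open (cod i `&` param i @^-1` W).
 apply: open_preim => //; [exact: cod_open|move=> y; exact: param_continuous].
have : nbhs c (cod i `&` param i @^-1` W).
 by apply: open_nbhs_nbhs; split => //; rewrite /= chartK.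
rewrite -nbhs_ballE => -[r /= r0 rB]; exists r => //.
have B y : `|y - c| < r -> ball c r y by rewrite -ball_normE distrC.
split=> [y /B/rB[]//|z [dz /B/rB[_]]] /=.
by rewrite chartK.
Qed.

Lemma ball_convex (c y z : 'rV[R]_m) r t : 0 <= t <= 1 -> `|y - c| < r -> `|z - c| < r ->
 `|y + t *: (z - y) - c| < r.
move=> /andP[t0 t1] yr zr.
have -> : y + t *: (z - y) - c = (1 - t) *: (y - c) + t *: (z - c).
 apply/rowP => l; rewrite !mxE; ring.
rewrite (le_lt_trans (ler_normD _ _)) // !normrZ (ger0_norm t0) ger0_norm; last lra.
have [->|tn] := eqVneq t 0; first by rewrite subr0 mul1r mul0r addr0.
have : t * `|z - c| < t * r by rewrite ltr_pM2l // lt_def tn.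
have : (1 - t) * `|y - c| <= (1 - t) * r by rewrite ler_wpM2l ?subr_ge0 // ltW.
lra.
Qed.

Definition segment (i : idx A) (y z : 'rV[R]_m) (t : R) : M :=
 param i (y + step t *: (z - y)).

Lemma step_itv t : 0 <= step t <= 1.
by rewrite step_ge0 step_le1. Qed.

Lemma segment_in i c r y z t : good_cell i c r -> `|y - c| < r -> `|z - c| < r ->
 cell i c r (segment i y z t).
move=> g yr zr; apply: cell_param => //; apply: ball_convex => //; exact: step_itv. Qed.

Lemma segment_smooth (i : idx A) c r y z : good_cell i c r -> `|y - c| < r -> `|z - c| < r ->
 smooth_path (segment i y z).
move=> g yr zr; split; last first.
 split=> t t0; rewrite /segment; first by rewrite !step0.
 by rewrite !step1.
apply: (smooth_to_comp openT (cod_open i) _ (smooth_to_param i)).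
 move=> t _; apply: g; apply: ball_convex => //; exact: step_itv.
move=> k l; rewrite ord1.
apply(@smooth_ext _ _ _ (fun x : 'rV_1 => (z - y) 0 l * step (x 0 0) + y 0 l)).
- exact: openT.
- move=> x _; rewrite !mxE; ring.
apply: smooth_affine1; first exact: openT.
apply(smooth_comp1 openT openT (fun _ _ => I) step_smooth).
exact: smooth_coord openT.
Qed.

Lemma segment0 i y z : segment i y z 0 = param i y.
by rewrite /segment step0 // scale0r addr0. Qed.

Lemma segment1 i y z : segment i y z 1 = param i z.
by rewrite /segment step1 // scale1r addrC subrK. Qed.

Definition joined (W : set M) (x y : M) : Prop :=
 exists p, [/\ smooth_path p, p 0 = x, p 1 = y & forall t, W (p t)].

Lemma joined_trans W x y z : joined W x y -> joined W y z -> joined W x z.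
move=> [p [ps p0 p1 pW]] [q [qs q0 q1 qW]].
have [z1 z2] := (proj2 ps, proj2 qs).
exists (cat3 p q (fun=> z)); split.
- by apply: cat3_smooth => //; [exact: cst_smooth|rewrite p1].
- by rewrite cat3_0 // p1.
- by rewrite cat3_end.
- by apply: cat3_in => //; rewrite -q1.
Qed.

Lemma joined_cell i c r x y : good_cell i c r -> cell i c r x -> cell i c r y ->
 joined (cell i c r) x y.
move=> g [dx xr] [dy yr]; exists (segment i (chart i x) (chart i y)); split.
- exact: segment_smooth yr.
- by rewrite segment0 chartK.
- by rewrite segment1 chartK.
- move=> t; exact: segment_in.
Qed.

Lemma joined_connected (K W : set M) x y : connected K -> open W -> K `<=` W -> K x -> K y ->
 joined W x y.
move=> Kc oW KW; apply(connected_rel (W := W)) => //.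
 move=> z Wz; have [r r0 [g rW]] := cell_ex oW Wz (chart_at_dom A z).
 set i := _ z in g rW; set c := _ z in g rW.
 have cz : cell i c r z by split; [exact: chart_at_dom|rewrite subrr normr0].
 have J u v : cell i c r u -> cell i c r v -> joined W u v.
  move=> cu cv; have [p [ps p0 p1 pW]] := joined_cell g cu cv.
  exists p; split => // t; exact: rW.
 exists (cell i c r); split => //; [exact: cell_open|move=> v; split; exact: J].
move=> u v t _ _ _; exact: joined_trans.
Qed.

End Paths.

Arguments smooth_path {R m M} A p.

(** * Line integrals, and exactness of 1-forms without periods *)

Section LineIntegral.
Context {R m M} {A : atlas R m M}.
Local Notation step := (@smooth_step R).

Lemma int_window (a : R -> R) l r : continuous a -> (forall t, t <= 0 \/ 1 <= t -> a t = 0) ->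
 l <= 0 -> 1 <= r -> \i[l, r] t, a t = \i[0, 1] t, a t.
move=> ac a0 l0 r1; pose P x := \int[mu]_(t in `[l - 1, x]) a t.
have Pd t : l <= t -> is_deriv t P (a t).
 by move=> lt; apply: FTC1 ac _; rewrite ltrBlDr ltr_pwDr.
have E x y : l <= x -> x <= y -> \i[x, y] t, a t = P y - P x.
 move=> lx xy; apply(FTC2 xy ac) => t /andP[xt _]; apply: Pd; exact: le_trans xt.
have Z x y : x <= y -> y <= 0 \/ 1 <= x -> \i[x, y] t, a t = 0.
 move=> xy H; rewrite (@eq_int _ _ (fun=> 0)); first by rewrite /Rintegral integral0.
 move=> t /andP[xt ty]; apply: a0; case: H => H; [left|right]; [exact: le_trans H|exact: le_trans xt].
have := Z l 0 l0 (or_introl (lexx _)); have := Z 1 r r1 (or_intror (lexx _)).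
rewrite !E; lra.
Qed.

Lemma int_rev (f : R -> R) : continuous f ->
 \i[0, 1] t, f (1 - t) = \i[0, 1] t, f t.
move=> fc; pose P x := \int[mu]_(t in `[-1, x]) f t.
have Pd t : -1 < t -> is_deriv t P (f t) by exact: FTC1.
have c1 : continuous (fun t : R => f (1 - t)).
 move=> t; apply(continuous_comp); last exact: fc.
 apply: cvgB; [exact: cvg_cst|exact: cvg_id].
have D t : 0 <= t <= 1 -> is_deriv t (fun t : R => - P (1 - t)) (f (1 - t)).
 move=> /andP[t0 t1].
 have d1 : is_dd t 1 (fun t : R^o => 1 - t) (-1).
  have idd : is_derive t 1 (fun t => t) 1 by exact: is_derive_id.
  have cd' : is_deriv t (cst 1) 0 by exact: is_derive_cst.
  by have := is_deriveB cd' idd; rewrite sub0r.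
 have Pd' : is_deriv (1 - t) P (f (1 - t)) by apply: Pd; lra.
 have := is_deriveN (@is_derive1_comp R P (fun t => 1 - t) t _ _ Pd' d1).
 by rewrite mulrN1 opprK.
have Pd01 t : 0 <= t <= 1 -> is_deriv t P (f t).
 move=> /andP[t0 _]; apply: Pd; lra.
by rewrite (FTC2 ler01 c1) (FTC2 ler01 fc) subrr subr0 opprK addrC.
Qed.

(** The conditions on [c] and [d] say that t |-> c t + d maps [0, 1] onto an interval containing
    [0, 1], the only place where [a] may be nonzero. *)
Lemma affine_window (a : R -> R) (c d : R) : continuous a -> (forall t, t <= 0 \/ 1 <= t -> a t = 0) ->
 0 <= c -> d <= 0 -> 1 <= c + d ->
 \i[0, 1] t, (c * a (c * t + d)) = \i[0, 1] t, a t.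
move=> ac a0 c0 d0 cd.
have fd (t : R) : is_deriv t (fun t : R => c * t + d) c.
 have := @smooth_dd R R^o setT (fun t => c * t + d) t 1.
 have idd : is_derive t 1 (fun t => t) 1 by exact: is_derive_id.
 have cd' : is_deriv t (cst d) 0 by exact: is_derive_cst.
 have := is_deriveD (is_deriveZ c idd) cd'.
 by rewrite addr0 /GRing.scale /= mulr1.
have cc : continuous (fun _ : R => c) by move=> t; exact: cvg_cst.
have lb (t : R) : 0 <= t <= 1 -> d - 1 < c * t + d.
 move=> /andP[t0 t1]; have : 0 <= c * t by rewrite mulr_ge0.
 lra.
have le : c * 0 + d <= c * 1 + d by lra.
rewrite (int_subst ler01 ac cc _ lb le).
rewrite int_window //; lra.
Qed.

Definition speed (p : R -> M) (a : dform A 1) (t : R) : R :=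
 pullback (curve p) a t%:M 1%:M.

Definition line (p : R -> M) (a : dform A 1) : R := \i[0, 1] t, speed p a t.

Variable a : dform A 1.
Hypothesis fa : is_form a.

Lemma speed_smooth p : smooth_to A setT (curve p) -> smooth1 (speed p a).
move=> ps.
have S := pullback_smooth openT ps 1%:M fa.
apply(@smooth_comp _ _ _ _ _ _ (fun t : R^o => t%:M)
 openT openT (fun _ _ => I) S).
apply(@scalar_smooth _ R^o setT).
apply: smooth_lin; [exact: openT|move=> x; exact: cvg_id|by []].
Qed.

Lemma speed_cont p : smooth_to A setT (curve p) -> continuous (speed p a).
move=> ps t; exact: smooth_cont (speed_smooth _) I. Qed.

Lemma scalar_mx1 p (c : R) : c%:M = c *: (1%:M : 'M[R]_p).
by rewrite scale_scalar_mx mulr1. Qed.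

Lemma ml1_scale p (b : 'M[R]_(1, p) -> R) c v : multilinear b -> b (c *: v) = c * b v.
move=> bm; have E u : u = setrow 0 u v.
 by apply/row_matrixP => i; rewrite row_setrow ord1 row_id.
by rewrite (E (c *: v)) (ml_scale bm) -E.
Qed.

Lemma jac_scalar p (f : 'rV[R]_p -> R) (U : set 'rV[R]_p) z v : open U -> smooth_fun U f -> U z ->
 v *m jacobian (fun x => (f x)%:M : 'rV[R]_1) z = (dd v f z)%:M.
move=> oU fs Uz; apply/rowP => l; rewrite -(derive_jacE oU (scalar_smooth fs) _ _ Uz) ord1.
rewrite mxE; congr ('D_v _ z); apply/funext => y.
by rewrite mxE.
Qed.

Lemma is_dd_coordc p (f : R -> R) (z v : 'rV[R]_p) k :
 smooth1 f ->
 is_dd z v (fun x : 'rV[R]_p => f (x 0 k)) (v 0 k * deriv1 f (z 0 k)).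
move=> fs.
have [d1 e1] := is_dd_scale (v 0 k) (@smooth_dd _ _ _ _ (z 0 k) 1 fs I).
have E : v 0 k *: 1 = v 0 k by rewrite /GRing.scale /= mulr1.
rewrite E in d1 e1.
have := @is_dd_aff R R _ (fun z : 'rV_p => z 0 k) f z _ v _ d1.
by rewrite e1; apply=> h; rewrite !mxE.
Qed.

Lemma dd_coordc p (f : R -> R) (z v : 'rV[R]_p) k :
 smooth1 f ->
 dd v (fun x : 'rV[R]_p => f (x 0 k)) z = v 0 k * deriv1 f (z 0 k).
by move=> fs; have [] := is_dd_coordc z v k fs. Qed.

Lemma smooth_coordc p (U : set 'rV[R]_p) (f : R -> R) k : open U ->
 smooth1 f -> smooth_fun U (fun x => f (x 0 k)).
move=> oU fs; apply(smooth_comp1 oU openT (fun _ _ => I) fs); exact: smooth_coord.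
Qed.

Lemma speed_comp p (f : R -> R) t : smooth_to A setT (curve p) ->
 smooth1 f ->
 speed (fun s => p (f s)) a t = deriv1 f t * speed p a (f t).
move=> ps fs; rewrite /speed.
have fs' : smooth_fun [set: 'rV_1] (fun z => f (z 0 0)) by exact: smooth_coordc openT _.
have E : curve (fun s => p (f s)) = fun z => curve p (f (z 0 0))%:M.
 by apply/funext => z; rewrite /curve mxE.
have e : (t%:M : 'rV_1) 0 0 = t by rewrite mxE.
rewrite E (pullback_comp a 1%:M openT openT ps (scalar_smooth fs') (fun _ _ => I) I).
rewrite (jac_scalar _ openT fs' I) dd_coordc // e mxE mul1r.
apply: etrans (ml1_scale _ 1%:M (proj1 (pullback_ml _ _%:M fa))).
by rewrite -scalar_mx1.
Qed.

Lemma speed_ext p q l r t : smooth_to A setT (curve p) -> (forall s, l < s < r -> p s = q s) ->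
 l < t < r -> speed p a t = speed q a t.
move=> ps pq lr; pose U := [set: 'rV[R]_1] `&` (fun z : 'rV[R]_1 => z 0 0) @^-1` `]l, r[%classic.
have oU : open U.
 apply(open_preim openT) => [|z _]; [exact: itv_open|exact: coord_continuous].
apply(@pullback_ext _ _ _ _ _ U) => //.
- exact: smooth_to_sub openT _ _.
- move=> z [_]; exact: pq.
- by split; rewrite //= mxE.
Qed.

Lemma D1_affine (c d t : R) : 'D_1 (fun t : R^o => c * t + d : R^o) t = c.
have idd : is_derive t 1 (fun t => t) 1 by exact: is_derive_id.
have cd' : is_deriv t (cst d) 0 by exact: is_derive_cst.
have [_] := is_deriveD (is_deriveZ c idd).
by rewrite addr0 /GRing.scale /= mulr1.
Qed.

Lemma smooth_affine (c d : R) : smooth_fun [set: R^o] (fun t : R^o => c * t + d).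
apply: smooth_affine1; first exact: openT.
apply: smooth_lin; [exact: openT|move=> x; exact: cvg_id|by []].
Qed.

Lemma speed_cst x t : speed (fun=> x) a t = 0.
have := @speed_comp _ (fun t => 0 * t + 0) t (smooth_to_cst x openT) (smooth_affine 0 0).
by rewrite D1_affine mul0r.
Qed.

Lemma cont_vanish (f : R -> R) x : continuous f ->
 (forall t, t < x -> f t = 0) \/ (forall t, x < t -> f t = 0) -> f x = 0.
move=> fc H; apply: contrapT => /eqP fx.
have : nbhs (f x) [set y | y != 0] by apply: open_nbhs_nbhs.
move/fc; rewrite nbhs_filterE => -[e /= e0 eB].
case: H => H; [have := eB (x - e / 2)|have := eB (x + e / 2)]; rewrite //= H ?eqxx.
- by rewrite opprB addrC subrK gtr0_norm; [|lra]; move=> /(_ ltac:(lra)).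
- by lra.
- by rewrite opprD addNKr normrN gtr0_norm; [|lra]; move=> /(_ ltac:(lra)).
- by lra.
Qed.

Lemma speed_flat p t : smooth_path A p -> t <= 0 \/ 1 <= t -> speed p a t = 0.
move=> [ps [p0 p1]].
have Z0 s : s < 0 -> speed p a s = 0.
 move=> s0; rewrite (@speed_ext p (fun=> p 0) (s - 1) 0) ?speed_cst //; last lra.
 move=> s' /andP[_ ss]; apply: p0; exact: ltW.
have Z1 s : 1 < s -> speed p a s = 0.
 move=> s0; rewrite (@speed_ext p (fun=> p 1) 1 (s + 1)) ?speed_cst //=; last lra.
 move=> s' /andP[ss _]; apply: p1; exact: ltW.
have sc := speed_cont ps.
rewrite !le_eqVlt => -[/predU1P[->|]|/predU1P[<-|]]; [|exact: Z0| |exact: Z1].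
- by apply(cont_vanish sc); left.
- by apply(cont_vanish sc); right.
Qed.

Lemma line_cat3 p q r : smooth_path A p -> smooth_path A q ->
 smooth_path A r -> p 1 = q 0 -> q 1 = r 0 ->
 line (cat3 p q r) a = line p a + line q a + line r a.
move=> ps qs rs pq qr; have [cs _] := cat3_smooth ps qs rs pq qr.
have sc p' (c d : R) : smooth_path A p' -> continuous (fun t => c * speed p' a (c * t + d)).
 move=> [ps' _] t; apply: cvgM; first exact: cvg_cst.
 apply: (@continuous_comp _ _ _ (fun t => c * t + d)); last exact: speed_cont.
 apply: cvgD; [apply: cvgM; [exact: cvg_cst|exact: cvg_id]|exact: cvg_cst].
have W p' (d : R) : smooth_path A p' -> - 4 <= d <= 0 ->
  line p' a = \i[0, 1] t, (5 * speed p' a (5 * t + d)).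
 move=> ps' d4; rewrite (@affine_window (speed p' a) 5 d); [by []|exact: speed_cont (proj1 ps')| |lra..].
 move=> t; exact: speed_flat.
rewrite (W p 0) ?(W q (- 2)) ?(W r (- 4)) //; [|lra..].
rewrite -intD; [|exact: sc..]; rewrite -intD; [|move=> t; apply: cvgD; exact: sc|exact: sc].
apply: eq_int => t _.
have [pf qf rf] := And3 (proj2 ps) (proj2 qs) (proj2 rs).
have S p' d : smooth_path A p' -> speed (fun s => p' (5 * s + d)) a t = 5 * speed p' a (5 * t + d).
 by move=> [ps']; rewrite (speed_comp t ps' (smooth_affine 5 d)) D1_affine.
have [t1|t1] := ltP t (2 / 5).
 rewrite (@speed_ext _ (fun s => p (5 * s + 0)) (t - 1) (2 / 5)); [|exact: cs| |lra].
  by rewrite S // (speed_flat qs) ?(speed_flat rs) //; lra.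
 by move=> s /andP[_ s1]; rewrite cat3_1 // addr0.
have [t2|t2] := ltP t (4 / 5).
 rewrite (@speed_ext _ (fun s => q (5 * s - 2)) (1 / 5) (4 / 5)); [|exact: cs| |lra].
  rewrite S // (speed_flat ps) ?(speed_flat rs) //; lra.
 by move=> s s1; rewrite cat3_2.
rewrite (@speed_ext _ (fun s => r (5 * s - 4)) (3 / 5) (t + 1)); [|exact: cs| |lra].
 by rewrite S // (speed_flat ps) ?(speed_flat qs) //; lra.
by move=> s /andP[s1]; rewrite cat3_3.
Qed.

Lemma line_rev p : smooth_path A p -> line (rev p) a = - line p a.
move=> [ps pf]; have sc := speed_cont ps.
have E t : speed (rev p) a t = - speed p a (1 - t).
 have := speed_comp t ps (smooth_affine (-1) 1).
 rewrite D1_affine mulN1r mulN1r [- t + 1]addrC => <-.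
 by congr (_ _ a t); apply/funext => s; rewrite /rev mulN1r addrC.
apply(etrans (eq_int (fun t _ => E t))).
have H : continuous (fun t : R => speed p a (1 - t)); last first.
 exact(etrans (intN 0 1 H) (congr1 -%R (int_rev sc))).
move=> t; apply(@continuous_comp R R R (fun t => 1 - t)); last exact: sc.
apply: cvgB; [exact: cvg_cst|exact: cvg_id].
Qed.

Lemma line_segment i c r y z : good_cell i c r -> `|y - c| < r -> `|z - c| < r ->
 line (segment i y z) a = \i[0, 1] t,
   (deriv1 step t * a i (y + step t *: (z - y)) (z - y)).
move=> g yr zr; apply: eq_int => t _; rewrite /speed.
pose h (x : 'rV_1) := y + step (x 0 0) *: (z - y).
have hs : smooth_mx [set: 'rV_1] h.
 move=> k l; rewrite ord1.
 apply(@smooth_ext _ _ _ (fun x : 'rV_1 => (z - y) 0 l * step (x 0 0) + y 0 l)).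
 - exact: openT.
 - move=> x _; rewrite !mxE; ring.
 apply: smooth_affine1; first exact: openT.
 exact: smooth_coordc openT step_smooth.
have hc x : setT x -> cod i (h x).
 move=> _; apply: g; apply: ball_convex => //; exact: step_itv.
rewrite (_ : _ _ = fun x => param i (h x)) //.
rewrite (pullback_comp a 1%:M openT (cod_open i) (smooth_to_param i) hs hc I).
have e : (t%:M : 'rV_1) 0 0 = t by rewrite mxE.
rewrite pullback_param //; last exact: hc.
have -> : 1%:M *m jacobian h t%:M = deriv1 step t *: (z - y).
 apply/rowP => l; rewrite -(derive_jacE openT hs _ _ I).
 have [_ D] := is_dd_coordc (t%:M : 'rV_1) 1%:M 0 step_smooth.
 have sd := @smooth_derivable _ _ _ (fun x : 'rV_1 => _) t%:M (1%:M : 'rV_1)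
  (smooth_coordc 0 openT step_smooth) I.
 rewrite (_ : (fun x => h x 0 l) = (z - y) 0 l *: (fun x : 'rV_1 => step (x 0 0)) + cst (y 0 l)); last first.
  by apply/funext => x; rewrite !mxE /cst addrC mulrC.
 rewrite deriveD; [|exact: derivableZ|exact: derivable_cst].
 rewrite derive_cst addr0 (deriveZ _ sd) D e !mxE mul1r.
 by rewrite /GRing.scale /= mulrC.
by rewrite (ml1_scale _ _ (form_ml fa (hc _ I))) /h e.
Qed.

Lemma line_cst x : line (fun=> x) a = 0.
rewrite /line (@eq_int _ _ (fun=> 0)); first by rewrite /Rintegral integral0.
move=> t _; exact: speed_cst.
Qed.

Lemma ml1_expand p (b : 'M[R]_(1, p) -> R) v : multilinear b ->
 b v = \sum_l v 0 l * b (delta_mx 0 l).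
move=> bm; rewrite (ml_expand_row bm 0); apply: eq_bigr => l _; congr (_ * b _).
by apply/row_matrixP => i; rewrite row_setrow ord1 eqxx row_id.
Qed.

Variable x0 : M.
Hypothesis Mc : connected [set: M].
Hypothesis periods : forall p, smooth_path A p -> p 0 = x0 -> p 1 = x0 -> line p a = 0.

Lemma based_path x : exists p, [/\ smooth_path A p, p 0 = x0 & p 1 = x].
have [p [ps p0 p1 _]] := joined_connected (A := A) Mc openT (fun _ _ => I) (I : setT x0) (I : setT x).
by exists p.
Qed.

Definition primitive x : R := line (projT1 (cid (based_path x))) a.

(** Two paths to [x] differ by a loop at [x0]: one path, a rest at [x], and the other path
    reversed. *)
Lemma primitiveE p x : smooth_path A p -> p 0 = x0 -> p 1 = x ->
 primitive x = line p a.
move=> ps p0 p1; rewrite /primitive; case: cid => q /= [qs q0 q1].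
have rs := rev_smooth qs.
have r0 : rev q 0 = x by rewrite /rev subr0.
have r1 : rev q 1 = x0 by rewrite /rev subrr.
have cs := cst_smooth (A := A) x.
have E := line_cat3 ps cs rs p1 (esym r0).
have ls := cat3_smooth ps cs rs p1 (esym r0).
have l0 : cat3 p (fun=> x) (rev q) 0 = x0.
 by rewrite (cat3_0 _ (proj2 ps)).
have l1 : cat3 p (fun=> x) (rev q) 1 = x0.
 by rewrite (cat3_end _ _ (proj2 rs)).
have := periods ls l0 l1; rewrite E (line_rev qs) line_cst addr0.
by move/eqP; rewrite subr_eq0 => /eqP ->.
Qed.

Lemma primitive_segment (i : idx A) c r y z : good_cell i c r -> `|y - c| < r -> `|z - c| < r ->
 primitive (param i z) = primitive (param i y) + line (segment i y z) a.
move=> g yr zr; have [p [ps p0 p1]] := based_path (param i y).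
have ss := segment_smooth g yr zr; have cs := cst_smooth (A := A) (param i z).
have ps0 : p 1 = segment i y z 0 by rewrite segment0.
have sc1 := segment1 i y z.
have e1 := etrans p1 (esym (segment0 i y z)).
have l0 : cat3 p (segment i y z) (fun=> param i z) 0 = x0.
 by rewrite (cat3_0 _ (proj2 ps) (proj2 ss)).
have l1 : cat3 p (segment i y z) (fun=> param i z) 1 = param i z.
 by rewrite (cat3_end _ (proj2 ss)).
rewrite (primitiveE ps p0 p1) (primitiveE (cat3_smooth ps ss cs e1 sc1) l0 l1).
by rewrite (line_cat3 ps ss cs e1 sc1) line_cst addr0.
Qed.

(** Integration along chart segments from [y] expresses the primitive near [y] as a constant plus
    the sum of (z_l - y_l) K_l(z) with smooth K_l. The derivative is needed only at the centre [y],
    where K_l(y) is the coefficient of [a] because the step has total variation 1; every point is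
    the centre of its own expansion. *)
Lemma primitive_local i y : cod i y -> exists2 U : set 'rV[R]_m, open U /\ U y &
 smooth_fun U (fun z => primitive (param i z)) /\
 forall v, dd v (fun z => primitive (param i z)) y = a i y v.
move=> cy.
have [r r0 [g _]] := cell_ex openT I (param_dom cy).
rewrite paramK // in g.
pose U := [set z : 'rV[R]_m | `|z - y| < r].
have oU : open U.
 have -> : U = ball y r by apply/seteqP; split=> z; rewrite -ball_normE //= distrC.
 exact: ball_open.
have Uy : U y by rewrite /U /= subrr normr0.
pose h t (z : 'rV_m) := y + step t *: (z - y).
have hc t z : U z -> cod i (h t z).
 move=> Uz; apply: g; apply: ball_convex => //; exact: step_itv.
pose ds t := deriv1 step t.
pose G l (t : R) z := ds t * a i (h t z) (delta_mx 0 l).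
have oTU := open_setTX oU.
have fst_smooth : smooth_fun ([set: R^o] `*` U : _) fst.
 apply: smooth_lin => // x; exact: cvg_fst.
have Gs l : smooth_fun ([set: R^o] `*` U : _) (fun p => G l p.1 p.2).
 apply: smoothM => //.
  apply: (smooth_comp1 oTU openT (fun _ _ => I) _ fst_smooth).
  exact: smooth_D step_smooth.
 apply(@smooth_comp _ _ _ _ _ (fun x => a i x _) (fun p => h p.1 p.2) oTU (cod_open i)).
 - move=> p [_]; exact: hc.
 - exact: form_smooth.
 move=> k l'; rewrite ord1.
 apply(@smooth_ext _ _ _ (fun p : R^o * 'rV_m => y 0 l' + step p.1 * (p.2 0 l' - y 0 l'))) => //.
  by move=> p; rewrite !mxE.
 apply: smoothD => //; first exact: smooth_cst.
 apply: smoothM => //.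
  exact: (smooth_comp1 _ openT _ step_smooth).
 apply: smoothB => //; last exact: smooth_cst.
 apply: smooth_lin => //.
 + move=> x; apply: (@continuous_comp _ _ _ _ (fun z : 'rV_m => z 0 _)); first exact: cvg_snd.
  exact: coord_continuous.
 + by move=> c x x'; rewrite !mxE.
pose K l z := \i[0, 1] t, G l t z.
have Ks l : smooth_fun U (K l) by exact: smooth_int.
have Gc l z : U z -> continuous (fun t => G l t z).
 move=> Uz; apply: joint_cont => t; exact: smooth_cont.
have E z : U z -> primitive (param i y) + \sum_l (z 0 l - y 0 l) * K l z =
  primitive (param i z).
 move=> Uz; rewrite (primitive_segment g Uy Uz) (line_segment g Uy Uz); congr (_ _).
 rewrite (eq_bigr (fun l => \i[0, 1] t, ((z 0 l - y 0 l) * G l t z))); last first.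
  move=> l; rewrite intZ //; exact: Gc.
 rewrite -int_sum; last by move=> l t; apply: cvgM; [exact: cvg_cst|exact: Gc].
 apply: eq_int => t _; rewrite (ml1_expand _ (form_ml fa (hc t z Uz))) mulr_sumr.
 by apply: eq_bigr => l; rewrite !mxE /G mulrCA.
have Ss : smooth_fun U (fun z => primitive (param i y) + \sum_l (z 0 l - y 0 l) * K l z).
 apply: smoothD => //; first exact: smooth_cst.
 apply(smooth_sum _ oU) => l _; apply: (smoothM oU _ (Ks l)).
 apply: smoothB => //; [exact: smooth_coord|exact: smooth_cst].
exists U => //; split; first exact: smooth_ext Ss.
move=> v; transitivity (dd v (fun z : 'rV_m => primitive (param i y) + \sum_l (z 0 l - y 0 l) * K l z) y).
 by apply: near_eq_derive; apply(nearU oU Uy) => z Uz; rewrite E.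
have Ky l : K l y = a i y (delta_mx 0 l).
 rewrite /K (@eq_int _ _ (fun t => a i y (delta_mx 0 l) * ds t)); last first.
  by move=> t; rewrite /G /h subrr scaler0 addr0 mulrC.
 have dc : continuous ds.
  by move=> t; have := smooth_D (1 : R^o) step_smooth => /(_ 0); apply.
 have sd t : 0 <= t <= 1 -> is_deriv t step (ds t).
  move=> _; exact: smooth_dd step_smooth I.
 by rewrite intZ // (FTC2 ler01 dc) (step0 (lexx 0)) (step1 (lexx 1)) subr0 mulr1.
rewrite (ml1_expand v (form_ml fa cy)).
have D l : is_dd y v (fun z : 'rV_m => (z 0 l - y 0 l) * K l z) (v 0 l * a i y (delta_mx 0 l)).
 have d1 : is_dd y v (fun z : 'rV_m => z 0 l - y 0 l) (v 0 l).
  by have := is_deriveB (is_dd_coord y v l) (is_derive_cst (y 0 l) y v); rewrite subr0.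
 have := is_deriveM d1 (smooth_dd v (Ks l) Uy).
 by rewrite subrr scale0r add0r Ky [_ *: v 0 l]mulrC.
have Dsum : is_derive y v (\sum_l fun z : 'rV_m => (z 0 l - y 0 l) * K l z)
  (\sum_l v 0 l * a i y (delta_mx 0 l)) by exact: is_derive_sum.
have := is_deriveD (is_derive_cst (primitive (param i y)) y v) Dsum.
rewrite add0r => -[_ <-]; congr ('D_v _ y); apply/funext => z.
by rewrite /=; rewrite fct_sumE.
Qed.

Lemma exact_of_periods : exact_form a.
exists (fun i y _ => primitive (param i y)); split.
 split.
 - move=> i x cx; split.
   move=> r; have := ltn_ord r; by [].
  by move=> V r; have := ltn_ord r.
 - move=> i V; apply: smooth_local => y cy.
  by have [U [_ Uy] []] := primitive_local cy; exists U.
 - move=> i j x V [cx dx]; congr primitive.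
  by rewrite chartK.
move=> i y V cy; rewrite /ext_d big_ord_recl big_ord0 addr0 mul1r.
have [U _ [_ D]] := primitive_local cy.
by rewrite D; rewrite row_id.
Qed.

End LineIntegral.

(** * Smooth squares, their composition and their areas *)

Section Squares.
Context {R m M} {A : atlas R m M}.
Local Notation step := (@smooth_step R).

Definition pt (s t : R) : 'rV[R]_2 := \row_(k < 2) if k == 0 then s else t.

Lemma pt0 s t : pt s t 0 0 = s. Proof. by rewrite mxE. Qed.

Lemma pt1 s t : pt s t 0 1 = t. Proof. by rewrite mxE. Qed.

Lemma pt_eta (z : 'rV[R]_2) : pt (z 0 0) (z 0 1) = z.
apply/rowP => k; rewrite mxE; case: eqP => [->|k0]; congr (z _).
by apply: val_inj; case: k k0 => -[|[]] //= kl k0; case: k0; apply: val_inj.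
Qed.

Definition sqmap (T : Type) (u : R -> R -> T) : 'rV[R]_2 -> T := fun z => u (z 0 0) (z 0 1).

Definition smooth_sq (u : R -> R -> M) : Prop := smooth_to A setT (sqmap u).

Definition smooth2 (f : R -> R -> R) : Prop := smooth_fun [set: 'rV[R]_2] (sqmap f).

Definition pd0 (f : R -> R -> R) s t : R := dd (delta_mx 0 0) (sqmap f) (pt s t).
Definition pd1 (f : R -> R -> R) s t : R := dd (delta_mx 0 1) (sqmap f) (pt s t).

Lemma smooth2_fst f : smooth1 f -> smooth2 (fun s t => f s).
move=> fs; exact: smooth_coordc openT _. Qed.

Lemma smooth2_snd f : smooth1 f -> smooth2 (fun s t => f t).
move=> fs; exact: smooth_coordc openT _. Qed.

Lemma smooth2D f g : smooth2 f -> smooth2 g -> smooth2 (fun s t => f s t + g s t).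
move=> fs gs; exact: smoothD openT _ _. Qed.

Lemma smooth2M f g : smooth2 f -> smooth2 g -> smooth2 (fun s t => f s t * g s t).
move=> fs gs; exact: smoothM openT _ _. Qed.

Lemma delta2 (k l : 'I_2) : (delta_mx 0 k : 'rV[R]_2) 0 l = (l == k)%:R.
by rewrite mxE. Qed.

Lemma pd_fst f s t : smooth1 f ->
 pd0 (fun s t => f s) s t = deriv1 f s /\ pd1 (fun s t => f s) s t = 0.
move=> fs; rewrite /pd0 /pd1 /sqmap !dd_coordc // !delta2 pt0 mul1r.
by rewrite mul0r.
Qed.

Lemma pd_snd f s t : smooth1 f ->
 pd0 (fun s t => f t) s t = 0 /\ pd1 (fun s t => f t) s t = deriv1 f t.
move=> fs; rewrite /pd0 /pd1 /sqmap !dd_coordc // !delta2 pt1 mul1r.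
by rewrite mul0r.
Qed.

Lemma pdD f g s t : smooth2 f -> smooth2 g ->
 pd0 (fun s t => f s t + g s t) s t = pd0 f s t + pd0 g s t /\
 pd1 (fun s t => f s t + g s t) s t = pd1 f s t + pd1 g s t.
move=> fs gs.
have H v : dd v (sqmap (fun s t => f s t + g s t)) (pt s t) =
  dd v (sqmap f) (pt s t) + dd v (sqmap g) (pt s t).
 exact: deriveD (@smooth_derivable _ _ _ _ _ v _ I) (@smooth_derivable _ _ _ _ _ v _ I).
split; exact: H.
Qed.

Lemma det2 (B : 'M[R]_2) : \det B = B 0 0 * B 1 1 - B 1 0 * B 0 1.
rewrite (expand_det_row _ 0) !big_ord_recl big_ord0 addr0 /cofactor !det_mx11 !mxE /=.
have e0 : lift 0 0 = 1 :> 'I_2 by apply: val_inj.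
have e1 : lift 1 0 = 0 :> 'I_2 by apply: val_inj.
by rewrite e0 e1 mul1r mulN1r mulrN [B 0 1 * _]mulrC.
Qed.

Variable a : dform A 2.
Hypothesis fa : is_form a.

Definition den (u : R -> R -> M) s t : R := pullback (sqmap u) a (pt s t) 1%:M.

Definition area (u : R -> R -> M) : R :=
 \i[0, 1] s, \i[0, 1] t, den u s t.

Lemma den_ext u v (U : set 'rV[R]_2) s t : smooth_sq u -> open U -> U (pt s t) ->
 (forall z, U z -> u (z 0 0) (z 0 1) = v (z 0 0) (z 0 1)) -> den u s t = den v s t.
move=> us oU Uz uv; apply(@pullback_ext _ _ _ _ _ U) => //.
exact: smooth_to_sub openT _ _.
Qed.

Lemma den_ext_fst u v (P : set R) s t : smooth_sq u -> open P -> P s ->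
 (forall s t, P s -> u s t = v s t) -> den u s t = den v s t.
move=> us oP Ps uv; apply(@den_ext u v (setT `&` (fun z : 'rV_2 => z 0 0) @^-1` P)) => //.
- apply(open_preim openT oP) => z _; exact: coord_continuous.
- by split => //=; rewrite pt0.
- move=> z [_]; exact: uv.
Qed.

Lemma den_ext_snd u v (P : set R) s t : smooth_sq u -> open P -> P t ->
 (forall s t, P t -> u s t = v s t) -> den u s t = den v s t.
move=> us oP Ps uv; apply(@den_ext u v (setT `&` (fun z : 'rV_2 => z 0 1) @^-1` P)) => //.
- apply(open_preim openT oP) => z _; exact: coord_continuous.
- by split => //=; rewrite pt1.
- move=> z [_]; exact: uv.
Qed.

Lemma pair_smooth f g : smooth2 f -> smooth2 g ->
 smooth_mx [set: 'rV[R]_2] (fun z => pt (sqmap f z) (sqmap g z)).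
move=> fs gs i j; rewrite ord1.
have [->|j0] := eqVneq j 0.
 by apply: smooth_ext openT _ fs => z; rewrite mxE.
by apply: smooth_ext openT _ gs => z; rewrite mxE (negbTE j0).
Qed.

Lemma sq_comp_smooth u f g : smooth_sq u -> smooth2 f -> smooth2 g ->
 smooth_sq (fun s t => u (f s t) (g s t)).
move=> us fs gs; have := smooth_to_comp openT openT (fun _ _ => I) us (pair_smooth fs gs).
by congr smooth_to; apply/funext => z; rewrite /sqmap pt0 pt1.
Qed.

Lemma sq_path_smooth p f : smooth_to A setT (curve p) -> smooth2 f ->
 smooth_sq (fun s t => p (f s t)).
move=> ps fs; exact: curve_comp openT _ _. Qed.

Lemma den_comp u f g s t : smooth_sq u -> smooth2 f -> smooth2 g ->
 den (fun s t => u (f s t) (g s t)) s t =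
 den u (f s t) (g s t) * (pd0 f s t * pd1 g s t - pd1 f s t * pd0 g s t).
move=> us fs gs; rewrite /den; pose h z := pt (sqmap f z) (sqmap g z).
have hs : smooth_mx [set: 'rV_2] h by exact: pair_smooth.
have E : sqmap (fun s t => u (f s t) (g s t)) = fun z => sqmap u (h z).
 by apply/funext => z; rewrite /sqmap /h pt0 pt1.
rewrite E (pullback_comp a 1%:M openT openT us hs (fun _ _ => I) I) mul1mx.
have [pm pa] := @pullback_ml _ _ _ _ _ (sqmap u) _ a (h (pt s t)) fa.
rewrite (alt_top pm pa).
have -> : h (pt s t) = pt (f s t) (g s t) by rewrite /h /sqmap pt0 pt1.
congr (_ _).
have J k l : jacobian h (pt s t) k l = dd (delta_mx 0 k) (fun z => h z 0 l) (pt s t).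
 exact: (jacE openT).
rewrite /pd0 /pd1.
have h0 : (fun z => h z 0 0) = sqmap f by apply/funext => z; rewrite /h pt0.
have h1 : (fun z => h z 0 1) = sqmap g by apply/funext => z; rewrite /h pt1.
by rewrite det2 !J h0 h1.
Qed.

(** The pullback factors through a space of dimension 1, where a 2-form vanishes. Such degenerate
    pieces can be added to a square without changing its area. *)
Lemma den_path p f s t : smooth_to A setT (curve p) -> smooth2 f ->
 den (fun s t => p (f s t)) s t = 0.
move=> ps fs; rewrite /den.
have E : sqmap (fun s t => p (f s t)) = fun z => curve p (sqmap f z)%:M.
 by apply/funext => z; rewrite /curve mxE.
rewrite E (pullback_comp a 1%:M openT openT ps (scalar_smooth fs) (fun _ _ => I) I).
have [pm pa] := @pullback_ml _ _ _ _ _ (curve p) _ a (sqmap f (pt s t))%:M fa.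
move: (1%:M *m _) => V.
rewrite (ml_expand_row pm 0) big_ord1 (ml_expand_row pm 1) big_ord1.
rewrite (pa _ 0 1) ?mulr0 //.
by rewrite row_setrow row_setrow row_setrow.
Qed.

Lemma den_smooth u : smooth_sq u -> smooth2 (den u).
move=> us; have E z : setT z -> pullback (sqmap u) a z 1%:M = sqmap (den u) z.
 by move=> _; rewrite [RHS]/den pt_eta.
exact: smooth_ext openT E (pullback_smooth openT _ 1%:M _).
Qed.

Lemma pt_continuous : continuous (fun p : R * R => pt p.1 p.2).
move=> p; apply: mx_continuousP => i j; rewrite ord1.
have [->|j0] := eqVneq j 0.
 by rewrite (_ : (fun _ => _) = fst); [exact: cvg_fst|apply/funext => q; rewrite mxE].
rewrite (_ : (fun => _) = snd); first exact: cvg_snd.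
by apply/funext => q; rewrite mxE (negbTE j0).
Qed.

Lemma sqmap_continuous f : smooth2 f -> continuous (fun p : R * R => f p.1 p.2).
move=> fs p; have := continuous_comp
 (@pt_continuous p) (smooth_cont fs I).
by congr continuous_at; apply/funext => q; rewrite /= /sqmap pt0 pt1.
Qed.

Lemma den_cont_snd u s : smooth_sq u -> continuous (fun t => den u s t).
move=> us; apply(joint_cont (G := fun t s => _ s t)) => t.
apply(@continuous_comp _ _ _ (fun p : R * R => (p.2, p.1)) (fun p => den u p.1 p.2)).
 exact: cvg_pair snd fst cvg_snd cvg_fst.
exact: sqmap_continuous (den_smooth _) _.
Qed.

Lemma inner_cont u : smooth_sq u ->
 continuous (fun s => \i[0, 1] t, den u s t).
move=> us s; apply(@int_continuous R R^o setT) => //; first exact: openT.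
move=> t s' _; apply(@continuous_comp _ _ _ (fun p : R * R => (p.2, p.1)) (fun p => den u p.1 p.2)).
 exact: cvg_pair fst cvg_snd cvg_fst.
exact: sqmap_continuous (den_smooth _) _.
Qed.

(** A homotopy from [p] to [q] with fixed starting point and free end point, stationary outside the
    unit square. The right edge is the trace of the end point; [square] below fixes it as well. *)
Record fsquare (u : R -> R -> M) (p q : R -> M) : Prop := FSquare {
 sq_smooth : smooth_sq u;
 sq_bottom : forall s t, t <= 0 -> u s t = p s;
 sq_top : forall s t, 1 <= t -> u s t = q s;
 sq_left : forall s t, s <= 0 -> u s t = p 0;
 sq_right : forall s t, 1 <= s -> u s t = u 1 t
}.

Lemma row_smooth u t : smooth_sq u -> smooth_to A setT (curve (fun s => u s t)).
move=> us.
have hs : smooth_mx [set: 'rV_1] (fun z => pt (z 0 0) t).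
 move=> i j; rewrite ord1; have [->|j0] := eqVneq j 0.
  by apply: smooth_ext openT _ (smooth_coord 0 0 openT) => z; rewrite mxE.
 by apply: smooth_ext openT _ (smooth_cst t openT) => z; rewrite mxE (negbTE j0).
have := smooth_to_comp openT openT (fun _ _ => I) us hs.
by congr smooth_to; apply/funext => z; rewrite /sqmap pt0 pt1.
Qed.

Lemma sq_row_path u p q t : fsquare u p q -> smooth_path A (fun s => u s t).
move=> [us _ _ uL uR]; split; first exact: row_smooth.
by split=> s s0; [rewrite !uL|exact: uR].
Qed.

Lemma sq_bottom_path u p q : fsquare u p q -> smooth_path A p.
move=> us; have := sq_row_path 0 us; congr smooth_path.
by apply/funext => s; rewrite (sq_bottom us).
Qed.

Lemma sq_top_path u p q : fsquare u p q -> smooth_path A q.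
move=> us; have := sq_row_path 1 us; congr smooth_path.
by apply/funext => s; rewrite (sq_top us).
Qed.

Lemma sq_start u p q : fsquare u p q -> q 0 = p 0.
by move=> us; rewrite -(sq_top us 0 (lexx 1)) (sq_left us). Qed.

Lemma smooth_scale (c : R) : smooth_fun [set: R^o] (fun t : R^o => c * t).
apply: smooth_ext openT _ (smooth_affine c 0) => t _.
by rewrite addr0.
Qed.

Lemma fsquare_refl p : smooth_path A p -> fsquare (fun s t => p s) p p.
move=> [ps [p0 p1]]; split=> //; last by move=> s _; exact: p1.
- apply(sq_path_smooth ps).
 by apply: smooth2_fst; apply: smooth_ext openT _ (smooth_scale 1) => s; rewrite mul1r.
- move=> s _; exact: p0.
Qed.

Lemma smooth_id : smooth_fun [set: R^o] (fun t : R^o => t : R).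
by apply: smooth_ext openT _ (smooth_scale 1) => s; rewrite mul1r. Qed.

Lemma D1_id (t : R) : 'D_1 (fun t : R^o => t : R^o) t = 1.
exact: derive_id. Qed.

Lemma fsquare_sym u p q : fsquare u p q -> fsquare (fun s t => u s (1 - t)) q p.
move=> us; split.
- apply(sq_comp_smooth (sq_smooth us)); first exact: smooth2_fst smooth_id.
 apply: smooth2_snd; apply: smooth_ext openT _ (smooth_affine (-1) 1) => t _.
 by rewrite mulN1r addrC.
- move=> s t t0; apply(us); lra.
- move=> s t t1; apply(us); lra.
- by move=> s t s0; rewrite (sq_left us) // (sq_start us).
- by move=> s t s1; rewrite (sq_right us).
Qed.

(** The squares occupy the strips 0 <= t <= 1/3 and 2/3 <= t <= 1; the cut at 1/2 lies in the gap,
    where both equal the common edge. *)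
Definition stack (u v : R -> R -> M) s t : M :=
 if t <= 1 / 2 then u s (3 * t) else v s (3 * t - 2).

Lemma stack_lo u v p q r s t : fsquare u p q -> fsquare v q r -> t < 2 / 3 ->
 stack u v s t = u s (3 * t).
move=> us vs t1; rewrite /stack; case: leP => // t2.
rewrite (sq_bottom vs) ?(sq_top us) //; lra.
Qed.

Lemma stack_hi u v p q r s t : fsquare u p q -> fsquare v q r -> 1 / 3 < t ->
 stack u v s t = v s (3 * t - 2).
move=> us vs t1; rewrite /stack; case: leP => // t2.
rewrite (sq_bottom vs) ?(sq_top us) //; lra.
Qed.

Lemma fsquare_stack u v p q r : fsquare u p q -> fsquare v q r -> fsquare (stack u v) p r.
move=> us vs; split.
- apply: (@smooth_glue _ _ _ A _ (sqmap (fun s t => u s (3 * t))) (sqmap (fun s t => v s (3 * t - 2)))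
  (fun z : 'rV[R]_2 => z 0 1) (1 / 3) (1 / 2) (2 / 3)).
 + exact: coord_continuous.
 + by lra.
 + apply: (sq_comp_smooth (sq_smooth us)); first exact: smooth2_fst smooth_id.
  exact: smooth2_snd (smooth_scale 3).
 + apply: (sq_comp_smooth (sq_smooth vs)); first exact: smooth2_fst smooth_id.
  exact: smooth2_snd (smooth_affine 3 (- 2)).
 + by move=> z /andP[z1 z2]; rewrite /sqmap (sq_bottom vs) ?(sq_top us) //; lra.
- by move=> s t t0; rewrite (stack_lo s us vs) ?(sq_bottom us) //; lra.
- by move=> s t t0; rewrite (stack_hi s us vs) ?(sq_top vs) //; lra.
- by move=> s t s0; rewrite /stack (sq_left us) // (sq_left vs) // (sq_start us); case: ifP.
- by move=> s t s0; rewrite /stack (sq_right us _ s0) (sq_right vs _ s0).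
Qed.

Lemma den_out u p q s t : fsquare u p q -> t <= 0 \/ 1 <= t -> den u s t = 0.
move=> us; have ss := sq_smooth us.
have Z0 t' : t' < 0 -> den u s t' = 0.
 move=> t0.
 have E s' t'' : [set t : R | t < 0] t'' -> u s' t'' = p s' by move=> /ltW; exact: (sq_bottom us).
 rewrite (den_ext_snd s ss (@open_lt R 0) t0 E).
 exact: (den_path s t' (proj1 (sq_bottom_path us)) (smooth2_fst smooth_id)).
have Z1 t' : 1 < t' -> den u s t' = 0.
 move=> t0.
 have E s' t'' : [set t : R | 1 < t] t'' -> u s' t'' = q s' by move=> /ltW; exact: (sq_top us).
 rewrite (den_ext_snd s ss (@open_gt R 1) t0 E).
 exact: (den_path s t' (proj1 (sq_top_path us)) (smooth2_fst smooth_id)).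
have dc := @den_cont_snd u s ss.
rewrite !le_eqVlt => -[/predU1P[->|]|/predU1P[<-|]]; [|exact: Z0| |exact: Z1].
- by apply: (cont_vanish dc); left.
- by apply: (cont_vanish dc); right.
Qed.

Definition square u p q : Prop := fsquare u p q /\ forall t, u 1 t = p 1.

Lemma den_side u p q s t : square u p q -> s < 0 \/ 1 < s -> den u s t = 0.
move=> [us uR]; have ss := sq_smooth us.
have c0 x := den_path s t (smooth_to_cst (A := A) x openT) (smooth2_fst smooth_id).
move=> [s0|s1].
 have E s' t' : [set s : R | s < 0] s' -> u s' t' = p 0 by move=> /ltW; exact: (sq_left us).
 by rewrite (den_ext_fst t ss (@open_lt R 0) s0 E); exact: c0.
have E s' t' : [set s : R | 1 < s] s' -> u s' t' = p 1.
 by move=> /ltW H; rewrite (sq_right us _ H) uR.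
by rewrite (den_ext_fst t ss (@open_gt R 1) s1 E); exact: c0.
Qed.

Lemma square_end u p q : square u p q -> q 1 = p 1.
by move=> [us uR]; rewrite -(sq_top us 1 (lexx 1)) uR. Qed.

Lemma square_sym u p q : square u p q -> square (fun s t => u s (1 - t)) q p.
move=> [us uR]; split; first exact: fsquare_sym.
by move=> t; rewrite uR (square_end (conj us uR)).
Qed.

Lemma square_stack u v p q r : square u p q -> square v q r -> square (stack u v) p r.
move=> [us uR] [vs vR]; split; first exact: fsquare_stack us vs.
by move=> t; rewrite /stack uR vR (square_end (conj us uR)); case: ifP.
Qed.

Lemma inner_side u p q s : square u p q -> s <= 0 \/ 1 <= s ->
 \i[0, 1] t, den u s t = 0.
move=> us; have ic := inner_cont (sq_smooth (proj1 us)).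
have Z s' : s' < 0 \/ 1 < s' -> \i[0, 1] t, den u s' t = 0.
 move=> H; rewrite (@eq_int _ _ (fun=> 0)); first by rewrite /Rintegral integral0.
 by move=> t _; exact: den_side us H.
rewrite !le_eqVlt => -[/predU1P[->|]|/predU1P[<-|]].
- by apply: (cont_vanish ic); left => s' H; apply: Z; left.
- by move=> H; apply: Z; left.
- by apply: (cont_vanish ic); right => s' H; apply: Z; right.
- by move=> H; apply: Z; right.
Qed.

Lemma area_sym u p q : square u p q -> area (fun s t => u s (1 - t)) = - area u.
move=> [us uR]; have ss := sq_smooth us.
have fs : smooth_fun [set: R^o] (fun t : R^o => 1 - t : R).
 by apply: (smooth_ext openT _ (smooth_affine (-1) 1)) => t _; rewrite mulN1r addrC.
have D1 (t : R) : 'D_1 (fun t : R^o => 1 - t : R^o) t = -1.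
 rewrite -[RHS](D1_affine (-1) 1 t); congr ('D_1 _ t).
 by apply/funext => s; rewrite mulN1r addrC.
have E s t : den (fun s t => u s (1 - t)) s t = - den u s (1 - t).
 have [f0 f1] := pd_fst s t smooth_id; have [g0 g1] := pd_snd s t fs.
 rewrite (den_comp s t ss (smooth2_fst smooth_id) (smooth2_snd fs)) f0 f1 g0 g1.
 by rewrite D1_id D1 mul0r subr0 mul1r mulrN1.
rewrite /area -intN; last exact: inner_cont.
apply: eq_int => s _; apply: (etrans (eq_int (fun t _ => E s t))).
have dc := @den_cont_snd u s ss.
have H : continuous (fun t : R => den u s (1 - t)); last first.
 exact: (etrans (intN 0 1 H) (congr1 -%R (int_rev dc))).
move=> t; apply: (@continuous_comp R R R (fun t : R => 1 - t) (den u s) t); last exact: dc.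
by apply: cvgB; [exact: cvg_cst|exact: cvg_id].
Qed.

Lemma continuous_affine (f : R -> R) (c d : R) : continuous f -> continuous (fun t => c * f (c * t + d)).
move=> fc t; apply: cvgM; first exact: cvg_cst.
apply: (@continuous_comp R R R (fun t => c * t + d) f t); last exact: fc.
by apply: cvgD; [apply: cvgM; [exact: cvg_cst|exact: cvg_id]|exact: cvg_cst].
Qed.

Lemma den_affine_snd u c d s t : smooth_sq u ->
 den (fun s t => u s (c * t + d)) s t = c * den u s (c * t + d).
move=> ss; have fs := smooth_affine c d.
have [f0 f1] := pd_fst s t smooth_id; have [g0 g1] := pd_snd s t fs.
rewrite (den_comp s t ss (smooth2_fst smooth_id) (smooth2_snd fs)) f0 f1 g0 g1.
by rewrite D1_id D1_affine mul0r subr0 mul1r mulrC.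
Qed.

Lemma den_affine_fst u c d s t : smooth_sq u ->
 den (fun s t => u (c * s + d) t) s t = c * den u (c * s + d) t.
move=> ss; have fs := smooth_affine c d.
have [f0 f1] := pd_snd s t smooth_id; have [g0 g1] := pd_fst s t fs.
rewrite (den_comp s t ss (smooth2_fst fs) (smooth2_snd smooth_id)) f0 f1 g0 g1.
by rewrite D1_id D1_affine mul0r subr0 mulr1 mulrC.
Qed.

Lemma int_windows (f1 f2 f3 h : R -> R) (c d1 d2 d3 : R) :
 continuous f1 -> continuous f2 -> continuous f3 ->
 (forall t, t <= 0 \/ 1 <= t -> f1 t = 0) -> (forall t, t <= 0 \/ 1 <= t -> f2 t = 0) ->
 (forall t, t <= 0 \/ 1 <= t -> f3 t = 0) ->
 0 <= c -> 1 - c <= d1 <= 0 -> 1 - c <= d2 <= 0 -> 1 - c <= d3 <= 0 ->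
 (forall t, h t = c * f1 (c * t + d1) + c * f2 (c * t + d2) + c * f3 (c * t + d3)) ->
 \i[0, 1] t, h t = \i[0, 1] t, f1 t + \i[0, 1] t, f2 t +
  \i[0, 1] t, f3 t.
move=> c1 c2 c3 z1 z2 z3 c0 e1 e2 e3 hE.
rewrite -(affine_window c1 z1 c0 (d := d1)); [|lra..].
rewrite -(affine_window c2 z2 c0 (d := d2)); [|lra..].
rewrite -(affine_window c3 z3 c0 (d := d3)); [|lra..].
rewrite -intD; [|exact: continuous_affine..].
rewrite -intD; [|move=> t; apply: cvgD; exact: continuous_affine|exact: continuous_affine].
by apply: eq_int => t _; exact: hE.
Qed.

Lemma add3_4 (l x y z : R) : l = x + y + z -> z = 0 -> l = x + y.
by move=> -> ->; rewrite addr0. Qed.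

Lemma area_stack u v p q r : fsquare u p q -> fsquare v q r ->
 area (stack u v) = area u + area v.
move=> us vs; have [uss vss] := (sq_smooth us, sq_smooth vs).
have ws := sq_smooth (fsquare_stack us vs).
rewrite /area -intD; [|exact: inner_cont..]; apply: eq_int => s _.
have uc := @den_cont_snd u s uss; have vc := @den_cont_snd v s vss.
(* [int_windows] adds three windows; here the third one is zero. *)
have zc : continuous (fun _ : R => 0 : R) by move=> t; exact: cvg_cst.
have zz (t : R) : t <= 0 \/ 1 <= t -> (fun _ : R => 0 : R) t = 0 by [].
have H t : den (stack u v) s t = 3 * den u s (3 * t + 0) + 3 * den v s (3 * t + - 2) + 3 * (fun=> 0) (3 * t + 0).
 rewrite mulr0 addr0; have [t1|t1] := ltP t (2 / 3).
  have E s' t' : [set t : R | t < 2 / 3] t' -> stack u v s' t' = u s' (3 * t' + 0).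
   by move=> H; rewrite (stack_lo s' us vs H) addr0.
  rewrite (den_ext_snd s ws (@open_lt R _) t1 E) (den_affine_snd _ _ _ _ uss).
  have z : 3 * t + - 2 <= 0 by lra.
  by rewrite (den_out s vs (or_introl z)) mulr0 !addr0.
 have E s' t' : [set t : R | 1 / 3 < t] t' -> stack u v s' t' = v s' (3 * t' + - 2).
  by move=> H; rewrite (stack_hi s' us vs H).
 have t1' : 1 / 3 < t by lra.
 rewrite (den_ext_snd s ws (@open_gt R _) t1' E) (den_affine_snd _ _ _ _ vss).
 have z : 1 <= 3 * t + 0 by lra.
 by rewrite (den_out s us (or_intror z)) mulr0 add0r.
have b1 : 1 - 3 <= (0 : R) <= 0 by lra.
have b2 : 1 - 3 <= (- 2 : R) <= 0 by lra.
have c3 : 0 <= 3 :> R by lra.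
have := int_windows uc vc zc (fun t => @den_out u p q s t us) (fun t => @den_out v q r s t vs) zz c3 b1 b2 b1 H.
move=> E3; have i0 : \i[0, 1] t, 0 = 0 :> R by rewrite /Rintegral integral0.
exact: add3_4 E3 i0.
Qed.

Lemma mid_window (s : R) : 2 / 5 <= s -> s < 4 / 5 -> 1 / 5 < s < 4 / 5.
by move=> s1 s2; lra. Qed.

Lemma open_mid : open [set s : R | 1 / 5 < s < 4 / 5].
rewrite (_ : [set _ | _] = [set s : R | 1 / 5 < s] `&` [set s : R | s < 4 / 5]).
 by apply: openI; [exact: open_gt|exact: open_lt].
by apply/seteqP; split=> s /=; [move=> /andP[]|move=> [-> ->]].
Qed.

Lemma add3_1 (l x y z : R) : l = x -> y = 0 -> z = 0 -> l = x + y + z.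
by move=> -> -> ->; rewrite !addr0. Qed.

Lemma add3_2 (l x y z : R) : l = y -> x = 0 -> z = 0 -> l = x + y + z.
by move=> -> -> ->; rewrite add0r addr0. Qed.

Lemma add3_3 (l x y z : R) : l = z -> x = 0 -> y = 0 -> l = x + y + z.
by move=> -> -> ->; rewrite !add0r. Qed.

Lemma fsquare_cat3 u1 u2 u3 p1 p2 p3 q1 q2 q3 : square u1 p1 q1 -> square u2 p2 q2 ->
 square u3 p3 q3 -> p1 1 = p2 0 -> p2 1 = p3 0 ->
 square (fun s t => cat3 (u1^~ t) (u2^~ t) (u3^~ t) s) (cat3 p1 p2 p3) (cat3 q1 q2 q3).
move=> s1 s2 s3 e12 e23.
have [us1 ur1] := s1; have [us2 ur2] := s2; have [us3 ur3] := s3.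
have f1 t := proj2 (sq_row_path t us1); have f2 t := proj2 (sq_row_path t us2).
have f3 t := proj2 (sq_row_path t us3).
have j12 t : u1 1 t = u2 0 t by rewrite ur1 (sq_left us2).
have j23 t : u2 1 t = u3 0 t by rewrite ur2 (sq_left us3).
have [g1 g2 g3] := And3 (proj2 (sq_bottom_path us1)) (proj2 (sq_bottom_path us2)) (proj2 (sq_bottom_path us3)).
split; last first.
 by move=> t; rewrite (cat3_end _ (f2 t) (f3 t) (j23 t)) ur3 (cat3_end _ g2 g3 e23).
split.
- rewrite /smooth_sq /sqmap; apply: (smooth_cat3 (p := fun (z : 'rV[R]_2) s => u1 s (z 0 1))
  (q := fun z s => u2 s (z 0 1)) (r := fun z s => u3 s (z 0 1)) (c := fun z : 'rV[R]_2 => z 0 0)).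
 + exact: coord_continuous.
 + by move=> z; exact: f1.
 + by move=> z; exact: f2.
 + by move=> z; exact: f3.
 + by move=> z; exact: j12.
 + by move=> z; exact: j23.
 + exact: (sq_comp_smooth (sq_smooth us1) (smooth2_fst (smooth_scale 5)) (smooth2_snd smooth_id)).
 + exact: (sq_comp_smooth (sq_smooth us2) (smooth2_fst (smooth_affine 5 (- 2))) (smooth2_snd smooth_id)).
 + exact: (sq_comp_smooth (sq_smooth us3) (smooth2_fst (smooth_affine 5 (- 4))) (smooth2_snd smooth_id)).
- by move=> s t t0; rewrite /cat3 (sq_bottom us1) // (sq_bottom us2) // (sq_bottom us3).
- by move=> s t t0; rewrite /cat3 (sq_top us1) // (sq_top us2) // (sq_top us3).
- move=> s t s0; rewrite (proj1 (cat3_flat (f1 t) (f2 t) (f3 t) (j12 t) (j23 t)) s s0).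
 by rewrite (cat3_0 _ (f1 t) (f2 t) (j12 t)) (cat3_0 _ g1 g2 e12) (sq_left us1).
- move=> s t s0; exact: (proj2 (cat3_flat (f1 t) (f2 t) (f3 t) (j12 t) (j23 t)) s s0).
Qed.

Lemma area_cat3 u1 u2 u3 p1 p2 p3 q1 q2 q3 : square u1 p1 q1 -> square u2 p2 q2 ->
 square u3 p3 q3 -> p1 1 = p2 0 -> p2 1 = p3 0 ->
 area (fun s t => cat3 (u1^~ t) (u2^~ t) (u3^~ t) s) = area u1 + area u2 + area u3.
move=> s1 s2 s3 e12 e23; have ws := sq_smooth (proj1 (fsquare_cat3 s1 s2 s3 e12 e23)).
have [us1 ur1] := s1; have [us2 ur2] := s2; have [us3 ur3] := s3.
have [ss1 ss2 ss3] := And3 (sq_smooth us1) (sq_smooth us2) (sq_smooth us3).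
have f1 t := proj2 (sq_row_path t us1); have f2 t := proj2 (sq_row_path t us2).
have f3 t := proj2 (sq_row_path t us3).
have j12 t : u1 1 t = u2 0 t by rewrite ur1 (sq_left us2).
have j23 t : u2 1 t = u3 0 t by rewrite ur2 (sq_left us3).
have ic1 := inner_cont ss1; have ic2 := inner_cont ss2; have ic3 := inner_cont ss3.
have b1 : 1 - 5 <= (0 : R) <= 0 by lra.
have b2 : 1 - 5 <= (- 2 : R) <= 0 by lra.
have b3 : 1 - 5 <= (- 4 : R) <= 0 by lra.
have c5 : 0 <= 5 :> R by lra.
apply: (int_windows ic1 ic2 ic3 (fun s => @inner_side _ _ _ s s1) (fun s => @inner_side _ _ _ s s2)
 (fun s => @inner_side _ _ _ s s3) c5 b1 b2 b3) => s.
have dE u p q : smooth_sq u -> square u p q -> forall d, (5 * s + d <= 0 \/ 1 <= 5 * s + d) ->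
  5 * \i[0, 1] t, den u (5 * s + d) t = 0.
 by move=> ss su d H; rewrite (inner_side su H) mulr0.
have I1 u d : smooth_sq u -> (forall t, den (fun s t => cat3 (u1^~ t) (u2^~ t) (u3^~ t) s) s t = 5 * den u (5 * s + d) t) ->
  \i[0, 1] t, den (fun s t => cat3 (u1^~ t) (u2^~ t) (u3^~ t) s) s t =
  5 * \i[0, 1] t, den u (5 * s + d) t.
 by move=> ss H; apply: (etrans (eq_int (fun t _ => H t))); apply: intZ; exact: den_cont_snd.
have [t1|t1] := ltP s (2 / 5).
 have h2 : 5 * s + (- 2) <= 0 by lra.
 have z2 := dE _ _ _ ss2 s2 (- 2) (or_introl h2).
 have h3 : 5 * s + (- 4) <= 0 by lra.
 have z3 := dE _ _ _ ss3 s3 (- 4) (or_introl h3).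
 apply: (add3_1 _ z2 z3); apply: (I1 u1 0 ss1) => t; rewrite -(den_affine_fst _ _ _ _ ss1).
 apply: (den_ext_fst t ws (@open_lt R _) t1) => s' t' H.
 by rewrite (cat3_1 _ (f1 t') (f2 t') (j12 t') H) addr0.
have [t2|t2] := ltP s (4 / 5).
 have h1 : 1 <= 5 * s + 0 by lra.
 have z1 := dE _ _ _ ss1 s1 0 (or_intror h1).
 have h3 : 5 * s + (- 4) <= 0 by lra.
 have z3 := dE _ _ _ ss3 s3 (- 4) (or_introl h3).
 apply: (add3_2 _ z1 z3); apply: (I1 u2 (- 2) ss2) => t; rewrite -(den_affine_fst _ _ _ _ ss2).
 apply: (den_ext_fst t ws open_mid (mid_window t1 t2)) => s' t' H.
 by rewrite (cat3_2 (f1 t') (f2 t') (f3 t') (j12 t') (j23 t') H).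
have t3 : 3 / 5 < s by lra.
have h1 : 1 <= 5 * s + 0 by lra.
 have z1 := dE _ _ _ ss1 s1 0 (or_intror h1).
have h2 : 1 <= 5 * s + (- 2) by lra.
 have z2 := dE _ _ _ ss2 s2 (- 2) (or_intror h2).
apply: (add3_3 _ z1 z2); apply: (I1 u3 (- 4) ss3) => t; rewrite -(den_affine_fst _ _ _ _ ss3).
apply: (den_ext_fst t ws (@open_gt R _) t3) => s' t' H.
by rewrite (cat3_3 _ (f2 t') (f3 t') (j23 t') H).
Qed.

End Squares.

Arguments smooth_sq {R m M} A u.
Arguments square {R m M} A u p q.
Arguments fsquare {R m M} A u p q.

(** * Spheres from closed squares, and tori swept out by a flow *)

Section SphereTorus.
Context {R m M} {A : atlas R m M}.
Local Notation step := (@smooth_step R).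
Variable a : dform A 2.
Hypothesis fa : is_form a.

Lemma smooth2_affine (c d : R) : smooth2 (fun s t : R => c * s + d) /\ smooth2 (fun s t : R => c * t + d).
split; [exact: smooth2_fst (smooth_affine c d)|exact: smooth2_snd (smooth_affine c d)]. Qed.

Lemma sphere_integralE (u : R -> R -> M) : sphere_integral (A := A) (sqmap u) a = area a u.
rewrite /sphere_integral /area; apply: eq_int => s _; apply: eq_int => t _.
by rewrite /den /pullback mul1mx.
Qed.

Lemma window_lo (t : R) : t < 2 / 5 -> 5 * t + - 2 <= 0.
by lra. Qed.

Lemma window_hi (t : R) : 3 / 5 < t -> 1 <= 5 * t + - 2.
by lra. Qed.

Lemma window_hi' (t : R) : 4 / 5 <= t -> 1 < 5 * t + - 2.
by lra. Qed.

Lemma window_hi'' (t : R) : 4 / 5 <= t -> 7 / 10 < t.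
by lra. Qed.

Lemma window_57 (t : R) : 7 / 10 < t -> 3 / 5 < t.
by lra. Qed.

Lemma window_mid (t : R) : t <= 3 / 5 -> t < 4 / 5.
by lra. Qed.

Section Close.
Variables (u : R -> R -> M) (p : R -> M).
Hypothesis su : square A u p p.

(** The square occupies the middle [2/5, 3/5] x [2/5, 3/5], and around it the sphere factors through
    [p]. To the right, [As] leaves the end of [p] and returns to its start at s = 1. Towards the
    bottom and the top, [Bt] decreases from 1 to 0 and contracts [p] to its start. Hence the whole
    boundary goes to [p 0]. *)
Let As (s : R) : R := (5 * s - 2) * (1 - step (5 * s - 4)).
Let Bt (t : R) : R := step (5 * t) * step (5 - 5 * t).
Let G s t := if s <= 7 / 10 then u (5 * s - 2) (5 * t - 2) else p (As s).
Let S s t := if t <= 3 / 10 then p (As s * Bt t) else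
 if t <= 7 / 10 then G s t else p (As s * Bt t).

Let us := proj1 su.
Let ps := proj1 (sq_bottom_path us).
Let pf := proj2 (sq_bottom_path us).

Let As_smooth : smooth1 As.
apply: smoothM; [exact: openT|exact: smooth_affine|].
apply: smoothB; [exact: openT|exact: smooth_cst openT|].
exact: smooth_comp1 openT openT _ step_smooth (smooth_affine 5 _).
Qed.

Let Bt_smooth : smooth1 Bt.
apply: smoothM; [exact: openT| |].
 exact: smooth_comp1 openT openT _ step_smooth (smooth_scale 5).
apply(smooth_comp1 openT openT (fun _ _ => I) step_smooth).
apply: smooth_ext openT _ (smooth_affine (- 5) 5) => t _.
by rewrite mulNr addrC.
Qed.

Let AsE s : s <= 4 / 5 -> As s = 5 * s - 2.
move=> s1; rewrite /As step0; lra. Qed.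

Let BtE t : 1 / 5 <= t <= 4 / 5 -> Bt t = 1.
move=> t1; rewrite /Bt !step1; lra. Qed.

Let pAB_smooth : smooth2 (fun s t => As s * Bt t).
exact: smooth2M (smooth2_fst _) (smooth2_snd _). Qed.

Let u_right s t : 1 <= s -> u s t = p 1.
move=> s1; rewrite (sq_right us _ s1); exact: (proj2 su). Qed.

Let G_smooth : smooth_sq A G.
apply: (@smooth_glue _ _ _ A _ (sqmap (fun s t => u (5 * s - 2) (5 * t - 2))) (sqmap (fun s t => p (As s)))
  (fun z : 'rV_2 => z 0 0) (3 / 5) _ (4 / 5)).
- exact: coord_continuous.
- by lra.
- have [f0 f1] := smooth2_affine 5 (- 2).
 exact: (sq_comp_smooth (sq_smooth us)).
- exact: sq_path_smooth (smooth2_fst _).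
- move=> z /andP[z1 z2]; rewrite /sqmap AsE; last exact: ltW.
 rewrite u_right ?(proj2 pf) //; lra.
Qed.

Let GE s t : t <= 2 / 5 \/ 3 / 5 <= t -> G s t = p (As s).
move=> H; rewrite /G; case: leP => // s1; rewrite AsE; last lra.
case: H => H; [rewrite (sq_bottom us)|rewrite (sq_top us)] => //; lra.
Qed.

Let S_lo s t : t < 2 / 5 -> S s t = p (As s * Bt t).
move=> t1; rewrite /S; case: leP => // t2; rewrite ifT; last lra.
rewrite GE; [rewrite BtE ?mulr1 //; lra|left; exact: ltW].
Qed.

Let S_hi s t : 3 / 5 < t -> S s t = p (As s * Bt t).
move=> t1; rewrite /S; case: leP => // t2; case: leP => // t3.
rewrite GE; [rewrite BtE ?mulr1 //; lra|right; exact: ltW].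
Qed.

Let S_mid s t : 1 / 5 < t < 4 / 5 -> S s t = G s t.
move=> t1; rewrite /S; case: leP => t2.
 rewrite GE; [rewrite BtE ?mulr1 //; lra|left; lra].
case: leP => // t3.
rewrite GE; [rewrite BtE ?mulr1 //; lra|right; lra].
Qed.

Let S_smooth : smooth_sq A S.
have ABs := sq_path_smooth ps pAB_smooth.
apply(@smooth_glue _ _ _ A _ (sqmap (fun s t => p (As s * Bt t))) _
  (fun z : 'rV_2 => z 0 1) (1 / 5) _ (2 / 5)).
- exact: coord_continuous.
- by lra.
- exact: ABs.
- apply: (@smooth_glue _ _ _ A _ (sqmap G) (sqmap (fun s t => p (As s * Bt t)))
  (fun z : 'rV_2 => z 0 1) (3 / 5) _ (4 / 5)).
 + exact: coord_continuous.
 + by lra.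
 + exact: G_smooth.
 + exact: ABs.
 + move=> z z1; rewrite /sqmap GE; last by right; case/andP: z1 => /ltW.
  rewrite BtE ?mulr1 //; lra.
- move=> z z1; rewrite /sqmap ifT; last lra.
 by rewrite GE; [rewrite BtE ?mulr1 //; lra|left; case/andP: z1 => _ /ltW].
Qed.

Let S_out s t : s <= 0 \/ 1 <= s \/ t <= 0 \/ 1 <= t -> S s t = p 0.
have B0 : 0 <= Bt t by rewrite mulr_ge0 ?step_ge0.
have As1 : 1 <= s -> As s = 0.
 move=> s1; rewrite /As step1; lra.
have As0 : s <= 0 -> As s <= 0 by move=> s1; rewrite AsE; lra.
have pAB : s <= 0 \/ 1 <= s \/ t <= 0 \/ 1 <= t -> p (As s * Bt t) = p 0.
 move=> [s0|[s1|[t0|t1]]].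
 - apply(pf); apply: mulr_le0_ge0 => //; exact: As0.
 - by rewrite As1 // mul0r.
 - rewrite /Bt step0 ?mul0r ?mulr0 //; lra.
 - rewrite /Bt (@step0 _ (5 - 5 * t)) ?mulr0 //; lra.
move=> H; rewrite /S pAB //; case: ifP => // t1; case: ifP => // t2.
rewrite /G; case: H => [s0|[s1|[t0|t3]]].
- rewrite ifT ?(sq_left us) //; lra.
- rewrite ifF ?As1 //; lra.
- move/negbT: t1; rewrite -ltNge => t1; exfalso; lra.
- exfalso; lra.
Qed.

(** The sphere [S] has the area of [u]: outside the middle window it factors through the path [p],
    and there both densities vanish. *)
Lemma area_square_closed : (forall v, sphere A v -> sphere_integral v a = 0) -> area a u = 0.
move=> H.
have Ssph : sphere A (sqmap S).
 split; first exact: S_smooth.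
 exists (p 0) => z; rewrite negb_forall => /existsP[k]; rewrite negb_and -!leNgt => kz.
 apply: S_out; have [E|k0] := eqVneq k 0.
  rewrite E in kz; case/orP: kz; tauto.
 have E : k = 1 by apply: val_inj; case: k k0 {kz} => -[|[]].
 rewrite E in kz; case/orP: kz; tauto.
rewrite -(H _ Ssph) sphere_integralE; have ss := sq_smooth us.
have ic := inner_cont fa ss.
have d2 : (- 2 : R) <= 0 by lra.
have c5 : 0 <= 5 :> R by lra.
have cd : 1 <= 5 - 2 :> R by lra.
apply(etrans (esym (affine_window ic (fun s => @inner_side _ _ _ _ a fa u p p s su) c5 d2 cd))).
apply: eq_int => s _.
have dc := @den_cont_snd _ _ _ _ a fa u (5 * s - 2) ss.
have E t : 5 * (5 * den a u (5 * s - 2) (5 * t - 2)) = den a S s t.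
 have D : den a (fun s t => u (5 * s - 2) (5 * t - 2)) s t =
   5 * (5 * den a u (5 * s + - 2) (5 * t + - 2)).
  have [f0 f1] := smooth2_affine 5 (- 2).
  have ss' : smooth_sq A (fun s t => u (5 * s - 2) t).
   exact: sq_comp_smooth (smooth2_snd smooth_id).
  by rewrite (den_affine_snd fa 5 _ s t ss') (den_affine_fst _).
 have Z x : x = 0 -> 5 * (5 * x) = 0 :> R by move->; rewrite !mulr0.
 have [t1|t1] := ltP t (2 / 5).
  have z := window_lo t1.
  have E s' t' : [set t : R | t < 2 / 5] t' -> S s' t' = p (As s' * Bt t') by exact: S_lo.
  apply(etrans (Z _ (den_out fa _ us (or_introl z)))).
  rewrite (den_ext_snd a s S_smooth (@open_lt R _) t1 E).
  by rewrite den_path.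
 have [t2|t2] := ltP (3 / 5) t.
  have z := window_hi t2.
  have E s' t' : [set t : R | 3 / 5 < t] t' -> S s' t' = p (As s' * Bt t') by exact: S_hi.
  apply(etrans (Z _ (den_out fa _ us (or_intror z)))).
  rewrite (den_ext_snd a s S_smooth (@open_gt R _) t2 E).
  by rewrite den_path.
 have t2' := window_mid t2.
 rewrite (den_ext_snd a s S_smooth open_mid (mid_window t1 t2') (fun s' _ H => S_mid _ H)).
 have [s1|s1] := ltP s (4 / 5).
  have E' s' t' : [set s : R | s < 4 / 5] s' -> G s' t' = u (5 * s' - 2) (5 * t' - 2).
   move=> /= s1'; rewrite /G; case: leP => // s2; rewrite AsE; last exact: ltW.
   have s3 := window_hi (window_57 s2); by rewrite (u_right _ s3) (proj2 pf).
  by rewrite (den_ext_fst a t _ _ _ E').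
 have z := window_hi' s1.
 apply(etrans (Z _ (den_side fa _ su (or_intror z)))).
 have s1' := window_hi'' s1.
 have E' s' t' : [set s : R | 7 / 10 < s] s' -> G s' t' = p (As s').
  by move=> s2; rewrite /G leNgt s2.
 rewrite (den_ext_fst a t G_smooth (@open_gt R _) s1' E').
 by rewrite (den_path _ s t _ (smooth2_fst _)).
apply: etrans (eq_int (fun t _ => E t)).
rewrite intZ; last exact: continuous_affine.
by rewrite (affine_window _ (fun t => @den_out _ _ _ _ a _ u p p _ t _)).
Qed.

End Close.

Section Torus.
Variables (Phi : R -> M -> M) (x0 : M) (p : R -> M).
Hypotheses (Phs : smooth_family A Phi) (ps : smooth_path A p).
Hypotheses (Ph0 : forall t, t <= 0 -> Phi t = id) (Ph1 : forall t, 1 <= t -> Phi t = id).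
Hypotheses (p0 : p 0 = x0) (p1 : p 1 = x0).

Definition orbit_path (t : R) : M := Phi t x0.

Definition cylinder (s t : R) : M := Phi t (p s).

(** At t = 0 the orbit is run before [p], at t = 1 after it; in between, the window of the orbit
    slides across that of [p]. This is the homotopy by which the orbit commutes with [p]. *)
Definition comm_square (s t : R) : M :=
 Phi (5 * s + - 4 * step t) (p (5 * s - 2)).

Lemma smooth2_sq (f : R -> R -> R) (g : R -> R -> R) : smooth2 f -> smooth2 g ->
 smooth_sq A (fun s t => Phi (f s t) (p (g s t))).
move=> fs gs; apply(family_comp openT Phs fs).
exact: sq_path_smooth (proj1 ps) _.
Qed.

Lemma orbit_smooth : smooth_path A orbit_path.
split.
 apply(family_comp openT Phs (smooth_coord 0 0 openT)); exact: smooth_to_cst openT.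
by split=> t t0; rewrite /orbit_path; [rewrite (Ph0 t0) Ph0|rewrite (Ph1 t0) Ph1].
Qed.

Lemma cylinder_smooth : smooth_sq A cylinder.
exact: smooth2_sq (smooth2_snd smooth_id) (smooth2_fst smooth_id). Qed.

Let commuting_fun_smooth : smooth2 (fun s t : R => 5 * s + - 4 * step t).
have h := smooth2D (smooth2_fst (smooth_scale 5)) (smooth2M (smooth2_fst (smooth_cst (- 4) openT)) (smooth2_snd (@step_smooth R))).
exact: h.
Qed.

Lemma orbit_path0 : orbit_path 0 = x0. Proof. by rewrite /orbit_path Ph0. Qed.
Lemma orbit_path1 : orbit_path 1 = x0. Proof. by rewrite /orbit_path Ph1. Qed.

Lemma comm_squareP : square A comm_square
 (cat3 orbit_path p (fun=> x0)) (cat3 (fun=> x0) p orbit_path).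
have [of_ pf] := (proj2 orbit_smooth, proj2 ps); have [pf0 pf1] := pf.
have cf : flat (fun _ : R => x0) by split.
have e1 : orbit_path 1 = p 0 by rewrite orbit_path1.
have e2 : p 1 = orbit_path 0 by rewrite orbit_path0.
have c0 : cat3 orbit_path p (fun=> x0) 0 = x0 by rewrite (cat3_0 _ of_ pf e1) orbit_path0.
have c1 : cat3 orbit_path p (fun=> x0) 1 = x0 by rewrite cat3_end.
have st t := step_itv (R := R) t.
split; [split|].
- exact: smooth2_sq (smooth2_fst (smooth_affine 5 _)).
- move=> s t t0; rewrite /comm_square (step0 t0) mulr0 addr0.
 have [s1|s1] := ltP s (2 / 5).
  by rewrite (cat3_1 _ of_ pf e1 s1) pf0 ?p0 //; lra.
 have [s2|s2] := ltP s (4 / 5).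
  rewrite cat3_2 ?Ph1 //; lra.
 rewrite cat3_3 ?Ph1 ?pf1 //; lra.
- move=> s t t0; rewrite /comm_square (step1 t0) mulr1.
 have [s1|s1] := ltP s (2 / 5).
  rewrite (cat3_1 _ cf pf (esym p0) s1) pf0 ?Ph0 //; lra.
 have [s2|s2] := ltP s (4 / 5).
  rewrite cat3_2 ?Ph0 //; lra.
 rewrite (cat3_3 _ _ _ e2) ?pf1 ?p1 //; lra.
- move=> s t s0; rewrite c0 /comm_square pf0; last lra.
 rewrite Ph0 //; have := st t; lra.
- move=> s t s0; have := st t => stt; rewrite /comm_square !pf1; [|lra..].
 rewrite !Ph1 //; lra.
- move=> t; have := st t => stt; rewrite c1 /comm_square pf1; last lra.
 rewrite Ph1 //; lra.
Qed.

Lemma den_cylinder_side s t : s < 0 \/ 1 < s -> den a cylinder s t = 0.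
have oc := proj1 orbit_smooth; have [pf0 pf1] := proj2 ps.
move=> [s0|s0].
 have E s' t' : [set s : R | s < 0] s' -> cylinder s' t' = orbit_path t'.
  by move=> /ltW s1; rewrite /cylinder pf0 // p0.
 rewrite (den_ext_fst a t cylinder_smooth (@open_lt R _) s0 E).
 exact(den_path fa s t oc (smooth2_snd smooth_id)).
have E s' t' : [set s : R | 1 < s] s' -> cylinder s' t' = orbit_path t'.
 by move=> /ltW s1; rewrite /cylinder pf1 // p1.
rewrite (den_ext_fst a t cylinder_smooth (@open_gt R _) s0 E).
exact(den_path fa s t oc (smooth2_snd smooth_id)).
Qed.

Lemma den_cylinder_out s t : t < 0 \/ 1 < t -> den a cylinder s t = 0.
move=> [s0|s0].
 have E s' t' : [set s : R | s < 0] t' -> cylinder s' t' = p s'.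
  by move=> /ltW s1; rewrite /cylinder Ph0.
 rewrite (den_ext_snd a s cylinder_smooth (@open_lt R _) s0 E).
 exact(den_path fa s t (proj1 ps) (smooth2_fst smooth_id)).
have E s' t' : [set s : R | 1 < s] t' -> cylinder s' t' = p s'.
 by move=> /ltW s1; rewrite /cylinder Ph1.
rewrite (den_ext_snd a s cylinder_smooth (@open_gt R _) s0 E).
exact(den_path fa s t (proj1 ps) (smooth2_fst smooth_id)).
Qed.

Lemma vanish_closure (f : R -> R) : continuous f -> (forall t, t < 0 \/ 1 < t -> f t = 0) ->
 forall t, t <= 0 \/ 1 <= t -> f t = 0.
move=> fc H t; rewrite !le_eqVlt => -[/predU1P[->|t0]|/predU1P[<-|t0]].
- by apply(cont_vanish fc); left => s s0; apply: H; left.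
- by apply: H; left.
- by apply(cont_vanish fc); right => s s0; apply: H; right.
- by apply: H; right.
Qed.

(** For s between 1/5 and 4/5 the argument [5 * s + - 4 * step t] sweeps the interval
    [5 s - 4, 5 s], which contains [0, 1]; the whole integral of [g] is collected. *)
Lemma int_step_window (g : R -> R) (s : R) : continuous g ->
 (forall t, t <= 0 \/ 1 <= t -> g t = 0) -> 1 / 5 <= s <= 4 / 5 ->
 \i[0, 1] t, (4 * (deriv1 step t * g (5 * s + - 4 * step t))) =
 \i[0, 1] t, g t.
move=> gc g0 s1.
have sd t : is_deriv t step (deriv1 step t).
 exact: smooth_dd step_smooth I.
have dsc : continuous (fun t => deriv1 step t).
 by move=> t; have := smooth_D (1 : R^o) step_smooth => /(_ 0); apply.
pose h (x : R) := 4 * g (5 * s + - 4 * x).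
have hc : continuous h.
 move=> x; apply: cvgM; first exact: cvg_cst.
 apply: (@continuous_comp R); last exact: gc.
 apply: cvgD; [exact: cvg_cst|apply: cvgM; [exact: cvg_cst|exact: cvg_id]].
have lb t : 0 <= t <= 1 -> -1 < step t.
 move=> _; rewrite (lt_le_trans _ (step_ge0 t)) //.
have s01 : step 0 <= step 1 by rewrite (step0 (lexx 0)) step1.
have := int_subst ler01 hc dsc sd lb s01.
rewrite (step0 (lexx 0)) (step1 (lexx 1)) => E.
have c4 : 0 <= 4 :> R by lra.
have d4 : 5 * s - 4 <= 0 by lra.
have cd : 1 <= 4 + (5 * s - 4) by lra.
apply: etrans (affine_window gc g0 c4 d4 cd).
have kc : continuous (fun x : R => 4 * g (4 * x + (5 * s - 4))) by exact: continuous_affine.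
apply: etrans (int_rev kc).
apply: etrans (etrans E _).
 by apply: eq_int => t; rewrite /h mulrCA.
apply: eq_int => t _; congr (_ * g _); ring.
Qed.

(** [comm_square] is the cylinder composed with a map of the plane whose Jacobian is -20 times the
    derivative of the step at t. For s outside [1/5, 4/5] the first argument leaves [0, 1] and both
    densities vanish. *)
Lemma area_commuting_square : area a comm_square = - area a cylinder.
have ks := cylinder_smooth; have ic := inner_cont fa ks.
pose J s := \i[0, 1] t, den a cylinder s t.
have J0 : forall s, s <= 0 \/ 1 <= s -> J s = 0.
 apply(vanish_closure ic) => s s0; rewrite /J (@eq_int _ _ (fun=> 0)).
  by rewrite /Rintegral integral0.
 move=> t _; exact: den_cylinder_side.
have D s t : den a comm_square s t = - 5 *
  (4 * (deriv1 step t * den a cylinder (5 * s - 2) (5 * s + - 4 * step t))).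
 have fs := smooth_affine (R := R) 5 (- 2).
 rewrite (den_comp fa s t ks (smooth2_fst fs) commuting_fun_smooth).
 have [-> ->] := pd_fst s t fs; rewrite D1_affine mul0r subr0.
 have gs : smooth_fun [set: R^o] (fun t : R^o => - 4 * step t).
  apply: smoothM; [exact: openT|exact: smooth_cst openT|exact: step_smooth].
 have -> : pd1 (fun s t => 5 * s + - 4 * step t) s t = - 4 * deriv1 step t.
  have [_ ->] := pdD s t (smooth2_fst (smooth_scale 5)) (smooth2_snd gs).
  have [_ ->] := pd_fst s t (smooth_scale 5).
  have [_ ->] := pd_snd s t gs.
  rewrite add0r.
  have [] // := is_deriveZ (- 4) (smooth_dd (1 : R^o) step_smooth (I : setT t)).
 ring.
have c0 : 0 <= 5 :> R by lra.
have d0 : - 2 <= 0 :> R by lra.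
have cd : 1 <= 5 - 2 :> R by lra.
apply: etrans (congr1 -%R (affine_window ic J0 c0 d0 cd)).
have jc : continuous (fun s : R => 5 * J (5 * s - 2)) by exact: continuous_affine.
apply: etrans (intN 0 1 jc); apply: eq_int => s _.
have kc := @den_cont_snd _ _ _ _ a fa _ (5 * s - 2) ks.
have k0 : forall t, t <= 0 \/ 1 <= t -> den a cylinder (5 * s - 2) t = 0.
 apply(vanish_closure kc) => t; exact: den_cylinder_out.
have wc : continuous (fun t : R => 4 * (deriv1 step t * den a cylinder (5 * s - 2) (5 * s + - 4 * step t))).
 move=> t; apply: cvgM; first exact: cvg_cst.
 apply: cvgM; first by have := smooth_D (1 : R^o) step_smooth => /(_ 0); apply.
 apply: (@continuous_comp R R R (fun t => 5 * s + - 4 * _)); last exact: kc.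
 apply: cvgD; first exact: cvg_cst.
 apply: cvgM; [exact: cvg_cst|exact: smooth_cont step_smooth I].
apply(etrans (eq_int (fun t _ => D s t))).
apply(etrans (intZ 0 1 _ wc)); rewrite mulNr; congr (- _ _).
have [s1|s1] := boolP (1 / 5 <= s <= 4 / 5).
 exact: int_step_window.
have ss : 5 * s - 2 < 0 \/ 1 < 5 * s - 2.
 move: s1; lra.
have z t : 4 * (deriv1 step t * den a cylinder (5 * s - 2) (5 * s + - 4 * step t)) = 0.
 by rewrite den_cylinder_side // !mulr0.
have z' t : den a cylinder (5 * s - 2) t = 0 by rewrite den_cylinder_side.
by rewrite (eq_int (fun t _ => z t)) /J (eq_int (fun t _ => z' t)).
Qed.

End Torus.
End SphereTorus.

(** * Monodromy of abstract states along a homotopy *)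

Section Grid.
Context {R : realType} {M : topologicalType}.
(** [Inn s V] places the state [s] in [V], and [Near W] says that two states are related by a move
    inside [W]. [near_ex] continues a state along a connected set, and [near_uniq] says that two
    states in the small set [V] that are near in a good set around it are already near in [V]. *)
Variables (S : Type) (Near : set M -> S -> S -> Prop) (Inn : S -> set M -> Prop).
Variable (Good : set M -> Prop).
Hypothesis near_mono : forall W W' s s', W `<=` W' -> Near W s s' -> Near W' s s'.
Hypothesis near_refl : forall V s, Inn s V -> Near V s s.
Hypothesis near_sym : forall W s s', Near W s s' -> Near W s' s.
Hypothesis near_trans : forall W s1 s2 s3, Near W s1 s2 -> Near W s2 s3 -> Near W s1 s3.
Hypothesis near_ex : forall K W V V' x y s, connected K -> open W -> K `<=` W -> K x -> K y ->
 Good V -> V x -> V `<=` W -> Good V' -> V' y -> V' `<=` W -> Inn s V ->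
 exists2 s', Inn s' V' & Near W s s'.
Hypothesis near_uniq : forall O V s s', Good O -> Good V -> V `<=` O -> Inn s V -> Inn s' V ->
 Near O s s' -> Near V s s'.
Hypothesis good_open : forall V, Good V -> open V.
Hypothesis good_base : forall x W, open W -> W x -> exists V, [/\ Good V, V x & V `<=` W].

Variable H : R * R -> M.
Hypothesis Hc : {within `[0, 1] `*` `[0, 1], continuous H}.
Let K2 : set (R * R) := `[0, 1] `*` `[0, 1].

Let Hnear z O : K2 z -> open O -> O (H z) ->
 exists2 d : R, 0 < d & forall z', K2 z' -> `|z'.1 - z.1| < d -> `|z'.2 - z.2| < d -> O (H z').
move=> Kz oO Oz; have := iffLR (subspace_continuousP _ _) Hc z Kz.
have nO : nbhs (H z) O by exact: open_nbhs_nbhs.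
move/(_ _ nO); rewrite -nbhs_ballE => -[d /= d0 dB].
exists d => // z' Kz' z1 z2; apply(dB) => //.
by split; rewrite /ball /= distrC.
Qed.

Let K2_compact : compact K2.
apply: compact_setX; exact: segment_compact. Qed.

(** Lebesgue number for the cover of the image of [H] by good sets, from compactness of the unit
    square with a mesh index going to infinity. *)
Let grid_cells : exists N : nat, forall z, K2 z -> exists O, Good O /\
 forall z', K2 z' -> `|z'.1 - z.1| <= N.+1%:R^-1 -> `|z'.2 - z.2| <= N.+1%:R^-1 -> O (H z').
pose P n z := exists O, Good O /\
 forall z', K2 z' -> `|z'.1 - z.1| <= n.+1%:R^-1 -> `|z'.2 - z.2| <= n.+1%:R^-1 -> O (H z').
have C := iffLR (compact_near_coveringP _) K2_compact _ \oo P.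
have C' : forall x, K2 x -> \forall x' \near x & i \near \oo, P i x'.
 move=> x Kx; have [Q [gO Ox _]] := good_base openT (I : _ (H x)).
 have [d d0 dP] := Hnear Kx (good_open gO) Ox.
 have d2 : 0 < d / 2 by rewrite divr_gt0.
 exists (ball x (d / 2), [set n | n.+1%:R^-1 < d / 2]) => /=.
  split; first exact: nbhsx_ballx.
  exact: near_infty_natSinv_lt (PosNum _).
 move=> [x' n] [/= [b1 b2] nd]; exists Q; split => // z' Kz' z1 z2.
 rewrite /ball /= in b1 b2; apply: dP => //.
  apply: le_lt_trans (ler_distD x'.1 _ _) _; rewrite (splitr d).
  by apply: ler_ltD; [exact: le_trans (ltW nd)|rewrite distrC].
 apply: le_lt_trans (ler_distD x'.2 _ _) _; rewrite (splitr d).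
 by apply: ler_ltD; [exact: le_trans (ltW nd)|rewrite distrC].
have [N _ NP] := C _ C'.
exists N => z; exact: (NP N (leqnn N)).
Qed.

Let image_connected (g : R -> R * R) a b : continuous g -> (forall t, a <= t <= b -> K2 (g t)) ->
 connected ((fun t => H (g t)) @` `[a, b]).
move=> gc gK; apply: connected_continuous_connected; first exact: segment_connected.
apply/subspace_continuousP => t tab; have tK t' : `[a, b]%classic t' -> K2 (g t').
 by rewrite /= => /gK.
move=> Q; rewrite nbhsE => -[Q' [oQ Qt] QQ]; rewrite nbhs_filterE /within /=.
have [d d0 dP] := Hnear (tK t tab) oQ Qt.
have B : _ t _ := gc t _ (nbhsx_ballx _ d d0).
apply: filterS B => t' [b1 b2] tab'; apply: QQ.
apply: dP; [exact: tK|rewrite distrC; exact: b1|rewrite distrC; exact: b2].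
Qed.

Let row_connected s a b : 0 <= s <= 1 -> 0 <= a -> b <= 1 ->
 connected ((fun t => H (s, t)) @` `[a, b]).
move=> s01 a0 b1; apply(image_connected (g := fun => _)) => [t|t /andP[a1 b2]].
 exact: (@cvg_pair _ _ _ _ (nbhs s) (nbhs t) _ _ _ _ id (cvg_cst s) cvg_id).
by split; rewrite /= in_itv /= // (le_trans a0 a1) (le_trans b2).
Qed.

Let column_connected t a b : 0 <= t <= 1 -> 0 <= a -> b <= 1 ->
 connected ((fun s => H (s, t)) @` `[a, b]).
move=> t01 a0 b1; apply: image_connected => [s|s /andP[a1 b2]].
 exact: (@cvg_pair _ _ _ _ _ (nbhs t) _ _ _ id _ cvg_id (cvg_cst t)).
by split; rewrite /= in_itv /= // (le_trans a0 a1) (le_trans b2).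
Qed.

Variable x0 : M.
Hypothesis Hside : forall s : R, 0 <= s <= 1 -> H (s, 0) = x0 /\ H (s, 1) = x0.

(* Lifts along the bottom and the top row of a sufficiently fine grid that
  start at the same state end at the same state, up to a small move. *)
Lemma grid_monodromy : exists (N : nat) (O0 O1 : nat -> set M) (V : M -> set M),
 [/\ forall k, (k <= N)%N -> [/\ Good (O0 k), Good (O1 k) &
   forall t : R, k%:R / N.+1%:R <= t <= k.+1%:R / N.+1%:R -> O0 k (H (0, t)) /\ O1 k (H (1, t))],
   forall x, Good (V x) /\ V x x &
   forall f g : nat -> S,
   (forall k, (k <= N.+1)%N -> Inn (f k) (V (H (0, k%:R / N.+1%:R))) /\
   Inn (g k) (V (H (1, k%:R / N.+1%:R)))) ->
   (forall k, (k <= N)%N -> Near (O0 k) (f k) (f k.+1) /\ Near (O1 k) (g k) (g k.+1)) ->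
   f 0%N = g 0%N -> Near (V x0) (f N.+1) (g N.+1)].
have [N NP] := grid_cells; pose q (k : nat) : R := k%:R / N.+1%:R.
have N0 : 0 < N.+1%:R :> R by [].
have q0 k : 0 <= q k by rewrite divr_ge0.
have q1 k : (k <= N.+1)%N -> q k <= 1 by move=> kN; rewrite ler_pdivrMr // mul1r ler_nat.
have q01 k : (k <= N.+1)%N -> 0 <= q k <= 1 by move=> kN; rewrite q0 q1.
have qS k : q k.+1 - q k = N.+1%:R^-1 by rewrite /q -mulrBl -natrB // subSnn mul1r.
have qK j k : (j <= N.+1)%N -> (k <= N.+1)%N -> K2 (q j, q k).
 by move=> jN kN; split; rewrite /= in_itv /= q01.
pose Ocell j k := xget setT [set O | Good O /\ forall z', K2 z' ->
  `|z'.1 - q j| <= N.+1%:R^-1 -> `|z'.2 - q k| <= N.+1%:R^-1 -> O (H z')].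
have OcellP j k : (j <= N)%N -> (k <= N)%N -> Good (Ocell j k) /\ forall s t : R,
  q j <= s <= q j.+1 -> q k <= t <= q k.+1 -> Ocell j k (H (s, t)).
 move=> jN kN; have [Q OP] := NP _ (qK j k (leqW jN) (leqW kN)).
 have : [set O | Good O /\ forall z', K2 z' -> `|z'.1 - q j| <= N.+1%:R^-1 ->
   `|z'.2 - q k| <= N.+1%:R^-1 -> O (H z')] (Ocell j k) by apply: xgetPex; exists Q.
 move=> [gO OP']; split => // s t /andP[s1 s2] /andP[t1 t2]; apply: OP' => /=.
 - split; rewrite /= in_itv /=.
   by rewrite (le_trans (q0 j) s1) (le_trans s2) // q1.
  by rewrite (le_trans (q0 k) t1) (le_trans t2) // q1.
 - by rewrite -(qS j) ger0_norm ?subr_ge0 // lerD2r.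
 - by rewrite -(qS k) ger0_norm ?subr_ge0 // lerD2r.
(* Only finitely many cells are involved, so a good neighbourhood of [x] fits into all those that
   contain [x]. *)
have VP x : exists V, [/\ Good V, V x & forall j k, (j <= N)%N -> (k <= N)%N -> Ocell j k x -> V `<=` Ocell j k].
 pose B := [set y | forall j k : 'I_N.+1, Ocell j k x -> Ocell j k y].
 have nB : nbhs x B.
  apply: filter_forall => j; apply: filter_forall => k.
  have [Ox|Ox] := pselect (Ocell j k x); last by near=> y => /Ox.
  have : nbhs x (Ocell j k).
   by apply: open_nbhs_nbhs; split => //; apply: good_open; have [] := OcellP j k (ltn_ord j) (ltn_ord k).
  by apply: filterS.
 have [V [gV Vx VB]] := good_base (@open_interior _ B) nB.
 exists V; split => // j k jN kN Ox y /VB/interior_subset By.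
 exact: (By (Ordinal (jN : j < N.+1)%N) (Ordinal (kN : k < N.+1)%N)).
pose V x := projT1 (cid (VP x)).
have VP2 x : [/\ Good (V x), V x x & forall j k, (j <= N)%N -> (k <= N)%N -> Ocell j k x -> V x `<=` Ocell j k].
 by rewrite /V; case: cid.
pose h j k := H (q j, q k).
have qle k : q k <= q k.+1 by rewrite -subr_ge0 qS invr_ge0.
have VO j k a b : (a <= N)%N -> (b <= N)%N -> (a == j) || (a.+1 == j) -> (b == k) || (b.+1 == k) ->
  V (h j k) `<=` Ocell a b.
 move=> aN bN aj bk; have [_ _ VO] := VP2 (h j k); apply: VO => //.
 have [_ OP] := OcellP a b aN bN; apply: OP.
  by case/orP: aj => /eqP <-; rewrite lexx ?qle.
 by case/orP: bk => /eqP <-; rewrite lexx ?qle.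
exists N, (Ocell 0%N), (Ocell N), V; split.
- move=> k kN; have [g0 O0] := OcellP 0%N k isT kN; have [gN ON] := OcellP N k (leqnn N) kN.
 split => // t tk; split; [apply: O0 => //|apply: ON => //].
  by have := q0 1%N; rewrite /q mul0r lexx.
 have E : q N.+1 = 1 by rewrite /q divff // gt_eqF.
 by rewrite -E lexx qle.
- by move=> x; have [] := VP2 x.
move=> f g fgV fgO fg0.
have q00 : q 0%N = 0 by rewrite /q mul0r.
have h0 j : (j <= N.+1)%N -> h j 0%N = x0.
 by move=> jN; rewrite /h {2}/q mul0r; have [-> _] := Hside (q01 j jN).
have E1 : q N.+1 = 1 by rewrite /q divff // gt_eqF.
have hN j : (j <= N.+1)%N -> h j N.+1 = x0.
 by move=> jN; rewrite /h E1; have [_ ->] := Hside (q01 j jN).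
(* Two lifts of row j that start together stay together. *)
have ladder0 j (a b : nat -> S) : (j <= N)%N -> forall j', (j' <= N.+1)%N -> (j == j') || (j.+1 == j') ->
  (forall k, (k <= N.+1)%N -> Inn (a k) (V (h j' k)) /\ Inn (b k) (V (h j' k))) ->
  (forall k, (k <= N)%N -> Near (Ocell j k) (a k) (a k.+1) /\ Near (Ocell j k) (b k) (b k.+1)) ->
  a 0%N = b 0%N -> forall k, (k <= N.+1)%N -> Near (V (h j' k)) (a k) (b k).
 move=> jN j' jN' jj' ab1 ab2 ab0; elim=> [|k IH] kN.
  by rewrite -ab0; apply: near_refl; have [] := ab1 0%N kN.
 have [a1 b1] := ab2 k kN.
 have [gO _] := OcellP j k jN kN; have [gV _ _] := VP2 (h j' k.+1).
 have [ia ib] := ab1 _ kN.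
 apply: (near_uniq gO gV _ ia ib); first by apply: VO => //; rewrite eqxx orbT.
 apply: near_trans b1; apply: near_trans (near_sym a1) _.
 by apply: near_mono (IH (ltnW kN)); apply: VO => //; rewrite eqxx.
(* Lifts of the consecutive rows j and j + 1 stay near each other in the cells between these
   rows. *)
have ladder j (a b : nat -> S) : (j <= N)%N ->
  (forall k, (k <= N.+1)%N -> Inn (a k) (V (h j k)) /\ Inn (b k) (V (h j.+1 k))) ->
  (forall k, (k <= N)%N -> Near (Ocell j k) (a k) (a k.+1) /\ Near (Ocell j k) (b k) (b k.+1)) ->
  a 0%N = b 0%N -> forall k, (k <= N)%N -> Near (Ocell j k) (a k) (b k) /\ Near (Ocell j k) (a k.+1) (b k.+1).
 move=> jN ab1 ab2 ab0.
 have step k : (k <= N)%N -> Near (Ocell j k) (a k) (b k) -> Near (Ocell j k) (a k.+1) (b k.+1).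
  move=> kN abk; have [a1 b1] := ab2 k kN.
  by apply: near_trans b1; apply: near_trans abk; exact: near_sym.
 elim=> [|k IH] kN.
  have ab : Near (Ocell j 0%N) (a 0%N) (b 0%N).
   rewrite -ab0; apply: near_mono (near_refl (proj1 (ab1 0%N isT))).
   by apply: VO => //; rewrite eqxx.
  by split => //; exact: step.
 have [_ IH2] := IH (ltnW kN).
 suff ab : Near (Ocell j k.+1) (a k.+1) (b k.+1) by split => //; exact: step.
 have kN' : (k <= N)%N by exact: ltnW.
 have [gk Ok] := OcellP j k jN kN'; have [gk1 Ok1] := OcellP j k.+1 jN kN.
 have [gV Vx _] := VP2 (h j k.+1); have [gV' Vx' _] := VP2 (h j.+1 k.+1).
 (* The grid edge shared by cells k and k + 1. The state of the lower row is continued along it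
    inside both cells; uniqueness at the far end identifies the result with the state of the upper
    row, so nearness passes to the next cell. *)
 pose K := (fun s => H (s, q k.+1)) @` `[q j, q j.+1].
 have Kc : connected K by apply: column_connected; [exact: q01|exact: q0|exact: q1].
 pose W := Ocell j k `&` Ocell j k.+1.
 have oW : open W by apply: openI; exact: good_open.
 have KW : K `<=` W.
  have h1 : q k <= q k.+1 <= q k.+1 by rewrite lexx qle.
  have h2 : q k.+1 <= q k.+1 <= q k.+2 by rewrite lexx qle.
  move=> y [s]; rewrite /= in_itv /= => sj <-.
  by split; [exact: Ok sj h1|exact: Ok1 sj h2].
 have Kx : K (h j k.+1) by exists (q j) => //; rewrite /= in_itv /= lexx qle.
 have Ky : K (h j.+1 k.+1) by exists (q j.+1) => //; rewrite /= in_itv /= lexx qle.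
 have VW : V (h j k.+1) `<=` W.
  by move=> z Vz; split; apply: VO Vz => //; rewrite eqxx ?orbT.
 have VW' : V (h j.+1 k.+1) `<=` W.
  by move=> z Vz; split; apply: VO Vz => //; rewrite eqxx ?orbT.
 have [ia ib] := ab1 k.+1 (leqW kN).
 have [c ic ac] := near_ex Kc oW KW Kx Ky gV Vx VW gV' Vx' VW' ia.
 have bc : Near (Ocell j k) (b k.+1) c.
  apply: near_trans (near_sym IH2) _; apply: near_mono ac; exact: subIsetl.
 have bc' := near_uniq gk gV' (fun z Vz => proj1 (VW' z Vz)) ib ic bc.
 apply: near_trans (near_mono _ ac) _; first exact: subIsetr.
 by apply: near_sym; apply: near_mono bc' => z /VW'[].
(* The lift [a] of row j moves inside the cells on both sides of the row, so that it can be compared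
   with its two neighbours; its end state is still near that of [f]. *)
have rows j : (j <= N.+1)%N -> exists a : nat -> S,
  [/\ forall k, (k <= N.+1)%N -> Inn (a k) (V (h j k)),
   forall i k, (i <= N)%N -> (i == j) || (i.+1 == j) -> (k <= N)%N -> Near (Ocell i k) (a k) (a k.+1),
   a 0%N = f 0%N & Near (V x0) (f N.+1) (a N.+1)].
 elim: j => [|j IH] jN.
  exists f; split => //.
  - by move=> k kN; have [] := fgV k kN; rewrite /h q00.
  - move=> i k iN; rewrite orbF => /eqP -> kN; by have [] := fgO k kN.
  - apply: near_refl; have [+ _] := fgV _ (leqnn N.+1); rewrite -/(q _).
   by rewrite -(hN 0%N isT) /h q00.
 have [a [aV aO a0 aN]] := IH (ltnW jN).
 have ex k s : (k <= N)%N -> Inn s (V (h j.+1 k)) -> exists s', Inn s' (V (h j.+1 k.+1)) /\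
   forall i, (i <= N)%N -> (i == j.+1) || (i.+1 == j.+1) -> Near (Ocell i k) s s'.
  move=> kN si; have [gV Vx _] := VP2 (h j.+1 k); have [gV' Vx' _] := VP2 (h j.+1 k.+1).
  pose W := [set y | forall i : 'I_N.+1, (val i == j.+1) || (i.+1 == j.+1) -> Ocell i k y].
  have oW : open W.
   rewrite openE => y Wy; apply: filter_forall => i.
   have [ij|ij] := boolP ((val i == j.+1) || (i.+1 == j.+1)); last by near=> z.
   have : nbhs y (Ocell i k).
   by apply: open_nbhs_nbhs; split; [apply: good_open; have [] := OcellP i k (ltn_ord i) kN|exact: Wy].
   by apply: filterS.
  pose K := (fun t => H (q j.+1, t)) @` `[q k, q k.+1].
  have Kc : connected K by apply: row_connected; [exact: q01|exact: q0|exact: q1].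
  have KW : K `<=` W.
   move=> y [t]; rewrite /= in_itv /= => tk <- i ij.
   have [_ Oi] := OcellP i k (ltn_ord i) kN; apply: Oi => //.
   by case/orP: ij => /eqP <-; rewrite lexx qle.
  have Kx : K (h j.+1 k) by exists (q k) => //; rewrite /= in_itv /= lexx qle.
  have Ky : K (h j.+1 k.+1) by exists (q k.+1) => //; rewrite /= in_itv /= lexx qle.
  have VW : V (h j.+1 k) `<=` W.
   by move=> z Vz i ij; apply: (VO _ _ _ _ (ltn_ord i) kN ij _ z Vz); rewrite eqxx.
  have VW' : V (h j.+1 k.+1) `<=` W.
   by move=> z Vz i ij; apply: (VO _ _ _ _ (ltn_ord i) kN ij _ z Vz); rewrite eqxx orbT.
  have [s' si' ss'] := near_ex Kc oW KW Kx Ky gV Vx VW gV' Vx' VW' si.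
  exists s'; split => // i iN ij; apply: near_mono ss' => z /(_ (Ordinal (iN : i < N.+1)%N)).
  exact.
 (* Made total, so that the new row can be built by recursion before its invariants are known. *)
 have ex' : forall k s, exists s', (k <= N)%N -> Inn s (V (h j.+1 k)) -> Inn s' (V (h j.+1 k.+1)) /\
   forall i, (i <= N)%N -> (i == j.+1) || (i.+1 == j.+1) -> Near (Ocell i k) s s'.
  move=> k s; have [[kN si]|H'] := pselect ((k <= N)%N /\ Inn s (V (h j.+1 k))).
   by have [s' ss'] := ex k s kN si; exists s'.
  by exists s => kN si; case: H'.
 pose nx k s := projT1 (cid (ex' k s)).
 have nxP k s := projT2 (cid (ex' k s)).
 pose b := fix b k := if k is k'.+1 then nx k' (b k') else f 0%N.
 have bV k : (k <= N.+1)%N -> Inn (b k) (V (h j.+1 k)).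
  elim: k => [|k IHk] kN /=.
   by rewrite h0 // -(h0 j (ltnW jN)) -a0; exact: aV.
  by have [] := nxP k (b k) kN (IHk (ltnW kN)).
 have bO i k : (i <= N)%N -> (i == j.+1) || (i.+1 == j.+1) -> (k <= N)%N -> Near (Ocell i k) (b k) (b k.+1).
  by move=> iN ij kN; have [_] := nxP k (b k) kN (bV k (leqW kN)); apply.
 exists b; split => //.
 have ab := ladder j a b jN.
 have [| | |_ abN] := ab _ _ _ N (leqnn N).
 - by move=> k kN; split; [exact: aV|exact: bV].
 - by move=> k kN; split; [apply: aO => //; rewrite eqxx|apply: bO => //; rewrite eqxx orbT].
 - by rewrite a0.
 apply: near_trans aN _.
 have [gO _] := OcellP j N jN (leqnn N); have [gV _ _] := VP2 x0.
 have iaN : Inn (a N.+1) (V x0) by rewrite -(hN j (ltnW jN)); exact: aV.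
 have ibN : Inn (b N.+1) (V x0) by rewrite -(hN j.+1 jN); exact: bV.
 apply: (near_uniq gO gV _ iaN ibN abN).
 by rewrite -(hN j (ltnW jN)); apply: VO => //; rewrite eqxx ?orbT.
have [a [aV aO a0 aN]] := rows N.+1 (leqnn _).
apply: near_trans aN _; rewrite -(hN N.+1 (leqnn _)).
apply: (ladder0 N a g (leqnn N) N.+1 (leqnn _)) => //.
- by rewrite eqxx orbT.
- move=> k kN; split; first exact: aV.
 by have [_] := fgV k kN; rewrite /h E1.
- move=> k kN; split; first by apply: aO => //; rewrite eqxx orbT.
 by have [] := fgO k kN.
- by rewrite a0.
Unshelve. all: by end_near.
Qed.

End Grid.

(** * Paths from the base point as states *)

Section PathStates.
Context {R m M} {A : atlas R m M}.
Local Notation step := (@smooth_step R).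

Definition good_nbhd (V : set M) : Prop :=
 exists (i : idx A) c r, [/\ 0 < r, good_cell i c r & V = cell i c r].

Lemma good_nbhd_open V : good_nbhd V -> open V.
move=> [i [c [r [_ _ ->]]]]; exact: cell_open. Qed.

Lemma good_nbhd_base x W : open W -> W x -> exists V, [/\ good_nbhd V, V x & V `<=` W].
move=> oW Wx; have dx := chart_at_dom A x; have [r r0 [g sub]] := cell_ex oW Wx dx.
exists (cell (chart_at A x) (chart (chart_at A x) x) r); split => //.
 by exists (chart_at A x), (chart (chart_at A x) x), r.
by split => //; rewrite subrr normr0.
Qed.

(** A convex combination of s and [f s] is at most 0 for s <= 0 and at least 1 for s >= 1, where [p]
    is constant; hence the end points do not move. *)
Lemma reparam_square p (f : R -> R) : smooth_path A p ->
 smooth1 f -> (forall s, s <= 0 -> f s <= 0) ->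
 (forall s, 1 <= s -> 1 <= f s) ->
 square A (fun s t => p (s + step t * (f s - s))) p (fun s => p (f s)).
move=> [ps [p0 p1]] fs f0 f1.
have st t := step_itv (R := R) t.
have L s t : s <= 0 -> s + step t * (f s - s) <= 0.
 move=> s0; have /andP[a b] := st t; have fs0 := f0 s s0.
 have : step t * f s <= 0 by rewrite mulr_ge0_le0.
 have : (1 - step t) * s <= 0 by rewrite mulr_ge0_le0 // subr_ge0.
 lra.
have H s t : 1 <= s -> 1 <= s + step t * (f s - s).
 move=> s1; have /andP[a b] := st t; have fs1 := f1 s s1.
 have : 0 <= step t * (f s - 1) by rewrite mulr_ge0 // subr_ge0.
 have : 0 <= (1 - step t) * (s - 1) by rewrite mulr_ge0 // subr_ge0.
 lra.
split; [split|].
- apply(sq_path_smooth ps); apply: smooth2D; first exact: smooth2_fst smooth_id.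
 apply: smooth2M; first exact: smooth2_snd step_smooth.
 apply: smooth2_fst; apply: smoothB; [exact: openT|exact: fs|exact: smooth_id].
- by move=> s t t0; rewrite step0 // mul0r addr0.
- by move=> s t t0; rewrite step1 // mul1r addrC subrK.
- move=> s t s0; rewrite p0 //; exact: L.
- move=> s t s1; rewrite !p1 //; exact: H.
- move=> t; rewrite p1 //; exact: H.
Qed.

Definition path_in (x0 : M) (p : R -> M) (V : set M) : Prop :=
 [/\ smooth_path A p, p 0 = x0 & V (p 1)].

Definition path_near (W : set M) (p q : R -> M) : Prop :=
 exists u, fsquare A u p q /\ forall t, W (u 1 t).

Lemma path_near_mono W W' p q : W `<=` W' -> path_near W p q -> path_near W' p q.
move=> WW [u []]; exists u; split => // t; exact: WW. Qed.

Lemma path_near_refl x0 V p : path_in x0 p V -> path_near V p p.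
move=> []; exists (fun s t => p s); split => //; exact: fsquare_refl. Qed.

Lemma path_near_sym W p q : path_near W p q -> path_near W q p.
move=> [u [us uW]]; exists (fun s t => u s (1 - t)); split => //.
exact: fsquare_sym.
Qed.

Lemma path_near_trans W p q r : path_near W p q -> path_near W q r -> path_near W p r.
move=> [u [us uW]] [v [vs vW]]; exists (stack u v); split; first exact: fsquare_stack vs.
by move=> t; rewrite /stack; case: ifP.
Qed.

Lemma square_near W p q u : square A u p q -> W (p 1) -> path_near W p q.
by move=> [us uR]; exists u; split => // t; rewrite uR. Qed.

Lemma stretch_square p : smooth_path A p ->
 square A (fun s t => p (s + step t * (5 * s - s))) p (fun s => p (5 * s)).
move=> ps; apply(reparam_square ps (smooth_scale 5)) => s; lra.
Qed.

(** The second square is glued to the moving right edge of the first, with the first two windows of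
    [cat3]. *)
Lemma attach_square (u v : R -> R -> M) p q r s : fsquare A u p q ->
 smooth_sq A v -> (forall a t, a <= 0 -> v a t = u 1 t) ->
 (forall a t, 1 <= a -> v a t = v 1 t) ->
 (forall a t, t <= 0 -> v a t = r a) -> (forall a t, 1 <= t -> v a t = s a) ->
 fsquare A (fun a t => if a <= 3 / 10 then u (5 * a) t else v (5 * a - 2) t)
  (fun a => if a <= 3 / 10 then p (5 * a) else r (5 * a - 2))
  (fun a => if a <= 3 / 10 then q (5 * a) else s (5 * a - 2)).
move=> us vs v0 v1 vr vq; split.
- apply(@smooth_glue _ _ _ A _ (sqmap (fun a t => u (5 * a) t)) (sqmap (fun a t => v (5 * a - 2) t))
  (fun z : 'rV_2 => z 0 0) (1 / 5) _ (2 / 5)).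
 + exact: coord_continuous.
 + by lra.
 + exact: sq_comp_smooth (sq_smooth us) (smooth2_fst (smooth_scale 5)) (smooth2_snd smooth_id).
 + exact: sq_comp_smooth (smooth2_fst (smooth_affine 5 _)) (smooth2_snd smooth_id).
 + move=> z /andP[z1 z2]; rewrite /sqmap (sq_right us); last lra.
  rewrite v0 //; lra.
- move=> t; case: ifP => _; [exact: (sq_bottom us)|exact: vr].
- move=> t; case: ifP => _; [exact: (sq_top us)|exact: vq].
- move=> a t a0; rewrite ifT; last lra.
 rewrite (sq_left us) ?ifT ?mulr0 //; lra.
- move=> a t a0; rewrite ifF; last by apply/negbTE; lra.
 rewrite ifF; last by apply/negbTE; lra.
 rewrite ?v1 //; lra.
Qed.

Lemma path_near_extend p e (W : set M) : smooth_path A p -> smooth_path A e ->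
 e 0 = p 1 -> (forall t, W (e t)) ->
 exists q, [/\ smooth_path A q, q 0 = p 0, q 1 = e 1 & path_near W p q].
move=> ps es e0 eW; have [pc [p0 p1]] := ps; have [ec [e0' e1']] := es.
have [ss ss1] := stretch_square ps.
have rs := fsquare_refl ps.
(* At height t only the part of [e] up to [step t] has been appended, so that the end point runs
   along [e], inside [W]. *)
pose v a t := e (step a * step t).
have vs : smooth_sq A v.
 apply(sq_path_smooth ec); apply: smooth2M.
  exact: smooth2_fst step_smooth.
 exact: smooth2_snd step_smooth.
have v0 a t : a <= 0 -> v a t = p 1 by move=> a0; rewrite /v step0 // mul0r.
have v1 a t : 1 <= a -> v a t = v 1 t.
 by move=> a1; rewrite /v (step1 a1) (step1 (lexx 1)).
have vb a t : t <= 0 -> v a t = p 1 by move=> t0; rewrite /v (step0 t0) mulr0.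
have vt a t : 1 <= t -> v a t = e (step a) by move=> t0; rewrite /v (step1 t0) mulr1.
have F := attach_square rs vs v0 v1 vb vt.
have E : (fun a => if a <= 3 / 10 then p (5 * a) else p 1) = fun a => p (5 * a).
 apply/funext => a; case: leP => // a1; rewrite p1 //; lra.
rewrite E in F.
set q := fun a => if a <= 3 / 10 then _ else _ in F.
exists q; split.
- exact: sq_top_path F.
- by rewrite (sq_start F) mulr0.
- rewrite /q ifF; last by apply/negbTE; lra.
 rewrite step1 //; lra.
- apply(@path_near_trans _ _ (fun a => p (5 * a))).
  by apply(square_near (stretch_square ps)); rewrite -e0.
 eexists; split; first exact: F.
 move=> t /=; rewrite ifF; last by apply/negbTE; lra.
 exact: eW.
Qed.

(** The end of [p] is first brought to [x] inside the convex cell [V], then from [x] to [y] inside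
    [W] by connectedness of [K]; the path is extended by this track. *)
Lemma path_near_ex x0 (K W V V' : set M) x y p : connected K -> open W -> K `<=` W -> K x -> K y ->
 good_nbhd V -> V x -> V `<=` W -> good_nbhd V' -> V' y -> V' `<=` W -> path_in x0 p V ->
 exists2 q, path_in x0 q V' & path_near W p q.
move=> Kc oW KW Kx Ky [i [c [r [_ g VE]]]] Vx VW _ Vy _ [ps p0 pV].
have [e1 [e1s e10 e11 e1W]] : joined (A := A) W (p 1) x.
 rewrite VE in Vx pV VW; have [e [es e0 e1 eW]] := joined_cell g pV Vx.
 exists e; split => // t; exact: VW.
have J : joined (A := A) W (p 1) y.
 apply(@joined_trans _ _ _ _ _ _ x); first by exists e1.
 exact: joined_connected Ky.
have [e [es e0 e1' eW]] := J.
have [q [qs q0 q1 pq]] := path_near_extend ps es e0 eW.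
by exists q => //; split => //; [rewrite q0|rewrite q1 e1'].
Qed.

(* The right edge of a square that stays in a convex chart domain can be
  deformed into any other edge in this domain. *)
Lemma edge_change (u : R -> R -> M) p q e (i : idx A) c r : fsquare A u p q -> good_cell i c r ->
 (forall t, cell i c r (u 1 t)) -> smooth_path A e -> (forall t, cell i c r (e t)) ->
 e 0 = p 1 -> e 1 = q 1 ->
 exists u', fsquare A u' p q /\ forall t, exists t', u' 1 t = e t'.
move=> us g uO es eO e0 e1.
have ps := sq_bottom_path us; have qs := sq_top_path us.
have [ec [ef0 ef1]] := es.
have u1c : smooth_sq A (fun a t => u 1 t).
 exact: sq_comp_smooth (sq_smooth us) (smooth_cst 1 openT) (smooth2_snd smooth_id).
have e1c : smooth_sq A (fun a t => e t) by exact: sq_path_smooth (smooth2_snd smooth_id).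
have chart_smooth f : smooth_sq A (fun a t => f t) -> (forall t, cell i c r (f t)) ->
  smooth_mx [set: 'rV_2] (fun z => chart i (f (z 0 1))).
 move=> [_ /(_ i) fs] fO; apply: smooth_mx_sub fs => z _; split => //.
 by have [] := fO (z 0 1).
pose y t := chart i (u 1 t); pose y' t := chart i (e t).
pose v' a t := param i (y t + step a *: (y' t - y t)).
have inball a t : `|y t + step a *: (y' t - y t) - c| < r.
 by apply: ball_convex; [exact: step_itv|have [] := uO t|have [] := eO t].
have vs : smooth_sq A v'.
 rewrite /smooth_sq /sqmap /v'.
 apply: (smooth_to_comp openT (cod_open i) _ (smooth_to_param i)
  (h := fun z : 'rV[R]_2 => y _ + _ *: _)).
  by move=> z _; apply: g.
 have ys := chart_smooth _ u1c uO; have ys' := chart_smooth _ e1c eO.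
 move=> k l; rewrite ord1.
 apply(smooth_ext openT (f := fun z : 'rV_2 => y (z 0 1) 0 l + step (z 0 0) * (y' (z 0 1) 0 l - y (z 0 1) 0 l))).
  by move=> z; rewrite !mxE.
 apply: smoothD; [exact: openT|exact: ys|].
 apply: smoothM; [exact: openT|exact: smooth_coordc openT step_smooth|].
 apply: smoothB; [exact: openT|exact: ys'|exact: ys].
have v0 a t : a <= 0 -> v' a t = u 1 t.
 by move=> a0; rewrite /v' step0 // scale0r addr0 /y chartK; have [] := uO t.
have v1 a t : 1 <= a -> v' a t = e t.
 by move=> a0; rewrite /v' step1 // scale1r addrC subrK /y' chartK; have [] := eO t.
have vb a t : t <= 0 -> v' a t = p 1.
 move=> t0; rewrite /v' /y /y' (sq_bottom us) // ef0 // e0 subrr scaler0 addr0.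
 by rewrite chartK -e0; have [] := eO 0.
have vt a t : 1 <= t -> v' a t = q 1.
 move=> t0; rewrite /v' /y /y' (sq_top us) // ef1 // e1 subrr scaler0 addr0.
 by rewrite chartK -e1; have [] := eO 1.
have F := attach_square us vs v0 (fun a t a1 => etrans (v1 a t a1) (esym (v1 1 t (lexx 1)))) vb vt.
have E p' : smooth_path A p' -> (fun a => if a <= 3 / 10 then p' (5 * a) else p' 1) = fun a => p' (5 * a).
 move=> [_ [_ p1]]; apply/funext => a; case: leP => // a1; rewrite p1 //; lra.
rewrite (E p ps) (E q qs) in F.
have [s1 r1] := stretch_square ps; have [s2 r2] := stretch_square qs.
eexists; split; first exact: fsquare_stack s1 (fsquare_stack F (fsquare_sym s2)).
have e1E t : u 1 t = u 1 t by [].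
have L : 5 * 1 - 2 >= 1 :> R by lra.
have N : 1 <= 3 / 10 :> R = false by apply/negbTE; lra.
move=> t; rewrite /stack N; case: ifP => _; first by exists 0; rewrite e0.
case: ifP => _; first by eexists; rewrite v1.
by exists 1; rewrite e1.
Qed.

(** The end points are joined by a path inside the convex [V]; [edge_change] in the larger cell [O]
    makes it the new right edge. *)
Lemma path_near_uniq x0 (O V : set M) p q : good_nbhd O -> good_nbhd V -> V `<=` O ->
 path_in x0 p V -> path_in x0 q V -> path_near O p q -> path_near V p q.
move=> [i [c [r [_ g OE]]]] [j [c' [r' [_ g' VE]]]] VO [ps p0 pV] [qs q0 qV] [u [us uO]].
rewrite VE in pV qV VO *; rewrite OE in VO uO.
have [e [es e0 e1 eV]] := joined_cell g' pV qV.
have [u' [us' u'e]] := edge_change us g uO es (fun t => VO _ (eV t)) e0 e1.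
exists u'; split => // t; have [t' ->] := u'e t; exact: eV.
Qed.

(** When the end points coincide, the constant path is an admissible right edge. *)
Lemma path_near_closed V p q : good_nbhd V -> smooth_path A p ->
 path_near V p q -> p 1 = q 1 -> V (p 1) -> exists u, square A u p q.
move=> [i [c [r [_ g VE]]]] ps [u [us uV]] pq pV; rewrite VE in uV pV.
have [u' [us' u'e]] := edge_change us g uV (cst_smooth _) (fun=> pV) erefl pq.
by exists u'; split => // t; have [] := u'e t.
Qed.

End PathStates.

Arguments good_nbhd {R m M} A V.
Arguments path_in {R m M} A x0 p V.
Arguments path_near {R m M} A W p q.

(** * Comparison of the periods of two loops *)

Section LoopComparison.
Context {R m M} {A : atlas R m M}.
Local Notation step := (@smooth_step R).

Lemma alt_col_swap k (b : 'M[R]_(1 + 1, k) -> R) u v : multilinear b -> Defs.alternating b ->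
 b (col_mx u v) = - b (col_mx v u).
move=> bm ba; have <- : xrow (lshift 1 0) (rshift 1 0) (col_mx v u) = col_mx u v.
 apply/matrixP => r c; rewrite mxE; case(splitP r) => r' rE.
  have -> : r = lshift 1 0 by apply: val_inj; rewrite /= rE ord1.
  by rewrite tpermL col_mxEd col_mxEu.
 have -> : r = rshift 1 0 by apply: val_inj; rewrite /= rE ord1.
 by rewrite tpermR col_mxEd col_mxEu.
by rewrite alt_swap.
Qed.

(** Bookkeeping for the stacked square in [line_flux_eq]: [k1] and [k2] are the areas of the two
    cylinders, [u] that of the square between the orbits, [z1] and [z2] those of degenerate squares.
    The two occurrences of [u] have opposite signs. *)
Lemma commutator_sum (T r1 r2 c1 c2 C2 S1 S2 s2 k1 k2 u z1 z2 : R) :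
 T = 0 -> T = c1 + r1 -> r1 = S1 + r2 -> r2 = C2 + S2 -> C2 = - c2 -> S2 = - s2 ->
 c1 = - k1 -> c2 = - k2 -> S1 = z1 + z2 + u -> s2 = u + z2 + z1 -> z1 = 0 -> z2 = 0 ->
 - k1 = - k2.
by lra. Qed.

Section Cylinder.
Variables (Phi : R -> M -> M) (p : R -> M) (a : dform A 2).
Hypotheses (Phs : smooth_family A Phi) (ps : smooth_path A p) (fa : is_form a).

(** In the cylinder the path variable comes first and time second, whereas the fibre integral puts
    time first; the swap produces the sign. *)
Lemma speed_fiber_int s :
 speed p (fiber_int Phi 0 1 a) s = - \i[0, 1] t, den a (cylinder Phi p) s t.
have cs := proj1 ps.
have ks : smooth_sq A (cylinder Phi p) by exact: cylinder_smooth.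
rewrite -intN; last exact: den_cont_snd.
rewrite /speed /pullback mul1mx; set i := chart_at A _; apply: eq_int => t _.
have e : (s%:M : 'rV_1) 0 0 = s by rewrite mxE.
have di : Defs.dom i (curve p s%:M) by exact: chart_at_dom.
pose U := [set: 'rV_2] `&` (fun z : 'rV_2 => p (z 0 0)) @^-1` Defs.dom i.
have pcs : smooth_to A [set: 'rV_2] (fun z => p (z 0 0)).
 exact: curve_comp openT _ (smooth_coord 0 0 openT).
have oU : open U by exact: smooth_to_open openT pcs (dom_open i).
have Uz : U (pt s t) by split => //=; rewrite pt0; move: di; rewrite /curve e.
pose h (z : 'rV_2) := tjoin (z 0 1) (chart i (p (z 0 0))).
have hs : smooth_mx U h.
 apply: smooth_tjoin => //; first exact: smooth_coord.
 by case: pcs => _ /(_ i).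
have hF z : U z -> fam_dom i (h z).
 move=> [_]; rewrite /fam_dom /= tjoinr; exact: chart_cod.
have KE z : U z -> sqmap (cylinder Phi p) z = fam_map Phi i (h z).
 by move=> [_ dz]; rewrite /sqmap /cylinder /fam_map /h tjoin0 tjoinr chartK.
rewrite /den (pullback_ext a 1%:M oU (smooth_to_sub oU openT (fun _ _ => I) ks) KE Uz).
rewrite (pullback_comp a 1%:M oU (fam_open i) (Phs i) hs hF Uz) mul1mx.
have hE : h (pt s t) = tjoin t (chart i (curve p s%:M)) by rewrite /h pt0 pt1 /curve e.
rewrite hE; have [pm pa] := @pullback_ml _ _ _ _ _ (fam_map Phi i) _ a (tjoin t (chart i (curve p s%:M))) fa.
set V := jacobian _ s%:M.
have oW : open ([set: 'rV_1] `&` curve p @^-1` Defs.dom i) by exact: smooth_to_open openT cs (dom_open i).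
have Ws : smooth_mx ([set: 'rV[R]_1] `&` curve p @^-1` Defs.dom i) (chart i \o curve p) by case: cs => _ /(_ i).
have Wz : ([set: 'rV_1] `&` curve p @^-1` Defs.dom i) s%:M by split.
have rowJ r : row r (jacobian h (pt s t)) = tjoin (r == 1)%:R ((r == 0)%:R *: V).
 apply/rowP => l; rewrite rowE -(derive_jacE oU hs _ _ Uz).
 case(splitP l) => l' lE.
  have -> : l = 0 by apply: val_inj; rewrite /= lE ord1.
  rewrite tjoin0 (_ : (fun => _) = fun y : 'rV_2 => y 0 1); last by apply/funext => y; rewrite /h tjoin0.
  have [_ ->] := is_dd_coord (pt s t) (delta_mx 0 r) 1.
  by rewrite mxE eq_sym.
 have -> : l = rshift 1 l' by apply: val_inj.
 rewrite row_mxEr mxE (_ : (fun y => _) = (fun z => (chart i \o curve p) z 0 l') \o fun y : 'rV_2 => (y 0 0)%:M); last first.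
  by apply/funext => y; rewrite /h row_mxEr /= /curve mxE.
 have sM : (pt s t 0 0)%:M = s%:M :> 'rV_1 by rewrite pt0.
 have Wd : derivable (fun z : 'rV_1 => (chart i \o curve p) z 0 l') (pt s t 0 0)%:M (r == 0)%:R%:M.
  rewrite sM; exact: smooth_derivable.
 have Lh c : ((c *: delta_mx 0 r + pt s t) 0 0)%:M = c *: (r == 0)%:R%:M + (pt s t 0 0)%:M :> 'rV_1.
  by apply/rowP => k; rewrite !mxE ord1 !mulr1n eq_sym.
 have [_ ->] := @is_dd_aff R _ _ (fun y : 'rV_2 => (y 0 0)%:M : 'rV_1)
  _ _ _ _ Lh Wd.
 by rewrite sM (derive_jacE oW Ws _ _ Wz) mul_scalar_mx mxE.
have JE : jacobian h (pt s t) = (col_mx (hlift V) tvec : 'M[R]__).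
 apply/row_matrixP => r; rewrite rowJ; case(@splitP 1 1 r) => r' rE.
  have -> : r = lshift 1 r' by apply: val_inj.
  rewrite (@rowKu _ 1) row_hlift ord1 scale1r; congr tjoin.
  by rewrite row_id.
 have -> : r = rshift 1 r' by apply: val_inj.
 by rewrite (@rowKd _ 1) ord1 scale0r; apply/rowP => k; rewrite [RHS]mxE.
by rewrite JE alt_col_swap.
Qed.

Lemma line_fiber_int : line p (fiber_int Phi 0 1 a) = - area a (cylinder Phi p).
have ks : smooth_sq A (cylinder Phi p) by exact: cylinder_smooth.
apply: etrans (intN 0 1 (inner_cont fa ks)).
apply: eq_int => s _; exact: speed_fiber_int.
Qed.

End Cylinder.

Lemma square_rev u p q : square A u p q ->
 square A (fun s t => u (1 - s) t) (rev p) (rev q).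
move=> [us ur]; split; [split|].
- have fs : smooth_fun [set: R^o] (fun t : R^o => 1 - t : R).
  by apply: smooth_ext openT _ (smooth_affine (-1) 1) => t; rewrite mulN1r addrC.
 exact: sq_comp_smooth (sq_smooth us) (smooth2_fst _) (smooth2_snd smooth_id).
- by move=> s t t0; rewrite (sq_bottom us).
- by move=> s t t0; rewrite (sq_top us).
- move=> s t s0; rewrite /rev subr0 (sq_right us) //; lra.
- move=> s t s0; rewrite !(sq_left us) //; lra.
- by move=> t; rewrite /rev subrr (sq_left us).
Qed.

Section Compare.
Variables (w : dform A 2) (Psi1 Phi1 Psi2 Phi2 : R -> M -> M) (x0 : M).
Hypotheses (F1 : flow_pair w Psi1 Phi1) (F2 : flow_pair w Psi2 Phi2).

(** A path from [x0] to the point [Psi t x0] that follows the inverse flow. Its end point traces the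
    orbit under Psi, whose homotopy is given, while at t = 1 it is the reversed orbit under Phi,
    which is the orbit that the periods involve. *)
Definition flow_state (Psi Phi : R -> M -> M) (t s : R) : M :=
 Phi (t * (1 - step s)) (Psi t x0).

Lemma flow_state_near Psi Phi (W : set M) t t' : flow_pair w Psi Phi -> t <= t' ->
 (forall r, t <= r <= t' -> W (Psi r x0)) ->
 path_near A W (flow_state Psi Phi t) (flow_state Psi Phi t').
move=> F tt'; exists (fun s r => flow_state Psi Phi (t + step r * (t' - t)) s); split.
 split.
 - have fs : smooth2 (fun s r => t + step r * (t' - t)).
   apply: smooth2D; first exact: smooth_cst openT.
   apply: smooth2M; first exact: smooth2_snd step_smooth.
   exact: smooth_cst openT.
  have gs : smooth2 (fun s r => (t + step r * (t' - t)) * (1 - step s)).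
   apply: smooth2M => //; apply: smooth2_fst; apply: smoothB; [exact: openT|exact: smooth_cst openT|exact: step_smooth].
  apply(family_comp openT (inv_smooth F) gs).
  apply(family_comp openT (flow_smooth F) fs); exact: smooth_to_cst openT.
 - by move=> s r r0; rewrite step0 // mul0r addr0.
 - by move=> s r r1; rewrite step1 // mul1r addrC subrK.
 - by move=> s r s0; rewrite /flow_state (step0 s0) (step0 (lexx 0)) subr0 !mulr1 !(flowK F).
 - by move=> s r s1; rewrite /flow_state (step1 s1) (step1 (lexx 1)).
move=> r; rewrite /flow_state (step1 (lexx 1)) subrr mulr0 (flow_inv0 F (lexx 0)).
apply: H; have /andP[a b] := step_itv r.
have : 0 <= step r * (t' - t) by rewrite mulr_ge0 // subr_ge0.
have : 0 <= (1 - step r) * (t' - t) by rewrite mulr_ge0 // subr_ge0.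
lra.
Qed.

Lemma flow_state_in Psi Phi (V : set M) t : flow_pair w Psi Phi -> V (Psi t x0) ->
 path_in A x0 (flow_state Psi Phi t) V.
move=> F Vt; split.
- have [u [us _]] := @flow_state_near _ _ setT t t F (lexx t) (fun _ _ => I).
 exact: sq_bottom_path us.
- by rewrite /flow_state step0 // subr0 mulr1 (flowK F).
- by rewrite /flow_state step1 // subrr mulr0 (flow_inv0 F).
Qed.

Lemma orbit_flow_state Psi Phi : flow_pair w Psi Phi -> exists u,
 square A u (orbit_path Phi x0) (rev (flow_state Psi Phi 1)).
move=> F; pose f s := 1 - step (1 - s).
have os := orbit_smooth x0 (inv_smooth F) (fun => flow_inv0 F) (fun => flow_inv1 F).
have fs : smooth1 f.
 apply: smoothB; [exact: openT|exact: smooth_cst openT|].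
 apply(smooth_comp1 openT openT (fun _ _ => I) step_smooth).
 by apply: smooth_ext openT _ (smooth_affine (-1) 1) => t; rewrite mulN1r addrC.
have f0 s : s <= 0 -> f s <= 0 by move=> s0; rewrite /f step1; lra.
have f1 s : 1 <= s -> 1 <= f s by move=> s0; rewrite /f step0; lra.
have := reparam_square os fs f0 f1.
rewrite (_ : (fun s => _) = rev (flow_state Psi Phi 1)); first by move=> s; eexists; exact: s.
by apply/funext => s; rewrite /rev /flow_state mul1r (flow1 F).
Qed.

Variable H : R * R -> M.
Hypothesis Hc : {within `[0, 1] `*` `[0, 1], continuous H}.
Hypothesis Hside : forall s : R, 0 <= s <= 1 -> H (s, 0) = x0 /\ H (s, 1) = x0.
Hypothesis Hrows : forall t : R, 0 <= t <= 1 -> H (0, t) = Psi1 t x0 /\ H (1, t) = Psi2 t x0.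

(** The flow states at the grid times are lifts of the bottom and top rows, both starting from the
    constant path. Their final paths are near each other in a cell around [x0] and both end at [x0],
    hence they are joined by a square with fixed ends. *)
Lemma homotopic_orbit_square : exists u,
 square A u (orbit_path Phi1 x0) (orbit_path Phi2 x0).
have [N [Q0 [Q1 [V [QP VP G]]]]] := @grid_monodromy R M (R -> M) _
 _ (good_nbhd A) (path_near_mono) (@path_near_refl _ _ _ _ x0)
 (@path_near_sym _ _ _ _) (@path_near_trans _ _ _ _) (@path_near_ex _ _ _ _ x0)
 (@path_near_uniq _ _ _ _ x0) (@good_nbhd_open _ _ _ _) (@good_nbhd_base _ _ _ _) H Hc x0 Hside.
pose q k : R := k%:R / N.+1%:R.
have qle k : q k <= q k.+1 by rewrite ler_pM2r // ler_nat.
have q01 k : (k <= N.+1)%N -> 0 <= q k <= 1.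
 by move=> kN; rewrite divr_ge0 //= ler_pdivrMr // mul1r ler_nat.
have q1 : q N.+1 = 1 by rewrite /q divff.
have q0 : q 0%N = 0 by rewrite /q mul0r.
have qin k t : (k <= N)%N -> q k <= t <= q k.+1 -> 0 <= t <= 1.
 move=> kN /andP[t1 t2]; have /andP[a _] := q01 k (leqW kN); have /andP[_ b] := q01 k.+1 kN.
 by rewrite (le_trans a t1) (le_trans t2).
have [gV Vx] := VP x0.
have i12 k : (k <= N.+1)%N -> path_in A x0 (flow_state Psi1 Phi1 (q k)) (V (H (0, q k))) /\
  path_in A x0 (flow_state Psi2 Phi2 (q k)) (V (H (1, q k))).
 move=> kN; have [-> ->] := Hrows (q01 k kN).
 by split; apply: flow_state_in => //; have [] := VP (Psi1 (q k) x0); have [] := VP (Psi2 (q k) x0).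
have n12 k : (k <= N)%N -> path_near A (Q0 k) (flow_state Psi1 Phi1 (q k)) (flow_state Psi1 Phi1 (q k.+1)) /\
  path_near A (Q1 k) (flow_state Psi2 Phi2 (q k)) (flow_state Psi2 Phi2 (q k.+1)).
 move=> kN; have [_ _ QH] := QP k kN.
 split; apply: flow_state_near => // t tk; have [Q1t Q2t] := QH t tk;
  have [h1 h2] := Hrows (qin k t kN tk); first by rewrite -h1.
 by rewrite -h2.
have f0 Psi Phi : flow_pair w Psi Phi -> flow_state Psi Phi (q 0%N) = fun=> x0.
 by move=> F; apply/funext => s; rewrite /flow_state q0 mul0r (flowK F).
have := G _ _ i12 n12 (etrans (f0 _ _ F1) (esym (f0 _ _ F2))).
rewrite q1 => near12.
have e1 Psi Phi : flow_pair w Psi Phi -> flow_state Psi Phi 1 1 = x0.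
 move=> F; rewrite /flow_state (step1 (lexx 1)) subrr mulr0 (flow_inv0 F (lexx 0)).
 by rewrite (flow1 F).
have [ps1 _ _] : path_in A x0 (flow_state Psi1 Phi1 1) setT by exact: flow_state_in.
have e12 := etrans (e1 _ _ F1) (esym (e1 _ _ F2)).
have V1 : V x0 (flow_state Psi1 Phi1 1 1) by rewrite e1.
have [u us] := path_near_closed gV ps1 near12 e12 V1.
have [v1 s1] := orbit_flow_state F1; have [v2 s2] := orbit_flow_state F2.
exists (stack v1 (stack (fun s t => u (1 - s) t) (fun s t => v2 s (1 - t)))).
exact: square_stack (square_stack (square_rev us) (square_sym _)).
Qed.

Variable a : dform A 2.
Hypothesis fa : is_form a.
Hypothesis spheres : forall v, sphere A v -> sphere_integral v a = 0.

Lemma line_flux_eq p : smooth_path A p -> p 0 = x0 -> p 1 = x0 ->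
 line p (fiber_int Phi1 0 1 a) = line p (fiber_int Phi2 0 1 a).
move=> ps p0 p1; have [u su] := homotopic_orbit_square.
apply(etrans (line_fiber_int (inv_smooth F1) ps fa)).
apply: etrans (esym (line_fiber_int (inv_smooth F2) ps fa)).
have z1 t := flow_inv0 (t := t) F1; have y1 t := flow_inv1 (t := t) F1.
have z2 t := flow_inv0 (t := t) F2; have y2 t := flow_inv1 (t := t) F2.
have c1 := comm_squareP (inv_smooth F1) ps z1 y1 p0 p1.
have c2 := comm_squareP (inv_smooth F2) ps z2 y2 p0 p1.
have a1 := area_commuting_square fa (inv_smooth F1) ps z1 y1 p0 p1.
have a2 := area_commuting_square fa (inv_smooth F2) ps z2 y2 p0 p1.
have refl_sq q : smooth_path A q -> square A (fun s t => q s) q q.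
 by move=> qs; split; first exact: fsquare_refl.
have refl_area q : smooth_path A q -> area a (fun s t => q s) = 0.
 move=> qs; rewrite /area (@eq_int _ _ (fun=> 0)); first by rewrite /Rintegral integral0.
 move=> s; rewrite (@eq_int _ _ (fun=> 0)); first by rewrite /Rintegral integral0.
 move=> t _; exact: den_path (proj1 qs) (smooth2_fst smooth_id).
have cs := cst_smooth (A := A) x0.
have [rc rp] := (refl_sq _ cs, refl_sq _ ps).
have o1 : orbit_path Phi1 x0 0 = x0 by exact: orbit_path0.
have o2 : orbit_path Phi1 x0 1 = x0 by exact: orbit_path1.
have e1 : (fun _ : R => x0) 1 = p 0 by rewrite p0.
have e2 : p 1 = orbit_path Phi1 x0 0 by rewrite o1.
have e3 : orbit_path Phi1 x0 1 = p 0 by rewrite o2.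
have s1 := fsquare_cat3 rc rp su e1 e2; have b1 := area_cat3 fa rc rp su e1 e2.
have s2 := fsquare_cat3 su rp rc e3 p1; have b2 := area_cat3 fa su rp rc e3 p1.
(* Closed square: the first orbit is moved behind [p], exchanged for the second orbit, moved back in
   front of [p], and exchanged for the first again. *)
have T := square_stack c1 (square_stack s1 (square_stack (square_sym c2) (square_sym s2))).
exact: (commutator_sum (area_square_closed fa T spheres)
 (area_stack fa (proj1 c1) (proj1 (square_stack s1 (square_stack (square_sym c2) (square_sym s2)))))
 (area_stack fa (proj1 s1) (proj1 (square_stack (square_sym c2) (square_sym s2))))
 (area_stack fa (proj1 (square_sym c2)) (proj1 (square_sym s2)))
 (area_sym fa c2) (area_sym fa s2) a1 a2 b1 b2 (refl_area _ cs) (refl_area _ ps)).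
Qed.

End Compare.
End LoopComparison.

(** * Linear combinations of forms, exactness and de Rham classes *)

Section FormAlgebra.
Context {R m M} {A : atlas R m M}.
Local Notation step := (@smooth_step R).

Definition form_comb k (a : dform A k) (c : R) (b : dform A k) : dform A k :=
 fun i x V => a i x V + c * b i x V.

Lemma form_comb_is k (a b : dform A k) c : is_form a -> is_form b -> is_form (form_comb a c b).
move=> [a1 a2 a3] [b1 b2 b3]; split.
- move=> i x cx; have [am aa] := a1 i x cx; have [bm ba] := b1 i x cx; split.
  move=> r V V1 V2 c1 c2 E E1 E2; rewrite /form_comb (am _ _ _ _ _ _ E E1 E2) (bm _ _ _ _ _ _ E E1 E2).
  ring.
 by move=> V r s rs E; rewrite /form_comb (aa _ _ _ rs E) (ba _ _ _ rs E) mulr0 addr0.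
- move=> i V; apply: smoothD; [exact: cod_open|exact: a2|].
 apply: smoothM; [exact: cod_open|exact: smooth_cst (cod_open i)|exact: b2].
- by move=> i j x V ov; rewrite /form_comb (a3 _ _ _ _ ov) (b3 _ _ _ _ ov).
Qed.

Lemma is_form_eq k (a b : dform A k) : form_eq a b -> is_form b -> is_form a.
move=> ab [b1 b2 b3]; split.
- move=> i x cx; have [bm ba] := b1 i x cx; split.
  move=> r V E E2; rewrite !ab //; exact: bm.
 move=> E; rewrite ab //; exact: ba.
- move=> i V; apply: smooth_ext (cod_open i) _ (b2 i V) => x cx.
 by rewrite ab.
- move=> i j x V ov; have [cx dx] := ov.
 rewrite ab // (b3 _ _ _ _ ov) ab //; exact: chart_cod.
Qed.

Lemma form_sub_is k (a b : dform A k) : is_form a -> is_form b -> is_form (form_sub a b).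
move=> fa fb; apply: is_form_eq (form_comb_is (-1) fa fb) => i x V _.
by rewrite /form_sub /form_comb mulN1r.
Qed.

Lemma exact_form_eq k (a b : dform A k.+1) : form_eq a b -> exact_form b -> exact_form a.
by move=> ab [c [fc cb]]; exists c; split => // i x V cx; rewrite cb // ab. Qed.

Lemma ext_d_comb k (a b : dform A k) c i x V : is_form a -> is_form b -> cod i x ->
 ext_d (form_comb a c b) i x V = ext_d a i x V + c * ext_d b i x V.
move=> fa fb cx; rewrite /ext_d mulr_sumr -big_split; apply: eq_bigr => r _ /=.
rewrite mulrCA -mulrDr; congr (_ _).
have da := @smooth_derivable _ _ _ _ _ (row r V) (form_smooth i (row' r V) fa) cx.
have db := @smooth_derivable _ _ _ _ _ (row r V) (form_smooth i (row' r V) fb) cx.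
have dc : derivable (c *: fun y => b i y (row' r V)) x (row r V) by exact: derivableZ.
have := deriveD da dc; rewrite (deriveZ c db); exact.
Qed.

Lemma exact_comb k (a b : dform A k.+1) c : exact_form a -> exact_form b ->
 exact_form (form_comb a c b).
move=> [a' [fa aa]] [b' [fb bb]]; exists (form_comb a' c b'); split; first exact: form_comb_is.
by move=> i x V cx; rewrite ext_d_comb // aa // bb.
Qed.

Lemma deRham_class_eq k (a b : dform A k.+1) : exact_form (form_sub a b) ->
 deRham_class a = deRham_class b.
move=> ab; apply/seteqP; split=> c [cc ca]; split => //.
 apply: exact_form_eq (exact_comb 1 ca ab) => i x V _.
 rewrite /form_comb /form_sub; ring.
apply: exact_form_eq (exact_comb (-1) ca ab) => i x V _.
rewrite /form_comb /form_sub; ring.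
Qed.

Lemma area_comb (a b : dform A 2) c u : is_form a -> is_form b -> smooth_sq A u ->
 area (form_comb a c b) u = area a u + c * area b u.
move=> fa fb us; have ia := inner_cont fa us; have ib := inner_cont fb us.
rewrite /area -intZ // -intD //; last first.
 move=> s; apply: cvgM; [exact: cvg_cst|exact: ib].
apply: eq_int => s _; have da := @den_cont_snd _ _ _ _ a fa u s us.
have db := @den_cont_snd _ _ _ _ b fb u s us.
rewrite -intZ // -intD //.
move=> t; apply: cvgM; [exact: cvg_cst|exact: db].
Qed.

Lemma line_comb (a b : dform A 1) c p : is_form a -> is_form b -> smooth_path A p ->
 line p (form_comb a c b) = line p a + c * line p b.
move=> fa fb [ps _]; have sa := speed_cont fa ps; have sb := speed_cont fb ps.
rewrite /line -intZ // -intD //.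
move=> t; apply: cvgM; [exact: cvg_cst|exact: sb].
Qed.

Lemma line_eq (a b : dform A 1) p : form_eq a b -> line p a = line p b.
move=> ab; apply: eq_int => t; rewrite /speed /pullback ab //.
apply: chart_cod; exact: chart_at_dom.
Qed.

Lemma smooth_sq_sphere (v : 'rV[R]_2 -> M) : sphere A v ->
 smooth_sq A (fun s t => v (pt s t)) /\ v = sqmap (fun s t => v (pt s t)).
have E : v = sqmap (fun s t => v (pt s t)) by apply/funext => z; rewrite /sqmap pt_eta.
by move=> []; rewrite /smooth_sq -E.
Qed.

Lemma sphere_integral_comb (a b : dform A 2) c v : is_form a -> is_form b -> sphere A v ->
 sphere_integral v (form_comb a c b) = sphere_integral v a + c * sphere_integral v b.
move=> fa fb /smooth_sq_sphere[vs ->].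
by rewrite !sphere_integralE area_comb.
Qed.

Lemma line_exact (a : dform A 1) p : exact_form a -> is_form a -> smooth_path A p ->
 p 0 = p 1 -> line p a = 0.
move=> [b [fb ba]] fa [ps pf] p01.
have bE t : pullback (curve p) b t%:M 0 = b (chart_at A (p t)) (chart (chart_at A (p t)) (p t)) 0.
 by rewrite /pullback mul0mx /curve mxE.
have bs := pullback_smooth openT ps 0 fb.
have D (t : R) : is_deriv t (fun t : R => pullback (curve p) b t%:M 0) (speed p a t).
 have dt : derivable (fun z => pullback (curve p) b z 0) (t%:M : 'rV_1) 1%:M.
  exact: smooth_derivable.
 have L h : (h *: 1 + t)%:M = h *: 1%:M + t%:M :> 'rV_1.
  by rewrite scale_scalar_mx raddfD.
 have := @is_dd_aff R _ R (fun t => t%:M : 'rV_1) _ t 1%:M 1 L dt.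
 have := extdE_pullback (x := t%:M) openT ps 1%:M fb fa ba I.
 rewrite /extdE big_ord_recl big_ord0 addr0 mul1r.
 have -> : row ord0 (1%:M : 'M[R]_1) = 1%:M by apply/row_matrixP => r; rewrite ord1 row_id.
 have -> : row' ord0 (1%:M : 'M[R]_1) = 0 by apply/matrixP => -[].
 by move->.
have sc := speed_cont fa ps.
rewrite /line (FTC2 ler01 sc) !bE p01 subrr //.
Qed.

End FormAlgebra.

(** * From equal classes in the fundamental group to a homotopy of flow orbits *)

Section Homotopy.
Context {R m M} {A : atlas R m M}.
Local Notation step := (@smooth_step R).

(** The constant homotopy puts [h] into its own class, hence into the class of [g]. *)
Lemma pi1_class_homotopic (x0 : M) (g h : R -> M) : loop_at x0 h ->
 pi1_class x0 g = pi1_class x0 h -> loop_homotopic x0 g h.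
move=> [hc h0 h1] gh.
suff : pi1_class x0 h h by rewrite -gh => -[].
split => //; exists (fun p => h p.2); split; last by [].
apply/subspace_continuousP => z [z1 z2].
move=> Q nQ; have := iffLR (subspace_continuousP _ _) hc z.2 z2 _ nQ.
rewrite !nbhs_filterE /within -!nbhs_ballE => -[d /= d0 dB].
exists d => //= z' [_ b2] [_]; exact: dB.
Qed.

Lemma symp_orbit_loop (w : dform A 2) psi x0 : Symp0_loop w psi -> loop_at x0 (fun t => psi t x0).
move=> [ps _ p0 p1]; split; rewrite ?p0 ?p1 //.
apply: continuous_subspaceT => t.
apply(@continuous_comp _ _ _ (fun t => (t, x0)) (fun p : R * M => _ p.1 p.2)).
 exact: (@cvg_pair _ _ _ _ _ _ _ _ _ id _ cvg_id (cvg_cst x0)).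
exact: family_cont (symp_path_family ps) _.
Qed.

(** The loop parameter is composed with the step, so that the rows become the orbits of the
    reparametrized flows of [loop_flow]. *)
Lemma homotopy_step (x0 : M) (g h : R -> M) : loop_homotopic x0 g h -> exists H : R * R -> M,
 [/\ {within `[0, 1] `*` `[0, 1], continuous H},
   forall s : R, 0 <= s <= 1 -> H (s, 0) = x0 /\ H (s, 1) = x0 &
   forall t : R, 0 <= t <= 1 -> H (0, t) = g (step t) /\ H (1, t) = h (step t)].
move=> [H [Hc HP]]; exists (fun z => H (z.1, step z.2)); split.
- apply/subspace_continuousP => z [z1 z2].
 have zK : (`[0, 1] `*` `[0, 1])%classic (z.1, step z.2).
  split => //=; exact: step_itv.
 move=> Q nQ; have := iffLR (subspace_continuousP _ _) Hc _ zK _ nQ.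
 have c : {for z, continuous (fun z : R * R => (z.1, step z.2))}.
  apply: (@cvg_pair _ _ _ (nbhs z) _ (nbhs (_ z.2))); first exact: cvg_fst.
  apply: continuous_comp; first exact: cvg_snd.
  exact: smooth_cont step_smooth I.
 rewrite !nbhs_filterE /within => /c; rewrite nbhs_filterE /=.
 apply: filterS => z' H1 [z1' z2']; apply: H1; split => //=.
 rewrite /=; exact: step_itv.
- move=> s s01; have [_ _ h0 h1] := HP s s01.
 by rewrite (step0 (lexx 0)) step1.
- by move=> t; have [] := HP _ (step_itv t).
Qed.

End Homotopy.

(** * The aspherical case *)

Section AsphericalCase.
Context {R m M} {A : atlas R m M}.
Variables (w : dform A 2) (psi phi : R -> M -> M) (x0 : M).
Hypotheses (Mcl : closed_connected_manifold M) (fw : is_form w).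
Hypotheses (psi_loop : Symp0_loop w psi) (phi_loop : Symp0_loop w phi).
Hypothesis orbits : loop_homotopic x0 (fun t => psi t x0) (fun t => phi t x0).

Lemma comb_zero (l x y : R) : l = x + -1 * y -> y = x -> l = 0.
by move=> -> ->; rewrite mulN1r subrr. Qed.

Definition inverse_flow (f : R -> M -> M) t y := xget y [set x | f (smooth_step t) x = y].

Lemma flux_class_eq :
 exact_form (form_sub (fiber_int (inverse_flow phi) 0 1 w) (fiber_int (inverse_flow psi) 0 1 w)) ->
 flux w psi = flux w phi.
move=> ex; apply: deRham_class_eq; apply: (exact_form_eq _ ex) => i x V cx.
rewrite /form_sub (flux_fiber Mcl fw psi_loop V cx) (flux_fiber Mcl fw phi_loop V cx).
by rewrite opprK addrC.
Qed.

Lemma flux_eq_of_periods : (forall p, smooth_path A p -> p 0 = x0 -> p 1 = x0 ->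
  line p (fiber_int (inverse_flow psi) 0 1 w) = line p (fiber_int (inverse_flow phi) 0 1 w)) ->
 flux w psi = flux w phi.
move=> H; apply: flux_class_eq; have [_ _ Mc] := Mcl.
have F1 := loop_flow Mcl psi_loop; have F2 := loop_flow Mcl phi_loop.
have f1 := fiber_int_form (inv_smooth F1) ler01 fw.
have f2 := fiber_int_form (inv_smooth F2) ler01 fw.
have fs := form_sub_is f2 f1.
apply(exact_of_periods fs Mc (x0 := x0)) => p ps p0 p1.
rewrite (@line_eq _ _ _ _ _ (form_comb (fiber_int (inverse_flow phi) 0 1 w) (-1) (fiber_int (inverse_flow psi) 0 1 w))); last first.
 by move=> i x V; rewrite /form_sub /form_comb mulN1r.
exact: comb_zero (line_comb _ _ f1 _) (H p _ p0 p1).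
Qed.

Lemma period_eq (a : dform A 2) : is_form a ->
 (forall v, sphere A v -> sphere_integral v a = 0) ->
 forall p, smooth_path A p -> p 0 = x0 -> p 1 = x0 ->
  line p (fiber_int (inverse_flow psi) 0 1 a) = line p (fiber_int (inverse_flow phi) 0 1 a).
move=> fa spheres p ps p0 p1.
have F1 := loop_flow Mcl psi_loop; have F2 := loop_flow Mcl phi_loop.
have [H [Hc Hs Hr]] := homotopy_step orbits.
exact: (line_flux_eq F1 F2 _ Hs).
Qed.

Lemma aspherical_flux_eq : symplectically_aspherical w -> flux w psi = flux w phi.
move=> asph; apply: flux_eq_of_periods; exact: period_eq. Qed.

End AsphericalCase.

(** * The exterior derivative of a form is a form *)

Section ExteriorDerivative.
Context {R m M} {A : atlas R m M}.

Lemma row_row' p q (r : 'I_p.+1) (s : 'I_p) (V : 'M[R]_(p.+1, q)) : row s (row' r V) = row (lift r s) V.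
by apply/rowP => l; rewrite !mxE. Qed.

Lemma row_eq_row' p q (r s : 'I_p.+1) (V W : 'M[R]_(p.+1, q)) : s != r -> row' r V = row' r W ->
 row s V = row s W.
move=> sr E; case: (unliftP r s) (sr) => [t -> _|->]; last by rewrite eqxx.
by rewrite -!row_row' E.
Qed.

Lemma ext_d_ml k (a : dform A k) i x : is_form a -> cod i x -> multilinear (ext_d a i x).
move=> fa cx r V V1 V2 c1 c2 E E1 E2; have oc := (cod_open i).
rewrite /ext_d !mulr_sumr -big_split; apply: eq_bigr => q _ /=.
rewrite mulrCA [c2 * _]mulrCA -mulrDr; congr (_ _).
have ds u B := @smooth_derivable _ _ _ _ _ u (form_smooth i B fa) cx.
have [->|qr] := eqVneq q r.
 rewrite E E1 E2; have fd := smooth_differentiable oc (form_smooth i (row' r V) fa) cx.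
 rewrite (derive_lin _ _ _ fd) -[_ *: _]addr0 (derive_lin _ _ _ fd).
 have := derive_lin 1 0 0 fd; rewrite scaler0 addr0 mul1r => /esym/eqP.
 by rewrite -subr_eq0 addrK => /eqP ->; rewrite addr0.
have R1 := row_eq_row' qr E1; have R2 := row_eq_row' qr E2.
rewrite R1 R2; case: (unliftP q r) qr => [r' rE|->] qr; last by rewrite eqxx in qr.
have H y : cod i y -> a i y (row' q V) = c1 * a i y (row' q V1) + c2 * a i y (row' q V2).
 move=> cy; have am := form_ml fa cy; apply(am r').
 - by rewrite !row_row' -rE.
 - apply/matrixP => s l; rewrite !mxE.
  have := row_eq_row' (s := lift q (lift r' s)) _ E1; rewrite {1}rE => /(_ _)/rowP/(_ l).
  by rewrite !mxE; apply; rewrite (inj_eq lift_inj) eq_sym neq_lift.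
 - apply/matrixP => s l; rewrite !mxE.
  have := row_eq_row' (s := lift q (lift r' s)) _ E2; rewrite {1}rE => /(_ _)/rowP/(_ l).
  by rewrite !mxE; apply; rewrite (inj_eq lift_inj) eq_sym neq_lift.
rewrite (near_eq_derive _ (nearU oc cx H)).
have d1 : derivable (c1 *: fun y => a i y (row' q V1)) x (row q V) by exact: derivableZ.
have d2 : derivable (c2 *: (fun y => a i y (row' q V2))) x (row q V) by exact: derivableZ.
have := deriveD d1 d2; rewrite (deriveZ _ (ds _ _)) (deriveZ c2 (ds _ _)); exact.
Qed.

(** If rows [r] and [s] agree, every other term contains both of them and vanishes. The two
    remaining terms have the same rows up to reordering and cancel by [lift_sign]. *)
Lemma ext_d_alt k (a : dform A k) i x : is_form a -> cod i x -> Defs.alternating (ext_d a i x).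
case: k a => [|k] a fa cx V r s rs E; first by rewrite !ord1 in rs.
have oc := (cod_open i).
have Z q : q != r -> q != s -> dd (row q V) (fun y => a i y (row' q V)) x = 0.
 move=> qr qs; case: (unliftP q r) qr => [r' rE|->] qr; last by rewrite eqxx in qr.
 case: (unliftP q s) qs => [s' sE|->] qs; last by rewrite eqxx in qs.
 have H y : cod i y -> a i y (row' q V) = 0.
  move=> cy; apply(form_alt fa cy (r := r') (s := s')).
   by apply: contra rs => /eqP rs; rewrite rE sE rs.
  by rewrite !row_row' -rE -sE.
 rewrite (near_eq_derive _ (nearU oc cx H)); exact: derive_cst.
rewrite /ext_d (bigD1 r) //= (bigD1 s) /=; last by rewrite eq_sym.
rewrite big1 ?addr0; last first.
 by move=> q /andP[qr qs]; rewrite Z ?mulr0.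
have ds u B := @smooth_derivable _ _ _ _ _ u (form_smooth i B fa) cx.
case: (unliftP r s) rs => [q1 sE|->] rs; last by rewrite eqxx in rs.
case: (unliftP s r) rs => [q2 rE|rE] rs; last by rewrite rE eqxx in rs.
pose B := col_mx (row r V) (row' q1 (row' r V)) : 'M[R]_(1 + k, m).
have BE : B = col_mx (row s V) (row' q2 (row' s V)) :> 'M[R]__.
 rewrite /B E; congr col_mx; apply/matrixP => i' l; rewrite !mxE; congr (V _).
 exact: lift2C.
have H1 y : cod i y -> a i y (row' r V) = (-1) ^+ q1 * a i y B.
 move=> cy; rewrite (alt_cycle _ q1 (form_ml fa cy) (form_alt fa cy)) row_row' -sE /B E //.
have H2 y : cod i y -> a i y (row' s V) = (-1) ^+ q2 * a i y B.
 by move=> cy; rewrite (alt_cycle _ q2 (form_ml fa cy) (form_alt fa cy)) row_row' -rE BE E.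
rewrite (near_eq_derive _ (nearU oc cx H1)) (near_eq_derive _ (nearU oc cx H2)) -E.
have D c : dd (row r V) (fun y => c * a i y B) x = c * dd (row r V) (fun y => a i y B) x.
 exact: deriveZ.
rewrite !D !mulrA -!exprD (lift_sign (esym sE) (esym rE)) mulNr subrr //.
Qed.

Lemma ext_d_form k (a : dform A k) : is_form a -> is_form (ext_d a).
move=> fa; split.
- move=> x; split; [exact: ext_d_ml|exact: ext_d_alt].
- move=> i V; have oc := (cod_open i).
 apply(smooth_sum _ oc) => r _; apply(smoothM oc); first exact: smooth_cst.
 apply: smooth_D; exact: form_smooth.
- move=> i j x V ov; have oO := overlap_open i j.
 have ts := trans_smx i j.
 have tc y : overlap i j y -> cod j (transition i j y).
  move=> [_]; exact: chart_cod.
 transitivity (extdE (fun y V => a j (transition i j y) (V *m jacobian (transition i j) y)) x V).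
  apply: extdE_ext oO _ ov => B; have [_ _ H] := fa; exact: H.
 apply: (extdE_pull V oO (cod_open j) ts tc _ _ ov).
  move=> y; split; [exact: form_ml|exact: form_alt].
 move=> B; exact: form_smooth.
Qed.

End ExteriorDerivative.

(** * Directional derivatives of matrix-valued maps *)

Section MatrixCalculus.
Context {R : realType} {V : normedModType R}.

Definition dmx p q (v : V) (f : V -> 'M[R]_(p, q)) (x : V) : 'M[R]_(p, q) :=
 \matrix_(i, j) dd v (fun y => f y i j) x.

Lemma dmx_ext p q (U : set V) v (f g : V -> 'M[R]_(p, q)) x : open U -> U x ->
 (forall y, U y -> f y = g y) -> dmx v f x = dmx v g x.
move=> oU Ux fg; apply/matrixP => i j; rewrite !mxE.
by apply: near_eq_derive; apply(nearU oU Ux) => y Uy; rewrite fg.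
Qed.

Lemma dmx_smooth p q (U : set V) v (f : V -> 'M[R]_(p, q)) : open U ->
 smooth_mx U f -> smooth_mx U (dmx v f).
move=> oU fs i j; apply: (smooth_ext oU _ (smooth_D v (fs i j))) => x Ux.
by rewrite mxE.
Qed.

Lemma dmx_cst p q v (B : 'M[R]_(p, q)) x : dmx v (fun=> B) x = 0.
apply/matrixP => i j; rewrite !mxE; exact: derive_cst. Qed.

Section Rules.
Variables (U : set V) (v x : V).
Hypotheses (oU : open U) (Ux : U x).

Lemma dmxD p q (f g : V -> 'M[R]_(p, q)) : smooth_mx U f -> smooth_mx U g ->
 dmx v (fun y => f y + g y) x = dmx v f x + dmx v g x.
move=> fs gs; apply/matrixP => i j; rewrite !mxE.
rewrite (_ : (fun y => _) = (fun y => f y i j) + fun y => g y i j); last first.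
 by apply/funext => y; rewrite mxE.
apply: deriveD; [exact: smooth_derivable|exact: smooth_derivable].
Qed.

Lemma dmxM p q r (f : V -> 'M[R]_(p, q)) (g : V -> 'M[R]_(q, r)) : smooth_mx U f -> smooth_mx U g ->
 dmx v (fun y => f y *m g y) x = dmx v f x *m g x + f x *m dmx v g x.
move=> fs gs; apply/matrixP => i j; rewrite !mxE -big_split /=.
have D l : is_dd x v (fun y => f y i l * g y l j)
  (dmx v f x i l * g x l j + f x i l * dmx v g x l j).
 have df := smooth_dd v (fs i l) Ux; have dg := smooth_dd v (gs l j) Ux.
 have := is_deriveM df dg; rewrite addrC !mxE.
 by rewrite /GRing.scale /= [g x l j * _]mulrC.
have := is_derive_sum (fun l => D l).
move=> [_ <-]; congr ('D_v _ x); apply/funext => y.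
by rewrite mxE fct_sumE.
Qed.

Lemma dmxtr p (f : V -> 'M[R]_p) : smooth_mx U f ->
 dd v (fun y => \tr (f y)) x = \tr (dmx v f x).
move=> fs; have D l : is_dd x v (fun y => f y l l) (dmx v f x l l).
 rewrite mxE; exact: smooth_dd.
have := is_derive_sum (fun l => D l).
move=> [_ E]; apply: (etrans _ E); congr ('D_v _ x); apply/funext => y.
by rewrite /mxtrace fct_sumE.
Qed.

End Rules.

Lemma smooth_tr p (U : set V) (f : V -> 'M[R]_p) : open U -> smooth_mx U f ->
 smooth_fun U (fun y => \tr (f y)).
move=> oU fs; apply: smooth_sum => //. Qed.

End MatrixCalculus.

Lemma dmx_line (R : realType) (V V' : normedModType R) p q v v' (f : V -> 'M[R]_(p, q)) (g : V' -> 'M[R]_(p, q)) x y :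
 (forall c : R, f (c *: v + x) = g (c *: v' + y)) -> dmx v f x = dmx v' g y.
move=> fg; apply/matrixP => i j; rewrite !mxE derive_line [RHS]derive_line.
have E : (fun h : R^o => f (h *: v + x) i j) = fun h => g (h *: v' + y) i j.
 by apply/funext => c; rewrite fg.
by rewrite E.
Qed.


(** * Matrix identities for curvature and trace *)

Section ChernAlgebra.
Context {R : realType} {m : nat}.
Implicit Types X Y : 'M[R]_m.

Lemma mx_entryD X Y a b : (X + Y) a b = X a b + Y a b. Proof. by rewrite mxE. Qed.
Lemma mx_entryN X a b : (- X) a b = - X a b. Proof. by rewrite mxE. Qed.

(* The curvature of the connection h^* nabla, from the structure equations
  A_a h = d_a h + h C_a. *)
Lemma curvature_conjugation (h As At Cs Ct hs ht hst hts Cst Cts Ast Ats : 'M[R]_m) :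
 h \in unitmx -> hst = hts ->
 As *m h = hs + h *m Cs -> At *m h = ht + h *m Ct ->
 Ats *m h + At *m hs = hst + (hs *m Ct + h *m Cts) ->
 Ast *m h + As *m ht = hts + (ht *m Cs + h *m Cst) ->
 Ats - Ast + At *m As - As *m At =
 h *m (Cts - Cst + Ct *m Cs - Cs *m Ct) *m invmx h.
move=> hu hE Es Et Ets Est.
suff E : (Ats - Ast + At *m As - As *m At) *m h = h *m (Cts - Cst + Ct *m Cs - Cs *m Ct).
 by rewrite -E mulmxK.
have E1 : Ats *m h = hst + (hs *m Ct + h *m Cts) - At *m hs by rewrite -Ets addrK.
have E2 : Ast *m h = hts + (ht *m Cs + h *m Cst) - As *m ht by rewrite -Est addrK.
have hsE : hs = As *m h - h *m Cs by rewrite Es addrK.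
have htE : ht = At *m h - h *m Ct by rewrite Et addrK.
rewrite !(mulmxDl, mulmxDr, mulNmx, mulmxN) E1 E2 hE hsE htE.
rewrite !(mulmxDl, mulmxDr, mulNmx, mulmxN) !mulmxA.
apply/matrixP => a b; rewrite !(mx_entryD, mx_entryN); ring.
Qed.

(* J0 stands for h^* J. *)
Lemma trace_curvature (J0 J0s As At Ats Ast h F J : 'M[R]_m) : h \in unitmx ->
 J0 *m h = h *m J -> At *m J0 = J0 *m At -> As *m J0 = J0s + J0 *m As ->
 Ats - Ast + At *m As - As *m At = h *m F *m invmx h ->
 \tr (F *m J) = \tr (Ats *m J0 + At *m J0s) - \tr (Ast *m J0).
move=> hu hJ Et Es E.
have -> : \tr (F *m J) = \tr (h *m F *m invmx h *m J0).
 have -> : J = invmx h *m J0 *m h by rewrite -mulmxA hJ mulKmx.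
 by rewrite mulmxA mxtrace_mulC !mulmxA.
rewrite -E !(mulmxDl, mulNmx) !mxtraceD !raddfN /=.
have -> : \tr (At *m As *m J0) = \tr (At *m J0s) + \tr (At *m J0 *m As).
 by rewrite -mulmxA Es mulmxDr mxtraceD mulmxA.
have -> : \tr (As *m At *m J0) = \tr (At *m J0 *m As).
 by rewrite -mulmxA mxtrace_mulC.
by ring.
Qed.

End ChernAlgebra.

(** * Derivatives of connection matrices along maps *)

Section ConnectionCalculus.
Context {R m M} {A : atlas R m M}.

Lemma dmx_comp p q r s (U : set 'rV[R]_p) (W : set 'rV[R]_q) (g : 'rV[R]_p -> 'rV[R]_q)
  (f : 'rV[R]_q -> 'M[R]_(r, s)) u z : open U -> open W -> smooth_mx U g -> smooth_mx W f ->
 (forall y, U y -> W (g y)) -> U z ->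
 dmx u (fun y => f (g y)) z = dmx (u *m jacobian g z) f (g z).
move=> oU oW gs fs gW Uz; apply/matrixP => i j; rewrite !mxE.
have fd := smooth_differentiable oW (fs i j) (gW _ Uz).
have [_ ->] := is_derive_comp fd (fun l => is_derive_jac oU gs u l Uz).
by rewrite derive_coord.
Qed.

Lemma dmx_schwarz p q r (U : set 'rV[R]_p) (f : 'rV[R]_p -> 'M[R]_(q, r)) u v x : open U ->
 smooth_mx U f -> U x -> dmx u (dmx v f) x = dmx v (dmx u f) x.
move=> oU fs Ux; apply/matrixP => a b; rewrite [LHS]mxE mxE.
have E c : (fun y => dmx c f y a b) = fun y => dd c (fun y' => f y' a b) y.
 by apply/funext => y; rewrite mxE.
by rewrite !E; exact: smooth_schwarz oU _ Ux.
Qed.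

Lemma derive_dmx p q r (U : set 'rV[R]_p) (f : 'rV[R]_p -> 'M[R]_(q, r)) v x :
 smooth_mx U f -> U x -> 'D_v f x = dmx v f x.
move=> fs Ux; apply: derive_mx; apply/derivable_mxP => i j.
exact: smooth_derivable.
Qed.

Lemma smooth_trmul p (V : normedModType R) (U : set V) (f g : V -> 'M[R]_p) : open U ->
 smooth_mx U f -> smooth_mx U g -> smooth_fun U (fun y => \tr (f y *m g y)).
move=> oU fs gs; apply: smooth_tr => //; exact: smooth_mulmx. Qed.

Section Connection.
Variable C : conn A.
Hypothesis Cc : is_connection C.

Lemma conn_expand i y (v : 'rV[R]_m) : cod i y ->
 C i y v = \sum_l v 0 l *: C i y (delta_mx 0 l).
move=> cy; have [lin _ _] := Cc.
have C0 : C i y 0 = 0.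
 have := lin i y 1 0 0 cy; rewrite scaler0 addr0 scale1r => /eqP.
 by rewrite -subr_eq0 opprD addrA subrr sub0r oppr_eq0 => /eqP.
have E s : C i y (\sum_(l <- s) v 0 l *: delta_mx 0 l) =
  \sum_(l <- s) v 0 l *: C i y (delta_mx 0 l).
 by elim: s => [|l s IH]; rewrite ?big_nil // !big_cons lin // IH.
by rewrite -E -row_sum_delta.
Qed.

Section Compose.
Variables (p : nat) (i : idx A) (U : set 'rV[R]_p) (g B : 'rV[R]_p -> 'rV[R]_m).
Hypotheses (oU : open U) (gs : smooth_mx U g) (Bs : smooth_mx U B).
Hypothesis gc : forall z, U z -> cod i (g z).

Let basis_smooth l : smooth_mx U (fun z => C i (g z) (delta_mx 0 l)).
have [_ sm _] := Cc; exact: (smooth_mx_comp _ (cod_open i) _ (sm i _)). Qed.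

Lemma conn_smooth : smooth_mx U (fun z => C i (g z) (B z)).
move=> a b; apply(smooth_ext oU (f := fun z => \sum_l B z 0 l * C i (g z) (delta_mx 0 l) a b)).
 move=> z /gc cz; rewrite (conn_expand _ cz) summxE.
 by apply: eq_bigr => l; rewrite mxE.
apply: smooth_sum => // l _; exact: smoothM (basis_smooth l a b).
Qed.

Lemma dmx_conn u z : U z -> dmx u (fun y => C i (g y) (B y)) z =
 dmx (u *m jacobian g z) (fun y => C i y (B z)) (g z) + C i (g z) (dmx u B z).
move=> Uz; have [_ sm _] := Cc.
have S1 w : smooth_mx U (fun y => C i (g y) w).
 exact: (smooth_mx_comp _ (cod_open i) _ (sm i _)).
rewrite -(dmx_comp u oU (cod_open i) gs (sm i _) gc Uz).
apply/matrixP => a b; rewrite !mxE (conn_expand _ (gc Uz)) summxE.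
have E c y : U y -> C i (g y) c a b = \sum_l c 0 l * C i (g y) (delta_mx 0 l) a b.
 by move=> Uy; rewrite (conn_expand _ (gc Uy)) summxE; apply: eq_bigr => l; rewrite mxE.
rewrite (near_eq_derive _ (nearU oU Uz (fun y Uy => E _ y Uy))).
rewrite (near_eq_derive _ (nearU oU Uz (fun y Uy => E _ y Uy))).
have dC l := smooth_dd u (basis_smooth l a b) Uz.
have D1 l : is_dd z u (fun y => B y 0 l * C i (g y) (delta_mx 0 l) a b)
  (B z 0 l * dd u (fun y => C i (g y) (delta_mx 0 l) a b) z +
   dmx u B z 0 l * C i (g z) (delta_mx 0 l) a b).
 have dB := smooth_dd u (Bs 0 l) Uz.
 have := is_deriveM dB (dC l); rewrite /GRing.scale /= mxE.
 by rewrite [C _ _ _ _ _ * _]mulrC.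
have D2 l : is_dd z u (fun y => B z 0 l * C i (g y) (delta_mx 0 l) a b)
  (B z 0 l * dd u (fun y => C i (g y) (delta_mx 0 l) a b) z).
 exact: is_deriveZ.
have [_] := is_derive_sum D1; rewrite fct_sumE => ->.
have [_] := is_derive_sum; rewrite fct_sumE => ->.
by rewrite big_split; congr (_ _); apply: eq_bigr => l; rewrite [RHS]mxE.
Qed.

End Compose.
End Connection.
End ConnectionCalculus.

(** [N] is the parallelism of J for the original connection, and [D] is the derivative of
    [J0 *m h = h *m J]. Together they say that the conjugated connection [B] makes [J0] parallel, up
    to the right factor [h]. *)
Lemma parallel_conjugation (R : realType) m (h J0 J0v B hv Cv J Jv : 'M[R]_m) : J0 *m h = h *m J ->
 B *m h = hv + h *m Cv -> J0v *m h + J0 *m hv = hv *m J + h *m Jv ->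
 Jv + J *m Cv = Cv *m J -> B *m J0 *m h = (J0v + J0 *m B) *m h.
move=> hJ BE D N; rewrite mulmxDl -[_ *B *m h]mulmxA BE mulmxDr addrA D mulmxA hJ.
by rewrite -mulmxA hJ mulmxA BE mulmxDl -mulmxA -N mulmxDr mulmxA addrA.
Qed.

Lemma anti4 (V : zmodType) (a b c d : V) : a - b + c - d = - (b - a + d - c).
by rewrite !opprD !opprK [- b + a]addrC -!addrA [- d + c]addrC. Qed.

Lemma neg_scale (R : realType) (c x y z f : R) : f = c * z -> z = x - y -> x = 0 -> - c * y = f.
by move=> -> -> ->; rewrite sub0r mulrN mulNr. Qed.

(** Under a change of frame [S] without derivative in the chosen direction, the connection matrix is
    conjugated by [S] with no inhomogeneous term, and the trace is preserved. *)
Lemma trace_conjugation (R : realType) m (B B' S X X' D D' Cv J J' : 'M[R]_m) : S \in unitmx ->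
 X' \in unitmx -> B *m X = D + X *m Cv -> B' *m X' = D' + X' *m Cv -> X = S *m X' ->
 D = S *m D' -> J *m S = S *m J' -> \tr (B *m J) = \tr (B' *m J').
move=> Su Xu BX BX' XE DE JS; have E : B *m S = S *m B'.
 have E : B *m S *m X' = S *m B' *m X'.
  by rewrite -mulmxA -XE BX DE XE -mulmxA -mulmxDr -BX' mulmxA.
 by have := congr1 (mulmx^~ (invmx X')) E; rewrite !mulmxK.
rewrite -[J](mulmxK Su) JS !mulmxA E -mulmxA mxtrace_mulC mulmxA mxtrace_mulC.
by rewrite mulmxKV.
Qed.

(** * Transgression of the Chern form along a symplectic flow *)

Section TwistedChernForm.
Context {R m M} {A : atlas R m M}.
Variables (w : dform A 2) (Psi Phi : R -> M -> M) (J : endo A) (C : conn A).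
Hypotheses (F : flow_pair w Psi Phi) (fw : is_form w).
Hypotheses (JP : compatible_J w J) (Cc : is_connection C) (CJ : preserves_J J C).
Local Notation f := (coord_fam Phi).
Local Notation U := (coord_dom Phi).
Local Notation jf k i z := (jacobian (coord_fam Phi k i) z : 'M[R]_(1 + m, m)).
Definition sjac (k i : idx A) (z : 'rV[R]_(1 + m)) : 'M[R]_m := dsubmx (jf k i z).
Definition srcJ (k : idx A) (z : 'rV[R]_(1 + m)) : 'M[R]_m := J k (rsubmx z).
(* The complex isomorphism from (TM, J) to (TM, Phi_t^* J) that averages the identity. *)
Definition twist (k i : idx A) z : 'M[R]_m := srcJ k z *m sjac k i z + sjac k i z *m J i (f k i z).
(** The connection pulled back by the flow map. [tconn] is its gauge transform by [twist], for which
    the time-independent structure J of the source is parallel ([tconn_J]), and [ttrace] is the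
    resulting local potential. *)
Definition pconn (k i : idx A) v z : 'M[R]_m := C i (f k i z) (v *m jf k i z).
Definition tconn (k i : idx A) v z : 'M[R]_m :=
 (dmx v (twist k i) z + twist k i z *m pconn k i v z) *m invmx (twist k i z).
Definition ttrace (k i : idx A) v z : R := \tr (tconn k i v z *m srcJ k z).

Section Local.
Variables k i : idx A.

Lemma fam_chart : open (U k i) /\ smooth_mx (U k i) (f k i).
split; last by have [_ /(_ i)] := inv_smooth F k.
exact: smooth_to_open (fam_open k) (inv_smooth F k) (dom_open i).
Qed.

Let oU := proj1 fam_chart.
Let fs := proj2 fam_chart.

Let fcod z : U k i z -> cod i (f k i z).
move=> [_]; exact: chart_cod. Qed.

Let scod z : U k i z -> cod k (rsubmx z).
by case. Qed.

Let jfs : smooth_mx (U k i) (fun z => jf k i z).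
exact: smooth_jac. Qed.

Lemma srcJ_smooth : smooth_mx (fam_dom k) (srcJ k).
have [Js _ _ _ _] := JP; have oF := fam_open k.
exact: smooth_mx_comp (cod_open k) _ _ (smooth_rsubmx _).
Qed.

Let srcJ_smoothU : smooth_mx (U k i) (srcJ k).
by apply: smooth_mx_sub srcJ_smooth => []. Qed.

Lemma tgtJ_smooth : smooth_mx (U k i) (fun z => J i (f k i z)).
have [Js _ _ _ _] := JP; exact: (smooth_mx_comp _ (cod_open i)). Qed.

Lemma sjac_smooth : smooth_mx (U k i) (sjac k i).
by move=> a b; apply: smooth_ext oU _ (jfs _ b) => z; rewrite /sjac [RHS]mxE. Qed.

Lemma twist_smooth : smooth_mx (U k i) (twist k i).
apply: smooth_mxD => //; apply: smooth_mulmx => //; [exact: sjac_smooth|exact: sjac_smooth|].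
exact: tgtJ_smooth.
Qed.

Lemma pconn_smooth v : smooth_mx (U k i) (pconn k i v).
apply: (conn_smooth Cc oU fs _ fcod); apply: smooth_mulmx => //.
exact: smooth_mx_cst.
Qed.

Lemma hlift_jac q (V : 'M[R]_(q, m)) z : hlift V *m jf k i z = V *m sjac k i z.
by rewrite /hlift -{}[jf k i z]vsubmxK mul_row_col mul0mx add0r. Qed.

Lemma twist_symp z V : U k i z -> w k (rsubmx z) V = w i (f k i z) (V *m sjac k i z).
move=> Uz; have [cz dz] := Uz; have zE := tjoin_eta z.
pose t := z 0 0; pose x := rsubmx z.
have dz' : Defs.dom i (Phi t (param k x)) by [].
have wP : preserved w (Psi t) by have [] := flow_symp F t.
rewrite -(slice_preserved F cz dz' erefl V fw wP) (slice_formE (inv_smooth F)) // zE.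
by rewrite (pullbackE (fam_open k) (inv_smooth F k) _ fw cz dz) hlift_jac.
Qed.

(** A kernel vector [v] satisfies v J S = - v S J' with S = [sjac]. Since S preserves [w], the
    positive number w(v, v J) equals - w(v S, (v S) J'), which is never positive. *)
Lemma twist_unit z : U k i z -> twist k i z \in unitmx.
move=> Uz; apply: unitmx_inj => v vh; apply/eqP/negPn/negP => v0.
have [_ _ _ _ pos] := JP; have cz := scod Uz.
have E (a b : 'rV_m) B : col_mx a b *m B = (col_mx (a *m B) (b *m B) : 'M[R]_(2, m)).
 exact: mul_col_mx.
have := pos k _ v cz v0; rewrite (twist_symp _ Uz) E.
have -> : v *m J k (rsubmx z) *m sjac k i z = - (v *m sjac k i z *m J i (f k i z)).
 by apply/eqP; rewrite -addr_eq0 -!mulmxA -mulmxDr; apply/eqP.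
have wm := form_ml fw (fcod Uz); have wa := form_alt fw (fcod Uz).
have N (a b : 'rV_m) : w i (f k i z) (col_mx a (- b)) = - w i (f k i z) (col_mx a b).
 rewrite (alt_col_swap _ _ wm wa) [in RHS](alt_col_swap _ _ wm wa) -[- b]scaleN1r.
 by rewrite (ml_col_scale _ _ _ wm) mulN1r.
rewrite N oppr_gt0 => H.
have [Z|nz] := eqVneq (v *m sjac k i z) 0.
 by move: H; rewrite Z -(scale0r 0) (ml_col_scale _ _ _ wm) mul0r ltxx.
by have := lt_trans H (pos i _ _ (fcod Uz) nz); rewrite ltxx.
Qed.

Lemma tconn_smooth v : smooth_mx (U k i) (tconn k i v).
apply: smooth_mulmx => //; last exact: smooth_invmx twist_smooth twist_unit.
apply: smooth_mxD => //; first exact: dmx_smooth twist_smooth.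
apply: smooth_mulmx => //; [exact: twist_smooth|exact: pconn_smooth].
Qed.

Lemma ttrace_smooth v : smooth_fun (U k i) (ttrace k i v).
apply: smooth_trmul => //; exact: tconn_smooth. Qed.

Lemma twist_J z : U k i z -> srcJ k z *m twist k i z = twist k i z *m J i (f k i z).
move=> Uz; have [_ _ J2 _ _] := JP.
rewrite mulmxDr mulmxDl !mulmxA (J2 _ _ (scod Uz)) -[X in _ = _ X]mulmxA (J2 _ _ (fcod Uz)).
by rewrite mulNmx mulmxN mul1mx mulmx1 addrC.
Qed.

Lemma tconn_twist v z : U k i z ->
 tconn k i v z *m twist k i z = dmx v (twist k i) z + twist k i z *m pconn k i v z.
by move=> Uz; rewrite mulmxKV // twist_unit. Qed.

Lemma tconn_J v z : U k i z ->
 tconn k i v z *m srcJ k z = dmx v (srcJ k) z + srcJ k z *m tconn k i v z.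
move=> Uz; have [Js _ _ _ _] := JP.
have D := dmx_ext v oU Uz twist_J.
rewrite (dmxM _ Uz srcJ_smoothU twist_smooth) (dmxM _ Uz twist_smooth tgtJ_smooth) in D.
rewrite (dmx_comp v oU (cod_open i) fs (Js i) fcod Uz) in D.
have N := CJ (v *m jf k i z) (fcod Uz).
rewrite (derive_dmx _ (Js i) (fcod Uz)) in N.
suff E : tconn k i v z *m srcJ k z *m twist k i z =
  (dmx v (srcJ k) z + srcJ k z *m tconn k i v z) *m twist k i z.
 by have := congr1 (mulmx^~ (invmx (twist k i z))) E; rewrite !mulmxK ?twist_unit.
exact: parallel_conjugation (twist_J _) (tconn_twist v _) D N.
Qed.

(** Along a direction [u] in which the source structure is constant, the quadratic terms of the
    curvature drop out of the trace, and d of the potential [ttrace] remains. *)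
Lemma curvature_ttrace u v z : U k i z -> dmx u (srcJ k) z = 0 ->
 \tr (curvature C i (f k i z) (v *m jf k i z) (u *m jf k i z) *m J i (f k i z)) =
 dd v (fun y => ttrace k i u y) z - dd u (fun y => ttrace k i v y) z.
move=> Uz uJ; have [_ Cs _] := Cc.
have ts := twist_smooth; have hu := twist_unit Uz.
have jD (a b : 'rV[R]__) : dmx a (fun y => b *m jf k i y) z = b *m dmx a (fun y => jf k i y) z.
 rewrite (dmxM a Uz (smooth_mx_cst b oU) jfs).
 by rewrite dmx_cst mul0mx add0r.
have sym : v *m dmx u (fun y => jf k i y) z = u *m dmx v (fun y => jf k i y) z.
 rewrite -!jD; apply/rowP => l; rewrite !mxE.
 have E (a b : 'rV[R]__) : dd a (fun y => (b *m jf k i y) 0 l) z =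
   dd a (fun y => dd b (fun y' => f k i y' 0 l) y) z.
  apply: near_eq_derive; apply(nearU oU Uz) => y Uy.
  by rewrite (derive_jacE oU).
 rewrite !E; exact: smooth_schwarz Uz.
have pD (a b : 'rV[R]__) : dmx a (pconn k i b) z =
  dmx (a *m jf k i z) (fun y => C i y (b *m jf k i z)) (f k i z) +
  C i (f k i z) (b *m dmx a (fun y => jf k i y) z).
 rewrite (dmx_conn Cc oU fs (smooth_mulmx oU (smooth_mx_cst b oU) jfs) fcod a Uz).
 by rewrite jD.
have tD (a b : 'rV__) : dmx a (tconn k i b) z *m twist k i z + tconn k i b z *m dmx a (twist k i) z =
  dmx a (dmx b (twist k i)) z + (dmx a (twist k i) z *m pconn k i b z + twist k i z *m dmx a (pconn k i b) z).
 have := dmx_ext a oU Uz (fun y => @tconn_twist b y).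
 rewrite (dmxM a Uz (tconn_smooth b) ts) => ->.
 rewrite (dmxD a Uz (dmx_smooth b oU ts) (smooth_mulmx oU ts (pconn_smooth b))).
 by rewrite (dmxM a _ _ (pconn_smooth b)).
have hst : dmx v (dmx u (twist k i)) z = dmx u (dmx v (twist k i)) z.
 exact: dmx_schwarz Uz.
have cc := curvature_conjugation hu hst (tconn_twist v Uz) (tconn_twist u Uz) (tD v u) (tD u v).
have FE : curvature C i (f k i z) (v *m jf k i z) (u *m jf k i z) =
  dmx v (pconn k i u) z - dmx u (pconn k i v) z + pconn k i u z *m pconn k i v z -
  pconn k i v z *m pconn k i u z.
 rewrite /curvature !pD sym (derive_dmx _ (Cs i _) (fcod Uz)) (derive_dmx _ (Cs i _) (fcod Uz)).
 by rewrite opprD addrACA subrr addr0.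
rewrite FE; have := tconn_J u Uz; rewrite uJ add0r => uc.
rewrite (trace_curvature hu (twist_J Uz) uc (tconn_J v Uz) cc).
have T (a b : 'rV__) : dd a (fun y => ttrace k i b y) z =
  \tr (dmx a (tconn k i b) z *m srcJ k z + tconn k i b z *m dmx a (srcJ k) z).
 have := dmxtr a Uz (smooth_mulmx oU (tconn_smooth b) srcJ_smoothU) => ->.
 by rewrite (dmxM a _ (tconn_smooth b)).
by have := T u v; rewrite uJ mulmx0 addr0 => ->; rewrite (T v u).
Qed.

End Local.

Lemma jf_target (k i i' : idx A) z : U k i z -> U k i' z ->
 jf k i' z = jf k i z *m jacobian (transition i i') (f k i z).
move=> Uz Uz'; have [oU fs] := fam_chart k i; have [oU' fs'] := fam_chart k i'.
have oI := openI oU oU'.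
have fo y : (U k i `&` U k i') y -> overlap i i' (f k i y).
 by move=> [[_ dy] []]; split; [exact: chart_cod|rewrite /= chartK].
have fsI : smooth_mx (U k i `&` U k i') (f k i) by apply: smooth_mx_sub fs => [].
rewrite -(jac_comp oI (overlap_open i _) fsI (trans_smx i _) fo (conj Uz Uz')).
apply: (jac_ext oI _ _ (conj Uz Uz')); first by apply: smooth_mx_sub fs' => [].
by move=> y [[_ dy]]; rewrite /coord_fam /transition /= chartK.
Qed.

(** A change of target chart multiplies [twist] on the right by its Jacobian [T]. The transformation
    rule of the connection absorbs the derivative of [T], so [tconn] itself does not change. *)
Lemma ttrace_target (k i i' : idx A) v z : U k i z -> U k i' z -> ttrace k i v z = ttrace k i' v z.
move=> Uz Uz'; have [oU fs] := fam_chart k i; have [oU' _] := fam_chart k i'.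
have [_ Jt _ _ _] := JP; have [_ _ Ct] := Cc.
have oI := openI oU oU'.
have fo y : (U k i `&` U k i') y -> overlap i i' (f k i y).
 by move=> [[_ dy] []]; split; [exact: chart_cod|rewrite /= chartK].
have fsI : smooth_mx (U k i `&` U k i') (f k i) by apply: smooth_mx_sub fs => [].
have oO := @overlap_open _ _ _ _ i i'.
have Ts := smooth_jac oO (trans_smx i _).
pose T y := jacobian (transition i i') (f k i y).
have TsI : smooth_mx (U k i `&` U k i') T by exact: (smooth_mx_comp _ oO).
have fE y : (U k i `&` U k i') y -> f k i' y = transition i i' (f k i y).
 by move=> [[_ dy]]; rewrite /coord_fam /transition /= chartK.
have hE y : (U k i `&` U k i') y -> twist k i' y = twist k i y *m T y.
 move=> [Uy Uy']; have sE : sjac k i' y = sjac k i y *m T y.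
  rewrite /sjac (jf_target Uy Uy') -{1}[jf k i y]vsubmxK mul_col_mx col_mxKd //.
 rewrite /twist sE mulmxDl -!mulmxA; congr (_ + _ *_).
 by rewrite (Jt _ _ _ (fo _ (conj Uy Uy'))) fE.
have tsI : smooth_mx (U k i `&` U k i') (twist k i) by apply: smooth_mx_sub (twist_smooth k i) => [].
have UI := conj Uz Uz' : (U k i `&` U k _) z.
have D := dmx_ext v oI UI hE.
rewrite (dmxM v UI tsI TsI) (dmx_comp v oI oO fsI Ts fo UI) in D.
have c := Ct _ _ _ (v *m jf k i z) (fo _ UI); rewrite /= (derive_dmx _ Ts (fo _ UI)) in c.
rewrite /ttrace; congr (\tr (_ *_)).
have E : tconn k i v z *m twist k i' z = tconn k i' v z *m twist k i' z.
 rewrite (tconn_twist v Uz') D (hE _ UI) /pconn (jf_target Uz Uz') [v *m (_ *m _)]mulmxA (fE _ UI).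
 rewrite -addrA -mulmxA -mulmxDr -c mulmxA mulmxA -mulmxDl.
 by rewrite tconn_twist.
by have := congr1 (mulmx^~ (invmx (twist k i' z))) E; rewrite !mulmxK ?twist_unit.
Qed.

(* The trace along the flow direction does not depend on the chart of the
  source, since the change of charts is constant in time. *)
Lemma ttrace_source (k k' i : idx A) z : U k i z -> overlap k k' (rsubmx z) ->
 ttrace k i tvec z = ttrace k' i tvec (tjoin (z 0 0) (transition k k' (rsubmx z))).
move=> Uz ov; have [oU fs] := fam_chart k i; have [oU' fs'] := fam_chart k' i.
have [_ Jt _ _ _] := JP; have oO := @overlap_open _ _ _ _ k k'.
have tr := @trans_smx _ _ _ _ k k'.
pose W := U k i `&` [set y | overlap k k' (rsubmx y)].
have oW : open W by apply: openI => //; exact: open_rsubmx.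
have Wz : W z by [].
pose h (y : 'rV_(1 + m)) := tjoin (y 0 0) (transition k k' (rsubmx y)).
have hs : smooth_mx W h.
 apply: smooth_tjoin => //; first exact: smooth_coord.
 by apply: smooth_mx_comp oW oO _ _ (smooth_rsubmx oW) => y [].
have FE y : W y -> fam_map Phi k' (h y) = fam_map Phi k y.
 by move=> [_ [_ dy]]; rewrite /fam_map /h tjoin0 tjoinr chartK.
have hU y : W y -> U k' i (h y).
 move=> Wy; have [[cy dy] [_ dy']] := Wy; split; first by rewrite /fam_dom /= /h tjoinr; exact: chart_cod.
 by rewrite /= FE.
have fE y : W y -> f k i y = f k' i (h y) by move=> Wy; rewrite /coord_fam /= FE.
pose S (y : 'rV_(1 + m)) := jacobian (transition k k') (rsubmx y).
have fsW : smooth_mx W (f k i) by apply: smooth_mx_sub fs => y [].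
have SsW : smooth_mx W S.
 by apply: smooth_mx_comp oW oO _ (smooth_jac oO _) (smooth_rsubmx oW) => y [].
have jE y (c : 'rV[R]__) : W y -> c *m jf k i y =
  tjoin (c 0 0) (rsubmx c *m S y) *m jf k' i (h y).
 move=> Wy; have [_ ovy] := Wy.
 have J1 := jac_ext oW fsW fE Wy.
 have J2 := jac_comp oW oU' hs fs' hU Wy; have J3 := etrans J1 J2.
 rewrite J3 mulmxA -{1}[c]tjoin_eta (jac_time _ _ oO) //.
have sE y : W y -> sjac k i y = S y *m sjac k' i (h y).
 move=> Wy; apply/row_matrixP => r.
 have := jE y (hlift (row r 1%:M)) Wy; rewrite hlift_jac -row_mul mul1mx => ->.
 have hl (v : 'rV[R]_m) : hlift v = tjoin 0 v by rewrite /hlift /tjoin raddf0.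
 by rewrite hl tjoin0 tjoinr -hl hlift_jac row1 -rowE row_mul.
have tE y : W y -> twist k i y = S y *m twist k' i (h y).
 move=> Wy; have [_ ovy] := Wy; rewrite /twist sE // mulmxDr !mulmxA fE //; congr (_ *_ + _).
 by rewrite /srcJ (Jt _ _ _ ovy) /h tjoinr.
have Su : S z \in unitmx.
 have := twist_unit Uz; rewrite tE // !unitmxE det_mulmx unitrM => /andP[].
 by [].
have tsW : smooth_mx W (fun y => twist k' i (h y)).
 exact: (smooth_mx_comp _ _ _ (twist_smooth _ i)).
have D := dmx_ext tvec oW Wz tE; rewrite (dmxM _ Wz SsW tsW) in D.
have S0 : dmx tvec S z = 0.
 rewrite -(dmx_cst tvec (S z) z); apply: dmx_line => c.
 by rewrite /S linearP /= tjoinr scaler0 add0r.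
rewrite S0 mul0mx add0r (dmx_comp _ oW oU' hs (twist_smooth _ i) hU Wz) in D.
have ht : tvec *m jacobian h z = tvec.
 by rewrite (jac_time _ _ oO tr (proj2 Wz)) mul0mx.
rewrite ht in D.
have tS : tjoin (@tvec R m 0 0) (rsubmx tvec *m S z) = tvec.
 by rewrite /tvec tjoin0 tjoinr mul0mx.
have tp : tvec *m jf k i z = tvec *m jf k' i (h z).
 by apply: (_ (jE z tvec Wz)); rewrite tS.
have JS : srcJ k z *m S z = S z *m srcJ k' (h z).
 by rewrite /srcJ (Jt _ _ _ (proj2 Wz)) /h tjoinr.
have pE : pconn k i tvec z = pconn k' i tvec (h z) by exact: f_equal2 (fE _ _) _.
have t1 := tconn_twist tvec Uz; rewrite pE in t1.
exact: trace_conjugation (twist_unit (hU _ Wz)) t1 (tconn_twist tvec (hU _ Wz)) (tE _ Wz) D JS.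
Qed.

Definition ttr (k : idx A) v z : R := ttrace k (chart_at A (fam_map Phi k z)) v z.

Lemma fam_dom_chart (k : idx A) z : fam_dom k z -> U k (chart_at A (fam_map Phi k z)) z.
move=> cz; split => //; exact: chart_at_dom. Qed.

Lemma ttr_local (k i : idx A) v z : U k i z -> ttr k v z = ttrace k i v z.
by move=> Uz; apply: ttrace_target => //; apply: fam_dom_chart; case: Uz. Qed.

Lemma ttr_smooth (k : idx A) v : smooth_fun (fam_dom k) (ttr k v).
apply: smooth_local => z /fam_dom_chart Uz; exists (U k (chart_at A (fam_map Phi k z))) => //.
apply: smooth_ext (proj1 (fam_chart _ _)) _ (ttrace_smooth _ _ v) => y Uy.
by rewrite (ttr_local _ Uy).
Qed.

Lemma ttr_derive (k i : idx A) u v z : U k i z ->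
 dd u (fun y => ttrace k i v y) z = dd u (fun y => ttr k v y) z.
move=> Uz; apply: near_eq_derive; apply(nearU (proj1 (fam_chart k i)) Uz) => y Uy.
by rewrite (ttr_local _ Uy).
Qed.

Lemma curvature_anti i y (u v : 'rV[R]_m) : curvature C i y u v = - curvature C i y v u.
exact: anti4. Qed.

(** Time is the direction in which [srcJ] is constant. [curvature_anti] puts it into the slot where
    [curvature_ttrace] expects such a direction. *)
Lemma chern_transgression (k : idx A) z v : is_form (chern_form J C) -> fam_dom k z ->
 pullback (fam_map Phi k) (chern_form J C) z (col_mx tvec (hlift v)) =
 (4 * pi)^-1 * (dd tvec (fun y => ttr k (hlift v) y) z - dd (hlift v) (fun y => ttr k tvec y) z).
move=> fc cz; have Uz := fam_dom_chart cz; set i := chart_at _ _ in Uz.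
have [oU fs] := fam_chart k i.
rewrite (pullbackE (fam_open k) (inv_smooth F k) _ fc cz (proj2 Uz)).
have E B : (col_mx tvec (hlift v) : 'M[R]__) *m B = (col_mx (tvec *m B) (hlift v *m B) : 'M[R]_(2, m)).
 exact: mul_col_mx.
rewrite E /chern_form col_mxKu col_mxKd; congr (_ _).
rewrite curvature_anti mulNmx raddfN /= (curvature_ttrace _ Uz); last first.
 rewrite -(dmx_cst tvec (srcJ k z) z); apply: dmx_line => c.
 by rewrite /srcJ linearP /= /tvec tjoinr scaler0 add0r.
by rewrite opprB (ttr_derive _ _ Uz) ttr_derive.
Qed.

(** Where the flow is the identity, [twist] is 2 J. The value does not involve t, so it is the same
    at both ends of the loop. *)
Lemma ttrace_id (k : idx A) t x v : cod k x -> Phi t = id ->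
 ttr k (hlift v) (tjoin t x) =
 \tr ((dmx v (fun y => J k y + J k y) x + (J k x + J k x) *m C k x v) *m invmx (J k x + J k x) *m J k x).
move=> cx Pt; have [oU fs] := fam_chart k k.
have FE y : fam_map Phi k (tjoin t y) = param k y by rewrite /fam_map tjoin0 tjoinr Pt.
have Ut y : cod k y -> U k k (tjoin t y).
 by move=> cy; split; [rewrite /fam_dom /= tjoinr|rewrite /= FE; exact: param_dom].
have fE y : cod k y -> f k k (tjoin t y) = y by move=> cy; rewrite /coord_fam /= FE paramK.
have oc := (cod_open k).
have js : smooth_mx (cod k) (tjoin t).
 apply: smooth_tjoin => //; [exact: smooth_cst|exact: smooth_mx_id].
have sE y : cod k y -> sjac k k (tjoin t y) = 1%:M.
 move=> cy; rewrite -[LHS]mul1mx -hlift_jac -(jac_tjoin t y).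
 rewrite mul1mx -(jac_comp oc oU js fs Ut cy) -(jac_id y).
 exact: (jac_ext _ (smooth_mx_comp _ oU Ut fs js)).
have tE y : cod k y -> twist k k (tjoin t y) = J k y + J k y.
 by move=> cy; rewrite /twist sE // mulmx1 mul1mx fE // /srcJ tjoinr.
have D : dmx (hlift v) (twist k k) (tjoin t x) = dmx v (fun y => J k y + J k y) x.
 rewrite -(dmx_ext v oc cx tE); apply: dmx_line => c.
 by rewrite tjoin_affine /hlift /tjoin raddf0.
rewrite (ttr_local _ (Ut _ cx)) /ttrace /tconn D /pconn hlift_jac sE // mulmx1 fE // tE //.
by rewrite /srcJ tjoinr.
Qed.

Lemma chern_fiber_exact : is_form (chern_form J C) ->
 exact_form (fiber_int Phi 0 1 (chern_form J C)).
move=> fc; pose K : R := - (4 * pi)^-1.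
pose b : dform A 0 := fun k x _ => K * \i[0, 1] t, ttr k tvec (tjoin t x).
have sm k v : smooth_fun ([set: R^o] `*` cod k : _)
  (fun p => ttr k v (tjoin p.1 p.2)).
 have := @smooth_aff R _ (R^o * 'rV_m)%type (fun p => _ p.1 p.2) (fun p => tjoin p.1 p.2)
  _ (fam_dom k) (fun z => _ k v z); apply.
 - exact: open_setTX (cod_open k).
 - by move=> p []; rewrite /fam_dom /= tjoinr.
 - by move=> p; apply: tjoin_cont; [exact: cvg_fst|exact: cvg_snd].
 - move=> h u x; exact: tjoin_lin.
 - exact: ttr_smooth.
have bs k := smooth_int (G := fun t x => _ (_ t x)) ler01 (cod_open k) (sm k tvec).
exists b; split.
 split=> [k x _|k V|k k' x V ov].
 - by split=> [[]|? []].
 - exact: smoothM (cod_open k) (smooth_cst K (cod_open k)) _.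
 - have E t : ttr k tvec (tjoin t x) = ttr k' tvec (tjoin t (transition k k' x)).
   have cz : fam_dom k (tjoin t x) by rewrite /fam_dom /= tjoinr; case: ov.
   have Uz := fam_dom_chart cz; rewrite {1}/ttr.
   have ov' : overlap k k' (rsubmx (tjoin t x)) by rewrite tjoinr.
   rewrite (ttrace_source Uz ov') /ttr /fam_map !tjoin0 !tjoinr.
   by rewrite chartK; case: ov.
  congr (K * _); exact: eq_int.
move=> k x V cx; have oF := fam_open k.
have zc t : fam_dom k (tjoin t x) by rewrite /fam_dom /= tjoinr.
rewrite /ext_d big_ord1 mul1r row_id.
have dI := smooth_int_is_derive (G := fun t x => _ (_ t x)) V ler01 (cod_open k) (sm k tvec) cx.
have [_ ->] := is_deriveZ K.
have DP u t : is_dd x V (fun y => ttr k u (tjoin t y)) (dd (tjoin 0 V) (fun z => ttr k u z) (tjoin t x)).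
 apply: is_dd_aff; first by move=> h; exact: tjoin_affine.
 exact: smooth_derivable (ttr_smooth k u) _.
have DT u t : is_deriv t (fun s => ttr k u (tjoin s x))
  (dd tvec (fun z => ttr k u z) (tjoin t x)).
 apply: is_dd_aff.
  move=> h; rewrite /GRing.scale /= mulr1; exact: tjoin_line.
 exact: smooth_derivable (ttr_smooth k u) _.
have cD u v : continuous (fun t : R => dd v (fun z => ttr k u z) (tjoin t x)).
 move=> t; apply: (@continuous_comp _ _ _ (fun => _) (fun z => dd v _ z)).
  apply: tjoin_cont; [exact: cvg_id|exact: cvg_cst].
 exact: smooth_cont (smooth_D v (ttr_smooth k u)) _.
have hl : tjoin 0 V = hlift V by rewrite /hlift /tjoin raddf0.
pose f1 t := dd tvec (fun z => ttr k (hlift V) z) (tjoin t x).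
pose f2 t := dd (hlift V) (fun z => ttr k tvec z) (tjoin t x).
have f1c : continuous f1 by exact: cD.
have f2c : continuous f2 by exact: cD.
have I1 : \i[0, 1] t, f1 t = 0.
 rewrite (FTC2 ler01 f1c).
 rewrite (ttrace_id V cx (flow_inv0 F (lexx 0))) (ttrace_id V cx (flow_inv1 F (lexx 1))).
 by rewrite subrr.
have f12 : continuous (fun t : R => f1 t - f2 t).
 move=> t; apply: cvgB; [exact: f1c|exact: f2c].
have E1 : \i[0, 1] t, dd V (fun y => ttr k tvec (tjoin t y)) x = \i[0, 1] t, f2 t.
 by apply: eq_int => t; have [_] := DP tvec t; rewrite hl.
have E2 : fiber_int Phi 0 1 (chern_form J C) k x V = \i[0, 1] t, ((4 * pi)^-1 * (f1 t - f2 t)).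
 apply: eq_int => t _; exact: chern_transgression.
apply(etrans (congr1 (fun y => K * y) E1)).
exact: neg_scale (etrans E2 (intZ _ _ _ f12)) (intB _ _ f1c f2c) I1.
Qed.

End TwistedChernForm.

(** * The spherically monotone case *)

Section MonotoneCase.
Context {R m M} {A : atlas R m M}.

Lemma fiber_int_comb (Phi : R -> M -> M) t0 t1 k (a b : dform A k.+1) c : smooth_family A Phi ->
 is_form a -> is_form b ->
 form_eq (fiber_int Phi t0 t1 (form_comb a c b))
  (form_comb (fiber_int Phi t0 t1 a) c (fiber_int Phi t0 t1 b)).
move=> Ps fa fb i x V cx; rewrite /form_comb /fiber_int.
have ca := fiber_cont (B := col_mx tvec (hlift V)) Ps fa cx.
have cb := fiber_cont (B := col_mx tvec (hlift V)) Ps fb cx.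
have cb' : continuous (fun t : R => c * pullback (fam_map Phi i) b (tjoin t x) (col_mx tvec (hlift V))).
 move=> t; apply: cvgM; [exact: cvg_cst|exact: cb].
exact: etrans (intD _ _ _ _) (congr1 _ (intZ _ _ _ _)).
Qed.

Lemma form0_is k : is_form (@form0 R m M A k).
split=> [i x _|i V|//]; last exact: smooth_cst (cod_open i).
by split=> [r V V1 V2 c1 c2 |]; rewrite /form0 ?mulr0 ?addr0.
Qed.

Lemma ext_d0 k i x V : ext_d (@form0 R m M A k) i x V = 0.
rewrite /ext_d big1 // => r _; rewrite /form0.
by rewrite derive_cst mulr0.
Qed.

Lemma exactN k (a : dform A k.+1) : exact_form a -> exact_form (form_comb (@form0 _ _ _ _ k.+1) (-1) a).
move=> [b [fb bE]]; have f0 := form0_is k.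
exists (form_comb (@form0 _ _ _ _ k) (-1) b); split; first exact: form_comb_is.
move=> i x V cx; by rewrite (ext_d_comb _ _ f0 fb cx) (bE i x V cx) ext_d0.
Qed.

(** The slices at 0 and 1 cancel in the homotopy formula, which leaves T (d b) = - d (T b) for the
    fibre integral T. *)
Lemma fiber_exact (Phi : R -> M -> M) k (b : dform A k.+1) : smooth_family A Phi ->
 Phi 0 = id -> Phi 1 = id -> is_form b ->
 exact_form (fiber_int Phi 0 1 (ext_d b)).
move=> Ps P0 P1 fb.
have fd := ext_d_form fb.
have E : exact_form (ext_d (fiber_int Phi 0 1 b)).
 exists (fiber_int Phi 0 1 b); exact: (conj (fiber_int_form _ _ fb)).
apply: exact_form_eq (exactN E) => i x V cx.
rewrite /form_comb (fiber_int_d Ps V ler01 fb fd (fun _ _ _ _ => erefl) cx).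
by rewrite /slice_form P0 P1 subrr sub0r mulrNN mul1r add0r.
Qed.

Variables (w : dform A 2) (psi phi : R -> M -> M) (x0 : M).
Hypotheses (Mcl : closed_connected_manifold M) (fw : is_form w).

Lemma c1_fiber_exact (c1 : dform A 2) (f : R -> M -> M) : represents_c1 w c1 -> Symp0_loop w f ->
 exact_form (fiber_int (inverse_flow f) 0 1 c1).
move=> [J [C [JP Cc CJ [[fc _] [b [fb bE]]]]]] fl; have F := loop_flow Mcl fl.
have P0 := flow_inv0 F (lexx 0); have P1 := flow_inv1 F (lexx 1).
have fd := ext_d_form fb.
have fch : is_form (chern_form J C).
 apply: is_form_eq (form_comb_is (-1) fc fd) => i x V cx.
 by rewrite /form_comb (bE i x V cx) /form_sub mulN1r opprB addrCA subrr addr0.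
have cE : form_eq c1 (form_comb (chern_form J C) 1 (ext_d b)).
 by move=> i x V cx; rewrite /form_comb (bE i x V cx) /form_sub mul1r addrCA subrr addr0.
have E := exact_comb 1 (chern_fiber_exact F fw JP Cc CJ fch) (fiber_exact (inv_smooth F) P0 P1 fb).
apply: (exact_form_eq _ E) => i x V cx.
rewrite -(fiber_int_comb 0 1 1 (inv_smooth F) fch fd V cx).
apply: eq_int => t _; apply: cE; exact: chart_cod (chart_at_dom _ _).
Qed.

Hypotheses (psi_loop : Symp0_loop w psi) (phi_loop : Symp0_loop w phi).
Hypothesis orbits : loop_homotopic x0 (fun t => psi t x0) (fun t => phi t x0).

Lemma add_scale0 (l1 l2 e1 e2 c z1 z2 : R) : e1 = l1 + c * z1 -> e2 = l2 + c * z2 -> z1 = 0 ->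
 z2 = 0 -> e1 = e2 -> l1 = l2.
by move=> -> -> -> ->; rewrite mulr0 !addr0. Qed.

Lemma monotone_flux_eq : spherically_monotone w -> flux w psi = flux w phi.
move=> [l [_ [c1 c1P sph]]]; have fc : is_form c1 by case: c1P => J [C [_ _ _ [[]]]].
have F1 := inv_smooth (loop_flow Mcl psi_loop); have F2 := inv_smooth (loop_flow Mcl phi_loop).
have fe := form_comb_is (- l) fw fc.
apply(flux_eq_of_periods Mcl fw psi_loop phi_loop (x0 := x0)) => p ps p0 p1.
have sz v : sphere A v -> sphere_integral v (form_comb w (- l) c1) = 0.
 by move=> sv; rewrite (sphere_integral_comb _ fw fc sv) (sph v sv) mulNr subrr.
have E := period_eq Mcl psi_loop phi_loop orbits fe sz ps p0 p1.
have LE f : smooth_family A (inverse_flow f) -> line p (fiber_int (inverse_flow f) 0 1 (form_comb w (- l) c1)) =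
  line p (fiber_int (inverse_flow f) 0 1 w) + - l * line p (fiber_int (inverse_flow f) 0 1 c1).
 move=> fs; apply(etrans (line_eq _ (fiber_int_comb 0 1 _ fs fw fc))).
 exact: line_comb (fiber_int_form fs _ fw) (fiber_int_form fs ler01 fc) ps.
have Z f : Symp0_loop w f -> line p (fiber_int (inverse_flow f) 0 1 c1) = 0.
 move=> fl; have fs := inv_smooth (loop_flow Mcl fl).
 apply(line_exact (c1_fiber_exact c1P fl) (fiber_int_form fs ler01 fc) ps); by rewrite p0.
exact: add_scale0 (LE _ _) (LE _ _) (Z _ _) (Z _ _) E.
Qed.

End MonotoneCase.

(** * Wedge products at a point *)

Section WedgeAlgebra.
Context {R : realType}.

Lemma row_off p q (r s : 'I_p) (V W : 'M[R]_(p, q)) : s != r -> row' r V = row' r W ->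
 row s V = row s W.
by case: p r s V W => [[]//|p] r s V W; exact: row_eq_row'. Qed.

(** A row that varies linearly is either absent from a selection of distinct rows or occurs there
    once. In [wdg_ml] it is present in exactly one of the two factors. *)
Lemma ml_rowsub k l m (a : 'M[R]_(k, m) -> R) (f : 'I_k -> 'I_l) (r : 'I_l)
  (V V1 V2 : 'M[R]_(l, m)) c1 c2 : multilinear a -> injective f ->
 row r V = c1 *: row r V1 + c2 *: row r V2 -> row' r V1 = row' r V -> row' r V2 = row' r V ->
 (forall q, f q != r) /\ rowsub f V1 = rowsub f V /\ rowsub f V2 = rowsub f V \/
 a (rowsub f V) = c1 * a (rowsub f V1) + c2 * a (rowsub f V2) /\
 (exists q, f q = r).
move=> am fi E E1 E2.
have eqr s : s != r -> row s V1 = row s V /\ row s V2 = row s V.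
 move=> sr; split; [exact: row_off E1|exact: row_off E2].
have [[q fq]|nf] := pselect (exists q, f q = r).
 right; split; last by exists q.
 have R0 (W : 'M[R]_(l, m)) s : row s (rowsub f W) = row (f s) W by apply/rowP => j; rewrite !mxE.
 have R' W : row' r W = row' r V -> row' q (rowsub f W) = row' q (rowsub f V).
  move=> EW; apply/row_matrixP => s.
  have RR (X : 'M[R]_(k, m)) : row s (row' q X) = row (lift q s) X by apply/rowP => j; rewrite !mxE.
  rewrite !RR !R0; apply: row_off EW.
  by rewrite -fq (inj_eq fi) eq_sym neq_lift.
 apply(am q); rewrite ?R0 ?fq //; [exact: R'|exact: R'].
left; have fr q : f q != r by apply/eqP => fq; apply: nf; exists q.
split => //; split; apply/row_matrixP => s; have [e1 e2] := eqr _ (fr s).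
 by move: e1 => /rowP e1; apply/rowP => j; have := e1 j; rewrite !mxE.
by move: e2 => /rowP e2; apply/rowP => j; have := e2 j; rewrite !mxE.
Qed.

Variable m : nat.

Definition wdg k l (a : 'M[R]_(k, m) -> R) (b : 'M[R]_(l, m) -> R) (V : 'M[R]_(k + l, m)) : R :=
 ((k`! * l`!)%N%:R)^-1 * \sum_(s : 'S_(k + l))
  (-1) ^+ s * a (usubmx (row_perm s V)) * b (dsubmx (row_perm s V)).

Fixpoint wdgp (w : 'M[R]_(2, m) -> R) p : 'M[R]_(p * 2, m) -> R :=
 match p return 'M[R]_(p * 2, m) -> R with
 | 0%N => fun=> 1
 | p'.+1 => wdg w (@wdgp w p')
 end.

Lemma wdg_term_r (e x c1 y1 c2 y2 : R) : e * x * (c1 * y1 + c2 * y2) = c1 * (e * x * y1) + c2 * (e * x * y2).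
by ring. Qed.

Lemma wdg_term_l (e y c1 x1 c2 x2 : R) : e * (c1 * x1 + c2 * x2) * y = c1 * (e * x1 * y) + c2 * (e * x2 * y).
by ring. Qed.

Lemma wdg_ml k l (a : 'M[R]_(k, m) -> R) (b : 'M[R]_(l, m) -> R) :
 multilinear a -> multilinear b -> multilinear (wdg a b).
move=> am bm r V V1 V2 c1 c2 E E1 E2; rewrite /wdg.
rewrite mulrCA [c2 * _]mulrCA -mulrDr; congr (_ _); rewrite !mulr_sumr -big_split.
apply: eq_bigr => s _ /=.
pose f q := s (lshift l q); pose g q := s (rshift k q).
have fi : injective f by move=> q q' /perm_inj/lshift_inj.
have gi : injective g by move=> q q' /perm_inj/rshift_inj.
have fE W : usubmx (row_perm s W) = rowsub f W by apply/matrixP => i j; rewrite !mxE.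
have gE W : dsubmx (row_perm s W) = rowsub g W by apply/matrixP => i j; rewrite !mxE.
rewrite !fE !gE.
have [[fr [-> ->]]|[-> [q fq]]] := ml_rowsub am fi E E1 E2;
 have [[gr [-> ->]]|[-> [q' gq]]] := ml_rowsub bm gi E E1 E2.
- have := splitP (s^-1%g r) => -[q qE|q qE].
  have /negP := fr q; case; apply/eqP; rewrite /f -[RHS](permKV s); congr (s _).
  exact: val_inj.
 have /negP := gr q; case; apply/eqP; rewrite /g -[RHS](permKV s); congr (s _).
 exact: val_inj.
- exact: wdg_term_r.
- exact: wdg_term_l.
- have := congr1 val (perm_inj (etrans fq (esym gq))) => /=; have := ltn_ord q; lia.
Qed.

(** Multiplication by the transposition of [r] and [s] pairs permutations of opposite sign and
    leaves the remaining factors unchanged when these rows agree. *)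
Lemma wdg_alt k l (a : 'M[R]_(k, m) -> R) (b : 'M[R]_(l, m) -> R) : Defs.alternating (wdg a b).
move=> V r s rs E.
have EV : row_perm (tperm r s) V = V.
 apply/row_matrixP => q; have -> : row q (row_perm (tperm r s) V) = row (tperm r s q) V.
  by apply/rowP => j; rewrite !mxE.
 by case: tpermP => [->|->|].
pose S := \sum_(t : 'S__) (-1) ^+ t * a (usubmx (row_perm t V)) * b (dsubmx (row_perm t V)).
suff SE : S = - S.
 by have S0 : S = 0 by [lra]; rewrite /wdg -/S S0 mulr0.
rewrite {1}/S (reindex_inj (mulIg (tperm r s))) -sumrN; apply: eq_bigr => t _.
have -> : row_perm (t * tperm r s)%g V = row_perm t V.
 rewrite -{2}EV; apply/matrixP => i j; rewrite !mxE permM //.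
by rewrite odd_permM odd_tperm rs signr_addb mulrN1 !mulNr.
Qed.

Lemma wdg_mul k l (a : 'M[R]_(k, m) -> R) (b : 'M[R]_(l, m) -> R) (g : 'M[R]_m) V :
 wdg a b (V *m g) = wdg (fun U => a (U *m g)) (fun U => b (U *m g)) V.
rewrite /wdg; congr (_ _); apply: eq_bigr => s _.
have -> : row_perm s (V *m g) = row_perm s V *m g.
 by apply/row_matrixP => q; apply/rowP => j; rewrite !mxE; apply: eq_bigr => t; rewrite mxE.
by rewrite mul_usub_mx mul_dsub_mx.
Qed.

Lemma wdg_ext k l (a a' : 'M[R]_(k, m) -> R) (b b' : 'M[R]_(l, m) -> R) V :
 (forall U, a U = a' U) -> (forall U, b U = b' U) -> wdg a b V = wdg a' b' V.
by move=> aE bE; congr (_ * _); apply: eq_bigr => s; rewrite aE bE. Qed.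

Lemma wdg_lin k l (a a1 a2 : 'M[R]_(k, m) -> R) (b : 'M[R]_(l, m) -> R) c1 c2 V :
 (forall U, a U = c1 * a1 U + c2 * a2 U) -> wdg a b V = c1 * wdg a1 b V + c2 * wdg a2 b V.
move=> aE; rewrite /wdg mulrCA [c2 * _]mulrCA -mulrDr; congr (_ _); rewrite !mulr_sumr -big_split.
apply: eq_bigr => s _; rewrite aE; exact: wdg_term_l.
Qed.

Lemma wdgp_ml w p : multilinear w -> multilinear (@wdgp w p).
by move=> wm; elim: p => [|p]; [case|exact: wdg_ml]. Qed.

Lemma wdgp_mul w w' p (g : 'M[R]_m) V : (forall U, w (U *m g) = w' U) ->
 wdgp w (V *m g) = @wdgp w' p V.
move=> wg; elim: p V => [//|p IH] V /=; rewrite wdg_mul; exact: wdg_ext. Qed.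

End WedgeAlgebra.

(** * Contraction of vectors with the symplectic volume *)

Section Interior.
Context {R : realType}.

Lemma det_col_row' k (X : 'rV[R]_k.+1) l :
 \det (col_mx X (row' l 1%:M) : 'M[R]_k.+1) = (-1) ^+ l * X 0 l.
have := cofactor_col_mx X 1%:M l; rewrite (bigD1 l) //= big1 => [|j jl]; last first.
 have := congr1 (fun B : 'M[R]_k.+1 => B j l) (mul_mx_adj (1%:M : 'M[R]_k.+1)).
 by rewrite mul1mx !mxE (negbTE jl) => ->; rewrite mulr0.
have := congr1 (fun B : 'M[R]_k.+1 => B l l) (mul_mx_adj (1%:M : 'M[R]_k.+1)).
rewrite mul1mx det1 !mxE eqxx => ->; rewrite mulr1 addr0 => <-.
by rewrite mulrA -exprD addnn -mul2n exprM sqrrN !expr1n mul1r.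
Qed.

Variables (p : nat).
Local Notation m := (p * 2).+2.
Variable w : 'M[R]_(2, m) -> R.
Hypotheses (wm : multilinear w) (wa : Defs.alternating w).
Hypothesis wn : forall v : 'rV[R]_m, v != 0 -> exists u : 'rV[R]_m, w (col_mx v u) != 0.
Let B (u v : 'rV[R]_m) := w (col_mx u v).

Let Blin c u u' v : B (c *: u + u') v = c * B u v + B u' v.
rewrite /B; have H (x : 'rV_m) : w (col_mx x v) = w (setrow (lshift 1 (0 : 'I_1)) x (col_mx 0 v)).
 by rewrite setrow_col_mx.
by rewrite !H ml_lin.
Qed.

Let Banti u v : B u v = - B v u.
exact: alt_col_swap. Qed.

Let Bself u : B u u = 0.
have := Banti u u => H; lra. Qed.

Let Blinr c u v v' : B u (c *: v + v') = c * B u v + B u v'.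
rewrite Banti Blin ![B _ u]Banti; ring. Qed.

Let B0 v : B 0 v = 0.
have := Blin 1 0 0 v; rewrite scaler0 addr0 => H; lra. Qed.

Let Bsc c u v : B (c *: u) v = c * B u v.
by rewrite -[c *: u]addr0 Blin B0 addr0. Qed.

Let Bscr c u v : B u (c *: v) = c * B u v.
by rewrite Banti Bsc [B u v]Banti mulrN. Qed.

(** Up to a constant factor, the contraction of [X] with w^(p+1). *)
Definition iwedge (X : 'rV[R]_m) (V : 'M[R]_(1 + p * 2, m)) : R :=
 wdg (fun v => w (col_mx X v)) (@wdgp R m w p) V.

Let iml X : multilinear (iwedge X).
apply: wdg_ml; last exact: wdgp_ml.
move=> r V V1 V2 c1 c2; rewrite !row_id => -> _ _.
change (B X (c1 *: V1 + c2 *: V2) = c1 * B X V1 + c2 * B X V2); by rewrite Blinr Bscr.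
Qed.

Lemma interior_wedge_linear c1 c2 X X1 X2 V : X = c1 *: X1 + c2 *: X2 ->
 iwedge X V = c1 * iwedge X1 V + c2 * iwedge X2 V.
move->; apply: wdg_lin => u.
change (B (c1 *: X1 + c2 *: X2) u = c1 * B X1 u + c2 * B X2 u).
by rewrite Blin Bsc.
Qed.

(** The symplectic transvection u |-> u + w(u, v) v, as a matrix acting on the right. *)
Let transv (v : 'rV[R]_m) : 'M[R]_m := 1%:M + (\col_i B (delta_mx 0 i) v) *m v.

Let transvE u v : u *m transv v = u + B u v *: v.
rewrite mulmxDr mulmx1 mulmxA; congr (_ _).
have -> : u *m \col_i B (delta_mx 0 i) v = (B u v)%:M.
 apply/matrixP => i j; rewrite !ord1 !mxE mulr1n.
 have H s : B (\sum_(l <- s) u 0 l *: delta_mx 0 l) v = \sum_(l <- s) u 0 l * B (delta_mx 0 l) v.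
  by elim: s => [|l s IH]; rewrite ?big_nil // !big_cons Blin IH.
 by rewrite [in RHS](row_sum_delta u) H; apply: eq_bigr => l; rewrite mxE.
by rewrite mul_scalar_mx.
Qed.

(* The symplectic transvections that fix X show that the vector dual to the
  (2n-1)-form [iwedge X] is orthogonal to the orthogonal of X, hence
  proportional to X. *)
Lemma iwedge_self X V s : row s V = X -> iwedge X V = 0.
move=> sV; have ia : Defs.alternating (iwedge X) by exact: wdg_alt.
have := alt_cotop (iml X) ia; set xi := \row_j _ => xiE.
have [X0|X0] := eqVneq X 0.
 rewrite (@interior_wedge_linear 0 0 X 0 0) ?scaler0 ?addr0 //.
 by rewrite mul0r addr0.
have ort v : B X v = 0 -> B xi v = 0.
 move=> Xv; apply/eqP/negPn/negP => a0.
 pose g := transv v; pose g' := transv (- v).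
 have winv U : w (U *m g) = w U.
  rewrite -[U](@vsubmxK _ 1) (@mul_col_mx _ 1) !transvE.
  set u1 := @usubmx _ 1 1 _ U; set u2 := @dsubmx _ 1 1 _ U.
  change (B (u1 + B u1 v *: v) (u2 + B u2 v *: v) = B u1 u2).
  rewrite addrC [u2 + _]addrC Blin !Blinr Bself [B v _]Banti; ring.
 have FX U : iwedge X (U *m g) = iwedge X U.
  rewrite /iwedge wdg_mul; apply: wdg_ext => u; last exact: wdgp_mul.
  have XX : X *m g = X by rewrite transvE Xv scale0r addr0.
  by rewrite -[in LHS]XX -mul_col_mx.
 (* Invariance under [g] says that det(xi; V g) = det(xi; V), and xi is the image of xi - w(xi, v) v
    under [g]. Pairing with v gives determinant 1, and then w(xi, v) v = 0. *)
 have E : xi = \det g *: (xi - B xi v *: v).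
  apply/rowP => l; have := FX (row' l 1%:M); rewrite !xiE.
  have -> : col_mx xi (row' l 1%:M *m g) = col_mx (xi - B xi v *: v) (row' l 1%:M) *m g :> 'M[R]_m.
   rewrite mul_col_mx transvE.
   have := Blin (- B xi v) v xi v; rewrite Bself mulr0 add0r scaleNr addrC => ->.
   by rewrite subrK.
  rewrite det_mulmx !det_col_row' [RHS]mulrC mulrAC -mulrA => H.
  have sn : ((-1) ^+ l : R) != 0 by rewrite signr_eq0.
  by rewrite [RHS]mxE; apply(mulIf sn); rewrite -H mulrC.
 have d1 : \det g = 1.
  have := congr1 (fun x => B x v) E; rewrite -[_ *: _]addr0 Blin.
  have := Blin (- B xi v) v xi v; rewrite Bself mulr0 add0r scaleNr addrC => ->.
  by rewrite B0 addr0 -{1}[B xi v]mul1r => /(mulIf a0).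
 move: E; rewrite d1 scale1r => /eqP; rewrite -subr_eq0 opprB addrCA subrr addr0 scaler_eq0 (negbTE a0) /=.
 by move=> /eqP v0; move: a0; rewrite v0 Banti B0 oppr0 eqxx.
have [u uX] := wn X0; rewrite -/(B X u) in uX.
pose c := B xi u / B X u.
have xc : xi - c *: X = 0.
 apply/eqP/negPn/negP => nz; have [v] := wn nz; rewrite -/(B _ v) => /negP; apply; apply/eqP.
 have := ort (- (B X v / B X u) *: u + v); rewrite !Blinr mulNr divfK // addNr => /(_ erefl).
 have := Blin (- c) X xi; rewrite scaleNr addrC => ->.
 by rewrite /c => H; rewrite -[B xi v](addKr (- (B X v / B X u) * B xi u)) H; field.
rewrite xiE; have -> : xi = c *: X by apply/eqP; rewrite -subr_eq0 xc.
rewrite (ml_col_scale c X V (@det_ml R m)).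
rewrite (det_alt (r := lshift _.+1 0) (s := rshift 1 s)) ?mulr0 //.
by rewrite rowKu rowKd row_id.
Qed.

(** By [iwedge_self], the expression alternates in [X] together with the rows of [V], hence is a
    multiple of the determinant. *)
Lemma iwedge_top : exists c, forall X V, iwedge X V = c * \det (col_mx X V : 'M[R]_m).
pose s (U : 'M[R]_m) := iwedge (row 0 U) (row' 0 U).
have sm : multilinear s.
 move=> r V V1 V2 c1 c2 E E1 E2; case(unliftP 0 r) => [q rE|rE].
  have r0 : 0 != r by rewrite rE.
  have nr t : lift 0 (lift q t) != r by rewrite rE eq_sym neq_lift.
  rewrite /s (row_off r0 E1) (row_off r0 E2); apply(iml _ (r := q)).
  - by rewrite !row_row' -rE.
  - apply/row_matrixP => t; rewrite !row_row'; exact: row_off.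
  - apply/row_matrixP => t; rewrite !row_row'; exact: row_off.
 rewrite rE in E E1 E2; rewrite /s E1 E2; exact: interior_wedge_linear.
have sa : Defs.alternating s.
 move=> V r q rq E; case: (unliftP 0 r) rq E => [r' ->|->]; case(unliftP 0 q) => [q' ->|->] rq E //.
 - apply(@wdg_alt R m 1 _ _ _ _ r' q'); first by rewrite (inj_eq lift_inj) in rq.
  by rewrite !row_row'.
 - by apply: (@iwedge_self _ _ r'); rewrite row_row'.
 - by apply(@iwedge_self _ _ q'); rewrite row_row' E.
exists (s 1%:M) => X V.
have := alt_top sm sa (col_mx X V : 'M[R]_m); rewrite /s row'_col_mx0.
have -> : row 0 (col_mx X V : 'M[R]_m) = X by rewrite -[RHS](row_id 0) -(@rowKu _ 1 _ _ 0 X V); congr row; apply: val_inj.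
exact.
Qed.

End Interior.

(** * The symplectic volume form and its fibre integral *)

Section Volume.
Context {R : realType} {p : nat} {M : topologicalType} {A : atlas R (p * 2).+2 M}.
Local Notation m := (p * 2).+2.

Lemma wdg_smooth (V0 : normedModType R) (U : set V0) q k l (a : V0 -> 'M[R]_(k, q) -> R)
  (b : V0 -> 'M[R]_(l, q) -> R) V : open U -> (forall B, smooth_fun U (fun x => a x B)) ->
 (forall B, smooth_fun U (fun x => b x B)) -> smooth_fun U (fun x => wdg (a x) (b x) V).
move=> oU sa sb; apply(smoothM oU (smooth_cst _ oU)); apply: smooth_sum => // s _.
by apply: smoothM => //; apply(smoothM oU (smooth_cst _ oU)).
Qed.

Lemma wdg_int q k l (f : R -> 'M[R]_(k, q) -> R) (b : 'M[R]_(l, q) -> R) V :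
 (forall B, continuous (fun t => f t B)) ->
 wdg (fun B => \i[0, 1] t, f t B) b V = \i[0, 1] t, wdg (f t) b V.
move=> fc; pose g (s : 'S__) t := (-1) ^+ s * b (dsubmx (row_perm s V)) * f t (usubmx (row_perm s V)).
have gc s : continuous (g s) by move=> t; apply: cvgM; [exact: cvg_cst|exact: fc].
have sc : continuous (fun t => \sum_s g s t) by move=> t; exact: continuous_sum_at (fun => _ t).
have E1 t : wdg (f t) b V = (k`! * l`!)%:R^-1 * \sum_s g s t.
 by congr (_ * _); apply: eq_bigr => s; rewrite /g mulrAC.
rewrite (eq_int (fun t _ => E1 t)) (intZ _ _ _ sc) (int_sum _ _ _ gc); congr (_ * _).
by apply: eq_bigr => s; rewrite (intZ _ _ _ (fc _)) mulrAC.
Qed.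

Variable w : dform A 2.
Hypothesis w_symp : symplectic_form w.
Let fw : is_form w. Proof. by case: w_symp => -[]. Qed.
Let wn i x : cod i x -> forall v : 'rV[R]_m, v != 0 -> exists u : 'rV[R]_m, w i x (col_mx v u) != 0.
move=> v v0; case: w_symp => _ H; exact: H. Qed.

(** A constant multiple of w^(p+1), written through the contraction so that [vol_col_mx] is
    immediate; that it alternates comes from [iwedge_top]. *)
Definition vol : dform A m := fun i x V => iwedge (w i x) (row 0 V) (row' 0 V).

Lemma wedge_powE i x k V : @wedge_pow _ _ _ _ w k i x V = wdgp (w i x) V.
by elim: k V => [//|k IH] V; apply: wdg_ext. Qed.

Lemma vol_col_mx i x (X : 'rV[R]_m) (V : 'M[R]_((p * 2).+1, m)) : vol i x (col_mx X V : 'M[R]_m) = iwedge (w i x) X V.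
rewrite /vol row'_col_mx0; congr iwedge.
rewrite -[RHS](row_id 0) -(@rowKu _ 1 _ _ 0 X V); congr row; exact: val_inj.
Qed.

Lemma iwedge_mul (w1 w2 : 'M[R]_(2, m) -> R) (g : 'M[R]_m) X V :
 (forall U, w1 U = w2 (U *m g)) -> iwedge w1 X V = iwedge w2 (X *m g) (V *m g).
move=> wE; rewrite /iwedge wdg_mul; apply: wdg_ext => U.
 by rewrite wE (@mul_col_mx _ 1).
by symmetry; apply: wdgp_mul => U'; rewrite wE.
Qed.

Lemma vol_mul i x j y g V : (forall U, w i x U = w j y (U *m g)) -> vol i x V = vol j y (V *m g).
move=> wE; apply(etrans (iwedge_mul _ _ wE)); rewrite /vol -row_mul.
congr (_ _); apply/matrixP => a b; rewrite !mxE.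
by apply: eq_bigr => t; rewrite mxE.
Qed.

Lemma vol_top i x : cod i x -> exists c, forall U, vol i x U = c * \det U.
move=> cx; have [c cE] := iwedge_top (form_ml fw cx) (form_alt fw cx) (wn cx).
exists c => U; rewrite /vol cE; congr (_ * \det _).
apply/row_matrixP => r; case(@splitP 1 _.+1 r) => q qE.
 have -> : r = lshift _.+1 q by apply: val_inj.
 by rewrite (@rowKu _ 1 _.+1) row_id; congr row; apply: val_inj; rewrite ord1.
have -> : r = rshift 1 q by apply: val_inj.
by rewrite (@rowKd _ 1 _.+1) row_row'; congr row; apply: val_inj.
Qed.

Lemma vol_form : is_form vol.
split=> [i x cx|i V|i j x V ov].
- have [c cE] := vol_top cx.
 split=> [r V V1 V2 c1 c2 E E1 E2|V r s rs E]; rewrite !cE.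
  rewrite (det_ml E E1 E2); ring.
 by rewrite (det_alt rs E) mulr0.
- have oc := cod_open i; apply: wdg_smooth => // B.
  exact: form_smooth.
 have H q (B' : 'M[R]_(q * 2, m)) : smooth_fun (cod i) (fun x => wdgp (w i x) B').
  elim: q B' => [|q IH] B' /=; first exact: smooth_cst.
  apply: wdg_smooth => // B2; exact: form_smooth.
 exact: H.
- apply: vol_mul => U; have [_ _ H] := fw; exact: H.
Qed.

Lemma vol_preserved f : preserved w f -> preserved vol f.
move=> H i j x V dj g; apply: vol_mul => U; exact: H. Qed.

Variables (Psi Phi : R -> M -> M).
Hypothesis F : flow_pair w Psi Phi.

(** At each time both sides contract with minus the velocity of the flow, and w^p does not depend on
    time, so that the wedge passes under the integral. *)
Lemma wedge_fiber_int i y V : cod i y ->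
 wedge (fiber_int Phi 0 1 w) (@wedge_pow _ _ _ _ w p) i y V = fiber_int Phi 0 1 vol i y V.
move=> cy; pose f t v := pullback (fam_map Phi i) w (tjoin t y) (col_mx tvec (hlift v)).
have fc B : continuous (fun t => f t B) by exact: (fiber_cont (inv_smooth F)).
transitivity (wdg (fun v => \i[0, 1] t, f t v) (wdgp (w i y) (p := p)) V).
 apply: wdg_ext => //; exact: wedge_powE.
rewrite (wdg_int _ _ fc); apply: eq_int => t _.
pose j := chart_at A (Phi t (param i y)); have dj : Defs.dom j (Phi t (param i y)) by exact: chart_at_dom.
have wP : preserved w (Psi t) by have [] := flow_symp F t.
rewrite (pull_time F cy dj erefl _ vol_form (vol_preserved wP)) vol_col_mx -mulN1r -[RHS]addr0 -(mul0r 0).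
set X := _ *m _; have -> : 0 * 0 = 0 * wdg (fun v => w i y (col_mx X v)) (wdgp (w i y) (p := p)) V.
 by rewrite !mul0r.
apply: wdg_lin => U; rewrite mul0r addr0 mulN1r.
exact: (pull_time F).
Qed.

End Volume.

(** * Closedness of the fibre integral of the symplectic form *)

Section FluxForms.
Context {R m M} {A : atlas R m M}.

Lemma closed_fiber_int (w : dform A 2) (Psi Phi : R -> M -> M) : closed_form w ->
 flow_pair w Psi Phi -> closed_form (fiber_int Phi 0 1 w).
move=> [fw dw] F; have Ps := inv_smooth F; split; first exact: fiber_int_form.
move=> i x V cx; rewrite (fiber_int_d Ps V ler01 fw (form0_is _) dw cx) /slice_form.
rewrite (flow_inv1 F (lexx 1)) (flow_inv0 F (lexx 0)) subrr sub0r; apply/eqP; rewrite oppr_eq0; apply/eqP.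
by rewrite /form0 -[RHS](mul0r (1 - 0)) -int_cst.
Qed.

Lemma exact_of_class (a b : dform A 1) : closed_form a -> deRham_class a = deRham_class b ->
 exact_form (form_sub a b).
move=> ca E; have : deRham_class a a; last by rewrite E => -[].
split => //; exists (@form0 _ _ _ _ 0); split; first exact: form0_is.
by move=> i x V; rewrite /form_sub subrr ext_d0.
Qed.

End FluxForms.

(** * The Poincare lemma with supports in a box, for functions and vector fields *)

Section BoxOperators.
Context {R : realType}.
(** [X k] climbs from 0 to 1 inside the side ]lo k, hi k[; its derivative is the bump of total
    integral 1 that represents a unit of mass in coordinate k. *)
Variables (m : nat) (lo hi : 'I_m -> R) (X : 'I_m -> R -> R).
Hypothesis Xs : forall k, smooth1 (X k).
Hypothesis Xlo : forall k s, s <= lo k -> X k s = 0 /\ deriv1 (X k) s = 0.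
Hypothesis Xhi : forall k s, hi k <= s -> X k s = 1 /\ deriv1 (X k) s = 0.
Implicit Types (f g : 'rV[R]_m -> R) (k j : 'I_m) (y : 'rV[R]_m).

Local Notation smooth f := (smooth_fun [set: 'rV[R]_m] f).
Definition pder k f y : R := dd (delta_mx 0 k) f y.
Definition setc k (s : R) y : 'rV[R]_m := \row_l if l == k then s else y 0 l.
Definition box_supp f := forall y k, y 0 k <= lo k \/ hi k <= y 0 k -> f y = 0.

Lemma setc_id k y : setc k (y 0 k) y = y.
by apply/rowP => l; rewrite mxE; case: eqP => [->|]. Qed.

Lemma setc_setc k s t y : setc k s (setc k t y) = setc k s y.
by apply/rowP => l; rewrite !mxE; case: eqP. Qed.

Lemma setc_same k s y : (setc k s y) 0 k = s. Proof. by rewrite mxE eqxx. Qed.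

Lemma setc_other k j s y : j != k -> (setc k s y) 0 j = y 0 j.
by move=> /negbTE jk; rewrite mxE jk. Qed.

Lemma setc_line k (h v s : R) y : setc k (h * v + s) y = h *: (v *: delta_mx 0 k) + setc k s y.
by apply/rowP => l; rewrite !mxE; case: eqP => _; rewrite ?mulr1 ?mulr0 ?add0r. Qed.

Lemma setc_shift k j (h s : R) y : j != k -> setc k s (h *: delta_mx 0 j + y) = h *: delta_mx 0 j + setc k s y.
move=> jk; apply/rowP => l; rewrite !mxE /=; case: eqP => [->|//].
by rewrite eq_sym (negbTE jk) mulr0 add0r.
Qed.

Lemma pder_smooth k f : smooth f -> smooth (pder k f). Proof. exact: smooth_D. Qed.

Lemma pder_is k f y : smooth f -> is_dd y (delta_mx 0 k) f (pder k f y).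
move=> fs; exact: smooth_dd. Qed.

Let pdir k f y (c : R) : smooth f -> is_dd y (c *: delta_mx 0 k) f (c * pder k f y).
move=> fs; apply: is_dd_scale; exact: pder_is. Qed.

(** The integral of [f] in coordinate k from [lo k] to [y 0 k], rescaled to fixed limits so that it
    can be differentiated as a parameter integral. *)
Definition prim k f y : R :=
 \i[0, 1] t, ((y 0 k - lo k) * f (setc k (t * (y 0 k - lo k) + lo k) y)).

Let arg k (p : R^o * 'rV[R]_m) := setc k (p.1 * (p.2 0 k - lo k) + lo k) p.2.

Let snd_smooth (l : 'I_m) : smooth_fun [set: R^o * 'rV[R]_m] (fun p => p.2 0 l).
apply(smooth_lin openT) => [p|a p q]; last by rewrite !mxE.
apply: (@continuous_comp _ _ _ _ (fun z : 'rV_m => z 0 l)); [exact: cvg_snd|exact: coord_continuous].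
Qed.

Let fst_smooth : smooth_fun [set: R^o * 'rV[R]_m] (fun p => p.1).
apply(smooth_lin openT) => [p|//]; exact: cvg_fst. Qed.

Let arg_smooth k f : smooth f -> smooth_fun [set: R^o * 'rV[R]_m] (fun p => f (arg k p)).
move=> fs; apply(smooth_comp openT openT (fun _ _ => I) fs) => i l; rewrite ord1 => n.
move: n; rewrite -/(smooth_fun _ _).
apply(smooth_ext openT (f := fun p : R^o * 'rV_m => if l == k then p.1 * (p.2 0 k - lo k) + lo k else p.2 0 l)).
 by move=> p; rewrite mxE.
case: eqP => _; last exact: snd_smooth.
apply: smoothD openT _ (smooth_cst _ openT); apply(smoothM openT fst_smooth).
exact: smoothB openT _ (smooth_cst _ openT).
Qed.

Let integrand_smooth k f : smooth f ->
 smooth_fun ([set: R^o] `*` [set: 'rV[R]_m] : set (R^o * 'rV[R]_m)) (fun p => (p.2 0 k - lo k) * f (arg k p)).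
move=> fs; rewrite setXTT; apply: smoothM openT _ (arg_smooth k fs).
exact: smoothB openT _ (smooth_cst _ openT).
Qed.

Let arg_cont k f y : smooth f -> continuous (fun t : R => f (arg k (t, y))).
move=> fs t; have := smooth_cont (arg_smooth k fs) (I : [set: R * 'rV_m] (t, y)).
by move=> /(@joint_cont_at R _ (fun t y => f (arg k (t, y)))).
Qed.

Lemma prim_smooth k f : smooth f -> smooth (prim k f).
move=> fs; exact: smooth_int openT (integrand_smooth k _).
Qed.

Let prim_FTC k f y (t : R) : smooth f ->
 is_deriv t (fun t => f (arg k (t, y))) ((y 0 k - lo k) * pder k f (arg k (t, y))).
move=> fs; have E h : arg k (h *: 1 + t : R, y) = h *: ((y 0 k - lo k) *: delta_mx 0 k) + arg k (t, y).
 rewrite -setc_line; congr setc; rewrite /GRing.scale /=; ring.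
have [d _] := pdir k (arg k (t, y)) (y 0 k - lo k) fs.
have [d' <-] := pdir k (arg k (t, y)) (y 0 k - lo k) fs.
exact: is_dd_aff.
Qed.

Lemma prim_pder k f y : smooth f -> prim k (pder k f) y = f y - f (setc k (lo k) y).
move=> fs; have c : continuous (fun t : R => (y 0 k - lo k) * pder k f (arg k (t, y))).
 move=> t; apply: cvgM; [exact: cvg_cst|exact: (arg_cont (pder_smooth k _))].
rewrite /prim (FTC2 ler01 c (fun t _ => prim_FTC k y t fs)) /arg /= mul1r subrK mul0r add0r.
by rewrite setc_id.
Qed.

Lemma pder_prim k f y : smooth f -> pder k (prim k f) y = f y.
move=> fs; have [_ E] := @smooth_int_is_derive R _ _ 0 1 (fun t y => (y 0 k - _) * f (arg k (t, y))) y (delta_mx 0 k) ler01 openT (integrand_smooth k fs) I.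
rewrite /pder; apply(etrans E).
have D t : is_dd y (delta_mx 0 k) (fun y => (y 0 k - lo k) * f (arg k (t, y)))
  ((y 0 k - lo k) * (t * pder k f (arg k (t, y))) + f (arg k (t, y))).
 have d1 : is_dd y (delta_mx 0 k) (fun y => y 0 k - lo k) 1.
  have := is_deriveB (is_dd_coord y _ k) (is_derive_cst (lo k) y (delta_mx 0 k)).
  by rewrite mxE !eqxx subr0.
 have A h : arg k (t, h *: delta_mx 0 k + y) = h *: (t *: delta_mx 0 k) + arg k (t, y).
  rewrite -setc_line; apply/rowP => l; rewrite !mxE /=; case(l =P k) => _.
   rewrite eqxx /=; ring.
  by rewrite mulr0 add0r.
 have [d _] := pdir k (arg k (t, y)) t fs; have [d' E'] := pdir k (arg k (t, y)) t fs.
 have := is_deriveM d1 (@is_dd_aff R _ _ (fun y => _ _) f y _ _ A d).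
 by rewrite E' /GRing.scale /= mulr1.
have c1 : continuous (fun t : R => (y 0 k - lo k) * (t * pder k f (arg k (t, y))) + f (arg k (t, y))).
 move=> t; apply: cvgD; last exact: arg_cont.
 apply: cvgM; [exact: cvg_cst|apply: cvgM; [exact: cvg_id|exact: (arg_cont (pder_smooth k _))]].
have E2 : \i[0, 1] t, dd (delta_mx 0 k) (fun y => (y 0 k - lo k) * f (arg k (t, y))) y =
  \i[0, 1] t, ((y 0 k - lo k) * (t * pder k f (arg k (t, y))) + f (arg k (t, y))).
 by apply: eq_int => t; have [] := D t.
apply(etrans E2).
have F (t : R) : is_deriv t (fun t => t * f (arg k (t, y)))
  ((y 0 k - lo k) * (t * pder k f (arg k (t, y))) + f (arg k (t, y))).
 have := is_deriveM (is_derive_id t 1) (prim_FTC k y t fs).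
 by rewrite /GRing.scale /= mulr1 mulrCA.
rewrite (FTC2 ler01 c1) mul0r subr0 mul1r /arg /= mul1r subrK.
by rewrite setc_id.
Qed.

Lemma pder_prim_comm k j f y : j != k -> smooth f -> pder j (prim k f) y = prim k (pder j f) y.
move=> jk fs; have [_ E] := @smooth_int_is_derive R _ _ 0 1 (fun t y => (y 0 k - _) * f (arg k (t, y))) y (delta_mx 0 j) ler01 openT (integrand_smooth k fs) I.
rewrite /pder; apply(etrans E); apply: eq_int => t _.
have kj : (delta_mx 0 j : 'rV[R]_m) 0 k = 0 by rewrite mxE eq_sym (negbTE jk).
have d1 : is_dd y (delta_mx 0 j) (fun y => y 0 k - lo k) 0.
 have := is_deriveB (is_dd_coord y _ k) (is_derive_cst (lo k) y (delta_mx 0 j)).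
 by rewrite kj subr0.
have A h : arg k (t, h *: delta_mx 0 j + y) = h *: delta_mx 0 j + arg k (t, y).
 rewrite /arg /= -(setc_shift _ _ _ jk); congr setc.
 have -> // : (h *: delta_mx 0 j + y) 0 k = y 0 k.
 by rewrite mxE mxE kj mulr0 add0r.
have [d _] := pder_is j (arg k (t, y)) fs; have [d' E'] := pder_is j (arg k (t, y)) fs.
have [_ ->] := is_deriveM _ (@is_dd_aff R _ _ (fun y => _ _) f y _ _ A d).
by rewrite /GRing.scale /= mulr0 addr0.
Qed.

Definition tot k f y : R := prim k f (setc k (hi k) y).

Definition bump k (s : R) : R := deriv1 (X k) s.
Definition proj k f y : R := bump k (y 0 k) * tot k f y.
(** Subtracting [X k] times the total integral makes the primitive vanish beyond [hi k], at the
    price of [proj]: the derivative in coordinate k is f - proj f. This is the homotopy operator of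
    the Poincare lemma with compact supports. *)
Definition hop k f y : R := prim k f y - X k (y 0 k) * tot k f y.

Let setc_smx k s : smooth_mx [set: 'rV[R]_m] (setc k s).
move=> i l; rewrite ord1; apply(smooth_ext openT (f := fun y => if l == k then s else y 0 l)).
 by move=> y; rewrite mxE.
case: eqP => _; [exact: smooth_cst openT|exact: smooth_coord openT].
Qed.

Lemma tot_smooth k f : smooth f -> smooth (tot k f).
move=> fs; exact: (smooth_comp openT openT _ (prim_smooth k _)). Qed.

Lemma pder_tot k f : pder k (tot k f) = fun=> 0.
apply/funext => y; rewrite /pder derive_line.
rewrite (_ : (fun h => _) = cst (tot k f y)) ?derive_cst //.
apply/funext => h; congr prim; apply/rowP => l; rewrite !mxE.
by case: eqP => //; rewrite mulr0 add0r.
Qed.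

Lemma pder_tot_comm k j f : j != k -> smooth f -> pder j (tot k f) = tot k (pder j f).
move=> jk fs; apply/funext => y.
have [d _] := pder_is j (setc k (hi k) y) (prim_smooth k fs).
have [_ E] := is_dd_aff (fun h => setc_shift h _ y jk) d.
exact(etrans E (pder_prim_comm _ jk fs)).
Qed.

Lemma tot_pder k f : box_supp f -> smooth f -> tot k (pder k f) = fun=> 0.
move=> sf fs; apply/funext => y; rewrite /tot prim_pder //.
by rewrite ?(sf _ k) ?subrr // setc_same; [left|right].
Qed.

Lemma prim_out k j f y : box_supp f -> j != k -> y 0 j <= lo j \/ hi j <= y 0 j -> prim k f y = 0.
move=> sf jk out; rewrite -(mul0r (1 - 0 : R)) -(int_cst 0 ler01); apply: eq_int => t _.
by rewrite (sf _ j) ?mulr0 // setc_other.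
Qed.

Lemma prim_lo k f y : box_supp f -> y 0 k <= lo k -> prim k f y = 0.
move=> sf yl; rewrite -(mul0r (1 - 0 : R)) -(int_cst 0 ler01); apply: eq_int => t /andP[t0 _].
rewrite (sf _ k) ?mulr0 //; left; rewrite setc_same.
by rewrite gerDr mulr_ge0_le0 // subr_le0.
Qed.

Lemma prim_hi k f y : box_supp f -> smooth f -> hi k <= y 0 k -> prim k f y = tot k f y.
move=> sf fs yh; pose v := (y 0 k - hi k) *: delta_mx 0 k : 'rV_m.
have yE t : t *: v + setc k (hi k) y = setc k (t * (y 0 k - hi k) + hi k) y by rewrite setc_line.
have [t /andP[t0 _]] := @MVT_dir R _ _ (fun z => _ * f z) (setc k (hi k) y) v
 (fun t _ => eq_ind _ (fun d => is_dd _ v _ (_ * d))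
   (pdir k _ _ (prim_smooth k fs)) _ (pder_prim k _ fs)).
rewrite -[v]scale1r yE mul1r subrK setc_id scale1r yE (sf _ k) ?mulr0.
 by move/eqP; rewrite subr_eq0 => /eqP.
by right; rewrite setc_same lerDr mulr_ge0 // subr_ge0.
Qed.

Lemma coord_fun_pder k j (b : R -> R) g y : smooth1 b -> smooth g ->
 pder j (fun y => b (y 0 k) * g y) y = (k == j)%:R * deriv1 b (y 0 k) * g y + b (y 0 k) * pder j g y.
move=> bs gs; have d1 := is_dd_coordc y (delta_mx 0 j) k bs.
have [_] := is_deriveM _ (pder_is j y gs).
by rewrite /pder => ->; rewrite /GRing.scale /= mxE addrC mulrC.
Qed.

Lemma proj_smooth k f : smooth f -> smooth (proj k f).
move=> fs; apply: smoothM openT _ (tot_smooth k fs).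
exact: (smooth_coordc k openT (smooth_D _ _)).
Qed.

Lemma proj_supp k f : box_supp f -> box_supp (proj k f).
move=> sf y j out; rewrite /proj; have [jk|jk] := eqVneq j k; last first.
 by rewrite /tot (prim_out _ jk) ?mulr0 // setc_other.
have -> : bump k (y 0 k) = 0; last by rewrite mul0r.
by rewrite -jk; case: out => [/Xlo[]|/Xhi[]].
Qed.

Lemma pder_proj k j f : j != k -> smooth f -> pder j (proj k f) = proj k (pder j f).
move=> jk fs; apply/funext => y.
rewrite (@coord_fun_pder k j (_ k) _ y (smooth_D _ (Xs k)) (tot_smooth k fs)).
by rewrite eq_sym (negbTE jk) !mul0r add0r pder_tot_comm.
Qed.

Lemma proj_pder k f : box_supp f -> smooth f -> proj k (pder k f) = fun=> 0.
by move=> sf fs; apply/funext => y; rewrite /proj tot_pder ?mulr0. Qed.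

Lemma hop_smooth k f : smooth f -> smooth (hop k f).
move=> fs; apply(smoothB openT (prim_smooth k fs)); apply: smoothM openT _ (tot_smooth k fs).
exact: (smooth_coordc k openT).
Qed.

Lemma hop_supp k f : box_supp f -> smooth f -> box_supp (hop k f).
move=> sf fs y j out; rewrite /hop; have [jk|jk] := eqVneq j k; last first.
 by rewrite /tot !(prim_out _ jk) ?mulr0 ?subrr // setc_other.
rewrite jk in out; case: out => out.
 by rewrite (proj1 (Xlo out)) mul0r subr0 prim_lo.
by rewrite (proj1 (Xhi out)) mul1r prim_hi // subrr.
Qed.

Let pderB j f g y : smooth f -> smooth g -> pder j (fun y => f y - g y) y = pder j f y - pder j g y.
by move=> fs gs; have [] := is_deriveB (pder_is j y fs) (pder_is j y gs). Qed.

Lemma pder_hop k j f y : smooth f ->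
 pder j (hop k f) y = if j == k then f y - proj k f y else hop k (pder j f) y.
move=> fs; rewrite pderB; [|exact: prim_smooth|]; last first.
 apply: smoothM openT _ (tot_smooth k fs); exact: (smooth_coordc k openT).
rewrite (@coord_fun_pder k j _ _ y (Xs k) (tot_smooth k fs)).
have [->|jk] := eqVneq j k; first by rewrite pder_prim // mul1r pder_tot mulr0 addr0.
by rewrite !mul0r add0r pder_prim_comm // pder_tot_comm.
Qed.

Lemma hop_pder k f y : box_supp f -> smooth f -> hop k (pder k f) y = f y.
move=> sf fs; rewrite /hop tot_pder // mulr0 subr0 prim_pder //.
by rewrite (sf (_ _) k) ?subr0 // setc_same; left.
Qed.

Definition projs (s : seq 'I_m) f := foldl (fun g k => proj k g) f s.

Lemma projs_smooth s f : smooth f -> smooth (projs s f).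
elim: s f => [//|k s IH] f fs; apply: IH; exact: proj_smooth. Qed.

Lemma projs_supp s f : box_supp f -> box_supp (projs s f).
elim: s f => [//|k s IH] f fs; apply: IH; exact: proj_supp. Qed.

Lemma pder_projs s j f : j \notin s -> smooth f -> pder j (projs s f) = projs s (pder j f).
elim: s f => [//|k s IH] f; rewrite inE negb_or => /andP[jk js] fs.
change (pder j (projs s (proj k f)) = projs s (proj k (pder j f))).
rewrite IH ?pder_proj //; exact: proj_smooth.
Qed.

Lemma projs_pder s j f : j \in s -> box_supp f -> smooth f -> projs s (pder j f) = fun=> 0.
have Z t : projs t (fun=> 0) = fun=> 0.
 elim: t => [|k t IH]; rewrite //= (_ : _ k _ = fun=> 0) //.
 apply/funext => y; rewrite /proj; have -> : tot k (fun=> 0) y = 0; last by rewrite mulr0.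
 apply: etrans (etrans (int_cst 0 ler01) (mul0r _)).
 by apply: eq_int => u; rewrite mulr0.
elim: s f => [//|k s IH] f; rewrite inE; have [->|jk] := eqVneq => /= js sf fs.
 rewrite proj_pder //.
change (projs s (proj k (pder j f)) = fun=> 0).
rewrite -pder_proj //; apply: IH => //; [exact: proj_supp|exact: proj_smooth].
Qed.

Definition below (j : nat) : seq 'I_m := take j (enum 'I_m).

Lemma mem_below (j : nat) (l : 'I_m) : (l \in below j) = (l < j)%N.
rewrite /below; have [mj|jm] := leqP m j.
 by rewrite take_oversize ?size_enum_ord // mem_enum (leq_trans _ mj).
apply/idP/idP => [/(nthP l)[n]|lj].
 rewrite size_take size_enum_ord jm => nj; rewrite nth_take // => <-.
 by rewrite nth_enum_ord // (ltn_trans nj).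
apply/(nthP l); exists l; first by rewrite size_take size_enum_ord jm.
by rewrite nth_take // nth_ord_enum.
Qed.

Lemma below_succ (j : 'I_m) : below j.+1 = rcons (below j) j.
by rewrite /below (take_nth j) ?size_enum_ord // nth_ord_enum. Qed.

(** Coordinate k contributes the difference between successive projections, which [pder_hop] writes
    as a derivative in coordinate k. *)
Lemma box_telescope (j : nat) f y : (j <= m)%N -> smooth f ->
 f y = \sum_(k < m | (k < j)%N) pder k (hop k (projs (below k) f)) y + projs (below j) f y.
move=> jm fs; elim: j jm => [|j IH] jm; first by rewrite big_pred0 // add0r /below take0.
pose oj := Ordinal jm; rewrite (IH (ltnW jm)) [in RHS](bigD1 oj) //=.
have S (g : 'I_m -> R) : \sum_(k < m | (k < j.+1)%N && (k != oj)) g k = \sum_(k < m | (k < j)%N) g k.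
 apply: eq_bigl => k; rewrite -val_eqE /=; lia.
rewrite S.
rewrite -/oj.+1 below_succ /projs foldl_rcons -/(projs _ _).
rewrite pder_hop ?eqxx; last exact: projs_smooth.
by rewrite addrAC subrK addrC.
Qed.

Definition tots (s : seq 'I_m) f := foldl (fun g k => tot k g) f s.

Lemma tots_smooth s f : smooth f -> smooth (tots s f).
elim: s f => [//|k s IH] f fs; apply: IH; exact: tot_smooth. Qed.

Lemma tot_mul k (a g : 'rV[R]_m -> R) y : (forall s z, a (setc k s z) = a z) -> smooth g ->
 tot k (fun y => a y * g y) y = a y * tot k g y.
move=> ak gs; rewrite /tot; set z := setc _ _ _.
have c : continuous (fun t : R => (z 0 k - lo k) * g (arg k (t, z))).
 move=> t; apply: cvgM; [exact: cvg_cst|exact: arg_cont].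
rewrite -(ak (hi k)) -/z; apply: etrans (intZ 0 1 _ c).
by apply: eq_int => t; rewrite ak mulrCA.
Qed.

Lemma tots_indep s f l t y : l \in s -> tots s f (setc l t y) = tots s f y.
elim/last_ind: s y => [//|s k IH] y; rewrite mem_rcons inE /tots foldl_rcons -/(tots _ _).
have [->|lk] := eqVneq => /= ls; first by rewrite /tot setc_setc.
have C s1 s2 z : setc k s1 (setc l s2 z) = setc l s2 (setc k s1 z).
 apply/rowP => i; rewrite !mxE; case(i =P k) => [->|]; case: eqP => // E.
 by rewrite E eqxx in lk.
rewrite /tot C; apply: eq_int => u _; rewrite setc_other 1?eq_sym //.
by rewrite C IH.
Qed.

Lemma projs_tots s f : uniq s -> smooth f ->
 projs s f = fun y => (\prod_(k <- s) bump k (y 0 k)) * tots s f y.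
elim/last_ind: s => [_ _|s k IH]; first by apply/funext => y; rewrite big_nil mul1r.
rewrite rcons_uniq => /andP[ks us] fs; apply/funext => y.
rewrite /projs /tots !foldl_rcons -/(projs _ _) -/(tots _ _) (IH us fs) /proj tot_mul.
- by rewrite -cats1 big_cat big_seq1 mulrA [bump _ _ * _]mulrC.
- move=> t z; rewrite !(big_nth k); apply: eq_big_nat => i /andP[_ il].
 rewrite setc_other //; apply: contraNneq ks => <-; exact: mem_nth.
- exact: tots_smooth.
Qed.

(** After all coordinates are projected, only the total integral of [f] is left, spread by the
    product of bumps; the iterated integral no longer depends on its argument, here 0. *)
Lemma projs_top f y : smooth f ->
 projs (below m) f y = tots (below m) f 0 * \prod_k bump k (y 0 k).
have bE : below m = enum 'I_m by rewrite /below take_oversize ?size_enum_ord.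
move=> fs; rewrite bE projs_tots ?enum_uniq // big_enum mulrC; congr (_ * _).
set g := _ f; have gi l t z : g (setc l t z) = g z by apply: tots_indep; rewrite mem_enum.
have H s z : g (foldl (fun z l => setc l 0 z) z s) = g z.
 by elim: s z => [//|l s IH] z; rewrite IH.
rewrite -(H (enum 'I_m)); congr g; apply/rowP => l.
have E s z : foldl (fun z l => setc l 0 z) z s 0 l = if l \in s then 0 else z 0 l.
 by elim: s z => [//|k s IH] z; rewrite IH inE mxE; case(l == k); case: (l \in s).
by rewrite E mem_enum mxE.
Qed.

Lemma prim_add k f g y : smooth f -> smooth g ->
 prim k (fun y => f y + g y) y = prim k f y + prim k g y.
move=> fs gs; have c h : smooth h -> continuous (fun t : R => (y 0 k - lo k) * h (arg k (t, y))).
 move=> hs t; apply: cvgM; [exact: cvg_cst|exact: arg_cont].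
apply: etrans (intD 0 1 (c _ fs) (c _ gs)).
by apply: eq_int => t; rewrite mulrDr.
Qed.

Lemma projs_add s f g : smooth f -> smooth g ->
 projs s (fun y => f y + g y) = fun y => projs s f y + projs s g y.
elim: s f g => [//|k s IH] f g fs gs.
change (projs s (proj k (fun y => f y + g y)) = fun y => projs s (proj k f) y + projs s (proj k g) y).
rewrite -(IH _ _ (proj_smooth k fs) (proj_smooth k gs)); congr projs; apply/funext => y.
by rewrite /proj /tot prim_add // mulrDr.
Qed.

Lemma hop_projs_sum (j : 'I_m) s (I : Type) (r : seq I) (F : I -> 'rV[R]_m -> R) y :
 (forall i, smooth (F i)) ->
 hop j (projs s (fun y => \sum_(i <- r) F i y)) y = \sum_(i <- r) hop j (projs s (F i)) y.
move=> Fs; have Hadd f g : smooth f -> smooth g ->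
  hop j (projs s (fun y => f y + g y)) y = hop j (projs s f) y + hop j (projs s g) y.
 move=> fs gs; rewrite projs_add // /hop /tot !prim_add ?mulrDr; try exact: projs_smooth.
 by rewrite opprD addrACA.
elim: r => [|i r IH].
 rewrite big_nil (_ : (fun y => _) = fun=> 0); last by apply/funext => z; rewrite big_nil.
 have c0 : smooth (fun=> 0) by exact: smooth_cst openT.
 have := Hadd _ _ c0 c0; rewrite (_ : (fun _ => 0 + 0) = fun=> 0); last by apply/funext => z; rewrite addr0.
 by move=> E; lra.
rewrite big_cons -IH -Hadd //; last exact: (smooth_sum _ openT (fun i _ => Fs i)).
by congr (hop j (projs s _) y); apply/funext => z; rewrite big_cons.
Qed.

Lemma hop_projs0 (j : 'I_m) s y : hop j (projs s (fun=> 0)) y = 0.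
have := @hop_projs_sum j s 'I_m [::] _ y (fun => smooth_cst 0 openT).
have -> : (fun z : 'rV[R]_m => \sum_(i <- [::] : _ 'I_m) 0 : R) = fun=> 0.
 by apply/funext => z; rewrite big_nil.
by rewrite big_nil.
Qed.

Lemma box_potential (Y : 'I_m -> 'rV[R]_m -> R) j y : (forall l, smooth (Y l)) ->
 (forall l, box_supp (Y l)) -> (forall y, \sum_l pder l (Y l) y = 0) ->
 Y j y = \sum_(l < m | (l < j)%N) pder l (hop l (projs (below l) (Y j))) y -
   \sum_(l < m | (j < l)%N) pder l (hop j (projs (below j) (Y l))) y.
move=> Ys Yb div; rewrite {}(@box_telescope j _ y (ltnW (ltn_ord j)) (Ys j)); congr (_ _).
have nj l : l \notin below j = (j <= l)%N by rewrite mem_below -leqNgt.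
have sb l := projs_supp (below j) (Yb l); have ss l := projs_smooth (below j) (Ys l).
rewrite -(hop_pder j y (sb j) (ss j)) pder_projs ?nj // -sumrN.
have := hop_projs_sum j (below j) (index_enum _) y (fun l => pder_smooth l (Ys l)).
rewrite (_ : (fun => _) = fun=> 0); last by apply/funext => z.
rewrite hop_projs0 (bigD1 j) //= => /esym/eqP; rewrite addr_eq0 => /eqP ->; rewrite -sumrN.
rewrite (bigID (fun l : 'I_m => (j < l)%N)) /= [X in _ + X]big1 ?addr0.
 apply: eq_big => [l|l /andP[lj jl]]; first by rewrite -val_eqE /=; lia.
 congr (- _); rewrite -pder_projs ?nj 1?ltnW // pder_hop //.
 by rewrite (negbTE lj).
move=> l /andP[lj jl]; rewrite projs_pder // ?mem_below.
 by rewrite (hop_projs0 j [::]) oppr0.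
move: lj; rewrite -val_eqE /=; lia.
Qed.

End BoxOperators.

(** * Supports of forms and extension by zero *)

Section Supports.
Context {R m M} {A : atlas R m M}.
Hypothesis Mcl : closed_connected_manifold M.

Definition off k (a : dform A k) (W : set M) : Prop :=
 forall (i : idx A) x V, cod i x -> W (param i x) -> a i x V = 0.
(** Support inside an open set, witnessed by an open [Q] that covers the rest of M and on which the
    form vanishes; no closure is formed. *)
Definition supp_in k (a : dform A k) (W : set M) : Prop :=
 exists Q, [/\ open Q, forall x, W x \/ Q x & off a Q].

Lemma param_open (i : idx A) (W : set M) : open W -> open (cod i `&` param i @^-1` W).
move=> oW; apply: open_preim => //; [exact: cod_open|move=> y; exact: param_continuous].
Qed.

Lemma off_ext_d k (a : dform A k) Q : open Q -> off a Q -> off (ext_d a) Q.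
move=> oQ aQ i x V cx Qx; rewrite /ext_d big1 // => r _.
have E y : (cod i `&` param i @^-1` Q) y -> a i y (row' r V) = 0 by move=> []; exact: aQ.
by rewrite (near_eq_derive _ (nearU (@param_open i _ oQ) (conj cx Qx) E)) derive_cst mulr0.
Qed.

Lemma supp_mono k (a : dform A k) W W' : W `<=` W' -> supp_in a W -> supp_in a W'.
by move=> WW' [Q [oQ QW]]; exists Q; split => // x; case(QW x) => [/WW'|]; [left|right].
Qed.

Lemma supp_comb k (a b : dform A k) c W : supp_in a W -> supp_in b W -> supp_in (form_comb a c b) W.
move=> [Q [oQ QW aQ]] [Q' [oQ' QW' bQ]]; exists (Q `&` Q'); split; first exact: openI.
 by move=> x; case(QW x) => []; [left|case(QW' x) => []; [left|right]].
by move=> i x V cx [Qx Qx']; rewrite /form_comb aQ // bQ // mulr0 addr0.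
Qed.

Lemma supp_form0 k W : supp_in (@form0 R m M A k) W.
by exists setT; split => //; [exact: openT|right]. Qed.

Lemma ball_open_norm (c : 'rV[R]_m) r : open [set y : 'rV[R]_m | `|y - c| < r].
rewrite (_ : [set y | _] = ball c r); first exact: ball_open.
by apply/seteqP; split=> y; rewrite -ball_normE //= distrC.
Qed.

Lemma outer_open (c : 'rV[R]_m) r : open [set y : 'rV[R]_m | r < `|y - c|].
have c1 : continuous (fun y : 'rV_m => `|y - c| : R).
 move=> y; exact: cvg_norm (cvgB _ (@cvg_cst _ c _ (nbhs y) _)).
exact: proj1 (continuousP _) _ _ (@open_gt _ r).
Qed.

Definition cell_compl (i : idx A) (c : 'rV[R]_m) (rho : R) : set M :=
 ~` (param i @` [set y | `|y - c| <= rho]).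

(** The complement of [Q] is compact and lies in the cell, so the chart distance to [c] has a
    maximum [g] on it; any radius strictly between [g] and [r] works, and the midpoint is taken. *)
Lemma supp_cell k (a : dform A k) (i : idx A) c r : 0 < r ->
 supp_in a (cell i c r) -> exists2 rho, 0 < rho < r & off a (cell_compl i c rho).
move=> r0 [Q [oQ QW aQ]]; have [_ Mc _] := Mcl.
have cK : compact (~` Q) by apply: (subclosed_compact _ Mc) => //; exact: open_closedC.
have KW x : (~` Q) x -> cell i c r x by move=> nQ; case(QW x).
have out rho : (forall x, (~` Q) x -> `|chart i x - c| < rho) -> off a (cell_compl i c rho).
 move=> H j x V cx nx; apply: aQ => //; apply: contrapT => nQ; apply: nx.
 by exists (chart i (param j x)); [exact: ltW (H _ _)|rewrite chartK; have [] := KW _ nQ].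
have [[x0 Kx0]|K0] := pselect (~` Q !=set0); last first.
 exists (r / 2); first by apply/andP; lra.
 by apply: out => x Kx; case: K0; exists x.
have fc : {within ~` Q, continuous (fun x => `|chart i x - c| : R)}.
 apply: continuous_in_subspaceT => x; rewrite inE => /KW[dx _].
 apply: cvg_norm; apply: cvgB; [exact: chart_continuous|exact: cvg_cst].
have [xm] := compact_EVT_max (ex_intro _ _ Kx0) cK fc; rewrite inE => Kxm xmax.
have [_ xr] := KW _ Kxm; set g := `|_ - c| in xr xmax.
have g0 : 0 <= g by exact: normr_ge0.
exists ((g + r) / 2); first by apply/andP; lra.
apply: out => x Kx.
have := xmax x; rewrite inE => /(_ Kx); lra.
Qed.

Section Extension.
Variables (i : idx A) (c : 'rV[R]_m) (r rho : R).
Hypotheses (gc : good_cell i c r) (rr : rho < r).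

Lemma cell_image_closed : closed (param i @` [set y | `|y - c| <= rho]).
have [H _ _] := Mcl; apply: compact_closed => //; apply: continuous_compact.
 apply: continuous_in_subspaceT => y; rewrite inE /= => yr; apply: param_continuous.
 apply: gc; exact: le_lt_trans rr.
apply: bounded_closed_compact.
 exists (rho + `|c|); split; first exact: num_real.
 move=> M' lM y /= yr; apply/ltW; apply: le_lt_trans lM.
 by rewrite -[y](subrK c); apply: le_trans (ler_normD _ _) _; rewrite lerD2r.
rewrite -(setCK [set y | _ <= _]); apply: open_closedC.
rewrite (_ : ~` _ = [set y | rho < `|y - c|]); first exact: outer_open.
by apply/seteqP; split=> y /=; rewrite ltNge => /negP.
Qed.

Let cell_compl := cell_compl i c rho.

Lemma cell_compl_open : open cell_compl.
exact: closed_openC cell_image_closed. Qed.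

Lemma cell_cover x : cell i c r x \/ cell_compl x.
have [|nx] := pselect (cell i c r x); [by left|right].
move=> [y yr xE]; apply: nx; rewrite -xE; apply: cell_param => //; exact: le_lt_trans rr.
Qed.

Lemma form_eq_cell k (a b : dform A k) : is_form a -> is_form b -> off a cell_compl ->
 off b cell_compl -> (forall y V, `|y - c| < r -> a i y V = b i y V) -> form_eq a b.
move=> [_ _ aT] [_ _ bT] ao bo ab j x V cx; case(cell_cover (param j x)) => [[dx xr]|nx]; last by rewrite ao // bo.
by rewrite (aT j i x V (conj cx dx)) (bT j i x V (conj cx dx)) ab.
Qed.

Section Form.
Variables (k : nat) (a : 'rV[R]_m -> 'M[R]_(k, m) -> R).
Hypothesis am : forall y, `|y - c| < r -> multilinear (a y) /\ Defs.alternating (a y).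
Hypothesis asm : forall V, smooth_fun [set y | `|y - c| < r] (fun y => a y V).
Hypothesis av : forall y V, `|y - c| < r -> rho < `|y - c| -> a y V = 0.

Definition extz : dform A k := fun j x V =>
 if pselect (cell i c r (param j x)) then a (transition j i x) (V *m jacobian (transition j i) x) else 0.

Lemma extz_in j x V : cell i c r (param j x) ->
 extz j x V = a (transition j i x) (V *m jacobian (transition j i) x).
by rewrite /extz; case: pselect. Qed.

Lemma extz_out j x V : ~ cell i c r (param j x) -> extz j x V = 0.
by rewrite /extz; case: pselect. Qed.

Lemma extz_off : off extz cell_compl.
move=> j x V cx nx; rewrite /extz; case: pselect => // -[dx xr]; apply: av => //.
rewrite ltNge; apply/negP => xl; apply: nx; exists (transition j i x) => //.
by rewrite chartK.
Qed.

Lemma extz_supp : supp_in extz (cell i c r).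
exists cell_compl; split; [exact: cell_compl_open|exact: cell_cover|exact: extz_off]. Qed.

(** M is covered by the open cell, where the form is carried by transition maps, and by the open
    complement of the smaller closed cell, where it is zero. *)
Lemma extz_form : is_form extz.
split=> [j x cx|j V|j l x V ov].
- have [[dx xr]|nx] := pselect (cell i c r (param j x)); last first.
  have E V : extz j x V = 0 by exact: extz_out.
  by split => [q W W1 W2 c1 c2 |W]; rewrite !E ?mulr0 ?addr0.
 have [ml al] := am xr; split => [q W W1 W2 c1 c2 E E1 E2|q s W qs E]; rewrite !extz_in //.
  by apply(ml q); rewrite ?row_mul ?row'_mul ?E ?E1 ?E2 // mulmxDl !scalemxAl.
 by apply: al qs _; rewrite !row_mul E.
- apply: smooth_local => x cx; case(cell_cover (param j x)) => [Cx|nx].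
  pose W := overlap j i `&` transition j i @^-1` [set y | `|y - c| < r].
  have oW : open W by exact: open_preim_mx (overlap_open j i) (@ball_open_norm c r) (trans_smx j i).
  exists W; first by case: Cx.
  apply(smooth_ext oW (f := fun y => a (transition j i y) (V *m jacobian (transition j i) y))).
   by move=> y [[_ dy] yr]; rewrite extz_in.
  have ts : smooth_mx W (transition j i) by apply: smooth_mx_sub (trans_smx j i) => y [].
  apply(smooth_ml oW (a := fun => _)) => [y [_ yr]|B|].
  + by have [] := am yr.
  + by apply: (smooth_comp oW (@ball_open_norm c r) _ (asm B)) => y [].
  + apply(smooth_mulmx oW (smooth_mx_cst V oW)).
   by apply: smooth_mx_sub (smooth_jac (overlap_open j i) (trans_smx j i)) => y [].
 exists (cod j `&` param j @^-1` cell_compl) => //.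
 apply(smooth_ext (@param_open j _ cell_compl_open) (f := fun=> 0)); last exact: smooth_cst (@param_open j _ cell_compl_open).
 by move=> y [cy ny]; rewrite extz_off.
- have [cx dx] := ov; have pE : param l (transition j l x) = param j x by rewrite chartK.
 have [Cx|nx] := pselect (cell i c r (param j x)); last first.
  by rewrite !extz_out ?pE.
 have Cx' : cell i c r (param l (transition j l x)) by rewrite pE.
 rewrite (@extz_in j x V Cx) (@extz_in l _ _ Cx'); have oJ := overlap_open j l; have oL := overlap_open l i.
 pose W := overlap j l `&` param j @^-1` Defs.dom i.
 have oW : open W.
  rewrite (_ : W = cod j `&` param j @^-1` Defs.dom i `&` overlap j l).
   exact: openI (param_open (dom_open i)) _.
  by apply/seteqP; split=> y; [move=> [[]]|move=> [[]]].
 have Wx : W x by case: Cx.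
 have Wo y : W y -> overlap l i (transition j l y).
  by move=> [[]]; split; [exact: chart_cod|rewrite /= chartK].
 have t1 : smooth_mx W (transition j l) by apply: smooth_mx_sub (trans_smx j l) => y [].
 have J := jac_comp oW oL t1 (trans_smx l i) Wo Wx.
 have E : jacobian (transition j i) x = jacobian (transition l i \o transition j l) x.
  symmetry; apply: jac_ext oW (smooth_mx_comp oW oL Wo (trans_smx l i) t1) _ Wx.
  by move=> y [[_ dy]]; rewrite /transition /= chartK.
 have yE : transition l i (transition j l x) = transition j i x by rewrite /transition /= chartK.
 by rewrite E J mulmxA yE.
Qed.

Lemma extz_chart y V : `|y - c| < r -> extz i y V = a y V.
move=> yr; have cy := gc yr; rewrite extz_in; last exact: cell_param.
have oB := @ball_open_norm c r.
have tE z : [set z : 'rV_m | `|z - c| < r] z -> z = transition i i z.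
 move=> zr; rewrite /transition /= paramK //; exact: gc.
rewrite -(jac_ext oB (smooth_mx_id oB) tE yr) jac_id mulmx1.
by rewrite -tE.
Qed.

Lemma extz_ext_d y V : `|y - c| < r -> ext_d extz i y V = extdE a y V.
move=> yr; apply: extdE_ext (@ball_open_norm c r) _ yr => B; exact: extz_chart.
Qed.

End Form.
End Extension.
End Supports.

(** * Vector fields and bivectors as forms of codegree 1 and 2 *)

Section VectorForms.
Context {R : realType} {k : nat}.
Local Notation m := k.+2.
Local Notation ebase j := (delta_mx 0 j : 'rV[R]_m).
Implicit Types (Y : 'I_m -> 'rV[R]_m -> R).

Lemma det_row_sum (X : 'rV[R]_m) (V : 'M[R]_(k.+1, m)) :
 \det (col_mx X V : 'M[R]_m) = \sum_j X 0 j * \det (col_mx (ebase j) V : 'M[R]_m).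
have H (u : 'rV_m) : \det (col_mx u V : 'M[R]_m) = \det (setrow (lshift k.+1 0) u (col_mx (0 : 'rV_m) V : 'M[R]_m)).
 by rewrite setrow_col_mx.
by rewrite H (ml_expand (@det_ml R m)); apply: eq_bigr => j; rewrite H.
Qed.

(** The contraction of the standard volume with the vector field [Y]; by [alt_cotop] every form of
    codegree 1 has this shape. *)
Definition vform Y (y : 'rV[R]_m) (V : 'M[R]_(k.+1, m)) : R := \det (col_mx (\row_l Y l y) V : 'M[R]_m).

Lemma vformE Y y V : vform Y y V = \sum_j Y j y * \det (col_mx (ebase j) V : 'M[R]_m).
by rewrite /vform det_row_sum; apply: eq_bigr => j; rewrite mxE. Qed.

Lemma extdE_scale p q (U : set 'rV[R]_p) (g : 'rV[R]_p -> R) (a : 'M[R]_(q, p) -> R) y (V : 'M[R]_(q.+1, p)) : open U ->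
 smooth_fun U g -> U y -> extdE (fun y W => g y * a W) y V =
 \sum_(r < q.+1) (-1) ^+ r * (\sum_l V r l * dd (delta_mx 0 l) g y) * a (row' r V).
move=> oU gs Uy; apply: eq_bigr => r _; rewrite -mulrA; congr (_ _).
have dg := smooth_dd (row r V) gs Uy; have [_] := is_deriveZ (a (row' r V)).
rewrite (_ : (fun y => g y * _) = a (row' r V) *: g); last first.
 by apply/funext => z; rewrite mulrC.
rewrite /GRing.scale /= => ->; rewrite (derive_coord _ (smooth_differentiable oU gs Uy)) mulrC.
by congr (_ * _); apply: eq_bigr => l; rewrite mxE.
Qed.

Lemma extdE_sum p q (U : set 'rV[R]_p) (I : Type) (s : seq I) (a : I -> 'rV[R]_p -> 'M[R]_(q, p) -> R) y V :
 open U -> U y -> (forall i W, smooth_fun U (fun y => a i y W)) ->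
 extdE (fun y W => \sum_(i <- s) a i y W) y V = \sum_(i <- s) extdE (a i) y V.
move=> oU Uy sm; rewrite exchange_big; apply: eq_bigr => r _; rewrite -mulr_sumr; congr (_ _).
elim: s => [|i s IH].
 rewrite big_nil (_ : (fun z => _) = cst 0) ?derive_cst //.
 by apply/funext => z; rewrite big_nil.
rewrite big_cons -IH; have da := smooth_dd (row r V) (sm i (row' r V)) Uy.
have ds := smooth_dd (row r V) (@smooth_sum _ _ _ _ s xpredT _ oU (fun i _ => sm i (row' r V))) Uy.
have [_ E] := is_deriveD da; apply: (etrans _ E).
have -> // : (fun z => \sum_(l <- i :: s) a l z (row' r V)) =
 (fun z => a i z (row' r V)) + fun z => \sum_(l <- s) a l z (row' r V).
by apply/funext => z; rewrite big_cons.
Qed.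

(** The exterior derivative is the divergence times the volume: [det_cramer], applied to the
    differential of each component of [Y], leaves the derivative of that component in its own
    direction. *)
Lemma extdE_vform (U : set 'rV[R]_m) Y y V : open U -> U y -> (forall l, smooth_fun U (Y l)) ->
 extdE (vform Y) y V = (\sum_l pder l (Y l) y) * \det V.
move=> oU Uy Ys; pose a j y W := Y j y * \det (col_mx (ebase j) W : 'M[R]_m).
rewrite (extdE_ext (b := fun y W => \sum_j a j y W) V oU _ Uy); last by move=> z B _; exact: vformE.
rewrite (extdE_sum _ _ oU Uy); last first.
 move=> j W; apply(smoothM oU (Ys j)); exact: smooth_cst.
rewrite mulr_suml; apply: eq_bigr => j _.
rewrite (extdE_scale _ V oU (Ys j) Uy).
rewrite (det_cramer _ V (fun l => pder l _ y)); congr (_ * _).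
rewrite (bigD1 j) //= mxE !eqxx mul1r big1 ?addr0 // => l lj.
by rewrite mxE (negbTE lj) mul0r.
Qed.

Lemma row'_col_mx_eq p q (u : 'rV[R]_p) (V W : 'M[R]_(q, p)) s : row' s W = row' s V ->
 row' (rshift 1 s) (col_mx u W : 'M[R]_(1 + q, p)) = row' (rshift 1 s) (col_mx u V : 'M[R]_(1 + q, p)).
by case: q s V W => [[]//|q] s V W E; rewrite !row'_col_mxS E. Qed.

Definition bivec (j l : 'I_m) (W : 'M[R]_(k, m)) : R :=
 \det (col_mx (ebase j) (col_mx (ebase l) W : 'M[R]_(1 + k, m)) : 'M[R]_m).

Lemma bivec_swap j l W : bivec j l W = - bivec l j W.
rewrite /bivec; set a := _ j; set b := _ l.
rewrite -(alt_swap (@det_ml R m) (@det_alt R m) (r := 0) (s := 1)) //; congr (\det _).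
apply/matrixP => r q; rewrite [RHS]mxE.
case: tpermP => [->|->|/eqP r0 /eqP r1].
- have -> : 0 = lshift k.+1 (0 : 'I_1) by apply: val_inj.
 have -> : 1 = rshift 1 (lshift k (0 : 'I_1)) by apply: val_inj.
 by rewrite (@col_mxEu _ 1 k.+1) (@col_mxEd _ 1 k.+1) (@col_mxEu _ 1).
- have -> : 0 = lshift k.+1 (0 : 'I_1) by apply: val_inj.
 have -> : 1 = rshift 1 (lshift k (0 : 'I_1)) by apply: val_inj.
 by rewrite (@col_mxEu _ 1 k.+1) (@col_mxEd _ 1 k.+1) (@col_mxEu _ 1).
have r2 : (1 < r)%N by case: r r0 r1 => -[|[]].
have rk : (r - 2 < k)%N by have := ltn_ord r; lia.
have -> : r = rshift 1 (rshift 1 (Ordinal rk)) by apply: val_inj => /=; lia.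
by rewrite !(@col_mxEd _ 1).
Qed.

(** [det_cramer] for the matrix with first row e_j, contracted with e_l: the term of the first row
    is the second summand, and the other terms form the exterior derivative. *)
Lemma extdE_bivec (U : set 'rV[R]_m) (g : 'rV[R]_m -> R) j l y (V : 'M[R]_(k.+1, m)) : open U -> U y -> smooth_fun U g ->
 extdE (fun y W => g y * bivec j l W) y V =
 pder l g y * \det (col_mx (ebase j) V : 'M[R]_m) - pder j g y * \det (col_mx (ebase l) V : 'M[R]_m).
move=> oU Uy gs; have D q : \sum_i (delta_mx 0 q : 'rV_m) 0 i * pder i g y = pder q g y.
 rewrite (bigD1 q) //= mxE !eqxx mul1r big1 ?addr0 // => i iq.
 by rewrite mxE (negbTE iq) mul0r.
have := det_cramer (ebase l) (col_mx (ebase j) V : 'M[R]_m) (fun i => pder i g y).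
rewrite D big_ord_recl /= mul1r => <-.
have -> : row' 0 (col_mx (ebase j) V : 'M[R]_m) = V by exact: row'_col_mx0.
have -> : \sum_i (col_mx (ebase j) V : 'M[R]_m) 0 i * pder i g y = pder j g y.
 rewrite -D; apply: eq_bigr => i _; congr (_ * _).
 by rewrite -(col_mxEu (_ j) V); congr (_ _ i); apply: val_inj.
rewrite (extdE_scale _ V oU gs Uy) addrAC subrr add0r; apply: eq_bigr => r _.
have rE : lift 0 r = rshift 1 r :> 'I_m by apply: val_inj.
rewrite rE; have -> : row' (rshift 1 r : 'I_m) (col_mx (ebase j) V : 'M[R]_m) = col_mx (ebase j) (row' r V).
 exact: row'_col_mxS.
rewrite -/(bivec l j _) [_ l j _]bivec_swap mulrN -mulNr -mulNr; congr (_ * _).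
rewrite /= /add1n exprS mulN1r opprK; congr (_ _); apply: eq_bigr => i _; congr (_ * _).
by rewrite (@col_mxEd _ 1 k.+1).
Qed.

End VectorForms.

(** * Poincare lemmas for forms supported in a cell *)

Section CellPoincare.
Context {R} {k : nat} {M} {A : atlas R k.+2 M}.
Local Notation m := k.+2.
Local Notation step := (@smooth_step R).
Hypothesis Mcl : closed_connected_manifold M.

Lemma shifted_step (q e : R) : 0 < e -> exists X : R -> R, [/\ smooth1 X,
 forall s, s < q - e -> X s = 0 /\ deriv1 X s = 0 &
 forall s, q + e < s -> X s = 1 /\ deriv1 X s = 0].
move=> e0; have ei : 0 < (2 * e)^-1 by rewrite invr_gt0 mulr_gt0.
pose a s := (2 * e)^-1 * s + (e - q) / (2 * e).
have aE s : a s = (s - (q - e)) / (2 * e) by rewrite /a; lra.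
exists (fun s => step (a s)).
have lo s : s < q - e -> step (a s) = 0 by move=> sl; rewrite step0 // aE pmulr_lle0; lra.
have hi s : q + e < s -> step (a s) = 1.
 move=> sl; rewrite step1 // aE ler_pdivlMr; lra.
split=> [|s sl|s sl].
- exact: smooth_comp1 openT openT _ step_smooth (smooth_affine _ _).
- split; first exact: lo.
 by rewrite (near_eq_derive _ (nearU (@open_lt _ _) sl lo)) derive_cst.
- split; first exact: hi.
 by rewrite (near_eq_derive _ (nearU (@open_gt _ _) sl hi)) derive_cst.
Qed.

Lemma norm_out p (y c : 'rV[R]_p) rho : 0 <= rho -> rho < `|y - c| -> exists l, rho < `|y 0 l - c 0 l|.
move=> r0 H; apply: contrapT => nl; move: H; rewrite ltNge => /negP; apply.
apply: mx_norm_le => // i l; rewrite ord1 !mxE leNgt; apply/negP => H; apply: nl.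
by exists l.
Qed.

Definition cut (c : 'rV[R]_m) r (g : 'rV[R]_m -> R) y : R := if pselect (`|y - c| < r) then g y else 0.

Lemma cut_in c r g y : `|y - c| < r -> cut c r g y = g y.
by rewrite /cut; case: pselect. Qed.

Lemma cut_far c r rho g y : (forall y, `|y - c| < r -> rho < `|y - c| -> g y = 0) ->
 rho < `|y - c| -> cut c r g y = 0.
move=> gv; rewrite /cut; case: pselect => //; exact: gv. Qed.

Lemma cut_smooth c r rho g : rho < r -> smooth_fun [set y | `|y - c| < r] g ->
 (forall y, `|y - c| < r -> rho < `|y - c| -> g y = 0) -> smooth_fun [set: 'rV[R]_m] (cut c r g).
move=> rr gs gv; apply: smooth_local => y _; have [yr|yr] := ltP `|y - c| r.
 exists [set y | `|y - c| < r] => //; apply: (smooth_ext (@ball_open_norm _ _ c r) _ gs) => z zr.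
 by rewrite cut_in.
have oo := @outer_open R m c rho.
exists [set y | rho < `|y - c|]; first exact: lt_le_trans yr.
by apply: smooth_ext oo _ (smooth_cst 0 oo) => z zr; rewrite (cut_far gv).
Qed.

Section Box.
Variables (i : idx A) (c : 'rV[R]_m) (r rho : R).
Hypotheses (gc : good_cell i c r) (rho0 : 0 < rho) (rr : rho < r).
Let lo (l : 'I_m) := c 0 l - rho.
Let hi (l : 'I_m) := c 0 l + rho.

Lemma cut_box rho' g : rho' < rho -> (forall y, `|y - c| < r -> rho' < `|y - c| -> g y = 0) ->
 box_supp lo hi (cut c r g).
move=> rr' gv y l out; apply(cut_far gv); apply: lt_le_trans rr' _.
apply: le_trans (coord_le _ 0 l); rewrite !mxE.
case: out; rewrite /lo /hi => H; rewrite ler_normr; lra.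
Qed.

Lemma box_far f y : box_supp lo hi f -> rho < `|y - c| -> f y = 0.
move=> fb /(norm_out (ltW rho0))[l]; rewrite lter_normr => /orP H; apply(fb y l).
rewrite /lo /hi; lra.
Qed.

Lemma cell_compl_mono rho' : rho' <= rho -> cell_compl i c rho `<=` cell_compl i c rho'.
move=> H x nx [y yr yE]; apply: nx; exists y => //=; exact: le_trans H. Qed.

Lemma cell_compl_param y : `|y - c| < r -> rho < `|y - c| -> cell_compl i c rho (param i y).
move=> yr ry [z zr E]; have cz : cod i z by apply: gc; exact: le_lt_trans rr.
have zy : z = y by rewrite -(paramK cz) E paramK //; exact: gc.
by move: ry; rewrite -zy ltNge zr.
Qed.

End Box.

(* Modulo differentials of forms with support in the cell, the top forms with
  support in the cell are multiples of a form with support near x. *)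
Lemma cell_top (i : idx A) c r x (N : set M) : good_cell i c r -> 0 < r -> cell i c r x ->
 open N -> N x -> exists b : dform A m, [/\ is_form b, supp_in b (cell i c r `&` N) &
 forall nu, is_form nu -> supp_in nu (cell i c r) -> exists C (tau : dform A k.+1),
  [/\ is_form tau, supp_in tau (cell i c r) & form_eq (ext_d tau) (form_comb nu (- C) b)]].
move=> gc r0 Cx oN Nx; have [dx xr] := Cx; set q := _ x in xr.
have [r' r'0 [gq qN]] := cell_ex (openI (cell_open i c r) oN) (conj Cx Nx) dx.
rewrite -/q in gq qN.
(* The bump at [q] has radius at most 2 e, which fits both in the cell inside [N] and in the cell of
   radius [r] around [c]. *)
pose e := Num.min (r' / 4) ((r - `|q - c|) / 4).
have rq : 0 < r - `|q - c| by rewrite subr_gt0.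
have e0 : 0 < e by rewrite lt_min !divr_gt0.
have er : 2 * e < r' by have : e <= r' / 4 by [rewrite ge_min lexx]; lra.
have eq : `|q - c| + 2 * e < r.
 have : e <= (r - `|q - c|) / 4 by [rewrite ge_min lexx orbT]; lra.
have /choice[X XP] := fun l => shifted_step (q 0 l) e0.
have Xs l : smooth1 (X l) by have [] := XP l.
have Bs : smooth_fun [set: 'rV_m] (fun y => \prod_l bump X l (y 0 l)).
 apply: smooth_prod; first exact: openT.
 move=> l _; exact: (smooth_coordc l openT (smooth_D _ _)).
have Bv (y : 'rV_m) : 2 * e < `|y - q| -> \prod_l bump X l (y 0 l) = 0.
 have e2 : 0 <= 2 * e by rewrite mulr_ge0 // ltW.
 move=> /(norm_out e2)[l]; rewrite lter_normr => H; rewrite (bigD1 l) //=.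
 have [_ X1 X2] := XP l; rewrite /bump; case/orP: H => H.
  by have [_ ->] := X2 (y 0 l) ltac:(lra); rewrite mul0r.
 by have [_ ->] := X1 (y 0 l) ltac:(lra); rewrite mul0r.
pose bf (y : 'rV_m) (V : 'M[R]_m) := \prod_l bump X l (y 0 l) * \det V.
have bm y : multilinear (bf y) /\ Defs.alternating (bf y).
 split=> [s V V1 V2 c1 c2 E E1 E2|V s t st E]; rewrite /bf.
  rewrite (det_ml E E1 E2); ring.
 by rewrite (det_alt st E) mulr0.
pose b := @extz R m M A i q r' m bf.
have fb : is_form b.
 apply(extz_form Mcl gq er (fun y _ => bm y)) => [V|y V _ yq]; last by rewrite /bf Bv // mul0r.
 apply(smooth_sub (fun _ _ => I)); apply(smoothM openT Bs); exact: smooth_cst openT.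
have boff : off b (cell_compl i q (2 * e)) by apply: extz_off => y V _ yq; rewrite /bf Bv // mul0r.
have bsupp : supp_in b (cell i q r') by apply(extz_supp Mcl gq er) => y V _ yq; rewrite /bf Bv // mul0r.
exists b; split => //; first exact: supp_mono qN _.
move=> nu fn sn; have [rho' /andP[rho'0 rho'r] noff] := supp_cell Mcl r0 sn.
(* The box must contain the support of [nu] and the bump at [q], and stay inside the cell. *)
pose rho := Num.max ((rho' + r) / 2) (`|q - c| + 2 * e).
have rr : rho < r by rewrite gt_max; lra.
have rho'l : rho' < rho by rewrite lt_max; lra.
have rho0 : 0 < rho by exact: lt_trans rho'l.
have rq2 : `|q - c| + 2 * e <= rho by rewrite le_max lexx orbT.
pose lo l := c 0 l - rho; pose hi l := c 0 l + rho.
have qc l : `|q 0 l - c 0 l| <= `|q - c| by have := coord_le (q - c) 0 l; rewrite !mxE.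
have Xlo l s : s <= lo l -> X l s = 0 /\ deriv1 (X l) s = 0.
 have [_ H _] := XP l; move=> sl; apply: H; have := qc l; rewrite ler_norml /lo in sl * => andP; lra.
have Xhi l s : hi l <= s -> X l s = 1 /\ deriv1 (X l) s = 0.
 have [_ _ H] := XP l; move=> sl; apply: H; have := qc l; rewrite ler_norml /hi in sl * => andP; lra.
pose g y := nu i y 1%:M.
have gv (y : 'rV_m) : `|y - c| < r -> rho' < `|y - c| -> g y = 0.
 move=> yr ry; apply: noff; [exact: gc|exact: cell_compl_param yr _].
pose f := cut c r g.
have fs : smooth_fun [set: 'rV_m] f.
 by apply: cut_smooth rho'r _ gv; apply: smooth_sub (form_smooth i 1%:M _).
have fbx : _ lo hi f := cut_box rho'l gv.
pose Y l := hop lo hi X l (projs lo hi X (below m l) f).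
have Ys l : smooth_fun [set: 'rV_m] (Y l) by apply: hop_smooth => //; exact: projs_smooth.
have Yb l : box_supp lo hi (Y l).
 by apply: (hop_supp Xlo Xhi); [apply: projs_supp|apply: projs_smooth].
have Yv (y : 'rV_m) V : `|y - c| < r -> rho < `|y - c| -> vform Y y V = 0.
 by move=> _ ry; rewrite vformE big1 // => l; rewrite (box_far rho0 (Yb l) ry) mul0r.
have vs V : smooth_fun [set: 'rV_m] (fun y => vform Y y V).
 apply(smooth_ext openT (f := fun y => \sum_j Y j y * \det (col_mx (delta_mx 0 j : 'rV_m) V : 'M[R]_m))).
  by move=> y; rewrite vformE.
 apply: smooth_sum; [exact: openT|move=> j _; apply(smoothM openT (Ys j)); exact: smooth_cst openT].
have vm y : multilinear (vform Y y) /\ Defs.alternating (vform Y y).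
 split; [exact: det_col_mx_ml|exact: det_col_mx_alt].
have vsb V : smooth_fun [set y : 'rV_m | `|y - c| < r] (fun y => vform Y y V) by exact: smooth_sub (vs V).
pose tau := @extz R m M A i c r k.+1 (vform Y).
have ft : is_form tau by exact: (extz_form _ _ rr).
(* The constant is the integral of [nu] over the box in the chart, and [tau] is the contraction of
   the volume with the field of the telescoping formula. *)
exists (tots lo hi (below m m) f 0), tau; split => //; first exact: (extz_supp _ gc rr).
have oC := cell_compl_open Mcl gc rr.
apply(form_eq_cell gc rr (ext_d_form ft) (form_comb_is _ fn fb)).
- apply(off_ext_d oC); exact: extz_off.
- move=> j z V cz nz; rewrite /form_comb noff ?(boff j z) ?mulr0 ?addr0 //.
  move=> [y yr yE]; apply: nz; exists y => //=; apply: le_trans rq2.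
  have -> : y - c = q - c + (y - q) by rewrite [RHS]addrC addrA subrK.
  by apply: le_trans (ler_normD _ _) _; rewrite lerD2l.
 exact: cell_compl_mono (ltW _) _ nz.
move=> y V yr; rewrite (extz_ext_d gc _ V yr) (extdE_vform V openT I Ys) /form_comb.
have -> : b i y V = bf y V.
 have [|yq] := ltP `|y - q| r'; first exact: extz_chart.
 rewrite /b extz_out /bf ?Bv ?mul0r //; first exact: lt_le_trans yq.
 move=> []; rewrite paramK ?ltNge ?yq //; exact: gc.
rewrite (alt_top (form_ml fn (gc _ yr)) (form_alt fn (gc _ yr))) -/(g y) -(cut_in g yr) -/f.
rewrite (@box_telescope R m lo hi X Xs m f y (leqnn m) fs) (projs_top _ _ X y fs).
have -> : \sum_(l < m | (l < m)%N) pder l (hop lo hi X l (projs lo hi X (below m l) f)) y = \sum_l pder l (Y l) y.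
 by apply: eq_bigl => l; rewrite ltn_ord.
rewrite /bf; ring.
Qed.

(** In the chart the form is the contraction of the volume with a field [Y] that has zero divergence
    because the form is closed; [box_potential] provides the bivector potential. *)
Lemma cell_cotop (i : idx A) c r (tau : dform A k.+1) : good_cell i c r -> 0 < r -> is_form tau ->
 supp_in tau (cell i c r) -> form_eq (ext_d tau) (@form0 R m M A k.+2) -> exact_form tau.
move=> gc r0 ft st dt; have [rho' /andP[rho'0 rho'r] toff] := supp_cell Mcl r0 st.
pose rho := (rho' + r) / 2.
have rr : rho < r by rewrite /rho; lra.
have rho'l : rho' < rho by rewrite /rho; lra.
have rho0 : 0 < rho by exact: lt_trans rho'l.
pose lo l := c 0 l - rho; pose hi l := c 0 l + rho.
have /choice[X XP] := fun l => shifted_step (c 0 l) (divr_gt0 rho0 (ltr0n R 2)).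
have Xs l : smooth1 (X l) by have [] := XP l.
have Xlo l s : s <= lo l -> X l s = 0 /\ deriv1 (X l) s = 0.
 have [_ H _] := XP l; move=> sl; apply: H; rewrite /lo in sl; lra.
have Xhi l s : hi l <= s -> X l s = 1 /\ deriv1 (X l) s = 0.
 have [_ _ H] := XP l; move=> sl; apply: H; rewrite /hi in sl; lra.
pose g (l : 'I_m) y := (-1) ^+ l * tau i y (row' l 1%:M).
have gv l (y : 'rV_m) : `|y - c| < r -> rho' < `|y - c| -> g l y = 0.
 move=> yr ry; rewrite /g toff ?mulr0 //; [exact: gc|exact: cell_compl_param yr _].
pose Y l := cut c r (g l).
have oB := @ball_open_norm R m c r.
have Ys l : smooth_fun [set: 'rV_m] (Y l).
 apply: cut_smooth rho'r _ (gv l); apply(smoothM oB (smooth_cst _ oB)).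
 by apply: smooth_sub (form_smooth i _ _).
have Yb l : _ lo hi (Y l) := cut_box rho'l (gv l).
have tE y V : `|y - c| < r -> tau i y V = vform Y y V.
 move=> yr; rewrite (alt_cotop (form_ml ft (gc _ yr)) (form_alt ft (gc _ yr))) /vform.
 have -> // : \row_(j < m) ((-1) ^+ j * tau i y (row' j (1%:M : 'M[R]_m))) = \row_l Y l y.
 by apply/rowP => l; rewrite mxE mxE /Y cut_in.
have div y : \sum_l pder l (Y l) y = 0.
 have [yr|yr] := ltP `|y - c| r.
  have := extdE_vform 1%:M oB yr (fun l => smooth_sub (fun _ _ => I) (Ys l)).
  rewrite det1 mulr1 => <-; apply: etrans (dt i y 1%:M (gc _ yr)).
  by apply: extdE_ext oB _ yr => z B zr; rewrite tE.
 apply: big1 => l _; have ry : rho' < `|y - c| by exact: lt_le_trans yr.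
 have H z : [set z : 'rV_m | rho' < `|z - c|] z -> Y l z = 0 by exact: cut_far (_ l).
 by rewrite /pder (near_eq_derive _ (nearU (@outer_open R m c _) ry H)) derive_cst.
pose a j l := hop lo hi X l (projs lo hi X (below m l) (Y j)).
have as_ j l : smooth_fun [set: 'rV_m] (a j l) by apply: hop_smooth => //; exact: projs_smooth.
have ab j l : box_supp lo hi (a j l).
 by apply(hop_supp Xlo Xhi); [apply: projs_supp|apply: projs_smooth].
(* The skew potential is summed over pairs l < j only, so that each bivector is counted once. *)
pose gam y W := \sum_(j < m) \sum_(l < m) (l < j)%:R * a j l y * bivec j l W.
have tm (j l : 'I_m) V : smooth_fun [set: 'rV_m] (fun y => (l < j)%:R * a j l y * @bivec R k j l V).
 apply: smoothM openT _ (smooth_cst _ openT); exact: (smoothM openT (smooth_cst _ openT)).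
have gs V : smooth_fun [set: 'rV_m] (fun y => gam y V).
 apply: smooth_sum => [|j _]; [exact: openT|apply: smooth_sum => [|l _]; [exact: openT|exact: tm]].
have bml j l : multilinear (@bivec R k j l) /\ Defs.alternating (@bivec R k j l).
 have [dm da] := (@det_col_mx_ml R k.+1 (delta_mx 0 j), @det_col_mx_alt R k.+1 (delta_mx 0 j)).
 split=> [s V V1 V2 c1 c2 E E1 E2|V s t nst E].
  by apply(dm (rshift 1 s)); [rewrite !(@rowKd _ 1)|exact: row'_col_mx_eq|exact: row'_col_mx_eq].
 by apply(da _ (rshift 1 s) (rshift 1 t)); rewrite // !(@rowKd _ 1).
have gm y : multilinear (gam y) /\ Defs.alternating (gam y).
 split=> [s V V1 V2 c1 c2 E E1 E2|V s t nst E]; rewrite /gam; last first.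
  by apply: big1 => j _; apply: big1 => l; rewrite (proj2 (bml j l) V s t nst E) mulr0.
 rewrite !mulr_sumr -big_split; apply: eq_bigr => j _; rewrite /= !mulr_sumr -big_split; apply: eq_bigr => l _.
 rewrite /= ((bml j l).1 s V _ _ _ _ E E1 E2); ring.
have gvan (y : 'rV_m) V : `|y - c| < r -> rho < `|y - c| -> gam y V = 0.
 by move=> _ ry; apply: big1 => j _; apply: big1 => l; rewrite (box_far rho0 (ab j l) ry) mulr0 mul0r.
have gsb V : smooth_fun [set y : 'rV_m | `|y - c| < r] (fun y => gam y V) by exact: smooth_sub (gs V).
pose b := @extz R m M A i c r k gam.
have fb : is_form b by exact: (extz_form _ _ rr).
exists b; split => //; have oC := cell_compl_open Mcl gc rr.
apply(form_eq_cell gc rr (ext_d_form fb) ft).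
- apply(off_ext_d oC); exact: extz_off.
- move=> j z V cz nz; apply: toff => //; exact: cell_compl_mono (ltW _) _ nz.
move=> y V yr; rewrite (extz_ext_d gc _ V yr) tE // vformE.
rewrite (extdE_sum _ V openT I); last first.
 move=> j W; apply: smooth_sum => [|l _]; [exact: openT|exact: tm].
pose d (j : 'I_m) := \det (col_mx (delta_mx 0 j : 'rV_m) V : 'M[R]_m).
have E (j : 'I_m) : extdE (fun y W => \sum_(l < m) (l < j)%:R * a j l y * bivec j l W) y V =
  \sum_(l < m) (l < j)%:R * (pder l (a j l) y * d j - pder j (a j l) y * d l).
 rewrite (extdE_sum _ V openT I); last by move=> W.
 apply: eq_bigr => l _; case(l < j)%N; last first.
  rewrite mul0r (extdE_ext (b := fun _ _ => 0) V openT _ I); last by move=> z B; rewrite !mul0r.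
  by rewrite /extdE big1 // => s; rewrite derive_cst mulr0.
 rewrite mul1r -(extdE_bivec j l V openT I (as_ j l)).
 by apply: (extdE_ext V openT _ I) => B; rewrite mul1r.
rewrite (eq_bigr _ (fun j _ => E j)).
have S1 : \sum_(j < m) \sum_(l < m) (l < j)%:R * (pder l (a j l) y * d j - pder j (a j l) y * d l) =
  \sum_(j < m) \sum_(l < m) (l < j)%:R * pder l (a j l) y * d j -
  \sum_(j < m) \sum_(l < m) (j < l)%:R * pder l (a l j) y * d j.
 rewrite [X in - X]exchange_big -sumrB; apply: eq_bigr => j _; rewrite -sumrB; apply: eq_bigr => l _.
 by rewrite mulrBr !mulrA.
apply(etrans S1); rewrite -sumrB; apply: eq_bigr => j _.
have P (e : pred 'I_m) h : \sum_(l < m) (e l)%:R * h l * d j = (\sum_(l < m | e l) h l) * d j.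
 rewrite [in RHS]big_mkcond mulr_suml; apply: eq_bigr => l _.
 by case(e); rewrite ?mul1r ?mul0r.
have P1 := P (fun l => (l < j)%N) (fun l => pder l (a j l) y).
have P2 := P (fun l => (j < l)%N) (fun l => pder l (a l j) y).
apply(etrans (f_equal2 (fun u v => u - v) P1 P2)); rewrite -mulrBl.
have BP := box_potential Xs Xlo Xhi j y Ys Yb div.
apply: etrans (congr1 (fun z => z * d j) (esym BP)).
by [].
Qed.

End CellPoincare.

(** * Top forms with an accumulated primitive as states *)

Section FormStates.
Context {R} {k : nat} {M} {A : atlas R k.+2 M}.
Local Notation m := k.+2.
Hypothesis Mcl : closed_connected_manifold M.

Lemma form_subE q (a b : dform A q) : form_sub a b = form_comb a (-1) b.
by apply/funext => i; apply/funext => x; apply/funext => V; rewrite /form_comb mulN1r. Qed.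

Lemma exact0 q (a : dform A q.+1) : form_eq a (@form0 R m M A q.+1) -> exact_form a.
move=> a0; exists (@form0 R m M A q); split; first exact: form0_is.
by move=> i x V cx; rewrite ext_d0 a0.
Qed.

Lemma top_closed (a : dform A m) : is_form a -> form_eq (ext_d a) (@form0 R m M A m.+1).
move=> fa i x V cx; have ml := ext_d_ml fa cx; have al := ext_d_alt fa cx.
apply(alt_eq (b := fun=> 0) ml al) => [r V0 V1 V2 c1 c2 ||f fi]; rewrite ?mulr0 ?addr0 //.
by have := leq_card f fi; rewrite !card_ord ltnn.
Qed.

Local Notation good_nbhd := (good_nbhd A).
Local Notation state := (dform A m * dform A k.+1)%type.
Definition state_in (s : state) (V : set M) : Prop := is_form s.1 /\ supp_in s.1 V.
(** The first component is the mass at its present place, the second the sum of the primitives used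
    to bring it there. A move in [W] changes the mass by d tau with tau supported in [W], and the
    second component by tau modulo exact forms. *)
Definition state_near (W : set M) (s s' : state) : Prop := exists tau, [/\ is_form tau, supp_in tau W,
 form_eq (ext_d tau) (form_comb s'.1 (-1) s.1) & exact_form (form_comb (form_comb s'.2 (-1) s.2) (-1) tau)].

Lemma state_near_mono W W' s s' : W `<=` W' -> state_near W s s' -> state_near W' s s'.
move=> sub [tau [f s1]]; exists tau; split => //; exact: supp_mono s1. Qed.

Lemma state_near_refl V s : state_in s V -> state_near V s s.
move=> _; exists (@form0 R m M A k.+1); split; [exact: form0_is|exact: supp_form0| |apply: exact0];
 move=> i x cx; rewrite ?ext_d0 /form_comb /form0 ?mulN1r ?subrr //.
Qed.

Lemma state_near_sym W s s' : state_near W s s' -> state_near W s' s.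
move=> [tau [f st d e]]; have f0 := form0_is (A := A) k.+1.
exists (form_comb (@form0 R m M A k.+1) (-1) tau); split.
- exact: form_comb_is.
- apply: supp_comb => //; exact: supp_form0.
- move=> i x V cx; rewrite (ext_d_comb _ _ f0 f cx) d // ext_d0 /form_comb; ring.
apply: exact_form_eq (exactN e) => i x V _; rewrite /form_comb /form0; ring.
Qed.

Lemma state_near_trans W s1 s2 s3 : state_near W s1 s2 -> state_near W s2 s3 -> state_near W s1 s3.
move=> [t1 [f1 u1 d1 e1]] [t2 [f2 u2 d2 e2]]; exists (form_comb t1 1 t2); split.
- exact: form_comb_is.
- exact: supp_comb.
- move=> i x V cx; rewrite (ext_d_comb _ _ f1 f2 cx) d1 // d2 // /form_comb; ring.
apply: exact_form_eq (exact_comb 1 e1 e2) => i x V _; rewrite /form_comb; ring.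
Qed.

(** By [cell_top] the form is a multiple of one supported near [x], modulo the differential of a
    form supported in [V]. *)
Lemma push_top V x N (nu : dform A m) : good_nbhd V -> V x -> open N -> N x -> is_form nu -> supp_in nu V ->
 exists nu' tau, [/\ is_form nu', supp_in nu' (V `&` N), is_form tau, supp_in tau V &
  form_eq (ext_d tau) (form_comb nu' (-1) nu)].
move=> [i [c [r [r0 gc ->]]]] Vx oN Nx fn sn.
have [b [fb sb H]] := cell_top Mcl gc r0 Vx oN Nx; have [C [tau [ft st dt]]] := H _ fn sn.
have f0 := form0_is (A := A).
exists (form_comb (@form0 _ _ _ _ m) C b), (form_comb (@form0 _ _ _ _ k.+1) (-1) tau); split.
- exact: form_comb_is.
- apply: supp_comb => //; exact: supp_form0.
- exact: form_comb_is.
- apply: supp_comb => //; exact: supp_form0.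
- move=> i' y Z cy; rewrite (ext_d_comb _ _ (f0 _) ft cy) dt // ext_d0 /form_comb /form0; ring.
Qed.

Lemma transport_top K W x y V V' (nu : dform A m) : connected K -> open W -> K `<=` W -> K x -> K y ->
 good_nbhd V -> V x -> V `<=` W -> good_nbhd V' -> V' y -> is_form nu -> supp_in nu V ->
 exists nu' tau, [/\ is_form nu', supp_in nu' V', is_form tau, supp_in tau W &
  form_eq (ext_d tau) (form_comb nu' (-1) nu)].
move=> cK oW KW Kx Ky gV Vx VW gV' V'y fn sn.
(* Mass located around the first point can be moved around the second one inside [W]. *)
pose Rl x y := forall V V' (nu : dform A m), good_nbhd V -> V x -> V `<=` W -> good_nbhd V' -> V' y ->
 is_form nu -> supp_in nu V -> exists nu' tau, [/\ is_form nu', supp_in nu' V', is_form tau, supp_in tau W &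
  form_eq (ext_d tau) (form_comb nu' (-1) nu)].
have join (n1 n2 n3 : dform A m) (t1 t2 : dform A k.+1) : is_form t1 -> is_form t2 ->
  form_eq (ext_d t1) (form_comb n2 (-1) n1) -> form_eq (ext_d t2) (form_comb n3 (-1) n2) ->
  form_eq (ext_d (form_comb t1 1 t2)) (form_comb n3 (-1) n1).
 move=> f1 f2 d1 d2 i z Z cz; rewrite (ext_d_comb _ _ f1 f2 cz) d1 // d2 // /form_comb; ring.
suff : Rl x y by move=> H; exact: H gV Vx VW gV' V'y fn sn.
apply: (connected_rel cK KW _ _ Kx Ky) => [z Wz|a b c Wa Wb Wc H1 H2 U U' n gU Ua UW gU' U'c fn' sn'].
 have [U [gU Uz UW]] := @good_nbhd_base R m M A _ _ oW Wz; exists U; split => //; first exact: good_nbhd_open gU.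
 have L a b : U a -> U b -> Rl a b.
  move=> Ua Ub Q Q' n gQ Qa QW gQ' Q'b fn' sn'.
  have [n1 [t1 [f1 s1 g1 u1 d1]]] := push_top gQ Qa (good_nbhd_open gU) Ua fn' sn'.
  have s1' : supp_in n1 U by apply: supp_mono s1 => ? [].
  have [n2 [t2 [f2 s2 g2 u2 d2]]] := push_top gU Ub (good_nbhd_open gQ') Q'b f1 s1'.
  exists n2, (form_comb t1 1 t2); split => //; [by apply: supp_mono s2 => ? []|exact: form_comb_is| |exact: join d1 d2].
  by apply: supp_comb; [exact: supp_mono u1|exact: supp_mono u2].
 by move=> y' Uy; split; exact: L.
have [U2 [gU2 U2b U2W]] := @good_nbhd_base R m M A _ _ oW Wb.
have [n1 [t1 [f1 s1 g1 u1 d1]]] := H1 U U2 n gU Ua UW gU2 U2b fn' sn'.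
have [n2 [t2 [f2 s2 g2 u2 d2]]] := H2 U2 U' n1 gU2 U2b U2W gU' U'c f1 s1.
exists n2, (form_comb t1 1 t2); split => //; [exact: form_comb_is|exact: supp_comb|exact: join d1 d2].
Qed.

Lemma state_near_ex K W V V' x y s : connected K -> open W -> K `<=` W -> K x -> K y ->
 good_nbhd V -> V x -> V `<=` W -> good_nbhd V' -> V' y -> V' `<=` W -> state_in s V ->
 exists2 s', state_in s' V' & state_near W s s'.
move=> cK oW KW Kx Ky gV Vx VW gV' V'y _ [fs ss].
have [nu [tau [fn sn ft st dt]]] := transport_top cK oW KW Kx Ky gV Vx VW gV' V'y fs ss.
exists (nu, form_comb s.2 1 tau); first by split.
exists tau; split => //; apply: exact0 => i z Z cz; rewrite /form_comb /form0 /=; ring.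
Qed.

(** Injectivity of top cohomology with support in a cell into that of M. It is decided by excluded
    middle, in place of an integral over M. *)
Definition locally_exact := forall V (nu : dform A m) (tau : dform A k.+1), good_nbhd V -> is_form nu ->
 supp_in nu V -> is_form tau -> form_eq (ext_d tau) nu ->
 exists tau', [/\ is_form tau', supp_in tau' V & form_eq (ext_d tau') nu].

(** Local exactness replaces [tau] by a form [t] supported in [V] with the same differential. The
    difference is closed and supported in the cell [O], hence exact by [cell_cotop], and does not
    affect the second components. *)
Lemma state_near_uniq O V s s' : locally_exact -> good_nbhd O -> good_nbhd V -> V `<=` O ->
 state_in s V -> state_in s' V -> state_near O s s' -> state_near V s s'.
move=> le [i [c [r [r0 gc OE]]]] gV VO [f1 s1] [f2 s2] [tau [ft st dt e]].
have fc := form_comb_is (-1) f2 f1.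
have [t [f' u' d']] := le V _ tau gV fc (supp_comb (-1) s2 s1) ft dt.
exists t; split => //; have fd := form_comb_is (-1) ft f'.
have sd : supp_in (form_comb tau (-1) t) (cell i c r).
 by rewrite -OE; apply: supp_comb => //; exact: supp_mono u'.
have ex := cell_cotop Mcl gc r0 fd sd.
have dd : form_eq (ext_d (form_comb tau (-1) t)) (@form0 R m M A m).
 by move=> j z Z cz; rewrite (ext_d_comb _ _ ft f' cz) dt // d' // mulN1r subrr.
apply: (exact_form_eq _ (exact_comb 1 e (ex dd))) => j z Z cz; rewrite /form_comb; ring.
Qed.

(* If uniqueness fails in some cell, then a form with nonzero mass is exact,
  hence all top forms with small support are. *)
Lemma not_locally_exact : ~ locally_exact -> forall V (nu : dform A m), good_nbhd V -> is_form nu ->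
 supp_in nu V -> exists2 tau : dform A k.+1, is_form tau & form_eq (ext_d tau) nu.
move=> nle V2 mu gV2 fmu smu; apply: contrapT => nmu; apply: nle => V nu tau gV fn sn ft dt.
apply: contrapT => nt; apply: nmu; have [_ _ Mc] := Mcl.
have [i [c [r [r0 gc VE]]]] := gV; have Vx : cell i c r (param i c).
 by apply: cell_param => //; rewrite subrr normr0.
have [b [fb _ H]] := cell_top Mcl gc r0 Vx openT I.
rewrite VE in sn nt; have [C [t1 [f1 s1 d1]]] := H nu fn sn.
(* If the mass were zero, [t1] would be the supported primitive that is assumed not to exist. *)
have C0 : C != 0.
 apply/eqP => C0; apply: nt; exists t1; split => // j z Z cz.
 by rewrite d1 // /form_comb C0 oppr0 mul0r addr0.
have [i2 [c2 [r2 [r20 gc2 V2E]]]] := gV2; have V2x : V2 (param i2 c2).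
 by rewrite V2E; apply: cell_param => //; rewrite subrr normr0.
rewrite -VE in Vx H.
have [nu' [t3 [fn' sn' f3 s3 d3]]] := transport_top Mc openT (fun _ _ => I) I I gV2 V2x (fun _ _ => I) gV Vx fmu smu.
have [C' [t4 [f4 s4 d4]]] := H nu' fn' sn'.
(* d (t4 - t3) is the given form minus C' b, while d (tau - t1) = C b. *)
exists (form_comb (form_comb t4 (-1) t3) (C' / C) (form_comb tau (-1) t1)).
 by apply: form_comb_is; exact: form_comb_is.
move=> j z Z cz; rewrite (ext_d_comb _ _ (form_comb_is _ f4 f3) (form_comb_is _ ft f1) cz).
rewrite (ext_d_comb _ _ f4 f3 cz) (ext_d_comb _ _ ft f1 cz) d4 // d3 // dt // d1 // /form_comb.
by field.
Qed.

End FormStates.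

(** * Supports of slices and fibre integrals along a flow *)

Section FlowTransport.
Context {R m M} {A : atlas R m M}.

Lemma int_split (f : R -> R) a b : 0 <= a -> a <= b -> continuous f ->
 \i[0, b] t, f t = \i[0, a] t, f t + \i[a, b] t, f t.
move=> a0 ab fc; pose G (y : R) := \int[mu]_(t in `[-1, y]) f t.
have D l u : 0 <= l -> forall t : R, l <= t <= u -> is_deriv t G (f t).
 by move=> l0 t /andP[lt _]; apply: FTC1 => //; lra.
rewrite (FTC2 (le_trans a0 ab) fc (D 0 b (lexx 0))) (FTC2 a0 fc (D 0 a (lexx 0))) (FTC2 ab fc (D a b a0)).
by rewrite [RHS]addrC addrA subrK.
Qed.

Lemma tube (f : R -> M -> M) a b x (Q : set M) : continuous (fun p : R * M => f p.1 p.2) -> open Q ->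
 (forall t, a <= t <= b -> Q (f t x)) -> \forall y \near x, forall t, a <= t <= b -> Q (f t y).
move=> fc oQ H; have C := (iffLR (compact_near_coveringP _) (@segment_compact R a b)) M (nbhs x)
 (fun y t => Q (f t y)) _.
have G t : `[a, b]%classic t -> \forall t' \near t & y \near x, Q (f t' y).
 rewrite /= in_itv /= => /H Qt; have := fc (t, x) Q (open_nbhs_nbhs (conj oQ Qt)).
 by rewrite /= nbhs_filterE => -[[P1 P2] /= [n1 n2] sub]; exists (P1, P2) => // p [p1 p2]; exact: sub.
have := C (nbhs_filter x) G; apply: filterS => y Hy t tab.
by apply: Hy; rewrite /= in_itv.
Qed.

Variables (w : dform A 2) (Psi Phi : R -> M -> M).
Hypothesis F : flow_pair w Psi Phi.
Let Ps := inv_smooth F.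

Lemma slice_is_form t k (a : dform A k) : is_form a -> is_form (slice_form Phi t a).
move=> fa; have st (i : idx A) : smooth_to A (cod i) (fun y => Phi t (param i y)).
 exact: family_comp (cod_open i) Ps (smooth_cst t (cod_open i)) (smooth_to_param i).
split=> [i x cx|i V|i j x V ov].
- exact: pullback_ml.
- exact: (pullback_smooth (cod_open i) (st i)).
- have oO := @overlap_open _ _ _ _ i j; have ts := @trans_smx _ _ _ _ i j.
 have tc y : overlap i j y -> cod j (transition i j y) by move=> [cy dy]; exact: chart_cod.
 rewrite /slice_form -(pullback_comp a V oO (cod_open j) (st j) ts tc ov).
 apply: (pullback_ext a V oO _ _ ov).
  by apply: smooth_to_sub (st i) => //; [exact: cod_open|move=> y []].
 by move=> y [cy dy]; rewrite /transition /= chartK.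
Qed.

Lemma pull_off k (a : dform A k) (Q : set M) (p : nat) (G : 'rV[R]_p -> M) z V : off a Q -> Q (G z) ->
 pullback G a z V = 0.
move=> aQ Qz; have d := chart_at_dom A (G z); apply: aQ; first exact: chart_cod.
by rewrite chartK.
Qed.

Lemma supp_slice t k (a : dform A k) (W W' : set M) : supp_in a W -> (forall x, W x -> W' (Psi t x)) ->
 supp_in (slice_form Phi t a) W'.
move=> [Q [oQ QW aQ]] WW'; exists (Phi t @^-1` Q); split.
- rewrite openE => x Qx; have H t' : t <= t' <= t -> Q (Phi t' x) by move=> /le_anti <-.
 by apply: filterS (tube (family_cont Ps) oQ H) => y; apply; rewrite lexx.
- move=> x; case: (QW (Phi t x)) => [Wx|]; [left|by right].
 by rewrite -(flow_invK F t x); exact: WW'.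
- by move=> i x V cx Qx; apply: pull_off aQ _.
Qed.

(** The support is swept along by Psi. The open set where the integral vanishes consists of the
    points whose whole track under Phi stays in [Q]; it is open by [tube]. *)
Lemma supp_fiber t0 t1 k (a : dform A k.+1) (W W' : set M) : supp_in a W ->
 (forall t x, t0 <= t <= t1 -> W x -> W' (Psi t x)) -> supp_in (fiber_int Phi t0 t1 a) W'.
move=> [Q [oQ QW aQ]] WW'; exists [set x | forall t, t0 <= t <= t1 -> Q (Phi t x)]; split.
- rewrite openE => x Qx; exact: (tube (family_cont Ps) oQ Qx).
- move=> x; have [|nQ] := pselect (forall t, t0 <= t <= t1 -> Q (Phi t x)); [by right|left].
 apply: contrapT => nW; apply: nQ => t tt; case: (QW (Phi t x)) => // Wx; exfalso; apply: nW.
 by rewrite -(flow_invK F t x); exact: WW'.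
- move=> i x V cx Qx; rewrite /fiber_int (@eq_int _ _ (fun=> 0)); first by rewrite /Rintegral integral0.
 move=> t tt; apply: pull_off aQ _.
 by rewrite /fam_map tjoin0 tjoinr; exact: Qx.
Qed.

End FlowTransport.

(** * Reduction to forms supported in cells *)

Section SmallSupports.
Context {R : realType} {m k : nat} {M : topologicalType} {A : atlas R m M}.
Hypothesis Mcl : closed_connected_manifold M.

Lemma cell_bump (c : 'rV[R]_m) r : 0 < r -> exists g : 'rV[R]_m -> R,
 [/\ smooth_fun [set: 'rV[R]_m] g, forall y, `|y - c| < r / 4 -> g y = 1 &
   forall y, 3 * (r / 4) < `|y - c| -> g y = 0].
move=> r0; have e0 : 0 < r / 4 by rewrite divr_gt0.
(* In each coordinate [X] rises between c - 3r/4 and c - r/4, and 1 - [Y] falls between c + r/4 and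
   c + 3r/4. *)
have /choice[X XP] := fun l : 'I_m => shifted_step (c 0 l - 2 * (r / 4)) e0.
have /choice[Y YP] := fun l : 'I_m => shifted_step (c 0 l + 2 * (r / 4)) e0.
exists (fun y => \prod_l (X l (y 0 l) * (1 - Y l (y 0 l)))); split.
- apply: smooth_prod => [|l _]; first exact: openT.
 have [Xs _ _] := XP l; have [Ys _ _] := YP l.
 apply: (smoothM openT (smooth_coordc l openT Xs)).
 exact: (smoothB openT (smooth_cst _ openT) (smooth_coordc l openT Ys)).
- move=> y yc; apply: big1 => l _; have [_ _ X1] := XP l; have [_ Y0 _] := YP l.
 have := le_lt_trans (coord_le (y - c) 0 l) yc; rewrite !mxE ltr_norml => /andP[h1 h2].
 have [-> _] := X1 (y 0 l) ltac:(lra); have [-> _] := Y0 (y 0 l) ltac:(lra).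
 by rewrite subr0 mulr1.
- move=> y yc; have q0 : 0 <= 3 * (r / 4) by rewrite mulr_ge0 // ltW.
 have [l] := norm_out q0 yc; rewrite lter_normr => H; rewrite (bigD1 l) //=.
 have [_ X0 _] := XP l; have [_ _ Y1] := YP l; case/orP: H => H.
  by have [-> _] := Y1 (y 0 l) ltac:(lra); rewrite subrr mulr0 mul0r.
 by have [-> _] := X0 (y 0 l) ltac:(lra); rewrite !mul0r.
Qed.

(* b is the product of a with a bump function. *)
Lemma localize (x : M) : exists (N : set M) (i : idx A) c r, [/\ open N, N x, 0 < r, good_cell i c r &
 forall a : dform A k, is_form a -> exists b : dform A k, [/\ is_form b, supp_in b (cell i c r),
  off (form_comb a (-1) b) N & forall Q, off a Q -> off b Q]].
have dx := chart_at_dom A x; set i := chart_at A x in dx; set c := chart i x.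
have [r r0 [gc _]] := cell_ex openT (I : [set: M] x) dx.
have [g [gs g1 g0]] := cell_bump c r0; pose rho := 3 * (r / 4).
have rr : rho < r by rewrite /rho; lra.
exists (cell i c (r / 4)), i, c, r; split => //; first exact: cell_open.
 by split => //; rewrite subrr normr0 divr_gt0.
move=> a fa; pose ga (y : 'rV[R]_m) (V : 'M[R]_(k, m)) := g y * a i y V.
have gm (y : 'rV[R]_m) : `|y - c| < r -> multilinear (ga y) /\ Defs.alternating (ga y).
 move=> yr; have [P _ _] := fa; have [ml al] := P i y (gc y yr); split=> [s V V1 V2 c1 c2 E E1 E2|V s t st E]; rewrite /ga.
  by rewrite (ml s V V1 V2 c1 c2 E E1 E2); ring.
 by rewrite (al V s t st E) mulr0.
have gas V : smooth_fun [set y | `|y - c| < r] (fun y => ga y V).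
 have [_ P _] := fa; apply: (smoothM (@ball_open_norm R m c r) (smooth_sub (fun _ _ => I) gs)).
 exact: smooth_sub gc (P i V).
have gv (y : 'rV[R]_m) V : `|y - c| < r -> rho < `|y - c| -> ga y V = 0 by move=> _ h; rewrite /ga g0 // mul0r.
have inc j z V : cod j z -> cell i c r (param j z) -> @extz R m M A i c r k ga j z V = g (transition j i z) * a j z V.
 move=> cz Cz; rewrite (extz_in _ _ Cz) /ga; have [_ _ P] := fa; have [dz _] := Cz.
 by rewrite (P j i z V).
exists (@extz R m M A i c r k ga); split.
- exact: (extz_form Mcl gc rr gm gas gv).
- exact: (extz_supp Mcl gc rr gv).
- move=> j z V cz [dz zr]; have rl : r / 4 < r by lra.
 by rewrite /form_comb inc //; [rewrite g1 // mul1r mulN1r subrr|split => //; exact: lt_trans zr rl].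
- move=> Q aQ j z V cz Qz; have [Cz|Cz] := pselect (cell i c r (param j z)).
  by rewrite inc // (aQ j z V cz Qz) mulr0.
 exact: extz_out.
Qed.

(** M is covered by finitely many of the sets [N y] of [localize]. For each of these in turn, the
    localized part is split off; the remainder vanishes on one more of the sets, and at the end
    everywhere. *)
Lemma small_support_ind (P : dform A k -> Prop) :
 (forall a b, form_eq a b -> P b -> P a) -> P (@form0 R m M A k) ->
 (forall a b, is_form a -> is_form b -> P a -> P b -> P (form_comb a 1 b)) ->
 (forall (i : idx A) c r a, 0 < r -> good_cell i c r -> is_form a -> supp_in a (cell i c r) -> P a) ->
 forall a, is_form a -> P a.
move=> Peq P0 Padd Psmall a fa; have [_ Mk _] := Mcl.
have /choice[N NP] := localize.
(* Finite lists of points ordered by inclusion; along this filter the near-covering form of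
   compactness yields a finite subcover. *)
pose F : set_system (seq M) := [set S | exists s0 : seq M, forall s : seq M, {subset s0 <= s} -> S s].
have FF : Filter F.
 split=> [|S T [s Ss] [t Tt]|S T ST [s Ss]]; first by exists [::].
  by exists (s ++ t) => u su; split; [apply: Ss|apply: Tt] => z zs; apply: su; rewrite mem_cat zs ?orbT.
 by exists s => u su; apply: ST; exact: Ss.
have near_cover (x : M) : \forall x' \near x & s \near F, exists2 y, y \in (s : seq M) & N y x'.
 have [i [c [r [oN Nx _ _ _]]]] := NP x; exists (N x, [set s : seq M | x \in s]) => /=.
  by split; [exact: open_nbhs_nbhs|exists [:: x] => s; apply; rewrite inE].
 by move=> [x' s] /= [Nx' xs]; exists x.
have [s0 sM] := (iffLR (compact_near_coveringP _) Mk) (seq M) F (fun s x => exists2 y, y \in s & N y x) FF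
 (fun x _ => near_cover x).
suff main (s : seq M) (Q : set M) : (forall x, Q x \/ exists2 y, y \in s & N y x) ->
  forall b, is_form b -> off b Q -> P b.
 by apply: (main s0 set0 _ a fa) => // x; right; exact: (sM s0 (fun _ h => h) x I).
elim: s Q => [|y s IH] Q QP b fb bQ.
 apply: Peq P0 => i x V cx; apply: bQ => //; by case: (QP (param i x)) => // -[].
have [i [c [r [_ _ r0 gc L]]]] := NP y; have [b1 [f1 s1 o1 oQ]] := L b fb.
have f2 := form_comb_is (-1) fb f1.
have P2 : P (form_comb b (-1) b1).
 apply: (IH (Q `|` N y)) => // [x|j x V cx [Qx|Nx]]; last exact: o1.
 - case: (QP x) => [Qx|[z]]; first by left; left.
  by rewrite inE => /orP[/eqP->|zs] Nz; [left; right|right; exists z].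
 - by rewrite /form_comb (bQ j x V cx Qx) (oQ Q bQ j x V cx Qx) mulr0 addr0.
apply: (Peq _ _ _ (Padd _ _ f1 f2 (Psmall i c r b1 r0 gc f1 s1) P2)) => j x V cx.
by rewrite /form_comb; ring.
Qed.

End SmallSupports.

(** * Transport of a top form along the two loops *)

Section MassTransport.
Context {R} {k : nat} {M} {A : atlas R k.+2 M}.
Local Notation m := k.+2.
Hypothesis Mcl : closed_connected_manifold M.
Variables (w : dform A 2) (Psi1 Phi1 Psi2 Phi2 : R -> M -> M) (x0 : M).
Hypotheses (F1 : flow_pair w Psi1 Phi1) (F2 : flow_pair w Psi2 Phi2).
Variable H : R * R -> M.
Hypothesis Hc : {within `[0, 1] `*` `[0, 1], continuous H}.
Hypothesis Hside : forall s : R, 0 <= s <= 1 -> H (s, 0) = x0 /\ H (s, 1) = x0.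
Hypothesis Hrows : forall t : R, 0 <= t <= 1 -> H (0, t) = Psi1 t x0 /\ H (1, t) = Psi2 t x0.

Definition mass_diff (a : dform A m) : dform A k.+1 :=
 form_comb (fiber_int Phi1 0 1 a) (-1) (fiber_int Phi2 0 1 a).

Lemma split_cancel (b a c : R) : b = a + c -> b + -1 * a + -1 * c = 0.
by move=> ->; ring. Qed.

Lemma mass_diff_sign (x y z : R) : x + -1 * y = 0 + -1 * (y + -1 * x + -1 * z + 1 * z).
by ring. Qed.

Lemma comb_cancel q (a b : dform A q) : a = b -> form_eq (form_comb a (-1) b) (@form0 R m M A q).
by move=> -> i x V _; rewrite /form_comb mulN1r subrr. Qed.

Lemma end_exact q (f f' g g' tau : dform A q.+1) : f = f' -> g = g' ->
 exact_form (form_comb (form_comb g (-1) f) (-1) tau) -> exact_form tau -> exact_form (form_comb f' (-1) g').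
move=> <- <- e et; apply: (exact_form_eq _ (exactN (exact_comb 1 e et))) => j x Z cx.
exact: mass_diff_sign.
Qed.

Section State.
Variables (Psi Phi : R -> M -> M) (a : dform A m).
Hypotheses (F : flow_pair w Psi Phi) (fa : is_form a).

(** The form carried by the flow up to time t, with the fibre integral over [0, t] as accumulated
    primitive. At t = 1 the second component is the full fibre integral. *)
Definition transport_state (t : R) : dform A m * dform A k.+1 :=
 (slice_form Phi t a, fiber_int Phi 0 t a).

Lemma transport_state_in t (V W : set M) : supp_in a V -> (forall x, V x -> W (Psi t x)) ->
 state_in (transport_state t) W.
by move=> sa VW; split; [exact: (slice_is_form F _ fa)|exact: (supp_slice F sa VW)]. Qed.

(** The homotopy formula for a top form, which is closed, gives the fibre integral over [s, t] as
    the move. *)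
Lemma transport_state_near s t (V W : set M) : 0 <= s -> s <= t -> supp_in a V ->
 (forall r x, s <= r <= t -> V x -> W (Psi r x)) -> state_near W (transport_state s) (transport_state t).
move=> s0 st sa VW; have Ps := inv_smooth F; exists (fiber_int Phi s t a); split.
- exact: fiber_int_form.
- exact: (supp_fiber F sa VW).
- move=> i x V0 cx; rewrite (fiber_int_d Ps V0 st fa (form0_is _) (top_closed fa) cx) /form_comb /=.
 have -> : fiber_int Phi s t (@form0 R m M A m.+1) i x V0 = 0.
  by rewrite /fiber_int (@eq_int _ _ (fun=> 0)) // /Rintegral integral0.
 by rewrite subr0 mulN1r.
apply: exact0 => i x V0 cx.
have c := fiber_cont (B := col_mx (tvec : 'rV[R]_(1 + m)) (hlift V0)) Ps fa cx.
have E := int_split s0 st c; rewrite /form_comb /form0 /= /fiber_int.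
exact: split_cancel E.
Qed.

End State.

(** [V0] is chosen so small that under both flows all its points follow the orbit of [x0] through
    the cells of the grid. The transport states at the grid times are then lifts of the two rows. *)
Lemma mass_diff_small : locally_exact (A := A) -> exists V0, good_nbhd A V0 /\ V0 x0 /\
 forall a, is_form a -> supp_in a V0 -> exact_form (mass_diff a).
move=> le.
have [N [Q0 [Q1 [V [Qg Vg mono]]]]] := grid_monodromy (@state_near_mono R k M A) (@state_near_refl R k M A)
 (@state_near_sym R k M A) (@state_near_trans R k M A) (@state_near_ex R k M A Mcl)
 (fun Q V s s' => @state_near_uniq R k M A Mcl Q V s s' le) (@good_nbhd_open R m M A)
 (@good_nbhd_base R m M A) Hc Hside.
pose tt (l : nat) : R := l%:R / N.+1%:R.
have N0 : 0 < N.+1%:R :> R by rewrite ltr0n.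
have t01 l : (l <= N.+1)%N -> 0 <= tt l <= 1.
 by move=> lN; rewrite /tt divr_ge0 //= ler_pdivrMr // mul1r ler_nat.
have tS l : tt l <= tt l.+1 by rewrite /tt ler_pM2r ?invr_gt0 // ler_nat.
have sub01 l r : (l <= N)%N -> tt l <= r <= tt l.+1 -> 0 <= r <= 1.
 move=> lN /andP[r1 r2]; have /andP[h1 _] := t01 l (leqW lN); have /andP[_ h2] := t01 l.+1 lN.
 by rewrite (le_trans h1 r1) (le_trans r2 h2).
have c1 := family_cont (flow_smooth F1); have c2 := family_cont (flow_smooth F2).
have pts (Psi : R -> M -> M) (row : R -> M) : continuous (fun p : R * M => Psi p.1 p.2) ->
  (forall t, 0 <= t <= 1 -> row t = Psi t x0) ->
  \forall x \near x0, forall l : 'I_N.+2, V (row (tt l)) (Psi (tt l) x).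
 move=> c rE; apply: filter_forall => l; have tl := t01 l (leq_ord l).
 have [g Vx] := Vg (row (tt l)).
 have Q t : tt l <= t <= tt l -> V (row (tt l)) (Psi t x0) by move=> /le_anti <-; rewrite -rE.
 by apply: filterS (tube c (good_nbhd_open g) Q) => x; apply; rewrite lexx.
have tubes (Psi : R -> M -> M) (Q : nat -> set M) : continuous (fun p : R * M => Psi p.1 p.2) ->
  (forall l, (l <= N)%N -> open (Q l) /\ forall t, tt l <= t <= tt l.+1 -> Q l (Psi t x0)) ->
  \forall x \near x0, forall l : 'I_N.+1, forall t, tt l <= t <= tt l.+1 -> Q l (Psi t x).
 move=> c QE; apply: filter_forall => l; have [oQ Ql] := QE l (leq_ord l).
 exact: tube c oQ Ql.
have n1 := pts _ (fun t => H (0, t)) c1 (fun t tt01 => proj1 (Hrows tt01)).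
have n2 := pts _ (fun t => H (1, t)) c2 (fun t tt01 => proj2 (Hrows tt01)).
have n3 : \forall x \near x0, forall l : 'I_N.+1, forall t, tt l <= t <= tt l.+1 -> Q0 l (Psi1 t x).
 apply: tubes => // l lN; have [g _ QQ] := Qg l lN; split; first exact: good_nbhd_open g.
 by move=> t tl; have [+ _] := QQ t tl; rewrite (proj1 (Hrows (sub01 _ _ lN tl))).
have n4 : \forall x \near x0, forall l : 'I_N.+1, forall t, tt l <= t <= tt l.+1 -> Q1 l (Psi2 t x).
 apply: tubes => // l lN; have [_ g QQ] := Qg l lN; split; first exact: good_nbhd_open g.
 by move=> t tl; have [_ +] := QQ t tl; rewrite (proj2 (Hrows (sub01 _ _ lN tl))).
have : \forall x \near x0, [/\ forall l : 'I_N.+2, V (H (0, tt l)) (Psi1 (tt l) x),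
  forall l : 'I_N.+2, V (H (1, tt l)) (Psi2 (tt l) x),
  forall l : 'I_N.+1, forall t, tt l <= t <= tt l.+1 -> Q0 l (Psi1 t x) &
  forall l : 'I_N.+1, forall t, tt l <= t <= tt l.+1 -> Q1 l (Psi2 t x)].
 by near=> x; split; near: x.
rewrite -[X in X -> _]/(nbhs x0 _) nbhsE => -[U [oU Ux] UP].
have [V0 [g0 V0x V0U]] := @good_nbhd_base R m M A _ _ oU Ux; exists V0; split => //; split => // a fa sa.
have P x : V0 x -> _ := fun Vx => UP x (V0U x Vx).
pose f l := transport_state Phi1 a (tt l); pose g l := transport_state Phi2 a (tt l).
have Hin l : (l <= N.+1)%N -> state_in (f l) (V (H (0, tt l))) /\ state_in (g l) (V (H (1, tt l))).
 move=> lN; split.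
  by apply: (transport_state_in F1 fa sa) => x /P[h _ _ _]; exact: (h (Ordinal (lN : (l < N.+2)%N))).
 by apply: (transport_state_in F2 fa sa) => x /P[_ h _ _]; exact: (h (Ordinal (lN : (l < N.+2)%N))).
have Hnear l : (l <= N)%N -> state_near (Q0 l) (f l) (f l.+1) /\ state_near (Q1 l) (g l) (g l.+1).
 move=> lN; have /andP[l0 _] := t01 l (leqW lN); split.
  apply: (transport_state_near F1 fa l0 (tS l) sa) => r x rl /P[_ _ h _].
  exact: (h (Ordinal (lN : (l < N.+1)%N))).
 apply: (transport_state_near F2 fa l0 (tS l) sa) => r x rl /P[_ _ _ h].
 exact: (h (Ordinal (lN : (l < N.+1)%N))).
have tt0 : tt 0%N = 0 by rewrite /tt mul0r.
have tt1 : tt N.+1 = 1 by rewrite /tt divff // gt_eqF.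
have slice0 t Phi : Phi t = id -> slice_form Phi t a = slice_form (fun _ => id) 0 a.
 by move=> E; apply/funext => i; apply/funext => x; apply/funext => Z; rewrite /slice_form E.
(* At time 0 both flows are the identity and the fibre integrals are over a single point, so the two
   states start equal. *)
have fg0 : f 0%N = g 0%N.
 rewrite /f /g tt0 /transport_state (slice0 _ _ (flow_inv0 F1 (lexx 0))) (slice0 _ _ (flow_inv0 F2 (lexx 0))).
 have fib0 Phi : fiber_int Phi 0 0 a = @form0 R m M A k.+1.
  by apply/funext => i; apply/funext => x; apply/funext => Z; exact: int_point.
 by rewrite !fib0.
have [tau [ft st dt e]] := mono f g Hin Hnear fg0.
have dt0 : form_eq (ext_d tau) (@form0 R m M A m).
 have E : (g N.+1).1 = (f N.+1).1.
  rewrite /f /g tt1; apply: (etrans (slice0 _ _ (flow_inv1 F2 (lexx 1)))).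
  exact: esym (slice0 _ _ (flow_inv1 F1 (lexx 1))).
 by move=> i x Z cx; exact: etrans (dt i x Z cx) (comb_cancel E Z cx).
have [[i [c [r [r0 gc VE]]]] _] := Vg x0; rewrite VE in st.
(* At time 1 both flows are again the identity, so the final masses coincide and the last move [tau]
   is closed, with support in a cell. *)
have et := cell_cotop Mcl gc r0 ft st dt0.
have sE Phi : (transport_state Phi a (tt N.+1)).2 = fiber_int Phi 0 1 a by rewrite tt1.
have fE : (f N.+1).2 = fiber_int Phi1 0 1 a := sE Phi1.
have gE : (g N.+1).2 = fiber_int Phi2 0 1 a := sE Phi2.
exact: (end_exact fE gE e et).
Unshelve. all: by end_near.
Qed.

Lemma mass_diff_eq (a b : dform A m) : form_eq a b -> form_eq (mass_diff a) (mass_diff b).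
have E Phi (i : idx A) x V : form_eq a b -> fiber_int Phi 0 1 a i x V = fiber_int Phi 0 1 b i x V.
 by move=> ab; apply: eq_int => t _; apply: ab; exact: chart_cod (chart_at_dom _ _).
by move=> ab i x V cx; congr (_ + _ * _); exact: E.
Qed.

Lemma comb_diff (x1 x2 y1 y2 X Y c : R) : X = x1 + c * x2 -> Y = y1 + c * y2 ->
 X + -1 * Y = (x1 + -1 * y1) + c * (x2 + -1 * y2).
by move=> -> ->; ring. Qed.

Lemma mass_diff_comb (a b : dform A m) c : is_form a -> is_form b ->
 form_eq (mass_diff (form_comb a c b)) (form_comb (mass_diff a) c (mass_diff b)).
move=> fa fb i x V cx; exact: (comb_diff (fiber_int_comb 0 1 c (inv_smooth F1) fa fb V cx)
 (fiber_int_comb 0 1 c (inv_smooth F2) fa fb V cx)).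
Qed.

Lemma mass_diff_exact (tau : dform A k.+1) a : is_form tau -> form_eq (ext_d tau) a ->
 exact_form (mass_diff a).
move=> ft ta; have e1 := fiber_exact (inv_smooth F1) (flow_inv0 F1 (lexx 0)) (flow_inv1 F1 (lexx 1)) ft.
have e2 := fiber_exact (inv_smooth F2) (flow_inv0 F2 (lexx 0)) (flow_inv1 F2 (lexx 1)) ft.
apply: (exact_form_eq _ (exact_comb (-1) e1 e2)).
by apply: mass_diff_eq => i x V cx; rewrite ta.
Qed.

(** By linearity a form supported in a cell suffices. It is moved into [V0] by an exact correction,
    whose fibre integrals are exact; if local exactness fails, the form itself is exact. *)
Lemma mass_diff_top (a : dform A m) : is_form a -> exact_form (mass_diff a).
have f0 := form0_is (A := A) k.+1.
have E0 : exact_form (mass_diff (@form0 R m M A m)).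
 by apply: mass_diff_exact f0 _ => i x V cx; exact: ext_d0.
apply: (small_support_ind Mcl (P := fun a => exact_form (mass_diff a)) _ E0) => [a1 b1 ab e1|a1 b1 fa fb ea eb|i c r a1 r0 gc fa sa].
- exact: exact_form_eq (mass_diff_eq ab) e1.
- exact: exact_form_eq (mass_diff_comb 1 fa fb) (exact_comb 1 ea eb).
have gV : good_nbhd A (cell i c r) by exists i, c, r.
have [le|nle] := pselect (locally_exact (A := A)); last first.
 have [tau ft dt] := not_locally_exact Mcl nle gV fa sa; exact: mass_diff_exact ft dt.
have [V0 [g0 [V0x small]]] := mass_diff_small le; have [_ _ Mc] := Mcl.
have Vx : cell i c r (param i c) by apply: cell_param => //; rewrite subrr normr0.
have [b [tau [fb sb ft _ dt]]] := transport_top Mcl Mc openT (fun _ _ => I) I I gV Vx (fun _ _ => I) g0 V0x fa sa.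
have fN := form_comb_is (-1) f0 ft.
have dN : form_eq (ext_d (form_comb (@form0 R m M A k.+1) (-1) tau)) (form_comb a1 (-1) b).
 by move=> j x V cx; rewrite (ext_d_comb _ _ f0 ft cx) ext_d0 dt // /form_comb; ring.
have E := exact_comb 1 (mass_diff_exact fN dN) (small b fb sb).
apply: (exact_form_eq _ E) => j x V cx; have fc := form_comb_is (-1) fa fb.
apply: etrans (mass_diff_comb 1 fc fb V cx); apply: mass_diff_eq => // l y W cy.
by rewrite /form_comb; ring.
Qed.

End MassTransport.

(** * The weak Lefschetz case *)

Section LefschetzCase.
Context {R : realType} {M : topologicalType}.

Lemma comb_eq (x y x1 y1 : R) : x = x1 -> y = y1 -> x + -1 * y = x1 + -1 * y1.
by move=> -> ->. Qed.

(** The dimension is a variable with an equation, since [2 * p.+1] in the theorem and [(p * 2).+2]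
    in the volume form are equal but not convertible. *)
Lemma mass_diff_flux m p (A : atlas R m M) (w : dform A 2) (psi phi : R -> M -> M) (x0 : M) : m = (p * 2).+2 ->
 closed_connected_manifold M -> symplectic_form w -> Symp0_loop w psi -> Symp0_loop w phi ->
 loop_homotopic x0 (fun t => psi t x0) (fun t => phi t x0) ->
 let L (f : R -> M -> M) : dform A (p * 2).+1 :=
  wedge (fiber_int (inverse_flow f) 0 1 w) (@wedge_pow _ _ _ _ w p) in
 deRham_class (L psi) = deRham_class (L phi).
move=> E; subst m => Mcl ws lpsi lphi orb L.
have F1 := loop_flow Mcl lpsi; have F2 := loop_flow Mcl lphi.
have [H [Hc Hs Hr]] := homotopy_step orb.
have e := mass_diff_top Mcl F1 F2 Hc Hs Hr (vol_form ws).
apply: deRham_class_eq; apply: (exact_form_eq _ e) => i x V cx.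
have e1 := wedge_fiber_int ws F1 V cx; have e2 := wedge_fiber_int ws F2 V cx.
rewrite form_subE; exact: (comb_eq e1 e2).
Qed.

Lemma lefschetz_flux_eq n (A : atlas R (2 * n) M) (w : dform A 2) (psi phi : R -> M -> M) (x0 : M) :
 closed_connected_manifold M -> symplectic_form w -> weak_lefschetz w -> Symp0_loop w psi -> Symp0_loop w phi ->
 loop_homotopic x0 (fun t => psi t x0) (fun t => phi t x0) -> flux w psi = flux w phi.
move=> Mcl ws wl lpsi lphi orb; have [[fw _] _] := ws.
have F1 := loop_flow Mcl lpsi; have F2 := loop_flow Mcl lphi.
have f1 := fiber_int_form (inv_smooth F1) ler01 fw; have f2 := fiber_int_form (inv_smooth F2) ler01 fw.
apply: (flux_class_eq Mcl fw lpsi lphi).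
case: n A w ws wl lpsi lphi F1 F2 f1 f2 fw => [|p] A w ws wl lpsi lphi F1 F2 f1 f2 fw.
 (* In dimension 0 tangent vectors have no coordinates, and multilinearity with zero coefficients
    forces every 1-form to vanish. *)
 exists (@form0 R _ M A 0); split=> [|i x V cx]; first exact: form0_is.
 have fs := form_sub_is f2 f1; have [P _ _] := fs; have [ml _] := P i x cx; rewrite ext_d0.
 have Z : row ord0 V = 0 *: row ord0 V + 0 *: row ord0 V by apply/rowP => -[].
 by rewrite (ml ord0 V V V 0 0 Z erefl erefl) !mul0r addr0.
have [cw _] := ws; apply: (exact_of_class (closed_fiber_int cw F2)).
apply: (wl _ _ (closed_fiber_int cw F2) (closed_fiber_int cw F1)).
have E : (2 * p.+1 = (p * 2).+2)%N by rewrite mulnC.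
exact: esym (mass_diff_flux E Mcl ws lpsi lphi orb).
Qed.

End LefschetzCase.

Theorem theorem1p4 (R : realType) (n : nat) (M : topologicalType)
  (A : atlas R (2 * n) M) (w : dform A 2)
  (M_closed : closed_connected_manifold M)
  (w_symplectic : symplectic_form w)
  (w_cond : symplectically_aspherical w \/ spherically_monotone w \/
   weak_lefschetz w)
  (x0 : M) (e : set (dform A 1) -> set (R -> M)) (e_hom : is_e_hom w x0 e) :
 set_inj (flux_group w) e.
move=> _ _ /set_mem[psi lpsi ->] /set_mem[phi lphi ->] Ee.
have E := etrans (esym (e_hom _ lpsi)) (etrans Ee (e_hom _ lphi)).
have orb := pi1_class_homotopic (symp_orbit_loop x0 lphi) E.
have [[fw _] _] := w_symplectic; case: w_cond => [wa|[wm|wl]].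
- exact: aspherical_flux_eq M_closed fw lpsi lphi orb wa.
- exact: monotone_flux_eq M_closed fw lpsi lphi orb wm.
- exact: lefschetz_flux_eq M_closed w_symplectic wl lpsi lphi orb.
Qed.
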